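(* Let $B_1\subset\mathbb{R}^n$ be the open unit ball centered at $0$, let $b_0,b_1\in C^{1,1}(B_1)$, and let $$b_{\mathrm{env}}:=\sup\{f\in\mathrm{SH}(B_1)\,:\,f\le\min\{b_0,b_1\}\}.$$ Then there exists a constant $C=C(n,\|b_0\|_{C^2(B_1)},\|b_1\|_{C^2(B_1)})$ such that $$\|b_{\mathrm{env}}\|_{C^2(B_{1/8})}\le C.$$
   Context: $B_R\subset\mathbb{R}^n$ is the open ball of radius $R$ centered at $0$. $\mathrm{SH}(B_1)$ is the set of subharmonic functions on $B_1$; the supremum is pointwise. $C^{1,1}$ denotes the Banach space of functions with finite $C^2$ norm, where $\|f\|_{C^2}$ is understood in the $C^{1,1}$ sense: the sum of the sup norms of $f$ and $\nabla f$ and the $L^\infty$ norm of the (weak) second derivatives $\nabla^2 f$. The notation $C=C(\cdots)$ means that $C$ is finite and depends only on the listed quantities. *)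

(* Defs.v *)
From HB Require Import structures.
From mathcomp Require Import all_boot all_order all_algebra.
From mathcomp Require Import all_classical all_reals all_analysis ess_sup_inf.
Set Implicit Arguments.
Unset Strict Implicit.
Unset Printing Implicit Defensive.
Import Order.TTheory GRing.Theory Num.Theory.
Import numFieldNormedType.Exports.
Local Open Scope classical_set_scope.
Local Open Scope ring_scope.

Definition rV_display : measure_display. Proof. exact. Qed.

Section rV_measurable.
Context {R : realType}.
Variable n : nat.

(* The product (= Borel) sigma-algebra, generated by the coordinates. *)
Definition rV_measurable : set (set 'rV[R]_n) :=
  g_sigma_preimage (fun (i : 'I_n) (v : 'rV[R]_n) => v 0 i : measurableTypeR R).

Let rV_set0 : rV_measurable set0.
Proof. exact: sigma_algebra0. Qed.

Let rV_setC A : rV_measurable A -> rV_measurable (~` A).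
Proof. exact: sigma_algebraC. Qed.

Let rV_bigcup (F : _^nat) :
  (forall i, rV_measurable (F i)) -> rV_measurable (\bigcup_i (F i)).
Proof. exact: sigma_algebra_bigcup. Qed.

HB.instance Definition _ := @isMeasurable.Build rV_display 'rV[R]_n
  rV_measurable rV_set0 rV_setC rV_bigcup.

End rV_measurable.

Section rV_cons.
Context {R : realType}.

Lemma measurable_coord n (i : 'I_n) :
  measurable_fun setT (fun v : 'rV[R]_n => v 0 i : measurableTypeR R).
Proof.
move=> _ Y mY; rewrite setTI; apply: sub_sigma_algebra => /=.
rewrite -bigcup_seq/=; exists i => /=; first by rewrite mem_index_enum.
by exists Y => //; rewrite setTI.
Qed.

Lemma measurable_fun_coordP d (T : measurableType d) n (f : T -> 'rV[R]_n) :
  (forall i, measurable_fun setT (fun x => f x 0 i : measurableTypeR R)) ->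
  measurable_fun setT f.
Proof.
move=> mf _ Y mY; rewrite setTI.
suff : rV_measurable (R := R) (n := n) `<=` [set Y | measurable (f @^-1` Y)].
  exact.
apply: smallest_sub.
  split => /=.
  - by rewrite preimage_set0.
  - by move=> A mA; rewrite setTD preimage_setC; exact: measurableC.
  - by move=> F mF; rewrite preimage_bigcup; exact: bigcup_measurable.
move=> A; rewrite -bigcup_seq => -[i _ [B mB <-]] /=.
rewrite setTI -comp_preimage -[X in measurable X]setTI.
exact: mf.
Qed.

Definition rV_cons n (p : R * 'rV[R]_n) : 'rV[R]_n.+1 := row_mx p.1%:M p.2.

Definition rV_uncons n (v : 'rV[R]_n.+1) : R * 'rV[R]_n :=
  (v 0 0, rsubmx (v : 'rV[R]_(1 + n))).

Lemma rV_cons0 n (p : R * 'rV[R]_n) : rV_cons p 0 0 = p.1.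
Proof.
have -> : (0 : 'I_n.+1) = lshift n (0 : 'I_1) by exact/val_inj.
by apply: etrans (row_mxEl _ _ _ _) _; rewrite mxE eqxx mulr1n.
Qed.

Lemma rV_consS n (p : R * 'rV[R]_n) i : rV_cons p 0 (lift ord0 i) = p.2 0 i.
Proof.
have -> : lift ord0 i = rshift 1 i by exact/val_inj.
exact: row_mxEr.
Qed.

Lemma rV_consK n : cancel (@rV_cons n) (@rV_uncons n).
Proof.
by case=> x v; rewrite /rV_uncons rV_cons0 /rV_cons row_mxKr.
Qed.

Lemma measurable_rV_cons n :
  measurable_fun setT (@rV_cons n : measurableTypeR R * 'rV[R]_n -> _).
Proof.
apply: measurable_fun_coordP => i; case: (unliftP ord0 i) => [j|] ->.
- rewrite (_ : (fun p => _) = (fun v : 'rV[R]_n => v 0 j) \o snd).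
    by apply: (measurableT_comp (measurable_coord j)); exact: measurable_snd.
  by apply/funext => p; rewrite rV_consS.
- rewrite (_ : (fun p => _) = fst); first exact: measurable_fst.
  by apply/funext => p; rewrite rV_cons0.
Qed.

Lemma measurable_rV_uncons n :
  measurable_fun setT (@rV_uncons n : _ -> measurableTypeR R * 'rV[R]_n).
Proof.
apply: measurable_fun_pair; first exact: measurable_coord.
apply: measurable_fun_coordP => i; under eq_fun do rewrite mxE.
exact: measurable_coord.
Qed.

End rV_cons.

Section lebesgue_rV_step.
Context {R : realType}.
Variables (n : nat) (mu : {sigma_finite_measure set 'rV[R]_n -> \bar R}).

Let prod : {measure set (measurableTypeR R * 'rV[R]_n) -> \bar R} :=
  (lebesgue_measure \x mu)%E.

Definition lebesgue_rV_step : set 'rV[R]_n.+1 -> \bar R :=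
  pushforward prod (@rV_cons R n).

Let step0 : lebesgue_rV_step set0 = 0%E.
Proof. by rewrite /lebesgue_rV_step /pushforward preimage_set0 measure0. Qed.

Let step_ge0 A : (0 <= lebesgue_rV_step A)%E.
Proof. exact: (measure_ge0 prod). Qed.

Let step_sigma_additive : semi_sigma_additive lebesgue_rV_step.
Proof.
move=> F mF tF mUF; rewrite /lebesgue_rV_step /pushforward preimage_bigcup.
apply: measure_semi_sigma_additive.
- by move=> k; rewrite -[X in measurable X]setTI; exact: measurable_rV_cons.
- apply/trivIsetP => /= i j _ _ ij; rewrite -preimage_setI.
  by move/trivIsetP : tF => /(_ _ _ _ _ ij) ->//; rewrite preimage_set0.
- rewrite -preimage_bigcup -[X in measurable X]setTI.
  exact: measurable_rV_cons.
Qed.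

HB.instance Definition _ := isMeasure.Build _ _ _ lebesgue_rV_step
  step0 step_ge0 step_sigma_additive.

Let step_sigma_finite : sigma_finite setT lebesgue_rV_step.
Proof.
have /sigma_finiteP[F [TF ndF Foo]] := sigma_finiteT (@lebesgue_measure R).
have /sigma_finiteP[G [TG ndG Goo]] := sigma_finiteT mu.
exists (fun k => @rV_uncons R n @^-1` (F k `*` G k)) => [|k].
  rewrite -preimage_bigcup (_ : \bigcup_k _ = setT) ?preimage_setT//.
  rewrite -setXTT TF TG predeqE => -[x y]; split.
    by move=> [k _ []/= ? ?]; split; exists k.
  move=> [/= [k _ Fkx] [l _ Gly]]; exists (maxn k l) => //; split.
    by move: x Fkx; exact/subsetPset/ndF/leq_maxl.
  by move: y Gly; exact/subsetPset/ndG/leq_maxr.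
have [mF Fk] := Foo k; have [mG Gk] := Goo k; split.
  rewrite -[X in measurable X]setTI; apply: measurable_rV_uncons => //.
  exact: measurableX.
rewrite /lebesgue_rV_step /pushforward -comp_preimage.
rewrite (_ : _ \o _ = id) ?preimage_id; last first.
  by apply/funext => p /=; rewrite rV_consK.
by rewrite /prod /= product_measure1E// lte_mul_pinfty// ge0_fin_numE.
Qed.

HB.instance Definition _ := Measure_isSigmaFinite.Build _ _ _ lebesgue_rV_step
  step_sigma_finite.

End lebesgue_rV_step.

Fixpoint lebesgue_rV {R : realType} (n : nat) :
    {sigma_finite_measure set 'rV[R]_n -> \bar R} :=
  match n with
  | 0 => \d_ (0 : 'rV[R]_0)
  | m.+1 => lebesgue_rV_step (lebesgue_rV m)
  end.

(* This identifies lebesgue_rV with the usual Lebesgue measure. *)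
Lemma lebesgue_rV_box (R : realType) (n : nat) (A : 'I_n -> set R) :
  (forall i, measurable (A i)) ->
  lebesgue_rV n [set v | forall i, A i (v 0 i)] =
  (\prod_(i < n) lebesgue_measure (A i))%E.
Proof.
elim: n A => [|n IHn] A mA.
  rewrite big_ord0 /= diracE mem_set//=; by case.
rewrite big_ord_recl /= /lebesgue_rV_step /pushforward -IHn//.
pose B := [set v : 'rV[R]_n | forall i, A (lift ord0 i) (v 0 i)].
rewrite -/B.
have mB : measurable B.
  rewrite (_ : B = \bigcap_(i in [set: 'I_n])
      ((fun v : 'rV[R]_n => v 0 i) @^-1` A (lift ord0 i))).
    apply: fin_bigcap_measurable => // i _.
    rewrite -[X in measurable X]setTI.
    exact: (measurable_coord i measurableT (mA (lift ord0 i))).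
  by apply/seteqP; split => [v Bv i _|v Bv i]; [exact: Bv|exact: (Bv i)].
rewrite -[RHS](product_measure1E lebesgue_measure (lebesgue_rV n) (mA ord0) mB).
congr product_measure1.
apply/seteqP; split => -[x v] /=.
- move=> H; split => /= [|i]; first by have := H ord0; rewrite rV_cons0.
  by have := H (lift ord0 i); rewrite rV_consS.
- move=> [Ax Bv] i; case: (unliftP ord0 i) => [j|] ->.
  + by rewrite rV_consS.
  + by rewrite rV_cons0.
Qed.

Section calculus.
Context {R : realType}.

(* The library norm on matrices is the max norm; this is the Euclidean norm
   of a vector, resp. the Frobenius norm of a matrix. *)
Definition l2norm m n (A : 'M[R]_(m, n)) : R :=
  Num.sqrt (\sum_i \sum_j A i j ^+ 2).

Definition eball n (c : 'rV[R]_n) (r : R) : set 'rV[R]_n :=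
  [set x | l2norm (x - c) < r].

Definition ecball n (c : 'rV[R]_n) (r : R) : set 'rV[R]_n :=
  [set x | l2norm (x - c) <= r].

Definition partial n (i : 'I_n) (f : 'rV[R]_n -> R) (x : 'rV[R]_n) : R :=
  'D_(delta_mx 0 i) f x.

Definition gradient n (f : 'rV[R]_n -> R) (x : 'rV[R]_n) : 'rV[R]_n :=
  \row_i partial i f x.

Definition C1_on n (Omega : set 'rV[R]_n) (f : 'rV[R]_n -> R) : Prop :=
  forall x, Omega x ->
    differentiable f x /\ {for x, continuous (gradient f)}.

Definition smooth n (phi : 'rV[R]_n -> R) : Prop :=
  forall (s : seq 'I_n) (x : 'rV[R]_n),
    differentiable (foldr (@partial n) phi s) x.

Definition test_function n (Omega : set 'rV[R]_n) (phi : 'rV[R]_n -> R) :=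
  smooth phi /\
  exists K, [/\ compact K, K `<=` Omega & forall x, ~ K x -> phi x = 0].

End calculus.

Section C11.
Context {R : realType}.
Variable n : nat.
Implicit Types (Omega : set 'rV[R]_n) (f : 'rV[R]_n -> R).
Local Open Scope ereal_scope.

Let mu := @lebesgue_rV R n.

Definition weak_hessian Omega f (H : 'rV[R]_n -> 'M[R]_n) : Prop :=
  forall i j : 'I_n,
    [/\ measurable_fun Omega (fun x => H x i j),
        forall K, compact K -> K `<=` Omega ->
          mu.-integrable K (fun x => (H x i j)%:E)
      & forall phi, test_function Omega phi ->
          \int[mu]_(x in Omega) (f x * partial i (partial j phi) x)%:E =
          \int[mu]_(x in Omega) (H x i j * phi x)%:E].

Definition sup_norm m Omega (g : 'rV[R]_n -> 'rV[R]_m) : \bar R :=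
  ereal_sup [set (l2norm (g x))%:E | x in Omega].

Definition Linfty_norm Omega (H : 'rV[R]_n -> 'M[R]_n) : \bar R :=
  ess_sup mu ((fun x => (l2norm (H x))%:E) \_ Omega).

(* A weak Hessian is unique almost everywhere, so the infimum is over at most
   one value; it is +oo when f is not C^1 or has no weak Hessian. *)
Definition C2norm Omega f : \bar R :=
  ereal_inf [set s | C1_on Omega f /\ exists H, weak_hessian Omega f H /\
    s = ereal_sup [set `|f x|%:E | x in Omega]
        + sup_norm Omega (gradient f) + Linfty_norm Omega H].

Definition C11 Omega f : Prop := C2norm Omega f < +oo.

End C11.

Section subharmonic.
Context {R : realType}.
Variable n : nat.
Implicit Types (Omega : set 'rV[R]_n) (f : 'rV[R]_n -> \bar R).
Local Open Scope ereal_scope.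

Let mu := @lebesgue_rV R n.

(* Values in [-oo, +oo[, upper semicontinuity, and the sub-mean value
   inequality on balls; only the values of f on Omega matter. *)
Definition subharmonic Omega f : Prop :=
  [/\ forall x, Omega x -> f x < +oo,
      forall x, Omega x ->
        forall a : R, f x < a%:E -> \forall y \near x, f y < a%:E
    & forall (x : 'rV[R]_n) (r : R), (0 < r)%R -> ecball x r `<=` Omega ->
        f x <= ((fine (mu (eball x r)))^-1)%:E * \int[mu]_(y in eball x r) f y].

Definition subharmonic_envelope Omega (b : 'rV[R]_n -> R) (x : 'rV[R]_n) :
    \bar R :=
  ereal_sup [set f x | f in
    [set f | subharmonic Omega f /\ forall y, Omega y -> f y <= (b y)%:E]].

End subharmonic.

(* Main.v *)
From HB Require Import structures.
Require Import Defs.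
From mathcomp Require Import all_boot all_order all_algebra.
From mathcomp Require Import all_classical all_reals all_analysis ess_sup_inf measurable_realfun.
From mathcomp Require Import lebesgue_integral_under.
From mathcomp Require Import ring lra.
Set Implicit Arguments.
Unset Strict Implicit.
Unset Printing Implicit Defensive.
Import Order.TTheory GRing.Theory Num.Theory.
Import numFieldNormedType.Exports.
Local Open Scope classical_set_scope.
Local Open Scope ring_scope.


(** The envelope solves an obstacle problem: it is the largest subharmonic
    function below [b = min b0 b1].  Such a solution can lose regularity at the
    obstacle's convex corners only, and a minimum of two [C^1,1] functions has
    none: at each point it lies below a touching paraboloid
    [b x + p . (y - x) + N |y - x| ^ 2] ([paraboloid], [min_paraboloid]).  This
    one-sided condition is all that is used of the obstacle
    ([obstacle_sol], [envelope_obstacle_sol]).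

    The basic tool is a competitor.  If [v] is subharmonic and the radius
    [rho] is a smooth function whose gradient and [rho * Laplacian rho] are
    small, then [x |-> average of v over the ball of radius rho x around x]
    is again subharmonic and lies above [v].  For smooth [v] the divergence
    theorem turns the Laplacian of this average into an integral of the
    Laplacian of [v] against a weight close to [1]
    ([Int_lap_moving], [moving_weight_ge0]); the general case follows by
    mollification ([sh_move]).  Taking for [rho] a small bump and comparing
    with the largest subharmonic minorant gives two facts:

    - averages of [v] over small balls exceed [v] by at most [N rho ^ 2],
      because the paraboloid bounds the average of [b] ([sol_avg]);
    - where [v < b], averages over small balls equal [v] ([sol_mean]), so [v]
      is reproduced by a smooth radial kernel ([kern_mean]).

    They yield a quadratic expansion with uniform constants at every point of
    the ball of radius [1/8] ([sol_expansion]).  At a contact point the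
    paraboloid gives the upper bound, and the first fact, together with the
    sub-mean-value property at twice the radius, the lower one
    ([contact_expansion]).  At distance [D] from the contact set the expansion
    at a nearby contact point bounds the distance of [v] to an affine function
    by a multiple of [D ^ 2], and the kernel at scale [D] converts this bound
    into an expansion ([scaled_expansion]).

    Finally, uniform quadratic expansions make the gradient Lipschitz, and
    weak limits of its difference quotients are the weak second derivatives
    ([weak_limit], [C2norm_expansion]). *)

(** * Euclidean geometry *)

Section euclid.
Context {R : realType} {n : nat}.
Implicit Types (x y z : 'rV[R]_n) (r s e : R).

Definition dotv x y : R := \sum_i x 0 i * y 0 i.

Lemma l2normE x : l2norm x = Num.sqrt (dotv x x).
Proof.
by rewrite /l2norm big_ord1; congr Num.sqrt; apply: eq_bigr => i _; rewrite expr2.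
Qed.

Lemma dotvv_ge0 x : 0 <= dotv x x.
Proof. by apply: sumr_ge0 => i _; rewrite -expr2 sqr_ge0. Qed.

Lemma l2norm_ge0 m1 m2 (x : 'M[R]_(m1, m2)) : 0 <= l2norm x.
Proof. exact: sqrtr_ge0. Qed.

Lemma l2norm_sqr x : l2norm x ^+ 2 = dotv x x.
Proof. by rewrite l2normE sqr_sqrtr// dotvv_ge0. Qed.

Lemma dotvDl x y z : dotv (x + y) z = dotv x z + dotv y z.
Proof. by rewrite -big_split; apply: eq_bigr => i _; rewrite mxE mulrDl. Qed.

Lemma dotvC x y : dotv x y = dotv y x.
Proof. by apply: eq_bigr => i _; rewrite mulrC. Qed.

Lemma dotvZl s x y : dotv (s *: x) y = s * dotv x y.
Proof. by rewrite mulr_sumr; apply: eq_bigr => i _; rewrite mxE mulrA. Qed.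

Lemma dotvNl x y : dotv (- x) y = - dotv x y.
Proof. by rewrite -scaleN1r dotvZl mulN1r. Qed.

Lemma dotvBl x y z : dotv (x - y) z = dotv x z - dotv y z.
Proof. by rewrite dotvDl dotvNl. Qed.

Lemma dotvDr x y z : dotv x (y + z) = dotv x y + dotv x z.
Proof. by rewrite dotvC dotvDl !(dotvC x). Qed.

Lemma dotvBr x y z : dotv x (y - z) = dotv x y - dotv x z.
Proof. by rewrite dotvC dotvBl !(dotvC x). Qed.

Lemma dotvZr s x y : dotv x (s *: y) = s * dotv x y.
Proof. by rewrite dotvC dotvZl dotvC. Qed.

Lemma dotv0l x : dotv 0 x = 0.
Proof. by rewrite -(scale0r 0) dotvZl mul0r. Qed.

Lemma dotvv_eq0 x : dotv x x = 0 -> x = 0.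
Proof.
move=> /eqP; rewrite psumr_eq0; last by move=> i _; rewrite -expr2 sqr_ge0.
move=> /allP h; apply/rowP => i; rewrite mxE.
by have := h i (mem_index_enum _); rewrite /= mulf_eq0 orbb => /eqP.
Qed.

Lemma cauchy_schwarz x y : `|dotv x y| <= l2norm x * l2norm y.
Proof.
rewrite -(ler_pXn2r (n:=2))// ?nnegrE ?mulr_ge0 ?l2norm_ge0//.
rewrite exprMn !l2norm_sqr real_normK ?num_real//.
have [y0|/eqP y0] := eqVneq (dotv y y) 0.
  by rewrite (dotvv_eq0 y0) dotvC !dotv0l expr0n mulr0.
have yp : 0 < dotv y y by rewrite lt_neqAle dotvv_ge0 eq_sym (introN eqP y0).
have := dotvv_ge0 (dotv y y *: x - dotv x y *: y).
rewrite dotvBl !dotvBr !dotvZl !dotvZr (dotvC y x).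
set a := dotv x x; set b := dotv y y in yp *; set c := dotv x y => h.
have : 0 <= b * (a * b - c ^+ 2) by apply: (le_trans h); rewrite le_eqVlt; apply/orP; left; apply/eqP; ring.
by rewrite pmulr_rge0// subr_ge0.
Qed.

Lemma l2norm0 : l2norm (0 : 'rV[R]_n) = 0.
Proof. by rewrite l2normE dotv0l sqrtr0. Qed.

Lemma l2norm_eq0 x : l2norm x = 0 -> x = 0.
Proof. by move=> h; apply: dotvv_eq0; rewrite -l2norm_sqr h expr0n. Qed.

Lemma l2normZ s x : l2norm (s *: x) = `|s| * l2norm x.
Proof.
rewrite !l2normE dotvZl dotvZr mulrA -expr2 sqrtrM ?sqr_ge0//.
by rewrite sqrtr_sqr.
Qed.

Lemma l2normN x : l2norm (- x) = l2norm x.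
Proof. by rewrite -scaleN1r l2normZ normrN1 mul1r. Qed.

Lemma l2normBC x y : l2norm (x - y) = l2norm (y - x).
Proof. by rewrite -opprB l2normN. Qed.

Lemma l2normD x y : l2norm (x + y) <= l2norm x + l2norm y.
Proof.
rewrite -(ler_pXn2r (n:=2))// ?nnegrE ?addr_ge0 ?l2norm_ge0//.
rewrite sqrrD !l2norm_sqr dotvDl !dotvDr (dotvC y x).
have := le_trans (ler_norm _) (cauchy_schwarz x y); lra.
Qed.

Lemma l2normB x y : l2norm (x - y) <= l2norm x + l2norm y.
Proof. by rewrite -(l2normN y) l2normD. Qed.

Lemma l2norm_dist x y z : l2norm (x - z) <= l2norm (x - y) + l2norm (y - z).
Proof. by rewrite (_ : x - z = (x - y) + (y - z)) ?l2normD// addrA subrK. Qed.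

Lemma ler_l2norm_add x y : l2norm y <= l2norm x + l2norm (y - x).
Proof. by rewrite -{1}(subrKC x y) l2normD. Qed.

Lemma coord_le_l2norm x i : `|x 0 i| <= l2norm x.
Proof.
rewrite l2normE -sqrtr_sqr ler_wsqrtr// /dotv (bigD1 i)//= -expr2 lerDl.
by apply: sumr_ge0 => j _; rewrite -expr2 sqr_ge0.
Qed.

Lemma l2norm_le_coord x e : 0 <= e -> (forall i, `|x 0 i| <= e) ->
  l2norm x <= n%:R * e.
Proof.
move=> e0 h; rewrite -(ler_pXn2r (n:=2))// ?nnegrE ?mulr_ge0 ?l2norm_ge0//.
rewrite l2norm_sqr (@le_trans _ _ (\sum_(i < n) e ^+ 2))//.
  apply: ler_sum => i _; rewrite -expr2 -real_normK ?num_real//.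
  by rewrite lerXn2r// nnegrE.
rewrite sumr_const card_ord exprMn -(mulr_natl (e ^+ 2)).
apply: ler_wpM2r; first exact: sqr_ge0.
by rewrite -natrX ler_nat; case: (n) => // k; rewrite expnS leq_pmulr// expn1.
Qed.

Lemma l2norm_delta i : l2norm (delta_mx 0 i : 'rV[R]_n) = 1.
Proof.
rewrite l2normE /dotv (bigD1 i)//= !mxE !eqxx/= mulr1 big1 ?addr0 ?sqrtr1//.
by move=> j ji; rewrite !mxE (negbTE ji) andbF mulr0.
Qed.

Lemma dotv_delta i x : dotv x (delta_mx 0 i) = x 0 i.
Proof.
rewrite /dotv (bigD1 i)//= !mxE !eqxx/= mulr1 big1 ?addr0//.
by move=> j ji; rewrite !mxE (negbTE ji) andbF mulr0.
Qed.

Lemma mx_norm_le_l2norm x : `|x| <= l2norm x.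
Proof.
have [->|/mx_norm_neq0[i]] := eqVneq `|x| 0; first exact: l2norm_ge0.
by rewrite [`|x|]/(Num.norm _)/= => ->; rewrite (ord1 i.1) coord_le_l2norm.
Qed.

Lemma coord_le_mx_norm x i : `|x 0 i| <= `|x|.
Proof.
rewrite [`|x|]/(Num.norm _)/= mx_normrE.
by apply: (@le_bigmax _ _ _ _ (fun ij : 'I_1 * 'I_n => `|x ij.1 ij.2|) (0, i)).
Qed.

Lemma l2norm_le_mx_norm x : l2norm x <= n%:R * `|x|.
Proof. by apply: l2norm_le_coord => // i; exact: coord_le_mx_norm. Qed.

(** The topology on row vectors comes from the max norm, which is equivalent to
    the Euclidean one. *)
Lemma nbhs_l2normP x (A : set 'rV[R]_n) :
  nbhs x A <-> exists2 e, 0 < e & forall y, l2norm (y - x) < e -> A y.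
Proof.
split.
  move=> /nbhs_ballP[e /= e0 h]; exists e => // y yx; apply: h.
  by rewrite -ball_normE /=; rewrite distrC (le_lt_trans (mx_norm_le_l2norm _)).
case=> e e0 h; apply/nbhs_ballP; exists (e / n.+1%:R) => /=; first by rewrite divr_gt0.
move=> y; rewrite -ball_normE /= distrC => yx; apply: h.
apply: (le_lt_trans (l2norm_le_mx_norm _)).
rewrite ltr_pdivlMr// in yx; apply: le_lt_trans yx.
by rewrite mulrC ler_wpM2l// ler_nat.
Qed.

Lemma near_l2norm x (P : 'rV[R]_n -> Prop) :
  (\forall y \near x, P y) <->
  exists2 e, 0 < e & forall y, l2norm (y - x) < e -> P y.
Proof. exact: nbhs_l2normP. Qed.

Lemma eball_open x r : open (eball x r).
Proof.
rewrite openE => y /= yx; apply/nbhs_l2normP; exists (r - l2norm (y - x)).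
  by rewrite subr_gt0.
move=> z zy /=; rewrite /eball/=.
by have := l2norm_dist z y x; move: zy; lra.
Qed.

Lemma l2norm_continuous : continuous (fun x => l2norm x).
Proof.
move=> x; apply/(@cvgrPdist_lt _ R^o _ (nbhs x) (nbhs_filter x)) => e e0.
apply/near_l2norm; exists e => // y yx.
have := ler_l2norm_add x y; have := ler_l2norm_add y x.
by rewrite (l2normBC x y) => h1 h2; rewrite ltr_norml; apply/andP; split; lra.
Qed.

Lemma ecball_closed x r : closed (ecball x r).
Proof.
rewrite (_ : ecball x r = (fun y => l2norm (y - x)) @^-1` [set s | s <= r])//.
apply: closed_comp; last exact: closed_le.
move=> y _; apply: (@continuous_comp _ _ _ (fun y => y - x)).
  by apply: continuousB => //; exact: cst_continuous.
exact: l2norm_continuous.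
Qed.

Lemma bounded_l2norm (A : set 'rV[R]_n) r :
  (forall y, A y -> l2norm y <= r) -> bounded_set A.
Proof.
move=> h; exists r; split; first by rewrite num_real.
move=> s rs y Ay /=; apply: le_trans (mx_norm_le_l2norm _) _.
by apply: le_trans (h _ Ay) (ltW rs).
Qed.

Lemma ecball_compact x r : compact (ecball x r).
Proof.
apply: bounded_closed_compact; last exact: ecball_closed.
apply: (@bounded_l2norm _ (l2norm x + r)) => y /= yx.
by apply: le_trans (ler_l2norm_add x y) _; rewrite lerD2l.
Qed.

Lemma ecball_sub_eball (x : 'rV[R]_n) r s : (0 < n)%N -> 0 < r ->
  ecball x r `<=` eball 0 s -> l2norm x + r < s.
Proof.
move=> n0 r0 h.
have [x0|x0] := eqVneq (l2norm x) 0.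
  have := h (r *: delta_mx 0 (Ordinal n0)); rewrite /ecball /eball/= subr0.
  rewrite (l2norm_eq0 x0) subr0 l2norm0 add0r l2normZ l2norm_delta mulr1.
  by rewrite gtr0_norm//; apply.
have xp : 0 < l2norm x by rewrite lt_neqAle eq_sym x0 l2norm_ge0.
have := h ((1 + r / l2norm x) *: x).
rewrite /ecball /eball/= subr0 {1}scalerDl scale1r (addrC x) addrK !l2normZ.
rewrite !gtr0_norm ?addr_gt0 ?divr_gt0// divfK// mulrDl mul1r divfK//.
by apply; rewrite lexx.
Qed.

End euclid.

(** * Lebesgue measure on row vectors *)

Section measurability.
Context {R : realType} {n : nat}.
Local Notation V := 'rV[R]_n.

(** The sigma-algebra generated by the coordinates contains the open sets,
    because an open set is a countable union of rational boxes. *)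
Lemma open_measurable_rV (A : set V) : open A -> measurable A.
Proof.
move=> oA.
pose box (c : 'rV[rat]_n * nat) : set V :=
  [set x | forall i, `|x 0 i - ratr (c.1 0 i)| < c.2.+1%:R^-1].
have mbox c : measurable (box c).
  rewrite (_ : box c = \bigcap_(i in [set: 'I_n])
      ((fun v : V => v 0 i) @^-1` ball (ratr (c.1 0 i) : R) c.2.+1%:R^-1)).
    apply: fin_bigcap_measurable => // i _.
    rewrite -[X in measurable X]setTI.
    by apply: (measurable_coord i measurableT); exact: measurable_ball.
  apply/seteqP; split => [x h i _ /=|x h i].
    by rewrite -ball_normE /= distrC.
  by have := h i I; rewrite /= -ball_normE /= distrC.
rewrite (_ : A = \bigcup_c (if `[< box c `<=` A >] then box c else set0)).
  apply: countable_bigcupT_measurable => [|c]; last by case: ifP.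
  exact: countableP.
apply/seteqP; split => [x Ax|x [c _]]; last by case: asboolP => // h /h.
have /nbhs_ballP[e /= e0 h] := open_nbhs_nbhs (conj oA Ax).
have [k /= ke] : exists k : nat, k.+1%:R^-1 < e / 2.
  have : (0 : R) < e / 2 by rewrite divr_gt0.
  by move=> /ltr_add_invr[k]; rewrite add0r => ?; exists k.
have /choice[q qx] : forall i : 'I_n, exists q : rat, `|x 0 i - ratr q| < k.+1%:R^-1.
  move=> i; have [|q] := @rat_in_itvoo R (x 0 i - k.+1%:R^-1) (x 0 i).
    by rewrite ltrBlDr ltrDl.
  rewrite in_itv/= => /andP[q1 q2]; exists q.
  by rewrite ger0_norm ?subr_ge0 ?(ltW q2)// ltrBlDr addrC -ltrBlDr.
exists (\row_i q i, k) => //=; case: asboolP => [_|[]].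
  by move=> i /=; rewrite mxE.
move=> y yb; apply: h; rewrite -ball_normE /=.
have [->|/mx_norm_neq0[i]] := eqVneq `|x - y| 0; first by [].
rewrite [`|x - y|]/(Num.norm _)/= => ->; rewrite (ord1 i.1) !mxE.
have := yb i.2; have := qx i.2; rewrite /= mxE.
move: (k.+1%:R^-1) ke => d ke h1 h2.
rewrite (_ : x 0 i.2 - y 0 i.2 = (x 0 i.2 - ratr (q i.2)) - (y 0 i.2 - ratr (q i.2))).
  by apply: le_lt_trans (ler_normB _ _) _; lra.
by ring.
Qed.

Lemma measurable_fun_lt (D : set V) (f : V -> R) :
  (forall a, measurable (D `&` [set x | f x < a])) -> measurable_fun D f.
Proof.
move=> h mD; apply: (measurability _ (RGenInftyO.measurableE R)) => //.
move=> _ [_ [a ->] <-]; rewrite (_ : _ `&` _ = D `&` [set x | f x < a])//.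
Qed.

Lemma continuous_measurable_rV (f : V -> R) :
  continuous f -> measurable_fun setT f.
Proof.
move=> cf; apply: measurable_fun_lt => a; rewrite setTI.
apply: open_measurable_rV.
rewrite (_ : mkset _ = f @^-1` [set y | y < a])//.
by move/continuousP : cf => /(_ _); apply; exact: open_lt.
Qed.

Lemma eball_measurable (c : V) r : measurable (eball c r).
Proof. by apply: open_measurable_rV; exact: eball_open. Qed.

Lemma ecball_measurable (c : V) r : measurable (ecball c r).
Proof.
rewrite -(setCK (ecball c r)); apply: measurableC; apply: open_measurable_rV.
by rewrite openC; exact: ecball_closed.
Qed.

Lemma compact_measurable_rV (K : set V) : compact K -> measurable K.
Proof.
move=> cK; rewrite -(setCK K); apply: measurableC; apply: open_measurable_rV.
rewrite openC; apply: compact_closed => //; exact: norm_hausdorff.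
Qed.

End measurability.

Section affine.
Context {R : realType}.

Definition affine_map n (a : 'rV[R]_n) (s : R) (x : 'rV[R]_n) := a + s *: x.

Lemma measurable_affine_map n (a : 'rV[R]_n) s :
  measurable_fun setT (affine_map a s).
Proof.
apply: measurable_fun_coordP => i; rewrite /affine_map.
under eq_fun do rewrite !mxE.
apply: measurable_funD => //; apply: measurable_funM => //.
exact: measurable_coord.
Qed.

Lemma lebesgue_measure_affine (a s : R) (s0 : s != 0) (A : set R) :
  measurable A ->
  lebesgue_measure A = (`|s|%:E * lebesgue_measure ((fun t => a + s * t)%R @^-1` A))%E.
Proof.
move=> mA.
have mf : measurable_fun setT (fun t : measurableTypeR R => a + s * t : measurableTypeR R).
  by apply: measurable_funD => //; apply: measurable_funM.
pose m := mscale (NngNum (normr_ge0 s))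
  (measure_function_pushforward__canonical__measure_function_Measure
     lebesgue_measure mf).
rewrite (lebesgue_measure_unique (mu := m))// => X /ocitvP[->|[[x y]/= xy ->]].
  by rewrite !measure0.
rewrite /m /mscale /= /pushforward.
rewrite lebesgue_measure_itv /= lte_fin xy.
have [sp|sn|/eqP] := ltgtP s 0; last by rewrite (negbTE s0).
  rewrite (_ : _ @^-1` _ = `[(y - a) / s, (x - a) / s[%classic).
    rewrite lebesgue_measure_itv/= lte_fin ltr_nM2r ?invr_lt0// ltrD2r xy.
    by rewrite ltr0_norm// -EFinM; congr EFin; field.
  apply/seteqP; split => t /=; rewrite !in_itv/=.
    by rewrite ler_ndivrMr// ltr_ndivlMr// => /andP[? ?]; apply/andP; split; lra.
  by rewrite ler_ndivrMr// ltr_ndivlMr// => /andP[? ?]; apply/andP; split; lra.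
rewrite (_ : _ @^-1` _ = `](x - a) / s, (y - a) / s]%classic).
  rewrite lebesgue_measure_itv/= lte_fin ltr_pM2r ?invr_gt0// ltrD2r xy.
  by rewrite gtr0_norm// -EFinM; congr EFin; field.
apply/seteqP; split => t /=; rewrite !in_itv/=.
  by rewrite ler_pdivlMr// ltr_pdivrMr// => /andP[? ?]; apply/andP; split; lra.
by rewrite ler_pdivlMr// ltr_pdivrMr// => /andP[? ?]; apply/andP; split; lra.
Qed.

Lemma rV_cons_affine n (a : 'rV[R]_n.+1) s t (x : 'rV[R]_n) :
  affine_map a s (rV_cons (t, x)) =
  rV_cons (a 0 0 + s * t, affine_map (rV_uncons a).2 s x).
Proof.
apply/rowP => i.
have -> : affine_map a s (rV_cons (t, x)) 0 i = a 0 i + s * rV_cons (t, x) 0 i.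
  by rewrite mxE [X in _ + X]mxE.
case: (unliftP ord0 i) => [j|] ->.
  rewrite (rV_consS (t, x) j) (rV_consS (_, _) j)/= !mxE.
  by congr (a _ _ + _); exact: val_inj.
by rewrite !rV_cons0.
Qed.

(** Both sides are measures on a product, so it suffices to compare them on
    rectangles, by induction on the dimension. *)
Lemma lebesgue_rV_affine n (a : 'rV[R]_n) (s : R) (s0 : s != 0)
    (A : set 'rV[R]_n) : measurable A ->
  lebesgue_rV n A = ((`|s| ^+ n)%:E * lebesgue_rV n (affine_map a s @^-1` A))%E.
Proof.
elim: n a A => [|n IHn] a A mA.
  rewrite expr0 mul1e /= !diracE; congr (_ %:R%:E); congr nat_of_bool.
  by apply/idP/idP; rewrite !inE /= [affine_map _ _ _]thinmx0.
rewrite /= /lebesgue_rV_step /pushforward.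
set X := @rV_cons R n @^-1` A.
have mX : measurable X by rewrite -[X]setTI; exact: measurable_rV_cons.
have mfst : measurable_fun setT (fun p : measurableTypeR R * 'rV[R]_n => p.1 : R).
  exact: measurable_fst.
have mf : measurable_fun setT (fun p : measurableTypeR R * 'rV[R]_n =>
    (a 0 0 + s * p.1 : measurableTypeR R, affine_map (rV_uncons a).2 s p.2)).
  apply: measurable_fun_pair.
    by apply: measurable_funD => //; apply: measurable_funM.
  apply: (measurableT_comp (measurable_affine_map (rV_uncons a).2 s)).
  exact: measurable_snd.
have e0 : 0 <= `|s| ^+ n.+1 by rewrite exprn_ge0.
pose m := mscale (NngNum e0) 
  (measure_function_pushforward__canonical__measure_function_Measure
     (lebesgue_measure \x lebesgue_rV n)%E mf).
apply: etrans (@product_measure_unique _ _ _ _ _ lebesgue_measure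
  (lebesgue_rV n) m _ X mX) _; last first.
  rewrite /m /mscale /= /pushforward; congr (_ * _)%E.
  by congr product_measure1; apply/seteqP; split => -[t x] /=;
    rewrite /X/= -rV_cons_affine.
move=> B C mB mC.
transitivity ((`|s| ^+ n.+1)%:E * (lebesgue_measure \x lebesgue_rV n)
  (((fun t => a 0 0 + s * t)%R @^-1` B) `*`
   (affine_map (rV_uncons a).2 s @^-1` C)))%E.
  by congr (_ * _)%E; congr product_measure1; apply/seteqP; split => -[].
rewrite product_measure1E//; first last.
- by rewrite -[X in measurable X]setTI; exact: measurable_affine_map.
- rewrite -[X in measurable X]setTI.
  have mf' : measurable_fun setT (fun t : measurableTypeR R => a 0 0 + s * t : measurableTypeR R).
    by apply: measurable_funD => //; apply: measurable_funM.
  exact: mf'.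
rewrite exprS EFinM muleACA (IHn (rV_uncons a).2 _ mC); congr (_ * _)%E.
exact/esym/(lebesgue_measure_affine (a 0 0) s0 mB).
Qed.

End affine.

(** * Balls and integrals of bounded functions with bounded support *)

Section balls.
Context {R : realType} {n : nat}.
Local Notation V := 'rV[R]_n.
Local Notation mu := (lebesgue_rV (R := R) n).

Let cube r : set V := [set v | forall i, `[- r, r]%classic (v 0 i)].

Let cube_measurable r : measurable (cube r).
Proof.
rewrite (_ : cube r = \bigcap_(i in [set: 'I_n]) ((fun v : V => v 0 i) @^-1` `[- r, r]%classic)).
  apply: fin_bigcap_measurable => // i _; rewrite -[X in measurable X]setTI.
  by apply: (measurable_coord i measurableT); exact: measurable_itv.
by apply/seteqP; split => [v Bv i _|v Bv i]; [exact: Bv|exact: (Bv i)].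
Qed.

Let cube_measure r : 0 < r -> mu (cube r) = ((2 * r) ^+ n)%:E.
Proof.
move=> r0.
rewrite [LHS](@lebesgue_rV_box R n (fun=> `[- r, r]%classic)).
  under eq_bigr do rewrite lebesgue_measure_itv/= lte_fin gtrN// -EFinB.
  rewrite prodEFin prodr_const card_ord; congr (_ ^+ _)%:E; ring.
by move=> i; exact: measurable_itv.
Qed.

Lemma ecball_fin c r : (mu (ecball c r) < +oo)%E.
Proof.
pose s := `|r| + l2norm c + 1.
have s0 : 0 < s by rewrite /s ltr_wpDl// addr_ge0// l2norm_ge0.
apply: (@le_lt_trans _ _ (mu (cube s))); last by rewrite cube_measure// ltry.
apply: le_measure; rewrite ?inE//; first exact: ecball_measurable.
move=> x; rewrite /ecball/= => xr i; rewrite /= in_itv/= -ler_norml.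
rewrite (le_trans (coord_le_l2norm x i))//.
by have := ler_l2norm_add c x; have := ler_norm r; rewrite /s; lra.
Qed.

Lemma eball_fin c r : (mu (eball c r) < +oo)%E.
Proof.
apply: le_lt_trans (ecball_fin c r); apply: le_measure; rewrite ?inE.
- exact: eball_measurable.
- exact: ecball_measurable.
- by move=> x /ltW.
Qed.

Definition vol : R := fine (mu (eball 0 1)).

Lemma mu_eball01 : mu (eball 0 1) = vol%:E.
Proof. by rewrite /vol fineK// ge0_fin_numE// eball_fin. Qed.

Lemma vol_gt0 : 0 < vol.
Proof.
rewrite -lte_fin -mu_eball01.
pose s : R := (n.+1%:R)^-1.
have s0 : 0 < s by rewrite invr_gt0.
apply: (@lt_le_trans _ _ (mu (cube s))).
  by rewrite cube_measure// lte_fin exprn_gt0// mulr_gt0.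
apply: le_measure; rewrite ?inE//; first exact: eball_measurable.
move=> x h; rewrite /eball/= subr0.
apply: (@le_lt_trans _ _ (n%:R * s)).
  by apply: l2norm_le_coord; [exact: ltW|move=> i; have := h i; rewrite /= in_itv/= -ler_norml].
by rewrite ltr_pdivrMr// mul1r ltr_nat.
Qed.

Lemma mu_eball c r : 0 < r -> mu (eball c r) = (r ^+ n * vol)%:E.
Proof.
move=> r0; rewrite (lebesgue_rV_affine c (lt0r_neq0 r0)); last exact: eball_measurable.
rewrite gtr0_norm// EFinM -mu_eball01; congr (_ * mu _)%E.
apply/seteqP; split => x; rewrite /eball /affine_map/= subr0 addrC addKr l2normZ gtr0_norm//.
  by rewrite gtr_pMr.
by rewrite gtr_pMr.
Qed.

(** A closed ball lies in open balls of any larger radius, whose measures are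
    known by scaling, so it has the measure of the open ball. *)
Lemma mu_sphere0 (c : V) r : 0 < r -> mu [set x | l2norm (x - c) = r] = 0.
Proof.
move=> r0.
have -> : [set x : V | l2norm (x - c) = r] = ecball c r `\` eball c r.
  apply/seteqP; split => x /=; rewrite /ecball /eball/=.
    by move=> ->; rewrite lexx ltxx.
  by move=> [h /negP]; rewrite -leNgt => h'; apply/eqP; rewrite eq_le h h'.
rewrite measureD; [|exact: ecball_measurable|exact: eball_measurable|exact: ecball_fin].
rewrite (_ : ecball c r `&` eball c r = eball c r); last first.
  by apply/seteqP; split => x; [case|move=> h; split => //; exact: ltW].
suff e : mu (ecball c r) = mu (eball c r).
  apply: etrans (congr1 (fun t => t - mu (eball c r))%E e) _.
  by rewrite subee// ge0_fin_numE// eball_fin.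
apply/eqP; rewrite eq_le; apply/andP; split; last first.
  by apply: le_measure; rewrite ?inE; [exact: eball_measurable|exact: ecball_measurable|move=> x /ltW].
have f : (mu (ecball c r) \is a fin_num)%E by rewrite ge0_fin_numE// ecball_fin.
rewrite -(fineK f) mu_eball// lee_fin.
pose u k : R := (r * (1 + k.+1%:R^-1)) ^+ n * vol.
have ul : u k @[k --> \oo] --> r ^+ n * vol.
  rewrite -[X in X ^+ n]mulr1 -[X in r * X](addr0 1).
  apply: cvgM; last exact: cvg_cst.
  have h : r * (1 + k.+1%:R^-1) @[k --> \oo] --> r * (1 + 0).
    by apply: cvgM; [exact: cvg_cst|apply: cvgD; [exact: cvg_cst|exact: cvg_harmonic]].
  exact: (cvg_comp _ _ h (@exprn_continuous _ n _)).
rewrite -(cvg_lim _ ul)//; apply: limr_ge; first by apply/cvg_ex; exists (r ^+ n * vol).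
apply: nearW => k; rewrite -lee_fin fineK// /u -(mu_eball c); last first.
  by rewrite mulr_gt0// addr_gt0.
apply: le_measure; rewrite ?inE; [exact: ecball_measurable|exact: eball_measurable|].
move=> x /le_lt_trans; apply; rewrite mulrDr mulr1 ltrDl.
by rewrite mulr_gt0.
Qed.

End balls.

Arguments vol R n : clear implicits.

Section bounded_integral.
Context {R : realType} {n : nat}.
Local Notation V := 'rV[R]_n.
Local Notation mu := (lebesgue_rV (R := R) n).
Implicit Types (f g : V -> R) (M : R).

(** Almost every integrand below is of this kind; a single constant bounds
    both the values and the support, which keeps side conditions short. *)
Definition bms M f := [/\ measurable_fun setT f, forall x, `|f x| <= M
  & forall x, M < l2norm x -> f x = 0].

Definition Int f : R := \int[mu]_x f x.

Lemma bmsW M M' f : M <= M' -> bms M f -> bms M' f.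
Proof.
move=> MM [mf b s]; split => // [x|x Mx]; first exact: le_trans (b x) MM.
by apply: s; exact: le_lt_trans Mx.
Qed.

Lemma bms_integrable M f : bms M f -> mu.-integrable setT (EFin \o f).
Proof.
case=> mf b s.
have := ecball_measurable (0 : V) M; set B := ecball _ _ => mB.
have -> : f = f \_ B.
  apply/funext => x; rewrite patchE; case: ifPn => //.
  rewrite notin_setE /B /ecball/= subr0 => /negP; rewrite -ltNge.
  exact: s.
rewrite -restrict_EFin; apply/integrable_restrict => //=; rewrite setTI.
apply: measurable_bounded_integrable => //.
- exact: ecball_fin.
- exact: measurable_funS mf.
- exists M; split; first by rewrite num_real.
  by move=> N MN x _ /=; exact: le_trans (b x) (ltW MN).
Qed.

Definition ballfun M (x : V) : R := M * \1_(ecball 0 M) x.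

Lemma ballfun_ge0 M x : 0 <= M -> 0 <= ballfun M x.
Proof. by move=> M0; rewrite mulr_ge0// indicE. Qed.

Lemma bms_ballfun M : 0 <= M -> bms (M + 1) (ballfun M).
Proof.
move=> M0; split => [|x|x h]; rewrite /ballfun.
- apply: measurable_funM => //; apply: measurable_indic; exact: ecball_measurable.
- rewrite indicE; case: (x \in _); rewrite ?mulr1 ?mulr0 ?normr0 ?ger0_norm//; lra.
- rewrite indicE memNset ?mulr0// /ecball/= subr0 => h'.
  by move: h; lra.
Qed.

Lemma bms_indic M (A : set V) : 0 <= M -> measurable A ->
  (forall x, A x -> l2norm x <= M) -> bms (M + 1) (\1_A).
Proof.
move=> M0 mA h; split => [|x|x Mx]; first exact: measurable_indic.
- by rewrite indicE; case: (x \in A); rewrite ?normr1 ?normr0; lra.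
- by rewrite indicE memNset// => /h; move: Mx; lra.
Qed.

Lemma ballfun_dominates M (a : R) x : `|a| <= M -> (M < l2norm x -> a = 0) ->
  `|a| <= ballfun M x.
Proof.
move=> b s; rewrite /ballfun indicE; case: (boolP (x \in _)) => [_|]; first by rewrite mulr1.
rewrite notin_setE /ecball/= subr0 => /negP; rewrite -ltNge => /s ->.
by rewrite normr0 mulr0.
Qed.

Lemma bms_ballfun_ge M f x : bms M f -> `|f x| <= ballfun M x.
Proof. by move=> [_ b s]; apply: ballfun_dominates => //; exact: s. Qed.

Lemma Int_ext f g : f =1 g -> Int f = Int g.
Proof. by move=> fg; congr Int; exact/funext. Qed.

Lemma bms0 M : 0 <= M -> bms M (fun=> 0).
Proof. by move=> M0; split => // x; rewrite normr0. Qed.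

Lemma bmsD M N f g : bms M f -> bms N g -> bms (M + N) (fun x => f x + g x).
Proof.
move=> [mf bf sf] [mg bg sg]; split; first exact: measurable_funD.
  by move=> x; apply: le_trans (ler_normD _ _) _; apply: lerD.
move=> x h; have M0 := le_trans (normr_ge0 _) (bf 0).
have N0 := le_trans (normr_ge0 _) (bg 0).
by rewrite sf ?sg ?addr0//; lra.
Qed.

(** For second factors, such as smooth functions, that are bounded only on
    bounded sets. *)
Lemma bmsM M N f g : bms M f -> measurable_fun setT g ->
  (forall x, f x != 0 -> `|g x| <= N) -> bms (M * (1 + `|N|)) (fun x => f x * g x).
Proof.
move=> [mf bf sf] mg bg.
have M0 := le_trans (normr_ge0 _) (bf 0).
split; first exact: measurable_funM.
  move=> x; rewrite normrM.
  have [->|/bg h] := eqVneq (f x) 0; first by rewrite normr0 mul0r mulr_ge0// addr_ge0.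
  apply: ler_pM => //; apply: le_trans h _.
  by apply: le_trans (ler_norm _) _; rewrite lerDr.
move=> x h; rewrite sf ?mul0r//; apply: le_lt_trans h.
by rewrite ler_peMr// lerDl.
Qed.

Lemma bmsZ M f a : bms M f -> bms (M * (1 + `|a|)) (fun x => a * f x).
Proof.
move=> bf; rewrite (_ : (fun x => _) = fun x => f x * a); last first.
  by apply/funext => x; rewrite mulrC.
by have := @bmsM M `|a| f (cst a) bf (measurable_cst a) (fun _ _ => lexx _); rewrite normr_id.
Qed.

Lemma bmsN M f : bms M f -> bms M (fun x => - f x).
Proof.
move=> [mf bf sf]; split => [|x|x /sf ->]; last by rewrite oppr0.
- exact: measurable_funN.
- by rewrite normrN.
Qed.

Lemma bmsB M N f g : bms M f -> bms N g -> bms (M + N) (fun x => f x - g x).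
Proof. by move=> bf bg; apply: bmsD => //; exact: bmsN. Qed.

Lemma IntD M N f g : bms M f -> bms N g ->
  Int (fun x => f x + g x) = Int f + Int g.
Proof. by move=> /bms_integrable bf /bms_integrable bg; exact: RintegralD. Qed.

Lemma IntZ M a f : bms M f -> Int (fun x => a * f x) = a * Int f.
Proof. by move=> /bms_integrable bf; exact: RintegralZl. Qed.

Lemma IntN M f : bms M f -> Int (fun x => - f x) = - Int f.
Proof.
by move=> bf; rewrite -mulN1r -(IntZ _ bf); apply: Int_ext => x; rewrite mulN1r.
Qed.

Lemma IntB M N f g : bms M f -> bms N g ->
  Int (fun x => f x - g x) = Int f - Int g.
Proof. by move=> bf bg; rewrite (IntD bf (bmsN bg)) (IntN bg). Qed.

Lemma Int_le M N f g : bms M f -> bms N g -> (forall x, f x <= g x) ->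
  Int f <= Int g.
Proof.
by move=> /bms_integrable bf /bms_integrable bg fg; apply: le_Rintegral.
Qed.

Lemma Int_ge0 f : (forall x, 0 <= f x) -> 0 <= Int f.
Proof. by move=> f0; apply: Rintegral_ge0 => x _. Qed.

Lemma Int0 : Int (fun=> 0) = 0.
Proof. by rewrite /Int /Rintegral integral0. Qed.

Lemma bms_norm M f : bms M f -> bms M (fun x => `|f x|).
Proof.
move=> [mf bf sf]; split => [|x|x /sf ->]; last by rewrite normr0.
- exact: measurableT_comp.
- by rewrite normr_id.
Qed.

Lemma Int_norm M f : bms M f -> `|Int f| <= Int (fun x => `|f x|).
Proof. by move=> /bms_integrable bf; apply: le_normr_Rintegral. Qed.

Lemma bms_sum (J : finType) M (f : J -> V -> R) : (forall j, bms M (f j)) ->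
  exists M', bms M' (fun x => \sum_j f j x).
Proof.
move=> bf; rewrite /index_enum; elim: (Finite.enum J) => [|j s [M' IH]].
  by exists 0; under eq_fun do rewrite big_nil; exact: bms0.
exists (M + M'); under eq_fun do rewrite big_cons.
exact: bmsD.
Qed.

Lemma Int_sum (J : finType) M (f : J -> V -> R) : (forall j, bms M (f j)) ->
  Int (fun x => \sum_j f j x) = \sum_j Int (f j).
Proof.
move=> bf; rewrite /index_enum.
suff : (exists M', bms M' (fun x => \sum_(j <- Finite.enum J) f j x)) /\
    Int (fun x => \sum_(j <- Finite.enum J) f j x) =
    \sum_(j <- Finite.enum J) Int (f j) by case.
elim: (Finite.enum J) => [|j s [[M' bs] IH]].
  rewrite (_ : (fun x => _) = fun=> 0); last by apply/funext => x; rewrite big_nil.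
  by rewrite big_nil Int0; split => //; exists 0; exact: bms0.
rewrite (_ : (fun x => _) = fun x => f j x + \sum_(i <- s) f i x); last first.
  by apply/funext => x; rewrite big_cons.
rewrite big_cons -IH; split; last by apply: IntD (bf j) bs.
by exists (M + M'); exact: bmsD.
Qed.

Lemma bms_affine M f a s : s != 0 -> bms M f ->
  bms (M + (M + l2norm a) / `|s|) (fun x => f (a + s *: x)).
Proof.
move=> s0 [mf bf sf]; have sp : 0 < `|s| by rewrite normr_gt0.
have M0 := le_trans (normr_ge0 _) (bf 0).
have q0 : 0 <= (M + l2norm a) / `|s|.
  by rewrite divr_ge0// addr_ge0// l2norm_ge0.
split.
- apply: (measurableT_comp mf (measurable_affine_map a s)).
- by move=> x; apply: le_trans (bf _) _; rewrite lerDl.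
- move=> x h; apply: sf.
  have : (M + l2norm a) / `|s| < l2norm x by apply: le_lt_trans h; rewrite lerDr.
  rewrite ltr_pdivrMr// mulrC -l2normZ => h'.
  have := l2normB (a + s *: x) a; rewrite addrC addKr; lra.
Qed.

Lemma ge0_integral_affine (g : V -> \bar R) a s : s != 0 ->
  measurable_fun setT g -> (forall x, 0 <= g x)%E ->
  (\int[mu]_x g x = (`|s| ^+ n)%:E * \int[mu]_x g (a + s *: x)%R)%E.
Proof.
move=> s0 mg g0.
have e0 : 0 <= `|s| ^+ n by rewrite exprn_ge0.
pose m := mscale (NngNum e0)
  (measure_function_pushforward__canonical__measure_function_Measure
     mu (measurable_affine_map a s)).
rewrite (eq_measure_integral m); last first.
  by move=> A mA _; exact: (lebesgue_rV_affine a s0 mA).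
rewrite ge0_integral_mscale//= ge0_integral_pushforward//.
exact: measurable_affine_map.
Qed.

Lemma Int_affine M f a s : s != 0 -> bms M f ->
  Int f = `|s| ^+ n * Int (fun x => f (a + s *: x)).
Proof.
move=> s0; wlog f0 : M f / forall x, 0 <= f x => [h bf|bf].
  have [mf b sf] := bf; have M0 : 0 <= M := le_trans (normr_ge0 _) (b 0).
  pose p x := Num.max (f x) 0; pose q x : R := Num.max (- f x) 0.
  have bp : bms M p.
    split => [|x|x /sf]; rewrite /p; [exact: measurable_maxr| |by move=> ->; rewrite maxxx].
    by have := b x; rewrite !ler_norml => /andP[? ?]; case: (leP (f x) 0) => ?; apply/andP; split; lra.
  have bq : bms M q.
    split => [|x|x /sf]; rewrite /q; [|by move: (b x); rewrite !ler_norml => /andP[? ?]; case: (leP (- f x) 0) => ?; apply/andP; split; lra|by move=> ->; rewrite oppr0 maxxx].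
    by apply: measurable_maxr => //; exact: measurable_funN.
  have fE : f = (fun x => p x - q x).
    by apply/funext => x; rewrite /p /q; case: (leP (f x) 0) => ?; case: (leP (- f x) 0) => ?; lra.
  have p0 x : 0 <= p x by rewrite le_max lexx orbT.
  have q0 x : 0 <= q x by rewrite le_max lexx orbT.
  rewrite fE (IntB bp bq) (IntB (bms_affine a s0 bp) (bms_affine a s0 bq)).
  by rewrite mulrBr -(h _ _ p0 bp) -(h _ _ q0 bq).
have i2 := bms_integrable (bms_affine a s0 bf).
rewrite /Int /Rintegral (ge0_integral_affine a s0)//; last first.
  by apply/measurable_EFinP; case: bf.
by rewrite fineM//; exact: integrable_fin_num i2.
Qed.

(** Dominated convergence, the dominating function being constant on a ball. *)
Lemma Int_cvg M N (F : nat -> V -> R) f : (forall k, bms M (F k)) -> bms N f ->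
  {ae mu, forall x, F k x @[k --> \oo] --> f x} ->
  Int (F k) @[k --> \oo] --> Int f.
Proof.
move=> bF bf Ff.
have [mf _ _] := bf.
have M0 : 0 <= M by case: (bF 0%N) => _ /(_ 0) + _; exact: le_trans.
have bg := bms_ballfun M0.
have := @dominated_convergence _ _ _ mu setT measurableT
  (fun k => EFin \o F k) (EFin \o f) _ _ _ _ (bms_integrable bg) _.
case.
- by move=> k; apply/measurable_EFinP; case: (bF k).
- exact/measurable_EFinP.
- by apply: filterS Ff => x h _; apply: cvg_EFin => //; exact: nearW.
- by apply: aeW => x k _ /=; rewrite lee_fin; exact: bms_ballfun_ge.
move=> _ _ h; apply: fine_cvg; rewrite fineK; first exact: h.
by apply: integrable_fin_num => //; exact: bms_integrable bf.
Qed.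

Lemma Int_cvg_all M (F : nat -> V -> R) f : (forall k, bms M (F k)) ->
  (forall x, F k x @[k --> \oo] --> f x) ->
  bms M f /\ Int (F k) @[k --> \oo] --> Int f.
Proof.
move=> bF Ff; suff bf : bms M f by split => //; apply: (Int_cvg bF bf); exact: aeW.
split => [|x|x Mx].
- apply: (measurable_fun_cvg (h := F)) => [k|x _]; last exact: Ff.
  by case: (bF k).
- have /cvg_norm h := Ff x; rewrite -(cvg_lim _ h)//.
  by apply: limr_le; [apply/cvg_ex; eexists; exact: h|apply: nearW => k; case: (bF k)].
- rewrite -(cvg_lim _ (Ff x))// (_ : (fun k => _) = cst 0) ?lim_cst//.
  by apply/funext => k /=; case: (bF k) => _ _; apply.
Qed.

Lemma Int_ae_eq M N f g : bms M f -> bms N g -> {ae mu, forall x, f x = g x} ->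
  Int f = Int g.
Proof.
move=> bf bg fg.
have h := Int_cvg (fun=> bf) bg (F := fun=> f).
rewrite -(cvg_lim _ (h _)) ?lim_cst//.
by apply: filterS fg => x ->; exact: cvg_cst.
Qed.

(** The derivatives in the parameter are dominated by a constant on a fixed ball. *)
Lemma Int_derive M (f df : R -> V -> R) (a e : R) : 0 < e ->
  (forall s, `|s - a| < e -> bms M (f s)) ->
  (forall s y, `|s - a| < e -> is_derive s 1 (f^~ y) (df s y)) ->
  (forall s y, `|s - a| < e -> `|df s y| <= M) ->
  (forall s y, `|s - a| < e -> M < l2norm y -> df s y = 0) ->
  is_derive a 1 (fun s => Int (f s)) (Int (df a)).
Proof.
move=> e0 bf dff bdf sdf.
have aa : `|a - a| < e by rewrite subrr normr0.
have M0 : 0 <= M by apply: le_trans (bdf a 0 aa).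
have II s : (`]a - e, a + e[%classic : set R) s -> `|s - a| < e.
  by rewrite /= in_itv/= => h; rewrite distrC ltr_distlC.
pose B := ecball (0 : V) M.
have mB : measurable B by exact: ecball_measurable.
pose G := ballfun M.
have bG : bms (M + 1) G by exact: bms_ballfun.
have d1 s y : `|s - a| < e -> partial1of2 f s y = df s y.
  by move=> sa; rewrite partial1of2E; have -> := @derive_val _ _ _ _ _ _ _ (dff s y sa).
have G0 y : 0 <= G y by exact: ballfun_ge0.
have Ia : (`]a - e, a + e[%classic : set R) a by rewrite /= in_itv/=; lra.
have i1 x : (`]a - e, a + e[%classic : set R) x -> mu.-integrable setT (EFin \o f x).
  by move=> /II xa; exact: bms_integrable (bf x xa).
have i2 x y : (`]a - e, a + e[%classic : set R) x -> setT y -> derivable (f ^~ y) x 1.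
  by move=> /II xa _; have [] := dff x y xa.
have i3 x y : (`]a - e, a + e[%classic : set R) x -> setT y -> `|partial1of2 f x y| <= G y.
  move=> /II xa _; rewrite d1//.
  by apply: ballfun_dominates; [exact: bdf|exact: sdf].
have := @derivable_under_integral _ _ _ mu f setT measurableT a _ _ Ia i1 i2 G G0 (bms_integrable bG) i3.
have := @differentiation_under_integral _ _ _ mu f setT measurableT a _ _ Ia i1 i2 G G0 (bms_integrable bG) i3.
rewrite derive1E => h1 h2; apply: DeriveDef => //; rewrite [LHS]h1.
by apply: eq_Rintegral => y _; rewrite d1.
Qed.

End bounded_integral.

Section fubini.
Context {R : realType} {n : nat}.
Local Notation V := 'rV[R]_n.
Local Notation mu := (lebesgue_rV (R := R) n).

Definition bms2 (M : R) (F : V -> V -> R) :=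
  [/\ measurable_fun setT (fun p : V * V => F p.1 p.2),
      forall x y, `|F x y| <= M
    & forall x y, M < l2norm x \/ M < l2norm y -> F x y = 0].

Lemma bms2_section M F x : bms2 M F -> bms M (F x).
Proof.
move=> [mF bF sF]; split => [|y|y My]; [|exact: bF|by apply: sF; right].
exact: (measurableT_comp mF (pair1_measurable x)).
Qed.

Lemma bms2_swap M F : bms2 M F -> bms2 M (fun x y => F y x).
Proof.
move=> [mF bF sF]; split => [|x y|x y h]; [|exact: bF|].
- exact: (measurableT_comp mF (@measurable_swap _ _ _ _)).
- by apply: sF; case: h; [right|left].
Qed.

Lemma bms2_integrable M F : bms2 M F ->
  (mu \x mu)%E.-integrable setT (fun p : V * V => (F p.1 p.2)%:E).
Proof.
move=> bF; have [mF b s] := bF.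
apply/integrable12ltyP => /=; first exact/measurable_EFinP.
pose B := ecball (0 : V) M.
have mB : measurable B by exact: ecball_measurable.
have fB : (mu B \is a fin_num)%E by rewrite ge0_fin_numE// ecball_fin.
have M0 : 0 <= M by exact: le_trans (b 0 0).
pose G := @ballfun R n M.
have bG : bms (M + 1) G by exact: bms_ballfun.
have G0 y : 0 <= G y by exact: ballfun_ge0.
have FG x y : `|F x y| <= \1_B x * G y.
  rewrite indicE; case: (boolP (x \in B)) => [_|].
    by rewrite mul1r; exact: bms_ballfun_ge (bms2_section x bF).
  rewrite notin_setE /B /ecball/= subr0 => /negP; rewrite -ltNge => h.
  by rewrite s ?normr0 ?mul0r ?mulr0//; left.
have h x : (\int[mu]_y `|(F x y)%:E| <= (\1_B x * Int G)%:E)%E.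
  rewrite EFinM.
  have -> : (Int G)%:E = (\int[mu]_y (G y)%:E)%E.
    by rewrite /Int /Rintegral fineK// integrable_fin_num//; exact: bms_integrable bG.
  rewrite -integralZl//; last exact: bms_integrable bG.
  apply: ge0_le_integral => //=.
  - apply/measurable_EFinP; apply: measurableT_comp => //.
    by case: (bms2_section x bF).
  - by apply/measurable_EFinP; apply: measurable_funM => //; case: bG.
  - by move=> y _; rewrite -EFinM lee_fin.
apply: (@le_lt_trans _ _ (\int[mu]_x (\1_B x * Int G)%:E)%E).
  apply: ge0_le_integral => //=.
  - by move=> x _; exact: integral_ge0.
  - apply: (@measurable_fun_fubini_tonelli_F _ _ _ _ _ mu (fun p : V * V => `|(F p.1 p.2)%:E|%E)) => //.
    by apply: measurableT_comp => //; exact/measurable_EFinP.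
  - by apply/measurable_EFinP; apply: measurable_funM => //; exact: measurable_indic.
  - by move=> x _; exact: h.
rewrite (eq_integral (fun x => (Int G)%:E * (\1_B x)%:E)%E); last first.
  by move=> x _; rewrite EFinM muleC.
rewrite integralZl//; last first.
  have := @bms_indic R n M B M0 mB; move/(_ _)/bms_integrable; apply.
  by move=> x; rewrite /B /ecball/= subr0.
rewrite integral_indic// setIT; move: fB; rewrite -[X in (_ * X)%E]/(mu B).
by move=> /fineK <-; rewrite -EFinM ltry.
Qed.

Lemma Int_fubini M F : bms2 M F ->
  Int (fun x => Int (F x)) = Int (fun y => Int (F^~ y)).
Proof.
move=> bF; have h := Fubini (bms2_integrable bF); rewrite /= in h.
rewrite /Int /Rintegral -[LHS]/(fine _) -[RHS]/(fine _).
have e1 : (fun x => (fine (\int[mu]_y (F x y)%:E))%:E)%E = (fun x => \int[mu]_y (F x y)%:E)%E.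
  apply/funext => x; rewrite fineK// integrable_fin_num//.
  exact: bms_integrable (bms2_section x bF).
have e2 : (fun y => (fine (\int[mu]_x (F x y)%:E))%:E)%E = (fun y => \int[mu]_x (F x y)%:E)%E.
  apply/funext => y; rewrite fineK// integrable_fin_num//.
  exact: bms_integrable (bms2_section y (bms2_swap bF)).
by rewrite e1 e2 h.
Qed.

Lemma bms_Int2 M F : bms2 M F ->
  bms (M + Int (@ballfun R n M)) (fun x => Int (F x)).
Proof.
move=> bF; have [mF b s] := bF.
have M0 : 0 <= M by exact: le_trans (b 0 0).
pose B := ecball (0 : V) M.
have mB : measurable B by exact: ecball_measurable.
pose G := @ballfun R n M.
have bG : bms (M + 1) G by exact: bms_ballfun.
split => [|x|x h].
- have := measurable_fubini_F (bms2_integrable bF).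
  rewrite (_ : fubini_F _ _ = fun x => (Int (F x))%:E); first by move/measurable_EFinP.
  apply/funext => x; rewrite /fubini_F /Int /Rintegral fineK// integrable_fin_num//.
  exact: bms_integrable (bms2_section x bF).
- apply: (le_trans (Int_norm (bms2_section x bF))).
  apply: (@le_trans _ _ (Int G)); last by rewrite lerDr.
  apply: (Int_le (bms_norm (bms2_section x bF)) bG) => y.
  exact: bms_ballfun_ge (bms2_section x bF).
- rewrite (_ : F x = fun=> 0) ?Int0//; apply/funext => y; apply: s; left.
  apply: le_lt_trans h; rewrite lerDl; apply: Int_ge0 => y'.
  exact: ballfun_ge0.
Qed.

End fubini.

(** * Smooth functions *)

Section differentials.
Context {R : realType} {n : nat}.
Local Notation V := 'rV[R]_n.
Implicit Types (f g : V -> R) (x y h v p : V).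

Lemma row_sum_coord v : v = \sum_i v 0 i *: delta_mx 0 i.
Proof. by rewrite {1}(matrix_sum_delta v) big_ord1. Qed.

Lemma derive_sum_partial f x v : differentiable f x ->
  'D_v f x = \sum_i v 0 i * partial i f x.
Proof.
move=> df; rewrite deriveE// {1}(row_sum_coord v) linear_sum.
by apply: eq_bigr => i _; rewrite linearZ/= /partial deriveE.
Qed.

Lemma is_derive_line f x v (t : R) : differentiable f (x + t *: v) ->
  is_derive t 1 (fun s : R => f (x + s *: v)) (\sum_i v 0 i * partial i f (x + t *: v)).
Proof.
move=> df.
have h : is_diff t (fun s : R => x + s *: v) (fun s => s *: v).
  rewrite -[X in is_diff_def _ _ X]add0r.
  exact: is_diffD.
have df' : differentiable (f \o (fun s : R => x + s *: v)) t.
  by apply: differentiable_comp.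
apply: DeriveDef; first exact: diff_derivable.
rewrite deriveE// [X in X _ = _](diff_comp (f := fun s : R => x + s *: v))//.
by rewrite /= (diff_val (is_diff_def := h)) scale1r -deriveE// derive_sum_partial.
Qed.

Lemma dotv_is_linear p : linear (dotv p : V -> R).
Proof. by move=> a x y; rewrite dotvDr dotvZr. Qed.

HB.instance Definition _ p := GRing.isLinear.Build R V R *:%R (dotv p) (dotv_is_linear p).

Lemma dotv_continuous p : continuous (dotv p : V -> R).
Proof.
move=> x; apply/(@cvgrPdist_lt _ R^o _ (nbhs x) (nbhs_filter x)) => e e0.
have q0 : 0 < l2norm p + 1 by rewrite ltr_wpDl// l2norm_ge0.
apply/near_l2norm; exists (e / (l2norm p + 1)); first by rewrite divr_gt0.
move=> y yx; rewrite -dotvBr; apply: le_lt_trans (cauchy_schwarz _ _) _.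
rewrite l2normBC; apply: (@le_lt_trans _ _ ((l2norm p + 1) * l2norm (y - x))).
  by apply: ler_wpM2r; [exact: l2norm_ge0|rewrite lerDl].
by rewrite mulrC -ltr_pdivlMr.
Qed.

Lemma differentiable_quadratic f x p (C e : R) : 0 < e ->
  (forall h, l2norm h < e -> `|f (x + h) - f x - dotv p h| <= C * l2norm h ^+ 2) ->
  differentiable f x /\ forall i, partial i f x = p 0 i.
Proof.
move=> e0 H.
have du := @diff_unique R V R f (dotv p) x (@dotv_continuous p).
lazymatch type of du with ?A -> _ => have E : A end.
  apply/eqaddoP => d d0; apply/near_l2norm.
  pose K : R := (`|C| + 1) * n.+1%:R.
  have K0 : 0 < K by rewrite mulr_gt0// ltr_wpDl.
  exists (Num.min e (d / K)); first by rewrite lt_min e0 divr_gt0.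
  move=> h; rewrite subr0 lt_min => /andP[he hd] /=.
  rewrite [X in `|X|](_ : _ = f (x + h) - f x - dotv p h); last first.
    by rewrite !fctE /= (addrC h) opprD addrA.
  apply: le_trans (H _ he) _; rewrite expr2 mulrA.
  rewrite ltr_pdivlMr// in hd.
  have h1 := l2norm_le_mx_norm h; have h0 := l2norm_ge0 h.
  have h2 : n%:R * `|h| <= n.+1%:R * `|h| by rewrite ler_wpM2r// ler_nat.
  have h3 : C <= `|C| := ler_norm C.
  apply: (@le_trans _ _ ((`|C| + 1) * l2norm h * (n.+1%:R * `|h|))).
    apply: (@le_trans _ _ ((`|C| + 1) * l2norm h * l2norm h)).
      by rewrite -!mulrA ler_wpM2r ?mulr_ge0//; lra.
    apply: ler_wpM2l; first by rewrite mulr_ge0// addr_ge0.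
    exact: le_trans h1 h2.
  rewrite (_ : _ * _ = (l2norm h * K) * `|h|); last by rewrite /K; ring.
  by apply: ler_wpM2r => //; exact: ltW.
have df : differentiable f x.
  apply/diff_locallyP; rewrite (du E); split => //; exact: dotv_continuous.
split => // i; rewrite /partial deriveE// (du E)/=; exact: dotv_delta.
Qed.

Lemma partialD f g i x : differentiable f x -> differentiable g x ->
  partial i (fun x => f x + g x) x = partial i f x + partial i g x.
Proof. by move=> df dg; apply: (deriveD (f := f) (g := g)); exact: diff_derivable. Qed.

Lemma partialM f g i x : differentiable f x -> differentiable g x ->
  partial i (fun x => f x * g x) x = f x * partial i g x + g x * partial i f x.
Proof. by move=> df dg; apply: (deriveM (f := f) (g := g)); exact: diff_derivable. Qed.

Lemma partial_comp (a : R -> R) da f i x : differentiable f x ->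
  is_derive (f x) 1 a da ->
  differentiable (a \o f) x /\ partial i (a \o f) x = partial i f x * da.
Proof.
move=> df [da1 da2]; have da3 : differentiable a (f x) by exact/derivable1_diffP.
have dc : differentiable (a \o f) x by exact: differentiable_comp.
split => //; rewrite /partial deriveE// diff_comp//= -[in RHS]da2 !deriveE//.
set u := 'd f x _; rewrite -[u in LHS]mulr1 -[u * 1]/(u *: (1 : R)).
by rewrite linearZ.
Qed.

(** The mean value theorem, applied twice along the segment. *)
Lemma taylor2 f a h (B : R) : (forall x, differentiable f x) ->
  (forall i x, differentiable (partial i f) x) ->
  (forall t : R, 0 <= t <= 1 ->
     `|\sum_i h 0 i * \sum_j h 0 j * partial j (partial i f) (a + t *: h)| <= B) ->
  `|f (a + h) - f a - \sum_i h 0 i * partial i f a| <= B.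
Proof.
move=> df ddf hB.
pose g t := \sum_i h 0 i * partial i f (a + t *: h).
pose gg t := \sum_i h 0 i * \sum_j h 0 j * partial j (partial i f) (a + t *: h).
have d1 (t : R) : is_derive t (1 : R) (fun s : R => f (a + s *: h)) (g t) by exact: is_derive_line.
have d2 (t : R) : is_derive t (1 : R) g (gg t).
  rewrite /g (_ : (fun _ => _) =
      \sum_i (fun s : R => h 0 i * partial i f (a + s *: h))); last first.
    by apply/funext => s; rewrite fct_sumE.
  apply: is_derive_sum => i.
  by have := is_deriveZ (h 0 i) (is_derive_line (ddf i (a + t *: h))).
have c1 : {within `[0, 1], continuous (fun s : R => f (a + s *: h))}.
  by apply: derivable_within_continuous => t _; have [] := d1 t.
have [c c01] := MVT ltr01 (fun t _ => d1 t) c1.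
rewrite scale1r scale0r addr0 subr0 mulr1 => ->.
move: c01; rewrite in_itv/= => /andP[c0 c1'].
have c2 : {within `[0, c], continuous g}.
  by apply: derivable_within_continuous => t _; have [] := d2 t.
have [e e0c] := MVT c0 (fun t _ => d2 t) c2.
rewrite subr0 {2}/g scale0r addr0 => ->.
move: e0c; rewrite in_itv/= => /andP[e0 ec].
have hh : `|gg e| <= B by apply: hB; apply/andP; split; lra.
rewrite normrM (ger0_norm (ltW c0)); apply: le_trans hh.
by rewrite ler_piMr// ltW.
Qed.

End differentials.

(** * A class of smooth functions containing bumps *)

Section flat.
Context {R : realType}.
Implicit Types (t : R) (k : nat).

(** All derivatives of [exp (-1/t)], extended by [0] to [t <= 0], are
    combinations of these functions. *)
Definition flat k t : R := if 0 < t then t^-1 ^+ k * expR (- t^-1) else 0.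

Lemma flat_ge0 k t : 0 <= flat k t.
Proof.
rewrite /flat; case: ifPn => // t0.
by rewrite mulr_ge0// ?expR_ge0// exprn_ge0// invr_ge0 ltW.
Qed.

Lemma flat_le0 k t : t <= 0 -> flat k t = 0.
Proof. by rewrite /flat leNgt => /negbTE ->. Qed.

Lemma flat_gt0 k t : 0 < t -> 0 < flat k t.
Proof. by move=> t0; rewrite /flat t0 mulr_gt0 ?expR_gt0// exprn_gt0// invr_gt0. Qed.

Lemma flat_le1 t : flat 0 t <= 1.
Proof.
rewrite /flat; case: ifPn => // t0; rewrite expr0 mul1r expR_le1.
by rewrite oppr_le0 invr_ge0 ltW.
Qed.

Lemma flat_nd t s : t <= s -> flat 0 t <= flat 0 s.
Proof.
move=> ts; rewrite {1}/flat; case: ifPn => [t0|_]; last exact: flat_ge0.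
have s0 : 0 < s := lt_le_trans t0 ts.
by rewrite /flat s0 !expr0 !mul1r ler_expR lerN2 lef_pV2.
Qed.

Lemma flat_bound k : exists2 C : R, 0 <= C & forall t, flat k t <= C * `|t|.
Proof.
exists ((k.+2)`!%:R) => // t; rewrite /flat; case: ifPn => [t0|_]; last by rewrite mulr_ge0.
have x0 : 0 <= t^-1 by rewrite invr_ge0 ltW.
have := expR_ge1Dxn k x0; rewrite gtr0_norm// => h.
have : t^-1 ^+ k.+1 / k.+1`!%:R <= expR t^-1 by move: h; lra.
rewrite ler_pdivrMr ?ltr0n ?fact_gt0// => h1.
rewrite expRN ler_pdivrMr ?expR_gt0// mulrAC -ler_pdivrMr//.
rewrite -exprSr; apply: le_trans h1 _; rewrite mulrC ler_wpM2r ?expR_ge0//.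
by rewrite ler_nat [(_.+2)`!]factS leq_pmull.
Qed.

Lemma is_derive_flat k t :
  is_derive t 1 (flat k) (- k%:R * flat k.+1 t + flat k.+2 t).
Proof.
have [t0|t0|->] := ltgtP t 0.
- rewrite !flat_le0 ?ltW// mulr0 addr0.
  apply: (@near_eq_is_derive _ _ _ (cst 0)) => //.
  by near=> s; rewrite /= flat_le0// ltW//; near: s; exact: lt_nbhsl.
- apply: (@near_eq_is_derive R R R (fun s : R => s^-1 ^+ k * expR (- s^-1))).
    by near=> s; rewrite /flat ifT//; near: s; exact: lt_nbhsr.
  have t' : t != 0 by rewrite gt_eqF.
  have dV : is_derive t (1 : R) (fun s : R => s^-1) (- t ^- 2).
    apply: DeriveDef; first exact: (@derivableV _ _ id).
    rewrite (@deriveV _ _ id)// derive_id.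
    by rewrite -[_ *: _]/(_ * _) mulr1.
  have dX : is_derive t (1 : R) (fun s : R => s^-1 ^+ k) (k%:R * t^-1 ^+ k.-1 * (- t ^- 2)).
    have h := @is_deriveX R R (fun s : R => s^-1) k t (1 : R) _ dV.
    rewrite (_ : (fun s : R => s^-1 ^+ k) = (fun s : R => s^-1) ^+ k); last first.
      by apply/funext => s; rewrite fctE; elim: (k) => // m; rewrite !exprS => ->.
    by apply: (is_derive_eq h); rewrite -[_ *: _]/(_ * _) mulr_natl.
  have dE : is_derive t (1 : R) (fun s : R => expR (- s^-1)) (expR (- t^-1) * t ^- 2).
    have dN : is_derive t (1 : R) (fun s : R => - s^-1) (t ^- 2).
      by rewrite -[t ^- 2]opprK; exact: is_deriveN.
    exact: (@is_derive1_comp R expR (fun s : R => - s^-1) t _ _ (is_derive_expR _) dN).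
  apply: (is_derive_eq (is_deriveM dX dE)).
  rewrite /flat t0 -[_ *: _]/(_ * _) -[X in _ + X]/(_ * _) !exprVn -!exprVn.
  case: (k) => [|m] /=; rewrite ?exprS; ring.
- rewrite !flat_le0// mulr0 addr0.
  have [C C0 HC] := flat_bound k.+1.
  have lim0 : h^-1 *: (flat k (h *: (1 : R) + 0) - flat k 0) @[h --> (0 : R)^'] --> (0 : R).
    apply/cvgr0Pnorm_le => e e0.
    near=> h; rewrite [X in `|X|](_ : _ = flat k.+1 h); last first.
      rewrite addr0 (flat_le0 k (lexx 0)) subr0 -[_%:A]/(h * 1) mulr1 -[_ *: _]/(_ * _).
      by rewrite /flat; case: ifPn => _; rewrite ?mulr0// mulrA -exprS.
    rewrite (ger0_norm (flat_ge0 _ _)); apply: le_trans (HC h) _.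
    apply: (@le_trans _ _ ((C + 1) * `|h|)); first by rewrite ler_wpM2r// lerDl.
    rewrite mulrC -ler_pdivlMr; last by rewrite ltr_wpDl.
    near: h; apply: dnbhs0_le; rewrite divr_gt0// ltr_wpDl//.
  apply: DeriveDef; first by apply/cvg_ex; exists 0.
  exact: cvg_lim.
Unshelve. all: by end_near. Qed.

End flat.

Section smooth_class.
Context {R : realType} {n : nat}.
Local Notation V := 'rV[R]_n.
Implicit Types (f g : V -> R) (x y h v p c : V) (r s e : R).

(** Closed under partial derivatives, so all members are smooth. *)
Inductive sexp : (V -> R) -> Prop :=
| sexp_cst a : sexp (fun=> a)
| sexp_coord i : sexp (fun x => x 0 i)
| sexp_add f g : sexp f -> sexp g -> sexp (fun x => f x + g x)
| sexp_mul f g : sexp f -> sexp g -> sexp (fun x => f x * g x)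
| sexp_flat k f : sexp f -> sexp (fun x => flat k (f x)).

Lemma differentiable_coord0 i x : differentiable (fun y : V => y 0 i) x.
Proof. exact: differentiable_coord. Qed.

Lemma partial_cst (a : R) i : partial i (fun _ : V => a) = fun=> 0.
Proof. by apply/funext => x; rewrite /partial derive_cst. Qed.

Lemma partial_coord i j : partial i (fun x : V => x 0 j) = fun=> (i == j)%:R.
Proof.
apply/funext => x.
have [h _|_ ->] := @differentiable_quadratic _ _ (fun y => y 0 j) x (delta_mx 0 j) 0 1 ltr01.
  rewrite mul0r mxE dotvC dotv_delta (addrC (x 0 j)) addrK subrr.
  by rewrite normr0.
by rewrite mxE eqxx.
Qed.

Lemma sexp_differentiable f : sexp f -> forall x, differentiable f x.
Proof.
elim => [a|i|{}f g _ df _ dg|{}f g _ df _ dg|k {}f _ df] x.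
- exact: differentiable_cst.
- exact: differentiable_coord0.
- exact: differentiableD.
- exact: differentiableM.
- apply: (@differentiable_comp _ _ _ _ f (flat k)) => //.
  by apply/derivable1_diffP; case: (is_derive_flat k (f x)).
Qed.

Lemma partial_flatE k f i : sexp f -> partial i (fun x => flat k (f x)) =
  (fun x => partial i f x * (- k%:R * flat k.+1 (f x) + flat k.+2 (f x))).
Proof.
move=> sf; apply/funext => x.
by have [_] := partial_comp i (sexp_differentiable sf x) (is_derive_flat k (f x)).
Qed.

Lemma partial_addE f g i : sexp f -> sexp g -> partial i (fun x => f x + g x) =
  (fun x => partial i f x + partial i g x).
Proof.
by move=> sf sg; apply/funext => x; rewrite partialD//; exact: sexp_differentiable.
Qed.

Lemma partial_mulE f g i : sexp f -> sexp g -> partial i (fun x => f x * g x) =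
  (fun x => f x * partial i g x + g x * partial i f x).
Proof.
by move=> sf sg; apply/funext => x; rewrite partialM//; exact: sexp_differentiable.
Qed.

Lemma sexp_partial i f : sexp f -> sexp (partial i f).
Proof.
elim => [a|j|{}f g sf hf sg hg|{}f g sf hf sg hg|k {}f sf hf].
- rewrite partial_cst; exact: sexp_cst.
- rewrite partial_coord; exact: sexp_cst.
- rewrite partial_addE//; exact: sexp_add.
- rewrite partial_mulE//; apply: sexp_add; exact: sexp_mul.
- rewrite partial_flatE//; apply: sexp_mul => //; apply: sexp_add.
    by apply: sexp_mul; [exact: sexp_cst|exact: sexp_flat].
  exact: sexp_flat.
Qed.

Lemma sexp_partialC i j f : sexp f -> partial i (partial j f) = partial j (partial i f).
Proof.
elim => [a|k|{}f g sf hf sg hg|{}f g sf hf sg hg|k {}f sf hf].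
- by rewrite !partial_cst.
- by rewrite !partial_coord !partial_cst.
- have pf l := sexp_partial l sf; have pg l := sexp_partial l sg.
  have E (a b : 'I_n) : partial a (partial b (fun x => f x + g x)) =
      fun x : V => partial a (partial b f) x + partial a (partial b g) x.
    apply: etrans (congr1 (partial a) (partial_addE b sf sg)) _.
    exact: partial_addE (pf b) (pg b).
  by apply: etrans (E i j) _; apply: etrans _ (esym (E j i)); rewrite hf hg.
- have pf l := sexp_partial l sf; have pg l := sexp_partial l sg.
  have E (a b : 'I_n) : partial a (partial b (fun x => f x * g x)) = fun x : V =>
      (f x * partial a (partial b g) x + partial b g x * partial a f x) +
      (g x * partial a (partial b f) x + partial b f x * partial a g x).
    apply: etrans (congr1 (partial a) (partial_mulE b sf sg)) _.
    apply: etrans (partial_addE a (sexp_mul sf (pg b)) (sexp_mul sg (pf b))) _.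
    apply/funext => x; apply: congr2.
      exact: (congr1 (@^~ x) (partial_mulE a sf (pg b))).
    exact: (congr1 (@^~ x) (partial_mulE a sg (pf b))).
  apply: etrans (E i j) _; apply: etrans _ (esym (E j i)).
  apply/funext => x; rewrite hf hg.
  move: (partial j (partial i f) x) (partial j (partial i g) x) => a b.
  move: (partial i f x) (partial i g x) (partial j f x) (partial j g x) => c d e1 e2.
  ring.
- have pf l := sexp_partial l sf.
  pose a1 x : R := - k%:R * flat k.+1 (f x).
  have s1 : sexp a1 by apply: sexp_mul (sexp_cst _) (sexp_flat k.+1 sf).
  have s2 := sexp_flat k.+2 sf.
  have E (a b : 'I_n) : partial a (partial b (fun x => flat k (f x))) = fun x : V =>
      partial b f x * (partial a f x *
        (- k%:R * (- k.+1%:R * flat k.+2 (f x) + flat k.+3 (f x)) +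
          (- k.+2%:R * flat k.+3 (f x) + flat k.+4 (f x)))) +
      (- k%:R * flat k.+1 (f x) + flat k.+2 (f x)) * partial a (partial b f) x.
    apply: etrans (congr1 (partial a) (partial_flatE k b sf)) _.
    apply: etrans (partial_mulE a (pf b) (sexp_add s1 s2)) _.
    apply/funext => x; congr (_ + _); congr (_ * _).
    apply: etrans (congr1 (@^~ x) (partial_addE a s1 s2)) _.
    have e1 := congr1 (@^~ x) (partial_flatE k.+2 a sf).
    have e2 := congr1 (@^~ x) (partial_mulE a (sexp_cst (- k%:R)) (sexp_flat k.+1 sf)).
    have e3 := congr1 (@^~ x) (partial_flatE k.+1 a sf).
    have e4 := congr1 (@^~ x) (partial_cst (- k%:R) a).
    rewrite /= in e1 e2 e3 e4; rewrite e1 e2 e3 e4.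
    move: (partial a f x) => c; ring.
  apply: etrans (E i j) _; apply: etrans _ (esym (E j i)).
  apply/funext => x; rewrite hf.
  move: (partial j (partial i f) x) (partial i f x) (partial j f x) => a b c.
  ring.
Qed.

Lemma sexp_smooth f : sexp f -> smooth f.
Proof.
move=> sf s; apply: sexp_differentiable.
by elim: s => //= i s; exact: sexp_partial.
Qed.

Lemma sexp_continuous f : sexp f -> continuous f.
Proof.
by move=> sf x; apply: differentiable_continuous; exact: sexp_differentiable.
Qed.

Lemma sexp_measurable f : sexp f -> measurable_fun setT f.
Proof. by move=> /sexp_continuous; exact: continuous_measurable_rV. Qed.

Lemma sexp_sum (J : finType) (f : J -> V -> R) : (forall j, sexp (f j)) ->
  sexp (fun x => \sum_j f j x).
Proof.
move=> sf; rewrite /index_enum; elim: (Finite.enum J) => [|j s IH].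
  rewrite (_ : (fun x => _) = fun=> 0); first exact: sexp_cst.
  by apply/funext => x; rewrite big_nil.
rewrite (_ : (fun x => _) = fun x => f j x + \sum_(i <- s) f i x); first exact: sexp_add.
by apply/funext => x; rewrite big_cons.
Qed.

Lemma partial_zero i f (A : set V) : open A -> (forall x, A x -> f x = 0) ->
  forall x, A x -> partial i f x = 0.
Proof.
move=> oA f0 x Ax; rewrite /partial (@near_eq_derive _ _ _ _ (cst 0)) ?derive_cst//.
near=> y; apply: f0; near: y; exact: open_nbhs_nbhs.
Unshelve. all: by end_near. Qed.

Definition csexp r f := sexp f /\ forall x, r < l2norm x -> f x = 0.

Lemma csexp_partial i r f : csexp r f -> csexp r (partial i f).
Proof.
move=> [sf f0]; split; first exact: sexp_partial.
apply: (@partial_zero i f [set x | r < l2norm x]) => //.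
rewrite (_ : mkset _ = ~` ecball 0 r); first by rewrite openC; exact: ecball_closed.
apply/seteqP; split => x; rewrite /ecball/= subr0.
  by rewrite ltNge => /negP.
by move=> /negP; rewrite -ltNge.
Qed.

Lemma csexp_bounded r f : csexp r f -> exists2 B : R, 0 <= B & forall x, `|f x| <= B.
Proof.
move=> [sf f0].
have : compact (f @` ecball 0 r).
  apply: continuous_compact; last exact: ecball_compact.
  by apply: continuous_subspaceT; exact: sexp_continuous.
move=> /compact_bounded [B [Br h]].
exists (`|B| + 1); first by rewrite addr_ge0.
move=> x; have [xr|rx] := leP (l2norm x) r; last by rewrite (f0 _ rx) normr0 addr_ge0.
have h1 : B < `|B| + 1 by rewrite (le_lt_trans (ler_norm B))// ltrDl.
by apply: (h _ h1 (f x)); exists x => //; rewrite /ecball/= subr0.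
Qed.

Lemma csexp_bms r f : csexp r f -> exists M, bms M f.
Proof.
move=> cf; have [B B0 hB] := csexp_bounded cf; case: cf => sf f0.
exists (B + `|r|); split; first exact: sexp_measurable.
- by move=> x; apply: le_trans (hB x) _; rewrite lerDl.
- by move=> x h; apply: f0; have := ler_norm r; lra.
Qed.

Lemma csexp_taylor r f : csexp r f -> exists2 B : R, 0 <= B & forall x h,
  `|f (x + h) - f x - \sum_i h 0 i * partial i f x| <= B * l2norm h ^+ 2.
Proof.
move=> cf.
have /choice[B hB] : forall ij : 'I_n * 'I_n, exists B, 0 <= B /\
    forall x, `|partial ij.2 (partial ij.1 f) x| <= B.
  move=> [i j]; have [B B0 hB] := csexp_bounded (csexp_partial j (csexp_partial i cf)).
  by exists B.
exists (\sum_i \sum_j B (i, j)).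
  by apply: sumr_ge0 => i _; apply: sumr_ge0 => j _; have [] := hB (i, j).
move=> x h; apply: taylor2.
- by apply: sexp_differentiable; case: cf.
- by move=> i; apply: sexp_differentiable; case: (csexp_partial i cf).
move=> t _; apply: le_trans (ler_norm_sum _ _ _) _; rewrite mulr_suml.
apply: ler_sum => i _; rewrite normrM.
apply: (@le_trans _ _ (`|h 0 i| * \sum_j `|h 0 j| * B (i, j))).
  apply: ler_wpM2l => //; apply: le_trans (ler_norm_sum _ _ _) _.
  apply: ler_sum => j _; rewrite normrM; apply: ler_wpM2l => //.
  by have [] := hB (i, j).
rewrite mulr_sumr mulr_suml; apply: ler_sum => j _.
have [B0 _] := hB (i, j).
have h1 := coord_le_l2norm h i; have h2 := coord_le_l2norm h j.
rewrite mulrA mulrC; apply: ler_wpM2l => //; rewrite expr2.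
by apply: ler_pM.
Qed.

Definition bump c r x : R := flat 0 (1 - dotv (x - c) (x - c) / r ^+ 2).

Lemma sexp_bump c r : sexp (bump c r).
Proof.
apply: sexp_flat; apply: sexp_add; first exact: sexp_cst.
rewrite (_ : (fun x => _) = fun x =>
    \sum_i (x 0 i + - c 0 i) * (x 0 i + - c 0 i) * (- r ^- 2)); last first.
  apply/funext => x; rewrite -mulr_suml mulrN -mulNr mulNr; congr (- (_ * _)).
  by apply: eq_bigr => i _; rewrite !mxE.
apply: sexp_sum => i; apply: sexp_mul; last exact: sexp_cst.
by apply: sexp_mul; apply: sexp_add; try exact: sexp_cst; exact: sexp_coord.
Qed.

Lemma bumpE c r x : bump c r x = flat 0 (1 - (l2norm (x - c) / r) ^+ 2).
Proof. by rewrite exprMn l2norm_sqr exprVn. Qed.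

Lemma bumpC c r x : bump c r x = bump x r c.
Proof. by rewrite !bumpE l2normBC. Qed.

Lemma bump_shift c r x : bump c r x = bump 0 r (x - c).
Proof. by rewrite !bumpE subr0. Qed.

Lemma bump_scale c r x : r != 0 -> bump c r (c + r *: x) = bump 0 1 x.
Proof.
move=> r0; rewrite !bumpE (addrC c) addrK subr0 divr1 l2normZ.
by rewrite !exprMn exprVn real_normK ?num_real// mulrAC divff ?mul1r// expf_neq0.
Qed.

Lemma bump_ge0 c r x : 0 <= bump c r x. Proof. exact: flat_ge0. Qed.

Lemma bump_le1 c r x : bump c r x <= 1. Proof. exact: flat_le1. Qed.

Lemma bump_eq0 c r x : 0 < r -> r <= l2norm (x - c) -> bump c r x = 0.
Proof.
move=> r0 h; rewrite bumpE flat_le0// subr_le0 exprn_ege1//.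
by rewrite ler_pdivlMr// mul1r.
Qed.

Lemma bump_anti c r x y : 0 < r -> l2norm (x - c) <= l2norm (y - c) ->
  bump c r y <= bump c r x.
Proof.
move=> r0 h; rewrite !bumpE flat_nd// lerD2l lerN2.
have d0 z : 0 <= l2norm (z - c) / r by rewrite divr_ge0 ?l2norm_ge0 ?ltW.
by apply: lerXn2r; rewrite ?nnegrE// ler_pM2r ?invr_gt0.
Qed.

Lemma csexp_bump r : 0 < r -> csexp r (bump 0 r).
Proof.
move=> r0; split; first exact: sexp_bump.
by move=> x rx; apply: bump_eq0 => //; rewrite subr0 ltW.
Qed.

Lemma test_bump (Omega : set V) c r : 0 < r -> ecball c r `<=` Omega ->
  test_function Omega (bump c r).
Proof.
move=> r0 cO; split; first exact/sexp_smooth/sexp_bump.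
exists (ecball c r); split => //; first exact: ecball_compact.
move=> x; rewrite /ecball/= => /negP; rewrite -ltNge => h.
by apply: bump_eq0 => //; exact: ltW.
Qed.

End smooth_class.

(** * Closure properties of smoothness; convolutions *)

Section smooth_closure.
Context {R : realType} {n : nat}.
Local Notation V := 'rV[R]_n.
Implicit Types (f g : V -> R) (x y h v p c z : V).

Lemma smooth_differentiable f x : smooth f -> differentiable f x.
Proof. by move=> /(_ [::] x). Qed.

Lemma smooth_partial f i : smooth f -> smooth (partial i f).
Proof. by move=> sf s x; have := sf (rcons s i) x; rewrite foldr_rcons. Qed.

Lemma smooth_continuous f : smooth f -> continuous f.
Proof. by move=> sf x; apply: differentiable_continuous; exact: smooth_differentiable. Qed.

Lemma smooth_measurable f : smooth f -> measurable_fun setT f.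
Proof. by move=> /smooth_continuous; exact: continuous_measurable_rV. Qed.

Lemma class_smooth (P : (V -> R) -> Prop) :
  (forall f x, P f -> differentiable f x) ->
  (forall f i, P f -> P (partial i f)) -> forall f, P f -> smooth f.
Proof.
move=> h1 h2 f Pf s x; apply: h1.
by elim: s => //= i s; exact: h2.
Qed.

(** Smoothness concerns iterated derivatives, for which the product rule gives
    sums of products; hence the detour through the generated algebra. *)
Inductive algebra_gen (B : (V -> R) -> Prop) : (V -> R) -> Prop :=
| alg_base f : B f -> algebra_gen B f
| alg_smooth f : smooth f -> algebra_gen B f
| alg_add f g : algebra_gen B f -> algebra_gen B g -> algebra_gen B (fun x => f x + g x)
| alg_mul f g : algebra_gen B f -> algebra_gen B g -> algebra_gen B (fun x => f x * g x).

Lemma algebra_gen_smooth (B : (V -> R) -> Prop) :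
  (forall f x, B f -> differentiable f x) ->
  (forall f i, B f -> algebra_gen B (partial i f)) ->
  forall f, algebra_gen B f -> smooth f.
Proof.
move=> h1 h2.
have d f x : algebra_gen B f -> differentiable f x.
  elim => {f} [f Bf|f sf|f g _ df _ dg|f g _ df _ dg].
  - exact: h1.
  - exact: smooth_differentiable.
  - exact: differentiableD.
  - exact: differentiableM.
apply: class_smooth => f; first by move=> x; exact: d.
move=> i; elim => {f} [f Bf|f sf|f g af df ag dg|f g af df ag dg].
- exact: h2.
- by apply: alg_smooth; exact: smooth_partial.
- rewrite (_ : partial i _ = fun x => partial i f x + partial i g x); first exact: alg_add.
  by apply/funext => x; apply: partialD; exact: d.
- rewrite (_ : partial i _ = fun x => f x * partial i g x + g x * partial i f x).
    by apply: alg_add; exact: alg_mul.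
  by apply/funext => x; apply: partialM; exact: d.
Qed.

Lemma smooth_cst (a : R) : smooth (fun _ : V => a).
Proof. exact/sexp_smooth/sexp_cst. Qed.

Lemma smoothM f g : smooth f -> smooth g -> smooth (fun x => f x * g x).
Proof.
move=> sf sg; apply: (@algebra_gen_smooth (fun=> False)) => //.
by apply: alg_mul; exact: alg_smooth.
Qed.

Lemma smooth_sum (J : finType) (f : J -> V -> R) : (forall j, smooth (f j)) ->
  smooth (fun x => \sum_j f j x).
Proof.
move=> sf; rewrite /index_enum; elim: (Finite.enum J) => [|j s IH].
  rewrite (_ : (fun x => _) = fun=> 0); first exact: smooth_cst.
  by apply/funext => x; rewrite big_nil.
rewrite (_ : (fun x => _) = fun x => f j x + \sum_(i <- s) f i x).
  apply: (@algebra_gen_smooth (fun=> False)) => //.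
  by apply: alg_add; exact: alg_smooth.
by apply/funext => x; rewrite big_cons.
Qed.

(** The chain rule along [x |-> x + rho x *: z]. *)
Lemma partial_moving (f : V -> R) (rho : V -> R) z x i :
  differentiable f (x + rho x *: z) -> differentiable rho x ->
  differentiable (fun x => f (x + rho x *: z)) x /\
  partial i (fun x => f (x + rho x *: z)) x =
  partial i f (x + rho x *: z) +
  partial i rho x * \sum_k z 0 k * partial k f (x + rho x *: z).
Proof.
move=> df dr.
have d1 : differentiable (fun x => rho x *: z) x by exact: differentiableZl.
have d2 : differentiable (fun x => x + rho x *: z) x.
  by apply: (@differentiableD _ _ _ id).
have dc : differentiable (f \o (fun x => x + rho x *: z)) x by exact: differentiable_comp.
split => //; rewrite [LHS](deriveE _ dc) (diff_comp d2 df) /=.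
have -> : 'd (fun x => x + rho x *: z) x 'e_i = 'e_i + partial i rho x *: z.
  have h1 : is_diff x (fun x => rho x *: z) (fun v => 'd rho x v *: z).
    by apply: DiffDef => //; rewrite diffZl.
  have h2 := @is_diffD _ _ _ id (fun x => rho x *: z) id _ x _ h1.
  by rewrite (diff_val (is_diff_def := h2 _)) /partial deriveE.
by rewrite linearD linearZ/= -!deriveE// (derive_sum_partial z).
Qed.

Lemma smooth_moving f (rho : V -> R) z : smooth f -> smooth rho ->
  smooth (fun x => f (x + rho x *: z)).
Proof.
move=> sf sr.
pose B g := exists2 f, smooth f & g = fun x => f (x + rho x *: z).
apply: (@algebra_gen_smooth B); last by apply: alg_base; exists f.
  move=> g x [{}f {}sf ->]; apply: (@differentiable_comp _ _ _ _ (fun x => x + rho x *: z) f).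
    apply: (@differentiableD _ _ _ id) => //; apply: differentiableZl.
    exact: smooth_differentiable.
  exact: smooth_differentiable.
move=> g i [{}f {}sf ->].
rewrite (_ : partial i _ = fun x => partial i f (x + rho x *: z) +
    partial i rho x * \sum_k z 0 k * partial k f (x + rho x *: z)); last first.
  apply/funext => x.
  by have [] := @partial_moving f rho z x i (smooth_differentiable _ sf) (smooth_differentiable _ sr).
apply: alg_add; first by apply: alg_base; exists (partial i f) => //; exact: smooth_partial.
apply: alg_mul; first by apply: alg_smooth; exact: smooth_partial.
apply: alg_base; exists (fun y => \sum_k z 0 k * partial k f y) => //.
apply: smooth_sum => k; apply: smoothM; first exact: smooth_cst.
exact: smooth_partial.
Qed.

Lemma is_diff_affine a (s : R) x :
  is_diff x (fun x : V => a + s *: x) (fun x => s *: x).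
Proof. by rewrite -[X in is_diff_def _ _ X]add0r; exact: is_diffD. Qed.

Lemma partial_affine f a (s : R) i x : differentiable f (a + s *: x) ->
  differentiable (fun x => f (a + s *: x)) x /\
  partial i (fun x => f (a + s *: x)) x = s * partial i f (a + s *: x).
Proof.
move=> df.
have d2 := is_diff_affine a s x.
have d3 : differentiable (fun x => a + s *: x) x by [].
have dc : differentiable (f \o (fun x => a + s *: x)) x by exact: differentiable_comp.
split => //; rewrite [LHS](deriveE _ dc) (diff_comp d3 df) /=.
by rewrite (diff_val (is_diff_def := d2)) linearZ/= -deriveE.
Qed.

Lemma smooth_affine f a (s : R) : smooth f -> smooth (fun x => f (a + s *: x)).
Proof.
move=> sf; pose B g := exists2 f, smooth f & g = fun x => f (a + s *: x).
apply: (@algebra_gen_smooth B); last by apply: alg_base; exists f.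
  move=> g x [{}f {}sf ->].
  have dd y := smooth_differentiable y sf.
  by apply: (@differentiable_comp _ _ _ _ (fun x => a + s *: x) f).
move=> g i [{}f {}sf ->].
rewrite (_ : partial i _ = fun x => s * partial i f (a + s *: x)); last first.
  apply/funext => x.
  by have [] := @partial_affine f a s i x (smooth_differentiable _ sf).
apply: alg_mul; first by apply: alg_smooth; exact: smooth_cst.
by apply: alg_base; exists (partial i f) => //; exact: smooth_partial.
Qed.

Lemma smooth_bounded_on f (r : R) : smooth f ->
  exists2 B : R, 0 <= B & forall x, l2norm x <= r -> `|f x| <= B.
Proof.
move=> sf.
have : compact (f @` ecball 0 r).
  apply: continuous_compact; last exact: ecball_compact.
  by apply: continuous_subspaceT; exact: smooth_continuous.
move=> /compact_bounded [B [Br h]].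
exists (`|B| + 1); first by rewrite addr_ge0.
move=> x xr.
have h1 : B < `|B| + 1 by rewrite (le_lt_trans (ler_norm B))// ltrDl.
by apply: (h _ h1 (f x)); exists x => //; rewrite /ecball/= subr0.
Qed.

End smooth_closure.

Section convolution.
Context {R : realType} {n : nat}.
Local Notation V := 'rV[R]_n.
Variables (u : V -> R) (M : R).
Hypothesis bu : bms M u.

Definition conv (f : V -> R) (x : V) : R := Int (fun y => u y * f (x - y)).

Lemma bms_conv (r : R) f x : csexp r f -> exists N, bms N (fun y => u y * f (x - y)).
Proof.
move=> cf; have [B B0 hB] := csexp_bounded cf; eexists.
apply: bmsM bu _ (fun y _ => hB (x - y)).
rewrite (_ : (fun y => _) = f \o affine_map x (-1)).
  apply: measurableT_comp; last exact: measurable_affine_map.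
  by apply: sexp_measurable; case: cf.
by apply/funext => y; rewrite /= /affine_map scaleN1r.
Qed.

Lemma conv_partial r f i x : csexp r f ->
  differentiable (conv f) x /\ partial i (conv f) x = conv (partial i f) x.
Proof.
move=> cf.
pose p : V := \row_k conv (partial k f) x.
have [C C0 HC] := csexp_taylor cf.
have [|d ->] := @differentiable_quadratic _ _ (conv f) x p (C * Int (fun y => `|u y|)) 1 ltr01.
  move=> h _.
  have [N1 b1] := bms_conv (x + h) cf.
  have [N2 b2] := bms_conv x cf.
  have /choice[N3 b3] := fun k => bms_conv x (csexp_partial k cf).
  have /choice[N4 b4] k : exists N, bms N (fun y => h 0 k * (u y * partial k f (x - y))).
    by eexists; exact: bmsZ (b3 k).
  pose N5 := \sum_k N4 k.
  have N40 k : 0 <= N4 k by case: (b4 k) => _ /(_ 0) + _; exact: le_trans.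
  have b5 k : bms N5 (fun y => h 0 k * (u y * partial k f (x - y))).
    by apply: bmsW (b4 k); rewrite /N5 (bigD1 k)//= lerDl sumr_ge0.
  have [N6 b6] := bms_sum b5.
  have -> : dotv p h = Int (fun y => \sum_k h 0 k * (u y * partial k f (x - y))).
    rewrite (Int_sum b5); apply: eq_bigr => k _.
    by rewrite (IntZ _ (b3 k)) mxE mulrC.
  rewrite -(IntB b1 b2) -(IntB (bmsB b1 b2) b6).
  apply: (le_trans (Int_norm (bmsB (bmsB b1 b2) b6))).
  rewrite mulrAC -(IntZ (C * l2norm h ^+ 2) (bms_norm bu)).
  apply: (Int_le (bms_norm (bmsB (bmsB b1 b2) b6)) (bmsZ _ (bms_norm bu))) => y.
  rewrite (_ : _ - _ - _ = u y * (f ((x - y) + h) - f (x - y) -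
      \sum_k h 0 k * partial k f (x - y))).
    by rewrite normrM mulrC ler_wpM2r.
  rewrite mulrBr mulrBr mulr_sumr (addrAC x h); congr (_ - _).
  by apply: eq_bigr => k _; rewrite mulrCA.
by split => //; rewrite mxE.
Qed.

Lemma conv_partialE r f i : csexp r f -> partial i (conv f) = conv (partial i f).
Proof. by move=> cf; apply/funext => x; have [] := conv_partial i x cf. Qed.

Lemma conv_differentiable r f x : csexp r f -> differentiable (conv f) x.
Proof.
case: (n =P 0)%N => [n0 cf|/eqP n0 cf]; last first.
  have n0' : (0 < n)%N by rewrite lt0n.
  by have [] := conv_partial (Ordinal n0') x cf.
suff -> : conv f = cst (conv f x) by exact: differentiable_cst.
apply/funext => y /=; congr conv; apply/rowP => i; exfalso.
by case: i => i; rewrite n0.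
Qed.

Lemma conv_smooth r f : csexp r f -> smooth (conv f).
Proof.
move=> cf; pose P g := exists2 f, csexp r f & g = conv f.
apply: (@class_smooth R n P); last by exists f.
  by move=> g x [{cf}f cf ->]; exact: conv_differentiable cf.
move=> g i [{cf}f cf ->]; exists (partial i f); first exact: csexp_partial.
exact: conv_partialE cf.
Qed.

Lemma conv_partialC r f i j : csexp r f ->
  partial i (partial j (conv f)) = partial j (partial i (conv f)).
Proof.
move=> cf; rewrite (conv_partialE j cf) (conv_partialE i cf).
rewrite (conv_partialE i (csexp_partial j cf)) (conv_partialE j (csexp_partial i cf)).
by rewrite sexp_partialC//; case: cf.
Qed.

End convolution.

(** * Integration by parts *)

Section integration_by_parts.
Context {R : realType} {n : nat}.
Local Notation V := 'rV[R]_n.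
Local Notation mu := (lebesgue_rV (R := R) n).
Implicit Types (f a : V -> R) (x y : V).

Let tt (k : nat) : R := k.+1%:R^-1.

Let tt_gt0 k : 0 < tt k. Proof. by rewrite invr_gt0. Qed.

Let tt_le1 k : tt k <= 1. Proof. by rewrite invf_le1// ler1n. Qed.

(** Translation invariance moves a difference quotient from one factor to the
    other, and dominated convergence passes to the limit. *)
Lemma Int_by_parts f a f' a' i (Ma Mf L N N' : R) :
  bms Ma a -> measurable_fun setT f ->
  (forall x, l2norm x <= Ma + 1 -> `|f x| <= Mf) ->
  (forall x (t : R), 0 < t -> t <= 1 -> `|a (x + t *: delta_mx 0 i) - a x| <= L * t) ->
  (forall x (t : R), l2norm x <= Ma -> 0 < t -> t <= 1 ->
     `|f x - f (x - t *: delta_mx 0 i)| <= L * t) ->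
  bms N (fun x => a' x * f x) -> bms N' (fun x => a x * f' x) ->
  {ae mu, forall x, (a (x + tt k *: delta_mx 0 i) - a x) / tt k @[k --> \oo] --> a' x} ->
  {ae mu, forall x, l2norm x <= Ma ->
     (f x - f (x - tt k *: delta_mx 0 i)) / tt k @[k --> \oo] --> f' x} ->
  Int (fun x => a' x * f x) = - Int (fun x => a x * f' x).
Proof.
move=> ba mf bf La Lf b1 b2 ca cf.
have [ma ba1 sa] := ba.
have Ma0 : 0 <= Ma := le_trans (normr_ge0 _) (ba1 0).
pose e : V := delta_mx 0 i.
have ne (t : R) : 0 < t -> t <= 1 -> l2norm (t *: e) <= 1.
  by move=> t0 t1; rewrite l2normZ l2norm_delta mulr1 gtr0_norm.
have mshift (g : V -> R) (c : V) : measurable_fun setT g ->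
    measurable_fun setT (fun x => g (x + c)).
  move=> mg; rewrite (_ : (fun x => _) = g \o affine_map c 1).
    apply: measurableT_comp => //; exact: measurable_affine_map.
  by apply/funext => x; rewrite /= /affine_map scale1r addrC.
pose F k x := (a (x + tt k *: e) - a x) / tt k * f x.
pose G k x := a x * ((f x - f (x - tt k *: e)) / tt k).
pose K : R := Ma + 1 + `|L| * `|Mf| + Ma * `|L|.
have K0 : 0 <= `|L| * `|Mf| by rewrite mulr_ge0.
have K1 : 0 <= Ma * `|L| by rewrite mulr_ge0.
have bF k : bms K (F k).
  split.
  - apply: measurable_funM => //; apply: measurable_funM => //.
    by apply: measurable_funB => //; exact: mshift.
  - move=> x; have [xM|xM] := leP (l2norm x) (Ma + 1).
      rewrite /F normrM; apply: (@le_trans _ _ (`|L| * `|Mf|)); last by rewrite /K; lra.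
      apply: ler_pM => //; last exact: le_trans (bf _ xM) (ler_norm _).
      rewrite normrM (gtr0_norm (x := (tt k)^-1)) ?invr_gt0//.
      rewrite ler_pdivrMr//; apply: le_trans (La _ _ (tt_gt0 k) (tt_le1 k)) _.
      by apply: ler_wpM2r; [exact: ltW|exact: ler_norm].
    rewrite /F !sa ?subrr ?mul0r ?normr0 /K; [lra|lra|].
    have := l2normB (x + tt k *: e) (tt k *: e); rewrite addrK.
    by have := ne _ (tt_gt0 k) (tt_le1 k); lra.
  - move=> x xK; rewrite /F !sa ?subrr ?mul0r//; first by move: xK; rewrite /K; lra.
    have := l2normB (x + tt k *: e) (tt k *: e); rewrite addrK.
    by have := ne _ (tt_gt0 k) (tt_le1 k); move: xK; rewrite /K; lra.
have bG k : bms K (G k).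
  split.
  - apply: measurable_funM => //; apply: measurable_funM => //.
    by apply: measurable_funB => //; exact: mshift.
  - move=> x; have [xM|xM] := leP (l2norm x) Ma.
      rewrite /G normrM; apply: (@le_trans _ _ (Ma * `|L|)); last by rewrite /K; lra.
      apply: ler_pM => //.
      rewrite normrM (gtr0_norm (x := (tt k)^-1)) ?invr_gt0//.
      rewrite ler_pdivrMr//; apply: le_trans (Lf _ _ xM (tt_gt0 k) (tt_le1 k)) _.
      by apply: ler_wpM2r; [exact: ltW|exact: ler_norm].
    by rewrite /G !sa ?mul0r ?normr0 /K//; lra.
  - by move=> x xK; rewrite /G !sa ?mul0r//; move: xK; rewrite /K; lra.
have cF : Int (F k) @[k --> \oo] --> Int (fun x => a' x * f x).
  apply: (Int_cvg bF b1); apply: filterS ca => x h.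
  by apply: cvgM; [exact: h|exact: cvg_cst].
have cG : Int (G k) @[k --> \oo] --> Int (fun x => a x * f' x).
  apply: (Int_cvg bG b2); apply: filterS cf => x h.
  have [xM|xM] := leP (l2norm x) Ma.
    by apply: cvgM; [exact: cvg_cst|exact: h].
  rewrite /G sa// mul0r (_ : (fun k => _) = cst 0); first exact: cvg_cst.
  by apply/funext => k; rewrite mul0r.
have FG k : Int (F k) = - Int (G k).
  pose p x := a (x + tt k *: e) * f x; pose q x := a x * f x.
  pose q' x := a x * f (x - tt k *: e).
  have mc : measurable_fun setT (fun x => a (x + tt k *: e)) by exact: mshift.
  have fb x : a x != 0 -> `|f x| <= Mf.
    move=> ax; apply: bf; rewrite leNgt; apply/negP => h.
    by move: ax; rewrite sa ?eqxx//; lra.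
  have bq : bms (Ma * (1 + `|Mf|)) q by exact: bmsM.
  have fb' x : a x != 0 -> `|f (x - tt k *: e)| <= Mf.
    move=> ax; apply: bf; apply: le_trans (l2normB _ _) _.
    apply: lerD; last exact: ne.
    by rewrite leNgt; apply/negP => h; move: ax; rewrite sa ?eqxx.
  have bq' : bms (Ma * (1 + `|Mf|)) q' by apply: bmsM => //; exact: mshift.
  have pE : p = (fun x => q' (tt k *: e + 1 *: x)).
    by apply/funext => x; rewrite /q' scale1r (addrC _ x) addrK.
  have bp := bms_affine (tt k *: e) (oner_neq0 R) bq'; rewrite -pE in bp.
  have e1 : Int p = Int q'.
    rewrite pE [RHS](Int_affine (tt k *: e) (oner_neq0 R) bq').
    by rewrite normr1 expr1n mul1r.
  rewrite (Int_ext (g := fun x => (tt k)^-1 * (p x - q x))); last first.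
    by move=> x; rewrite /F /p /q; ring.
  rewrite [X in - X](Int_ext (g := fun x => (tt k)^-1 * (q x - q' x))); last first.
    by move=> x; rewrite /G /q' /q; ring.
  rewrite (IntZ _ (bmsB bp bq)) (IntZ _ (bmsB bq bq')) (IntB bp bq) (IntB bq bq') e1.
  by rewrite -mulrN opprB.
have -> : Int (fun x => a' x * f x) = lim (Int (F k) @[k --> \oo]) by exact/esym/cvg_lim.
apply: cvg_lim => //; rewrite (_ : (fun k => Int (F k)) = (fun k => - Int (G k))).
  exact: cvgN.
by apply/funext.
Qed.

Lemma smooth_lipschitz_on f i (r : R) : smooth f ->
  exists2 L : R, 0 <= L & forall x (t : R), l2norm x <= r -> `|t| <= 1 ->
    `|f (x + t *: delta_mx 0 i) - f x| <= L * `|t|.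
Proof.
move=> sf; have [B B0 hB] := smooth_bounded_on (r + 1) (smooth_partial i sf).
exists B => // x t xr t1; pose e : V := delta_mx 0 i.
have d (s : R) : is_derive s (1 : R) (fun s : R => f (x + s *: (t *: e)))
    (t * partial i f (x + s *: (t *: e))).
  have := @is_derive_line R n f x (t *: e) s (smooth_differentiable _ sf).
  rewrite (bigD1 i)//= big1 ?addr0; first by rewrite !mxE !eqxx/= mulr1.
  by move=> j ji; rewrite !mxE (negbTE ji) andbF mulr0 mul0r.
have c : {within `[0, 1], continuous (fun s : R => f (x + s *: (t *: e)))}.
  by apply: derivable_within_continuous => s _; have [] := d s.
have [s s01] := MVT ltr01 (fun s _ => d s) c.
rewrite scale1r scale0r addr0 subr0 mulr1 => ->; rewrite normrM mulrC.
apply: ler_wpM2r => //; apply: hB.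
move: s01; rewrite in_itv/= => /andP[s0 s1].
apply: le_trans (l2normD _ _) _; apply: lerD => //.
rewrite !l2normZ l2norm_delta mulr1 gtr0_norm//.
by apply: mulr_ile1 => //; apply: ltW.
Qed.

Lemma derive_quotient f x v : differentiable f x ->
  (f x - f (x - tt k *: v)) / tt k @[k --> \oo] --> 'D_v f x /\
  (f (x + tt k *: v) - f x) / tt k @[k --> \oo] --> 'D_v f x.
Proof.
move=> df; have /cvg_ex[l hl] : derivable f x v by exact: diff_derivable.
have -> : 'D_v f x = l by exact: cvg_lim hl.
have tn k : tt k != 0 by rewrite gt_eqF.
have tl : tt k @[k --> \oo] --> 0 by exact: cvg_harmonic.
have H (u : R^nat) : (forall k, u k != 0) -> u @ \oo --> (0 : R) ->
    (u k)^-1 * (f (x + u k *: v) - f x) @[k --> \oo] --> l.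
  move=> u0 ul; have := (cvgr_dnbhsP _ _ _).1 hl u (conj u0 ul).
  by rewrite /= (_ : (fun k => _) = (fun k => (u k)^-1 * (f (x + u k *: v) - f x)))//;
    apply/funext => k; rewrite (addrC x).
split.
- have h := H (fun k => - tt k).
  rewrite (_ : (fun k => _) = (fun k => (- tt k)^-1 * (f (x + (- tt k) *: v) - f x))).
    apply: h; first by move=> k; rewrite oppr_eq0.
    by rewrite -oppr0; exact: cvgN.
  by apply/funext => k; rewrite invrN mulNr -mulrN opprB scaleNr mulrC.
- rewrite (_ : (fun k => _) = (fun k => (tt k)^-1 * (f (x + tt k *: v) - f x))).
    exact: H.
  by apply/funext => k; rewrite mulrC.
Qed.

Lemma differentiable_quotient f x i : differentiable f x ->
  (f x - f (x - tt k *: delta_mx 0 i)) / tt k @[k --> \oo] --> partial i f x /\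
  (f (x + tt k *: delta_mx 0 i) - f x) / tt k @[k --> \oo] --> partial i f x.
Proof. exact: derive_quotient. Qed.

Definition ind : V -> R := \1_(eball 0 1).

Definition wgt (y : V) : R := Num.max (1 - dotv y y) 0.

Lemma indE y : ind y = (l2norm y < 1)%R%:R.
Proof.
rewrite /ind indicE; congr (_ : bool)%:R; apply/idP/idP.
  by rewrite inE /eball/= subr0.
by move=> h; rewrite inE /eball/= subr0.
Qed.

Lemma ind_ge0 y : 0 <= ind y. Proof. by rewrite indE ler0n. Qed.

Lemma ind_le1 y : ind y <= 1. Proof. by rewrite indE lern1 leq_b1. Qed.

Lemma bms_ind : bms 2 ind.
Proof.
apply: bmsW (bms_indic (M := 1) ler01 _ _); [lra|exact: eball_measurable|].
by move=> x; rewrite /eball/= subr0 => /ltW.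
Qed.

Lemma Int_ind : Int ind = vol R n.
Proof. by rewrite /Int /Rintegral integral_indic ?setIT//; exact: eball_measurable. Qed.

Lemma dotvv_lt1 y : (dotv y y < 1) = (l2norm y < 1).
Proof. by rewrite -l2norm_sqr expr_lt1 ?l2norm_ge0. Qed.

Lemma wgt_ge0 y : 0 <= wgt y. Proof. by rewrite /wgt le_max lexx orbT. Qed.

Lemma wgt_le_ind y : wgt y <= ind y.
Proof.
rewrite indE -dotvv_lt1 /wgt; case: ltP => h /=; have := dotvv_ge0 y => h0.
  by rewrite ge_max; apply/andP; split; lra.
by rewrite ge_max; apply/andP; split; lra.
Qed.

Lemma wgt_eq0 y : 1 <= l2norm y -> wgt y = 0.
Proof.
by move=> h; apply/eqP; rewrite eq_le wgt_ge0 andbT (le_trans (wgt_le_ind y))// indE ltNge h.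
Qed.

Lemma dotv_continuous2 : continuous (fun y : V => dotv y y).
Proof.
move=> x; rewrite (_ : (fun y => _) = (fun y => l2norm y * l2norm y)).
  by apply: continuousM; exact: l2norm_continuous.
by apply/funext => y; rewrite -expr2 l2norm_sqr.
Qed.

Lemma wgt_measurable : measurable_fun setT wgt.
Proof.
apply: measurable_maxr => //; apply: measurable_funB => //.
by apply: continuous_measurable_rV; exact: dotv_continuous2.
Qed.

Lemma bms_wgt : bms 1 wgt.
Proof.
split; first exact: wgt_measurable.
  by move=> x; rewrite ger0_norm ?wgt_ge0// (le_trans (wgt_le_ind _) (ind_le1 _)).
by move=> x /ltW; exact: wgt_eq0.
Qed.

Lemma measurable_row_coord i : measurable_fun setT (fun y : V => y 0 i).
Proof. exact: measurable_coord. Qed.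

(** The divergence theorem on the unit ball for fields [w f e_i] whose weight
    [w y = 1 - |y|^2] vanishes on the boundary. *)
Lemma Int_wgt_partial f i : smooth f ->
  Int (fun y => wgt y * partial i f y) = 2 * Int (fun y => ind y * (y 0 i * f y)).
Proof.
move=> sf; have sfi := smooth_partial i sf.
have [B B0 hB] := smooth_bounded_on 3 sf.
have [Bi Bi0 hBi] := smooth_bounded_on 1 sfi.
have [L L0 hL] := smooth_lipschitz_on i 2 sf.
have indb y : ind y != 0 -> l2norm y < 1.
  by rewrite indE; case: ltP => //; rewrite eqxx.
have mc := measurable_row_coord i; have mf := smooth_measurable sf.
have b0 : bms (2 * (1 + `|B|)) (fun y => ind y * (y 0 i * f y)).
  apply: bmsM bms_ind _ _; first exact: measurable_funM.
  move=> y /indb y1; rewrite normrM -[B]mul1r; apply: ler_pM => //.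
    exact: le_trans (coord_le_l2norm y i) (ltW y1).
  by apply: hB; lra.
pose a' y : R := - 2 * (ind y * y 0 i).
have h : Int (fun y => a' y * f y) = - Int (fun y => wgt y * partial i f y).
  apply: (@Int_by_parts f wgt (partial i f) a' i 2 B (5 + L)
    (2 * (1 + `|B|) * (1 + `|- 2|)) (1 * (1 + `|Bi|))).
  - by apply: bmsW bms_wgt; lra.
  - exact: mf.
  - by move=> x hx; apply: hB; lra.
  - move=> x t t0 t1; have [x2|x2] := leP (l2norm x) 2.
      apply: (@le_trans _ _ (5 * t)); last by apply: ler_wpM2r; [exact: ltW|lra].
      apply: (@le_trans _ _ `|dotv (x + t *: delta_mx 0 i) (x + t *: delta_mx 0 i) - dotv x x|).
        rewrite /wgt; set p := dotv _ _; set q := dotv _ _.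
        by rewrite ler_norml; have := ler_norm (p - q); have := ler_norm (- (p - q));
          rewrite normrN; case: (leP (1 - p) 0) => ?; case: (leP (1 - q) 0) => ?;
          move=> ? ?; apply/andP; split; lra.
      rewrite dotvDl !dotvDr !dotvZl !dotvZr (dotvC _ x) dotv_delta.
      rewrite -[dotv 'e_i _]l2norm_sqr l2norm_delta expr1n mulr1.
      rewrite (_ : _ - _ = t * (2 * x 0 i + t)); last by ring.
      rewrite normrM gtr0_norm// mulrC; apply: ler_wpM2r; first exact: ltW.
      have := coord_le_l2norm x i; rewrite ler_norml => /andP[? ?].
      by rewrite ler_norml; apply/andP; split; lra.
    rewrite !wgt_eq0 ?subrr ?normr0 ?mulr_ge0//; [lra|exact: ltW|lra|].
    have := l2normB (x + t *: delta_mx 0 i) (t *: delta_mx 0 i); rewrite addrK.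
    by rewrite l2normZ l2norm_delta mulr1 gtr0_norm//; lra.
  - move=> x t x2 t0 t1; rewrite distrC -scaleNr.
    apply: (@le_trans _ _ (L * t)); last by apply: ler_wpM2r; [exact: ltW|lra].
    have := hL x (- t) x2; rewrite normrN gtr0_norm//; exact.
  - have := bmsZ (- 2) b0.
    rewrite (_ : (fun y => _) = (fun y => a' y * f y)); first by move=> h; exact: h.
    by apply/funext => y; rewrite /a'; ring.
  - apply: bmsM bms_wgt _ _ => [|x]; first exact: smooth_measurable.
    by have [/wgt_eq0 ->|h _] := leP 1 (l2norm x); [rewrite eqxx|apply: hBi; exact: ltW].
  - exists [set x : V | l2norm (x - 0) = 1]; split.
    + rewrite (_ : mkset _ = ecball 0 1 `\` eball 0 1).
        by apply: measurableD; [exact: ecball_measurable|exact: eball_measurable].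
      apply/seteqP; split => x /=; rewrite /ecball /eball/= subr0.
        by move=> ->; rewrite lexx ltxx.
      by move=> [h /negP]; rewrite -leNgt => h'; apply/eqP; rewrite eq_le h h'.
    + exact: mu_sphere0.
    move=> x /= hx; rewrite subr0; apply/eqP; apply/negPn/negP => x1; apply: hx.
    pose e : V := delta_mx 0 i.
    have tl : tt k @[k --> \oo] --> 0 by exact: cvg_harmonic.
    have txc : l2norm (x + tt k *: e) @[k --> \oo] --> l2norm x.
      apply/cvgrPdist_le => d d0; near=> k.
      have := ler_l2norm_add x (x + tt k *: e); have := ler_l2norm_add (x + tt k *: e) x.
      rewrite (l2normBC x) (addrC x) addrK l2normZ l2norm_delta mulr1 gtr0_norm//.
      have : tt k <= d by near: k; exact: (cvgr_le _ tl).
      by move=> ? ? ?; rewrite ler_norml; apply/andP; split; lra.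
    have [xl|xg] := ltP (l2norm x) 1.
      rewrite /a' indE xl mul1r.
      apply: (@cvg_trans _ (- 2 * x 0 i - tt k @[k --> \oo])).
        apply: near_eq_cvg; near=> k.
        rewrite /wgt !max_l.
        - rewrite dotvDl !dotvDr !dotvZl !dotvZr (dotvC _ x) dotv_delta.
          rewrite -[dotv 'e_i _]l2norm_sqr l2norm_delta expr1n mulr1.
          by have := tt_gt0 k; move: (tt k) => t t0; field; rewrite gt_eqF.
        - by rewrite subr_ge0 ltW// dotvv_lt1.
        - rewrite subr_ge0 ltW// dotvv_lt1; near: k; exact: (cvgr_lt _ txc).
      have : - 2 * x 0 i - tt k @[k --> \oo] --> - 2 * x 0 i - 0.
        by apply: cvgB => //; exact: cvg_cst.
      by rewrite subr0.
    have {x1} x1 : 1 < l2norm x by rewrite lt_neqAle eq_sym x1.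
    rewrite /a' indE ltNge xg mul0r mulr0.
    apply: (@cvg_trans _ ((cst 0 : R^nat) k @[k --> \oo])); last exact: cvg_cst.
    apply: near_eq_cvg; near=> k.
    rewrite !wgt_eq0 ?subrr ?mul0r// ltW//.
    by near: k; exact: (cvgr_gt _ txc).
  - by apply: aeW => x _; have [] := differentiable_quotient i (smooth_differentiable x sf).
rewrite -[LHS]opprK -h (Int_ext (g := fun y => - 2 * (ind y * (y 0 i * f y)))); last first.
  by move=> y; rewrite /a'; ring.
by rewrite (IntZ _ b0) mulNr opprK.
Unshelve. all: by end_near. Qed.

End integration_by_parts.

(** * Variable-radius averages of smooth functions *)

Section bm.
Context {R : realType} {n : nat}.
Local Notation V := 'rV[R]_n.
Implicit Types (f g : V -> R) (x y z : V).

Definition bm f := exists M, bms M f.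

Lemma bmD f g : bm f -> bm g -> bm (fun x => f x + g x).
Proof. by move=> [M bf] [N bg]; eexists; exact: bmsD bf bg. Qed.

Lemma bmB f g : bm f -> bm g -> bm (fun x => f x - g x).
Proof. by move=> [M bf] [N bg]; eexists; exact: bmsB bf bg. Qed.

Lemma bmZ (a : R) f : bm f -> bm (fun x => a * f x).
Proof. by move=> [M bf]; eexists; exact: bmsZ bf. Qed.

Lemma bm_uniform (J : finType) (f : J -> V -> R) : (forall j, bm (f j)) ->
  exists M, forall j, bms M (f j).
Proof.
move=> /choice[M bf]; exists (\sum_j M j) => j; apply: bmsW (bf j).
rewrite (bigD1 j)//= lerDl; apply: sumr_ge0 => k _.
by case: (bf k) => _ /(_ 0) + _; exact: le_trans.
Qed.

Lemma bm_sum (J : finType) (f : J -> V -> R) : (forall j, bm (f j)) ->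
  bm (fun x => \sum_j f j x).
Proof. by move=> /bm_uniform[M bf]; exact: bms_sum bf. Qed.

Lemma bIntD f g : bm f -> bm g -> Int (fun x => f x + g x) = Int f + Int g.
Proof. by move=> [M bf] [N bg]; exact: IntD bf bg. Qed.

Lemma bIntB f g : bm f -> bm g -> Int (fun x => f x - g x) = Int f - Int g.
Proof. by move=> [M bf] [N bg]; exact: IntB bf bg. Qed.

Lemma bIntZ (a : R) f : bm f -> Int (fun x => a * f x) = a * Int f.
Proof. by move=> [M bf]; exact: IntZ bf. Qed.

Lemma bInt_sum (J : finType) (f : J -> V -> R) : (forall j, bm (f j)) ->
  Int (fun x => \sum_j f j x) = \sum_j Int (f j).
Proof. by move=> /bm_uniform[M bf]; exact: Int_sum bf. Qed.

Lemma bInt_le f g : bm f -> bm g -> (forall x, f x <= g x) -> Int f <= Int g.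
Proof. by move=> [M bf] [N bg]; exact: Int_le bf bg. Qed.

Lemma bm_ext f g : f =1 g -> bm f -> bm g.
Proof. by move=> /funext ->. Qed.

Lemma bm_ind_mul g (B : R) : measurable_fun setT g ->
  (forall x, l2norm x < 1 -> `|g x| <= B) -> bm (fun y => ind y * g y).
Proof.
move=> mg hg; eexists; apply: bmsM bms_ind mg _ => x.
by rewrite indE; case: ltP => [h _|_]; rewrite ?eqxx//; exact: hg.
Qed.

Lemma bm_ind_smooth g : smooth g -> bm (fun y => ind y * g y).
Proof.
move=> sg; have [B _ hB] := smooth_bounded_on 1 sg.
apply: (bm_ind_mul (B := B)); first exact: smooth_measurable.
by move=> x /ltW; exact: hB.
Qed.

Lemma bm_wgt_smooth g : smooth g -> bm (fun y => wgt y * g y).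
Proof.
move=> sg; have [B _ hB] := smooth_bounded_on 1 sg.
eexists; apply: bmsM bms_wgt (smooth_measurable sg) _ => x.
by have [/wgt_eq0 ->|/ltW h _] := leP 1 (l2norm x); [rewrite eqxx|exact: hB].
Qed.

End bm.

Section laplacian.
Context {R : realType} {n : nat}.
Local Notation V := 'rV[R]_n.
Implicit Types (f g U : V -> R) (x y z p q : V) (s r : R).

Definition lap f x : R := \sum_i partial i (partial i f) x.

Definition dirder z f x : R := \sum_k z 0 k * partial k f x.

Lemma smooth_lap f : smooth f -> smooth (lap f).
Proof.
by move=> sf; apply: smooth_sum => i; do 2 apply: smooth_partial.
Qed.

Lemma smooth_coord i : smooth (fun x : V => x 0 i).
Proof. exact/sexp_smooth/sexp_coord. Qed.

Lemma smooth_dirder z f : smooth f -> smooth (dirder z f).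
Proof.
move=> sf; apply: smooth_sum => i; apply: smoothM; first exact: smooth_cst.
exact: smooth_partial.
Qed.

Let paff f x s i y : smooth f ->
  partial i (fun y => f (x + s *: y)) y = s * partial i f (x + s *: y).
Proof.
by move=> sf; have [] := @partial_affine _ _ f x s i y (smooth_differentiable _ sf).
Qed.

Lemma Int_ind_coord f x s i : smooth f ->
  s * Int (fun y => wgt y * partial i f (x + s *: y)) =
  2 * Int (fun y => ind y * (y 0 i * f (x + s *: y))).
Proof.
move=> sf; rewrite -(Int_wgt_partial i (smooth_affine x s sf)).
rewrite -bIntZ; last by apply: bm_wgt_smooth; apply: smooth_affine; exact: smooth_partial.
by apply: Int_ext => y; rewrite paff// mulrCA.
Qed.

Lemma smooth_coord_affine f x s i : smooth f -> smooth (fun y : V => y 0 i * f (x + s *: y)).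
Proof. by move=> sf; apply: smoothM; [exact: smooth_coord|exact: smooth_affine]. Qed.

Lemma Int_ind_radial f x s : smooth f ->
  2 * Int (fun y => ind y * dirder y f (x + s *: y)) =
  s * Int (fun y => wgt y * lap f (x + s *: y)).
Proof.
move=> sf; have sfi i := smooth_partial i sf.
rewrite (Int_ext (g := fun y => \sum_i ind y * (y 0 i * partial i f (x + s *: y)))); last first.
  by move=> y; rewrite mulr_sumr.
rewrite [X in s * X](Int_ext (g := fun y => \sum_i wgt y * partial i (partial i f) (x + s *: y))); last first.
  by move=> y; rewrite mulr_sumr.
rewrite !bInt_sum; last 2 first.
- by move=> i; apply: bm_wgt_smooth; apply: smooth_affine; exact: smooth_partial.
- by move=> i; apply: bm_ind_smooth; exact: smooth_coord_affine.
by rewrite !mulr_sumr; apply: eq_bigr => i _; rewrite Int_ind_coord.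
Qed.

Definition ballint f x s : R := Int (fun y => ind y * f (x + s *: y)).

Lemma is_derive_weighted K (a : V -> R) f x s : bms K a ->
  (forall y, 1 < l2norm y -> a y = 0) -> smooth f ->
  is_derive s 1 (fun t => Int (fun y => a y * f (x + t *: y)))
    (Int (fun y => a y * dirder y f (x + s *: y))).
Proof.
move=> [ma aK _] a1 sf; have sfi i := smooth_partial i sf.
have K0 : 0 <= K := le_trans (normr_ge0 _) (aK 0).
pose r : R := l2norm x + `|s| + 1.
have [B B0 hB] := smooth_bounded_on r sf.
have /choice[Bi hBi] i : exists B : R, 0 <= B /\ forall y, l2norm y <= r -> `|partial i f y| <= B.
  by have [b b0 h] := smooth_bounded_on r (sfi i); exists b.
have inr (t : R) y : `|t - s| < 1 -> l2norm y <= 1 -> l2norm (x + t *: y) <= r.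
  move=> ts y1; apply: le_trans (l2normD _ _) _; rewrite /r -addrA lerD2l l2normZ.
  have h1 : `|t| <= `|s| + 1 by have := ler_normD s (t - s); rewrite subrKC; lra.
  by rewrite -[X in _ <= X]mulr1; apply: ler_pM => //; exact: l2norm_ge0.
have sumB0 : 0 <= \sum_i Bi i by apply: sumr_ge0 => i _; have [] := hBi i.
have KB0 : 0 <= K * B by exact: mulr_ge0.
have KS0 : 0 <= K * \sum_i Bi i by exact: mulr_ge0.
pose M := 1 + K * B + K * \sum_i Bi i.
apply: (@Int_derive _ _ M (fun t y => a y * f (x + t *: y))
  (fun t y => a y * dirder y f (x + t *: y)) s 1 ltr01).
- move=> t ts; split.
  + by apply: measurable_funM => //; apply: smooth_measurable; exact: smooth_affine.
  + move=> y; rewrite normrM; have [y1|/a1 ->] := leP (l2norm y) 1; last first.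
      by rewrite normr0 mul0r /M; lra.
    apply: (@le_trans _ _ (K * B)); last by rewrite /M; lra.
    by apply: ler_pM => //; apply: hB; exact: inr.
  + by move=> y My; rewrite a1 ?mul0r//; move: My; rewrite /M; lra.
- move=> t y _; apply: (is_deriveZ (f := fun t : R => f (x + t *: y))).
  exact: (is_derive_line (smooth_differentiable _ sf)).
- move=> t y ts; rewrite normrM; have [y1|/a1 ->] := leP (l2norm y) 1; last first.
    by rewrite normr0 mul0r /M; lra.
  apply: (@le_trans _ _ (K * \sum_i Bi i)); last by rewrite /M; lra.
  apply: ler_pM => //.
  apply: le_trans (ler_norm_sum _ _ _) _; apply: ler_sum => i _; rewrite normrM.
  rewrite -[X in _ <= X]mul1r; apply: ler_pM => //.
    exact: le_trans (coord_le_l2norm y i) y1.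
  by have [_] := hBi i; apply; exact: inr.
- by move=> t y _ My; rewrite a1 ?mul0r//; move: My; rewrite /M; lra.
Qed.

Lemma is_derive_ballint f x s : smooth f ->
  is_derive s 1 (ballint f x) (s / 2 * Int (fun y => wgt y * lap f (x + s *: y))).
Proof.
move=> sf.
have -> : s / 2 * Int (fun y => wgt y * lap f (x + s *: y)) =
    Int (fun y => ind y * dirder y f (x + s *: y)).
  by rewrite mulrAC -(Int_ind_radial x s sf) mulrC mulKf.
apply: is_derive_weighted bms_ind _ sf => y /ltW y1.
by rewrite indE ltNge y1.
Qed.

Lemma ballint0 f x : ballint f x 0 = f x * vol R n.
Proof.
rewrite /ballint (Int_ext (g := fun y => f x * ind y)); last first.
  by move=> y; rewrite scale0r addr0 mulrC.
by rewrite (IntZ _ bms_ind) Int_ind.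
Qed.

Lemma nondecreasing_from_derivative (g dg : R -> R) r : 0 <= r ->
  (forall s, is_derive s (1 : R) g (dg s)) ->
  (forall s, 0 <= s -> s <= r -> 0 <= dg s) -> g 0 <= g r.
Proof.
move=> r0 dgs pos.
have c : {within `[0, r], continuous g}.
  by apply: derivable_within_continuous => s _; case: (dgs s).
have [s] := MVT_segment r0 (fun s _ => dgs s) c.
rewrite in_itv/= => /andP[s0 sr] e; rewrite -subr_ge0 e mulr_ge0 ?subr_ge0//.
exact: pos.
Qed.

Lemma Int_wgt_gt0 : 0 < Int (wgt : V -> R).
Proof.
have r0 : (0 : R) < 2^-1 by rewrite invr_gt0.
have b : bms (1 + 1) (\1_(eball (0 : V) 2^-1)).
  apply: bms_indic => //; first exact: eball_measurable.
  by move=> x; rewrite /eball/= subr0; lra.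
apply: (@lt_le_trans _ _ (2^-1 * Int (\1_(eball (0 : V) 2^-1)))).
  rewrite mulr_gt0// /Int /Rintegral integral_indic ?setIT//; last exact: eball_measurable.
  suff : 0 < fine (lebesgue_rV n (eball (0 : V) 2^-1)) by [].
  by rewrite mu_eball//= mulr_gt0 ?vol_gt0// exprn_gt0.
rewrite -(IntZ _ b); apply: (Int_le (bmsZ _ b) bms_wgt) => y; rewrite indicE.
case: (boolP (y \in _)) => [|_]; last by rewrite mulr0 wgt_ge0.
rewrite inE /eball/= subr0 mulr1 => yh; rewrite /wgt le_max; apply/orP; left.
have := l2norm_sqr y; rewrite expr2 => <-.
have : l2norm y * l2norm y <= 2^-1 * 2^-1 by apply: ler_pM; rewrite ?l2norm_ge0 ?ltW.
lra.
Qed.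

(** The derivative of the average in the radius is a weighted integral of the
    Laplacian, so a negative Laplacian contradicts the sub-mean-value
    inequality on small balls. *)
Lemma ballint_lap_ge0 f x (d : R) : smooth f -> 0 < d ->
  (forall r, 0 < r -> r < d -> f x * vol R n <= ballint f x r) -> 0 <= lap f x.
Proof.
move=> sf d0 h; rewrite leNgt; apply/negP => l0.
pose c : R := - lap f x / 2; have c0 : 0 < c by rewrite divr_gt0// oppr_gt0.
have : \forall y \near x, lap f y < - c.
  have lc : lap f x < - c by rewrite /c; lra.
  have cl : lap f @ x --> lap f x by exact: (smooth_continuous (smooth_lap sf)).
  exact: (cvgr_lt _ cl).
move=> /near_l2norm[e e0 he].
pose r : R := Num.min d e / 2.
have m0 : 0 < Num.min d e by rewrite lt_min d0.
have r0 : 0 < r by rewrite divr_gt0.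
have [rd re] : r < d /\ r < e.
  by have : r < Num.min d e by [rewrite /r; lra]; rewrite lt_min => /andP.
have cc : {within `[0, r], continuous (ballint f x)}.
  by apply: derivable_within_continuous => s _; case: (is_derive_ballint x s sf).
have [s] := MVT r0 (fun s _ => is_derive_ballint x s sf) cc.
rewrite in_itv/= => /andP[s0 sr] E.
have := h r r0 rd; rewrite -ballint0 -subr_ge0 E subr0; apply/negP; rewrite -ltNge.
rewrite pmulr_llt0// pmulr_rlt0 ?divr_gt0//.
apply: (@le_lt_trans _ _ (- c * Int (wgt : V -> R))); last first.
  by rewrite nmulr_rlt0 ?oppr_lt0// Int_wgt_gt0.
rewrite -(IntZ _ bms_wgt); apply: bInt_le.
- by apply: bm_wgt_smooth; apply: smooth_affine; exact: smooth_lap.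
- by eexists; exact: bmsZ bms_wgt.
move=> y; have [/wgt_eq0 ->|y1] := leP 1 (l2norm y); first by rewrite mul0r mulr0.
rewrite mulrC; apply: ler_wpM2r; first exact: wgt_ge0.
apply/ltW/he; rewrite addrC addKr l2normZ gtr0_norm//.
apply: le_lt_trans re; apply: (@le_trans _ _ s); last exact: ltW.
by rewrite ler_piMr ?ltW.
Qed.

End laplacian.

Section moving_average.
Context {R : realType} {n : nat}.
Local Notation V := 'rV[R]_n.
Implicit Types (f g : V -> R) (x y z p q : V) (s r : R).
Variable U : V -> R.
Hypothesis sU : smooth U.
Hypothesis commU : forall i j, partial i (partial j U) = partial j (partial i U).
Hypothesis commU' : forall i j k, partial i (partial j (partial k U)) =
  partial j (partial i (partial k U)).

Let lap_partial i : lap (partial i U) = partial i (lap U).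
Proof.
apply/funext => x; rewrite /lap.
have e : partial i (fun x => \sum_k partial k (partial k U) x) x =
    \sum_k partial i (partial k (partial k U)) x.
  have h : is_derive x (delta_mx 0 i) (\sum_k partial k (partial k U))
     (\sum_k partial i (partial k (partial k U)) x).
    apply: is_derive_sum => k; apply: DeriveDef => //.
    apply: diff_derivable; apply: smooth_differentiable.
    by do 2 apply: smooth_partial.
  rewrite -[RHS](derive_val (is_derive := h)) /partial; congr ('D_ _ _ _).
  by apply/funext => y; rewrite fct_sumE.
rewrite e; apply: eq_bigr => k _.
by rewrite (commU k i) (commU' k i k).
Qed.

Let Phi p (rho : R) (g : V -> R) : R := Int (fun z => g z * lap U (p + rho *: z)).

Let first_order p rho :
  2 * Int (fun z => ind z * dirder z U (p + rho *: z)) = rho * Phi p rho wgt.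
Proof. exact: Int_ind_radial. Qed.

Let mixed_order p rho i :
  Int (fun z => ind z * dirder z (partial i U) (p + rho *: z)) =
  Phi p rho (fun z => ind z * z 0 i).
Proof.
have two : (2 : R) != 0 by [].
apply: (mulfI two); rewrite (Int_ind_radial p rho (smooth_partial i sU)) lap_partial.
rewrite (Int_ind_coord p rho i (smooth_lap sU)); congr (_ * _).
by apply: Int_ext => z; rewrite mulrA.
Qed.

Let bw g p rho : smooth g -> bm (fun z => wgt z * g (p + rho *: z)).
Proof. by move=> sg; apply: bm_wgt_smooth; exact: smooth_affine. Qed.

Let bi g p rho : smooth g -> bm (fun z => ind z * g (p + rho *: z)).
Proof. by move=> sg; apply: bm_ind_smooth; exact: smooth_affine. Qed.

Let sp2 i j : smooth (partial i (partial j U)).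
Proof. by do 2 apply: smooth_partial. Qed.

Let sp3 i j k : smooth (partial i (partial j (partial k U))).
Proof. by do 3 apply: smooth_partial. Qed.

Let partial_coord_affine g p rho i l z : smooth g ->
  partial i (fun z => z 0 l * g (p + rho *: z)) z =
  z 0 l * (rho * partial i g (p + rho *: z)) + (i == l)%:R * g (p + rho *: z).
Proof.
move=> sg; have [d e] := @partial_affine _ _ g p rho i z (smooth_differentiable _ sg).
rewrite partialM//; last exact: differentiable_coord0.
by rewrite e (congr1 (@^~ z) (partial_coord i l)) [X in _ + X]mulrC.
Qed.

Let second_order p rho :
  2 * Int (fun z => ind z * dirder z (dirder z U) (p + rho *: z)) =
  2 * Phi p rho (fun z => ind z * dotv z z) - (n%:R - 1) * Phi p rho wgt.
Proof.
have bw2 k l : bm (fun z => wgt z * (z 0 l * (rho * partial k (partial k (partial l U)) (p + rho *: z)))).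
  apply: bm_wgt_smooth; apply: smoothM; first exact: smooth_coord.
  by apply: smoothM; [exact: smooth_cst|exact: smooth_affine].
have A l k : 2 * Int (fun z => ind z * (z 0 k * (z 0 l * partial k (partial l U) (p + rho *: z)))) =
    Int (fun z => wgt z * (z 0 l * (rho * partial k (partial k (partial l U)) (p + rho *: z)))) +
    (k == l)%:R * Int (fun z => wgt z * partial k (partial k U) (p + rho *: z)).
  rewrite -(Int_wgt_partial k (smooth_coord_affine p rho l (sp2 k l))).
  rewrite -bIntZ; last exact: bw.
  rewrite -bIntD; [|exact: bw2|by apply: bmZ; exact: bw].
  apply: Int_ext => z.
  apply: etrans (congr1 (fun t => wgt z * t) (partial_coord_affine p rho k l z (sp2 k l))) _.
  case: (k =P l) => [->|_].
    move: (partial l (partial l (partial l U)) _) (partial l (partial l U) _) => t1 t2.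
    ring.
  move: (partial k (partial k (partial l U)) _) (partial k (partial l U) _) (partial k (partial k U) _) => t1 t2 t3.
  have -> : (false%:R : R) = 0 by [].
  ring.
have B l : \sum_k Int (fun z => wgt z * (z 0 l * (rho * partial k (partial k (partial l U)) (p + rho *: z)))) =
    2 * Int (fun z => ind z * (z 0 l * z 0 l * lap U (p + rho *: z))) - Phi p rho wgt.
  rewrite -bInt_sum//.
  rewrite (Int_ext (g := fun z => wgt z * (z 0 l * (rho * partial l (lap U) (p + rho *: z))))); last first.
    move=> z; rewrite -mulr_sumr -mulr_sumr -mulr_sumr; congr (_ * (_ * (_ * _))).
    exact: (congr1 (@^~ (p + rho *: z)) (lap_partial l)).
  rewrite [X in 2 * X](Int_ext (g := fun z => ind z * (z 0 l * (z 0 l * lap U (p + rho *: z))))); last first.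
    by move=> z; rewrite !mulrA.
  rewrite -(Int_wgt_partial l (smooth_coord_affine p rho l (smooth_lap sU))).
  rewrite /Phi -bIntB; last 2 first.
  - apply: bm_wgt_smooth; apply: smooth_partial; apply: smooth_coord_affine.
    exact: smooth_lap.
  - by apply: bw; exact: smooth_lap.
  apply: Int_ext => z; apply: etrans (esym (congr1 (fun t => wgt z * t - _)
    (partial_coord_affine p rho l l z (smooth_lap sU)))).
  rewrite (eqxx l) (mul1r (lap U (p + rho *: z))).
  move: (partial l (lap U) (p + rho *: z)) (lap U (p + rho *: z)) => t1 t2; ring.
have bA l k : bm (fun z => ind z * (z 0 k * (z 0 l * partial k (partial l U) (p + rho *: z)))).
  apply: bm_ind_smooth; apply: smoothM; first exact: smooth_coord.
  exact: smooth_coord_affine.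
have dE z q : dirder z (dirder z U) q = \sum_l \sum_k z 0 k * (z 0 l * partial k (partial l U) q).
  rewrite /dirder exchange_big/=; apply: eq_bigr => k _; rewrite -mulr_sumr; congr (_ * _).
  have h : is_derive q (delta_mx 0 k) (\sum_l (fun y => z 0 l * partial l U y))
     (\sum_l z 0 l * partial k (partial l U) q).
    apply: is_derive_sum => l; apply: is_deriveZ; apply: DeriveDef => //.
    by apply: diff_derivable; apply: smooth_differentiable; exact: smooth_partial.
  rewrite -[RHS](derive_val (is_derive := h)) /partial; congr ('D_ _ _ _).
  by apply/funext => y; rewrite fct_sumE.
rewrite (Int_ext (g := fun z => \sum_l \sum_k ind z * (z 0 k * (z 0 l * partial k (partial l U) (p + rho *: z))))); last first.
  by move=> z; rewrite dE mulr_sumr; apply: eq_bigr => l _; rewrite mulr_sumr.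
rewrite bInt_sum; last by move=> l; apply: bm_sum.
under eq_bigr => l _ do rewrite bInt_sum//.
rewrite mulr_sumr.
under eq_bigr => l _.
  rewrite mulr_sumr; under eq_bigr => k _ do rewrite A.
  rewrite big_split/= B (bigD1 l)//= eqxx mul1r big1 ?addr0; last first.
    by move=> k /negbTE ->; rewrite mul0r.
  over.
rewrite big_split sumrB/= sumr_const card_ord -mulr_sumr -bInt_sum; last first.
  move=> l; apply: bm_ind_smooth; apply: smoothM; last by apply: smooth_affine; exact: smooth_lap.
  by apply: smoothM; exact: smooth_coord.
rewrite -bInt_sum; last by move=> l; exact: bw.
rewrite -[X in _ - X]mulr_natl -addrA; congr (_ + _).
  congr (_ * _); apply: Int_ext => z; rewrite /dotv -mulr_sumr -mulr_suml.
  by rewrite mulrA.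
rewrite mulrBl mul1r opprB addrC; congr (_ + _).
by apply: Int_ext => z; rewrite -mulr_sumr.
Qed.

Let partial_dirder z k q : partial k (dirder z U) q = dirder z (partial k U) q.
Proof.
have h : is_derive q (delta_mx 0 k) (\sum_l (fun y => z 0 l * partial l U y))
   (\sum_l z 0 l * partial k (partial l U) q).
  apply: is_derive_sum => l; apply: is_deriveZ; apply: DeriveDef => //.
  by apply: diff_derivable; apply: smooth_differentiable; exact: smooth_partial.
have -> : partial k (dirder z U) q = \sum_l z 0 l * partial k (partial l U) q.
  rewrite -[RHS](derive_val (is_derive := h)) /partial; congr ('D_ _ _ _).
  by apply/funext => y; rewrite fct_sumE.
by apply: eq_bigr => l _; rewrite commU.
Qed.

Variable rho : V -> R.
Hypothesis srho : smooth rho.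

Let fz z p := U (p + rho p *: z).

Lemma smooth_fz z : smooth (fz z). Proof. exact: smooth_moving. Qed.

(** The Laplacian of [p |-> U (p + rho p *: z)], expanded by the chain rule. *)
Definition lap_moving z p : R := let q := p + rho p *: z in
  lap U q + 2 * (\sum_i partial i rho p * dirder z (partial i U) q) +
  (\sum_i partial i rho p * partial i rho p) * dirder z (dirder z U) q +
  lap rho p * dirder z U q.

Lemma lap_fz z p : lap (fz z) p = lap_moving z p.
Proof.
have dmv g (sg : smooth g) x i := @partial_moving _ _ g rho z x i
  (smooth_differentiable _ sg) (smooth_differentiable _ srho).
have E i : partial i (partial i (fz z)) p =
    (partial i (partial i U) (p + rho p *: z) +
     partial i rho p * dirder z (partial i U) (p + rho p *: z)) +
    (partial i rho p * (dirder z (partial i U) (p + rho p *: z) +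
      partial i rho p * dirder z (dirder z U) (p + rho p *: z)) +
     dirder z U (p + rho p *: z) * partial i (partial i rho) p).
  have e1 : partial i (fz z) = (fun p => partial i U (p + rho p *: z) +
      partial i rho p * dirder z U (p + rho p *: z)).
    by apply/funext => x; have [] := dmv U sU x i.
  have [d1 e2] := dmv (partial i U) (smooth_partial i sU) p i.
  have [d2 e3] := dmv (dirder z U) (smooth_dirder z sU) p i.
  have d3 := smooth_differentiable p (smooth_partial i srho).
  apply: etrans (congr1 (fun f => partial i f p) e1) _.
  apply: etrans (partialD i d1 (differentiableM d3 d2)) _.
  apply: congr2; first exact: e2.
  apply: etrans (partialM i d3 d2) _; apply: congr2 => //.
  congr (_ * _); apply: etrans e3 _; congr (_ + _); exact: partial_dirder.
apply: etrans (eq_bigr _ (fun i _ => E i)) _.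
have aux (a b c h : 'I_n -> R) (d e : R) :
    \sum_i ((a i + b i * c i) + (b i * (c i + b i * d) + e * h i)) =
    \sum_i a i + 2 * (\sum_i b i * c i) + (\sum_i b i * b i) * d + (\sum_i h i) * e.
  rewrite mulr_sumr !mulr_suml -!big_split /=; apply: eq_bigr => i _; ring.
exact: aux.
Qed.

(** The density against which the Laplacian of [U] is integrated when the radius
    has value [r0], gradient [g] and Laplacian [lr]; for constant radius it is
    the indicator of the ball. *)
Definition moving_weight (g : V) (r0 lr : R) (z : V) : R :=
  ind z + 2 * (dotv g z * ind z) +
  dotv g g * (ind z * dotv z z - (n%:R - 1) / 2 * wgt z) + lr * r0 / 2 * wgt z.

(** Integration by parts turns every second-order term in the Laplacian of a
    variable-radius average of [U] into the Laplacian of [U]. *)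
Lemma Int_lap_moving p : Int (fun z => ind z * lap_moving z p) =
  Phi p (rho p) (moving_weight (gradient rho p) (rho p) (lap rho p)).
Proof.
set g := gradient rho p; set r0 := rho p; set lr := lap rho p.
have gE i : g 0 i = partial i rho p by rewrite mxE.
have slU := smooth_lap sU.
have two : (2 : R) != 0 by [].
have bd1 (f : V -> R) : smooth f -> bm (fun z => ind z * dirder z f (p + r0 *: z)).
  move=> sf; apply: bm_ext (bm_ind_smooth (g := fun z => \sum_k z 0 k * partial k f (p + r0 *: z)) _) => //.
  by apply: smooth_sum => k; apply: smooth_coord_affine; exact: smooth_partial.
have bd2 : bm (fun z => ind z * dirder z (dirder z U) (p + r0 *: z)).
  apply: bm_ext (bm_ind_smooth (g := fun z => \sum_k z 0 k * \sum_l z 0 l * partial l (partial k U) (p + r0 *: z)) _).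
    by move=> z; congr (_ * _); apply: eq_bigr => k _; rewrite partial_dirder.
  apply: smooth_sum => k; apply: smoothM; first exact: smooth_coord.
  by apply: smooth_sum => l; exact: smooth_coord_affine.
have b0 := bi p r0 slU; have bw0 := bw p r0 slU.
rewrite (Int_ext (g := fun z => ind z * lap U (p + r0 *: z) +
    (2 * (\sum_i g 0 i * (ind z * dirder z (partial i U) (p + r0 *: z))) +
    (dotv g g * (ind z * dirder z (dirder z U) (p + r0 *: z)) +
     lr * (ind z * dirder z U (p + r0 *: z)))))); last first.
  move=> z; rewrite /lap_moving -/r0 -/lr !mulrDr -!addrA; congr (_ + (_ + (_ + _))).
  - rewrite mulrCA; congr (_ * _); rewrite mulr_sumr; apply: eq_bigr => i _.
    by rewrite gE mulrCA.
  - by rewrite mulrCA; congr (_ * _); apply: eq_bigr => i _; rewrite gE.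
  - by rewrite mulrCA.
have bs : bm (fun z => \sum_i g 0 i * (ind z * dirder z (partial i U) (p + r0 *: z))).
  by apply: bm_sum => i; apply: bmZ; apply: bd1; exact: smooth_partial.
rewrite (bIntD b0); last by apply: bmD; [exact: bmZ|apply: bmD; apply: bmZ => //; exact: bd1].
rewrite (bIntD (bmZ _ bs)); last by apply: bmD; apply: bmZ => //; exact: bd1.
rewrite (bIntD (bmZ _ bd2) (bmZ _ (bd1 _ sU))).
rewrite (bIntZ _ bs) (bIntZ _ bd2) (bIntZ _ (bd1 _ sU)).
rewrite bInt_sum; last by move=> i; apply: bmZ; apply: bd1; exact: smooth_partial.
have bc i : bm (fun z => ind z * z 0 i * lap U (p + r0 *: z)).
  apply: bm_ext (bm_ind_smooth (smooth_coord_affine p r0 i slU)) => z.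
  by rewrite mulrA.
rewrite (eq_bigr (fun i => Int (fun z => g 0 i * (ind z * z 0 i * lap U (p + r0 *: z))))); last first.
  move=> i _; rewrite bIntZ; last by apply: bd1; exact: smooth_partial.
  by rewrite mixed_order (bIntZ _ (bc i)).
rewrite -bInt_sum; last by move=> i; exact: bmZ.
have -> : Int (fun z => ind z * dirder z (dirder z U) (p + r0 *: z)) =
    Phi p r0 (fun z => ind z * dotv z z) - (n%:R - 1) / 2 * Phi p r0 wgt.
  by apply: (mulfI two); rewrite second_order; field.
have -> : Int (fun z => ind z * dirder z U (p + r0 *: z)) = r0 / 2 * Phi p r0 wgt.
  by apply: (mulfI two); rewrite first_order; field.
have bzz : bm (fun z => ind z * dotv z z * lap U (p + r0 *: z)).
  apply: bm_ext (bm_ind_smooth (g := fun z => dotv z z * lap U (p + r0 *: z)) _).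
    by move=> z; rewrite mulrA.
  apply: smoothM; last exact: smooth_affine.
  by apply: smooth_sum => i; apply: smoothM; exact: smooth_coord.
have bs2 : bm (fun z => \sum_i g 0 i * (ind z * z 0 i * lap U (p + r0 *: z))).
  by apply: bm_sum => i; exact: bmZ.
rewrite /Phi -(bIntZ _ bs2) -!(bIntZ _ bw0) -(bIntB bzz (bmZ _ bw0)).
rewrite -(bIntZ _ (bmB bzz (bmZ _ bw0))) -(bIntZ _ (bmZ _ bw0)).
rewrite -(bIntD (bmZ _ (bmB bzz (bmZ _ bw0))) (bmZ _ (bmZ _ bw0))).
rewrite -(bIntD (bmZ _ bs2)); last first.
  by apply: bmD; apply: bmZ; [apply: bmB => //; exact: bmZ|exact: bmZ].
rewrite -(bIntD b0); last first.
  apply: bmD; first exact: bmZ.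
  by apply: bmD; apply: bmZ; [apply: bmB => //; exact: bmZ|exact: bmZ].
apply: Int_ext => z; rewrite /moving_weight.
rewrite (_ : \sum_i _ = dotv g z * ind z * lap U (p + r0 *: z)); last first.
  by rewrite /dotv !mulr_suml; apply: eq_bigr => i _; ring.
move: (lap U _) (dotv g z) (dotv g g) (dotv z z) (wgt z) (ind z) (n%:R : R).
move=> t1 t2 t3 t4 t5 t6 t7; ring.
Qed.

(** Chosen so that the perturbation of the constant weight [1] in
    [moving_weight] never exceeds [1]. *)
Definition slow (p : V) := 2 * l2norm (gradient rho p) +
  n%:R * l2norm (gradient rho p) ^+ 2 + `|lap rho p * rho p| <= 1.

Lemma moving_weight_ge0 p z : slow p ->
  0 <= moving_weight (gradient rho p) (rho p) (lap rho p) z.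
Proof.
rewrite /slow /moving_weight l2norm_sqr; set g := gradient rho p.
set a := lap rho p * rho p => h.
have [z1|z1] := leP 1 (l2norm z).
  by rewrite indE ltNge z1 wgt_eq0//=; rewrite !(mulr0, mul0r, subr0, addr0).
have w0 := wgt_ge0 z; have w1 := wgt_le_ind z.
move: w1; rewrite indE z1 /= => w1; rewrite !mulr1 !mul1r.
have gz : `|dotv g z| <= l2norm g.
  apply: le_trans (cauchy_schwarz g z) _.
  by rewrite ler_piMr ?l2norm_ge0// ltW.
move: gz; rewrite ler_norml => /andP[gz _].
have aw : `|a / 2 * wgt z| <= `|a| / 2.
  rewrite normrM (ger0_norm w0) normrM [`|2^-1|]ger0_norm//.
  by rewrite ler_piMr// divr_ge0.
move: aw; rewrite ler_norml => /andP[aw _].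
have zz := dotvv_ge0 z; have gg := dotvv_ge0 g.
have nw : (n%:R - 1) / 2 * wgt z <= n%:R / 2.
  apply: (@le_trans _ _ (n%:R / 2 * wgt z)).
    by apply: ler_wpM2r => //; rewrite mulrBl; lra.
  by rewrite ler_piMr// divr_ge0.
have ggw : - (dotv g g * (n%:R / 2)) <= dotv g g * (dotv z z - (n%:R - 1) / 2 * wgt z).
  by rewrite -mulrN; apply: ler_wpM2l => //; lra.
have : 0 <= n%:R * dotv g g by rewrite mulr_ge0.
have := normr_ge0 a.
move: h aw ggw; rewrite (mulrC (dotv g g) (n%:R / 2)) (mulrAC n%:R).
move: (lap rho p * _ / 2 * _) (dotv g g * (_ - _)) (n%:R * dotv g g) => t1 t2 t3; lra.
Qed.

Lemma measurable_fst2 (g : V -> R) : measurable_fun setT g ->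
  measurable_fun setT (fun zp : V * V => g zp.1).
Proof. by move=> mg; apply: measurableT_comp mg _; exact: measurable_fst. Qed.

Lemma measurable_snd2 (g : V -> R) : measurable_fun setT g ->
  measurable_fun setT (fun zp : V * V => g zp.2).
Proof. by move=> mg; apply: measurableT_comp mg _; exact: measurable_snd. Qed.

Let tame (Q : V -> V -> R) := measurable_fun setT (fun zp : V * V => Q zp.1 zp.2) /\
  forall r1 : R, exists B : R, forall z p, l2norm z <= 1 -> l2norm p <= r1 ->
    `|Q z p| <= B.

Let tameD Q Q' : tame Q -> tame Q' -> tame (fun z p => Q z p + Q' z p).
Proof.
move=> [m h] [m' h']; split; first exact: measurable_funD.
move=> r1; have [B hB] := h r1; have [B' hB'] := h' r1; exists (B + B') => z p z1 pr.
by apply: le_trans (ler_normD _ _) _; apply: lerD; [exact: hB|exact: hB'].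
Qed.

Let tameM Q Q' : tame Q -> tame Q' -> tame (fun z p => Q z p * Q' z p).
Proof.
move=> [m h] [m' h']; split; first exact: measurable_funM.
move=> r1; have [B hB] := h r1; have [B' hB'] := h' r1; exists (B * B') => z p z1 pr.
by rewrite normrM; apply: ler_pM => //; [exact: hB|exact: hB'].
Qed.

Let tame_p g : smooth g -> tame (fun z p => g p).
Proof.
move=> sg; split; first by apply: measurable_snd2; exact: smooth_measurable.
by move=> r1; have [B _ hB] := smooth_bounded_on r1 sg; exists B => z p _; exact: hB.
Qed.

Let tame_sum (Q : 'I_n -> V -> V -> R) : (forall i, tame (Q i)) ->
  tame (fun z p => \sum_i Q i z p).
Proof.
move=> h; rewrite /index_enum; elim: (Finite.enum 'I_n) => [|i s IH].
  rewrite (_ : (fun z p => _) = fun z p => 0); first exact: (tame_p (smooth_cst 0)).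
  by apply/funext => z; apply/funext => p; rewrite big_nil.
rewrite (_ : (fun z p => _) = fun z p => Q i z p + \sum_(j <- s) Q j z p); first exact: tameD.
by apply/funext => z; apply/funext => p; rewrite big_cons.
Qed.

Let tame_z i : tame (fun z p => z 0 i).
Proof.
split; first exact: (measurable_fst2 (measurable_row_coord i)).
by move=> r1; exists 1 => z p z1 _; exact: le_trans (coord_le_l2norm z i) z1.
Qed.

Let tame_move g : smooth g -> tame (fun z p => g (p + rho p *: z)).
Proof.
move=> sg; split.
  apply: (measurableT_comp (smooth_measurable sg)).
  apply: measurable_fun_coordP => i; under eq_fun do rewrite !mxE.
  apply: measurable_funD; first exact: (measurable_snd2 (measurable_row_coord i)).
  apply: measurable_funM; first by apply: measurable_snd2; exact: smooth_measurable.
  exact: (measurable_fst2 (measurable_row_coord i)).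
move=> r1; have [B B0 hB] := smooth_bounded_on r1 srho.
have [C C0 hC] := smooth_bounded_on (r1 + B) sg; exists C => z p z1 pr.
apply: hC; apply: le_trans (l2normD _ _) _; apply: lerD => //.
rewrite l2normZ -[B]mulr1; apply: ler_pM => //; first exact: l2norm_ge0.
exact: hB.
Qed.

Let tame_dirder g : smooth g -> tame (fun z p => dirder z g (p + rho p *: z)).
Proof.
move=> sg; apply: tame_sum => k; apply: tameM; first exact: tame_z.
by apply: tame_move; exact: smooth_partial.
Qed.

Let tame_lap : tame lap_moving.
Proof.
have c2 (a : R) : tame (fun z p => a) by exact: (tame_p (smooth_cst a)).
rewrite /lap_moving; apply: tameD; [apply: tameD; [apply: tameD|]|].
- by apply: tame_move; exact: smooth_lap.
- apply: tameM => //; apply: tame_sum => i; apply: tameM.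
    by apply: tame_p; exact: smooth_partial.
  by apply: tame_dirder; exact: smooth_partial.
- apply: tameM.
    by apply: tame_sum => i; apply: tameM; apply: tame_p; exact: smooth_partial.
  rewrite (_ : (fun z p => _) = fun z p => \sum_k z 0 k * dirder z (partial k U) (p + rho p *: z)).
    apply: tame_sum => k; apply: tameM; first exact: tame_z.
    by apply: tame_dirder; exact: smooth_partial.
  apply/funext => z; apply/funext => p; apply: eq_bigr => k _.
  by rewrite partial_dirder.
- apply: tameM; first by apply: tame_p; exact: smooth_lap.
  exact: tame_dirder.
Qed.

Let bms2_tame (b : V -> R) Q x0 (S : R) : measurable_fun setT b ->
  (forall y, 0 <= b y) -> (forall y, b y <= ind y) -> tame Q ->
  exists M : R, forall s, `|s| <= S ->
    bms2 M (fun z y => ind z * (b y * Q z (x0 + s *: y))).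
Proof.
move=> mb b0 bi1 [mQ hQ]; have [B hB] := hQ (l2norm x0 + `|S|).
have [mi _ _] := @bms_ind R n.
exists (`|B| + 1) => s sS; split.
- apply: measurable_funM; first exact: measurable_fst2.
  apply: measurable_funM; first exact: measurable_snd2.
  have mh : measurable_fun setT (fun zy : V * V => (zy.1, x0 + s *: zy.2)).
    apply: measurable_fun_pair; first exact: measurable_fst.
    by apply: (measurableT_comp (measurable_affine_map x0 s)); exact: measurable_snd.
  exact: (measurableT_comp mQ mh).
- move=> z y; rewrite indE.
  case: ltP => [z1|_]; last by rewrite mul0r normr0 addr_ge0.
  have := bi1 y; rewrite indE.
  case: ltP => [y1|_] by1; last first.
    have -> : b y = 0 by apply/eqP; rewrite eq_le b0 by1.
    by rewrite mul0r mulr0 normr0 addr_ge0.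
  rewrite mul1r normrM (ger0_norm (b0 y)); apply: (@le_trans _ _ `|B|); last by rewrite lerDl.
  rewrite -[X in _ <= X]mul1r; apply: ler_pM => //.
  apply: le_trans (ler_norm B); apply: hB; first exact: ltW.
  apply: le_trans (l2normD _ _) _; rewrite lerD2l l2normZ -[X in _ <= X]mulr1.
  by apply: ler_pM; [|exact: l2norm_ge0|exact: le_trans sS (ler_norm S)|exact: ltW].
- move=> z y h; have B0 := normr_ge0 B.
  case: h => h; first by rewrite indE ltNge (le_trans _ (ltW h)) ?mul0r//; lra.
  have : b y <= 0 by have := bi1 y; rewrite indE ltNge (le_trans _ (ltW h))//; lra.
  by move=> bl; have -> : b y = 0 by [apply/eqP; rewrite eq_le b0 bl]; rewrite mul0r mulr0.
Qed.

Let Phi_ge0 p : slow p -> (forall z, l2norm z < 1 -> 0 <= lap U (p + rho p *: z)) ->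
  0 <= Int (fun z => ind z * lap_moving z p).
Proof.
move=> sp h; rewrite Int_lap_moving; apply: Int_ge0 => z.
have [z1|z1] := leP 1 (l2norm z); last by rewrite mulr_ge0 ?moving_weight_ge0 ?h.
rewrite (_ : moving_weight _ _ _ z = 0) ?mul0r//.
by rewrite /moving_weight indE ltNge z1 wgt_eq0//=; rewrite !(mulr0, mul0r, subr0, addr0).
Qed.

(** The average over the outer ball of radius [s] has, as a function of [s], a
    derivative that is a weighted integral of the Laplacian of the inner average;
    this is nonnegative as long as the radius varies slowly. *)
Lemma moving_average_submean x0 (r : R) : 0 <= r ->
  (forall p, l2norm (p - x0) <= r -> slow p /\
     forall z, l2norm z < 1 -> 0 <= lap U (p + rho p *: z)) ->
  ballint U x0 (rho x0) * vol R n <=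
  Int (fun y => ind y * ballint U (x0 + r *: y) (rho (x0 + r *: y))).
Proof.
move=> r0 h.
have [mi _ _] := @bms_ind R n.
pose F1 s z y := ind z * (ind y * fz z (x0 + s *: y)).
pose F2 s z y := ind z * (wgt y * lap_moving z (x0 + s *: y)).
have bF1 (S : R) : exists M : R, forall s, `|s| <= S -> bms2 M (F1 s).
  exact: (bms2_tame x0 S mi ind_ge0 (fun y => lexx _) (tame_move sU)).
have bF2 (S : R) : exists M : R, forall s, `|s| <= S -> bms2 M (F2 s).
  exact: (bms2_tame x0 S wgt_measurable wgt_ge0 wgt_le_ind tame_lap).
have ibz (b : V -> R) s z (Q : V -> R) : smooth Q -> (forall g, smooth g -> bm (fun y => b y * g y)) ->
    Int (fun y => ind z * (b y * Q (x0 + s *: y))) =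
    ind z * Int (fun y => b y * Q (x0 + s *: y)).
  by move=> sQ hb; apply: bIntZ; apply: hb; exact: smooth_affine.
pose f s z := ind z * ballint (fz z) x0 s.
pose df s z := s / 2 * Int (F2 s z).
have fE s : f s = fun z => Int (F1 s z).
  apply/funext => z; rewrite /f /ballint -ibz//; first exact: smooth_fz.
  by move=> g; exact: bm_ind_smooth.
have dfE s z : df s z = ind z * (s / 2 * Int (fun y => wgt y * lap (fz z) (x0 + s *: y))).
  rewrite /df mulrCA -ibz; last by move=> g; exact: bm_wgt_smooth.
    congr (_ * _); apply: Int_ext => y; rewrite /F2; congr (_ * (_ * _)).
    by rewrite lap_fz.
  exact: smooth_lap (smooth_fz z).
pose Psi s := Int (f s).
have dPsi (s : R) : is_derive s (1 : R) Psi (Int (df s)).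
  have [M1 h1] := bF1 (`|s| + 1); have [M2 h2] := bF2 (`|s| + 1).
  have ss t : `|t - s| < 1 -> `|t| <= `|s| + 1.
    by move=> ts; have := ler_normD s (t - s); rewrite subrKC; lra.
  pose C1 := M1 + Int (@ballfun R n M1); pose C2 := M2 + Int (@ballfun R n M2).
  have C10 : 0 <= C1.
    by case: (bms_Int2 (h1 s _)) => [|_ /(_ 0) + _]; [rewrite lerDl|exact: le_trans].
  have C20 : 0 <= C2.
    by case: (bms_Int2 (h2 s _)) => [|_ /(_ 0) + _]; [rewrite lerDl|exact: le_trans].
  have M20 : 0 <= (`|s| + 1) / 2 * C2 by rewrite mulr_ge0// divr_ge0// addr_ge0.
  apply: (@Int_derive _ _ (C1 + C2 + (`|s| + 1) / 2 * C2) f df s 1 ltr01).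
  - move=> t ts; rewrite fE; apply: bmsW (bms_Int2 (h1 t (ss _ ts))).
    by rewrite -/C1; lra.
  - move=> t z _; rewrite dfE; apply: is_deriveZ.
    exact: is_derive_ballint (smooth_fz z).
  - move=> t z ts; rewrite /df normrM.
    apply: (@le_trans _ _ ((`|s| + 1) / 2 * C2)); last by lra.
    apply: ler_pM => //; last by case: (bms_Int2 (h2 t (ss _ ts))) => _ + _; exact.
    rewrite normrM [`|2^-1|]ger0_norm//; apply: ler_wpM2r => //; exact: ss.
  - move=> t z ts Mz; rewrite /df; case: (bms_Int2 (h2 t (ss _ ts))) => _ _ ->.
      by rewrite mulr0.
    by apply: le_lt_trans Mz; rewrite -/C2; lra.
have Pr : Psi 0 <= Psi r.
  apply: nondecreasing_from_derivative r0 dPsi _ => s s0 sr.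
  have [M2 /(_ s)] := bF2 `|s|; move=> /(_ (lexx _)) b2.
  rewrite (IntZ _ (bms_Int2 b2)) mulr_ge0 ?divr_ge0//.
  rewrite (Int_fubini b2); apply: Int_ge0 => y.
  have [/wgt_eq0 y1|y1] := leP 1 (l2norm y).
    rewrite (_ : (fun x => _) = fun=> 0) ?Int0//.
    by apply/funext => z; rewrite /F2 y1 mul0r mulr0.
  have -> : Int (fun x => F2 s x y) = wgt y * Int (fun z => ind z * lap_moving z (x0 + s *: y)).
    rewrite -bIntZ; first by apply: Int_ext => z; rewrite /F2 mulrCA.
    have [mQ hQ] := tame_lap; have [B hB] := hQ (l2norm (x0 + s *: y)).
    apply: (bm_ind_mul (B := B)).
      exact: (measurableT_comp mQ (@pair2_measurable _ _ _ _ (x0 + s *: y))).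
    by move=> z z1; apply: hB => //; exact: ltW.
  apply: mulr_ge0; first exact: wgt_ge0.
  have [|sp hp] := h (x0 + s *: y); last exact: Phi_ge0.
  rewrite addrC addKr l2normZ ger0_norm// -[r]mulr1.
  by apply: ler_pM => //; [exact: l2norm_ge0|exact: ltW].
have [M1 /(_ r)] := bF1 `|r|; move=> /(_ (lexx _)) b1.
suff [<- <-] : Psi 0 = ballint U x0 (rho x0) * vol R n /\
    Psi r = Int (fun y => ind y * ballint U (x0 + r *: y) (rho (x0 + r *: y))) by [].
split.
  rewrite /Psi /f (Int_ext (g := fun z => vol R n * (ind z * U (x0 + rho x0 *: z)))).
    by apply: etrans (bIntZ (vol R n) (bi _ _ sU)) _; exact: mulrC.
  by move=> z; rewrite ballint0 /fz; ring.
rewrite /Psi fE (Int_fubini b1); apply: Int_ext => y.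
rewrite /ballint -bIntZ; last exact: bi.
by apply: Int_ext => z; rewrite /F1 mulrCA.
Qed.

End moving_average.

(** * Bounded subharmonic functions and moving averages *)

Section continuity.
Context {R : realType} {n : nat}.
Local Notation V := 'rV[R]_n.
Local Notation mu := (@lebesgue_rV R n).
Implicit Types (f g v : V -> R) (x z : V).

Lemma continuous_l2P f x : {for x, continuous f} <->
  forall e : R, 0 < e -> exists2 d : R, 0 < d &
    forall y, l2norm (y - x) < d -> `|f y - f x| < e.
Proof.
split => [/(@cvgrPdist_lt _ R^o _ (nbhs x) (nbhs_filter x)) h e /h /near_l2norm[d d0 hd]|h].
  by exists d => // y /hd; rewrite distrC.
apply/(@cvgrPdist_lt _ R^o _ (nbhs x) (nbhs_filter x)) => e /h[d d0 hd].
by apply/near_l2norm; exists d => // y /hd; rewrite distrC.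
Qed.

Definition near_seq (x : V) (y : nat -> V) := forall k, l2norm (y k - x) < k.+1%:R^-1.

Lemma invS_lt (d : R) : 0 < d -> exists k0, forall k, (k0 <= k)%N -> k.+1%:R^-1 < d.
Proof.
move=> d0; have [k0 _ h] := near_infty_natSinv_lt (PosNum d0).
by exists k0 => k /h.
Qed.

Lemma cvg_seqP (u : nat -> R) (l : R) : (u k @[k --> \oo] --> l) <->
  forall e : R, 0 < e -> exists k0, forall k, (k0 <= k)%N -> `|u k - l| < e.
Proof.
split => [/(@cvgrPdist_lt _ R^o) h e /h[k0 _ hk]|h].
  by exists k0 => k /hk; rewrite distrC.
apply/(@cvgrPdist_lt _ R^o) => e /h[k0 hk].
by exists k0 => // k /= /hk; rewrite distrC.
Qed.

Lemma continuous_near_seq f x y : {for x, continuous f} -> near_seq x y ->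
  f (y k) @[k --> \oo] --> f x.
Proof.
move=> /continuous_l2P h cy; apply/cvg_seqP => e /h[d /invS_lt[k0 hk] hd].
by exists k0 => k /hk k0k; apply: hd; exact: lt_trans (cy k) k0k.
Qed.

Lemma near_seq_continuous f x :
  (forall y, near_seq x y -> f (y k) @[k --> \oo] --> f x) -> {for x, continuous f}.
Proof.
move=> h; apply/continuous_l2P => e e0; apply: contrapT => /forall2NP nd.
have /choice[y hy] (k : nat) : exists y : V, l2norm (y - x) < k.+1%:R^-1 /\ e <= `|f y - f x|.
  have [/negP|/existsNP[y /not_implyP[yx /negP]]] := nd (k.+1%:R^-1).
    by rewrite invr_gt0 ltr0n.
  by rewrite -leNgt => ey; exists y.
have /cvg_seqP/(_ _ e0)[k0 /(_ k0 (leqnn _))] := h y (fun k => (hy k).1).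
by rewrite ltNge (hy k0).2.
Qed.

Lemma Int_continuous M (F : V -> V -> R) x : (forall p, bms M (F p)) ->
  {ae mu, forall z, {for x, continuous (F^~ z)}} ->
  {for x, continuous (fun p => Int (F p))}.
Proof.
move=> bF cF; apply: near_seq_continuous => y cy.
apply: (@Int_cvg _ _ M M (fun k => F (y k))) => //.
by apply: filterS cF => z cz; exact: (continuous_near_seq cz cy).
Qed.

End continuity.

Section averages.
Context {R : realType} {n : nat}.
Local Notation V := 'rV[R]_n.
Local Notation mu := (@lebesgue_rV R n).
Implicit Types (f g v : V -> R) (x y z : V).

Lemma bms_moved M v x (s : R) : bms M v ->
  bms (2 * (1 + `|M|)) (fun z => ind z * v (x + s *: z)).
Proof.
move=> [mv bv _]; apply: bmsM bms_ind _ _.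
  by apply: (measurableT_comp mv); exact: (measurable_affine_map x s).
by move=> z _; exact: bv.
Qed.

Lemma ballint_bound M N v x (s : R) : bms M v -> (forall x, `|v x| <= N) ->
  `|ballint v x s| <= N * vol R n.
Proof.
move=> bv vN; have bi := bms_moved x s bv.
apply: le_trans (Int_norm bi) _; rewrite -Int_ind -(IntZ _ bms_ind).
apply: Int_le (bms_norm bi) (bmsZ _ bms_ind) _ => z.
by rewrite normrM ger0_norm ?ind_ge0// mulrC ler_wpM2r// ind_ge0.
Qed.

Lemma ballint_moving_continuous M v (rho : V -> R) : bms M v -> continuous v ->
  continuous rho -> continuous (fun x => ballint v x (rho x)).
Proof.
move=> bv cv cr x; apply: (Int_continuous (fun p => bms_moved p (rho p) bv)).
apply: aeW => z; apply: near_seq_continuous => y cy.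
apply: cvgMr; apply/cvg_seqP => e e0.
have /continuous_l2P/(_ _ e0)[d d0 hd] := cv (x + rho x *: z).
have z0 : 0 < l2norm z + 1 by rewrite ltr_wpDl// l2norm_ge0.
have /cvg_seqP/(_ (d / 2 / (l2norm z + 1)))[|k0 hk] := continuous_near_seq (cr x) cy.
  by rewrite !divr_gt0.
have [k1 hk1] : exists k0, forall k, (k0 <= k)%N -> k.+1%:R^-1 < d / 2.
  by apply: invS_lt; rewrite divr_gt0.
exists (maxn k0 k1) => k; rewrite geq_max => /andP[/hk k0k /hk1 k1k]; apply: hd.
rewrite (_ : _ - _ = (y k - x) + (rho (y k) - rho x) *: z); last first.
  by rewrite scalerBl opprD addrACA.
apply: le_lt_trans (l2normD _ _) _; rewrite l2normZ.
have h1 := cy k.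
have h2 : `|rho (y k) - rho x| * l2norm z <= d / 2.
  rewrite ltr_pdivlMr// in k0k; apply: le_trans (ltW k0k).
  by apply: ler_wpM2l => //; rewrite lerDl.
by move: h1 h2 k1k; move: (k.+1%:R^-1) => t; lra.
Qed.

Lemma ballint_centered M v x (r : R) : bms M v -> 0 < r ->
  bms (M * (1 + `|1|)) (fun w => v w * ind (r^-1 *: (w - x))) /\
  r ^+ n * ballint v x r = Int (fun w => v w * ind (r^-1 *: (w - x))).
Proof.
move=> bv r0; have rn0 := lt0r_neq0 r0.
have bF : bms (M * (1 + `|1|)) (fun w => v w * ind (r^-1 *: (w - x))).
  apply: bmsM => // [|w _]; last by rewrite ger0_norm ?ind_ge0// ind_le1.
  have [mi _ _] := @bms_ind R n.
  rewrite (_ : (fun w => _) = ind \o affine_map (- (r^-1 *: x)) r^-1).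
    by apply: measurableT_comp => //; exact: measurable_affine_map.
  by apply/funext => w /=; rewrite /affine_map scalerBr addrC.
split => //; rewrite (Int_affine x rn0 bF) gtr0_norm//; congr (_ * _).
by apply: Int_ext => z; rewrite (addrC x) addrK scalerA mulVf// scale1r mulrC.
Qed.

Lemma ballint_center_le M v x x0 (r r0 : R) : bms M v -> 0 < r -> 0 < r0 ->
  l2norm (x - x0) + r <= r0 -> (forall y, l2norm (y - x0) <= r0 -> 0 <= v y) ->
  r ^+ n * ballint v x r <= r0 ^+ n * ballint v x0 r0.
Proof.
move=> bv rp r0p xr v0; have [b1 ->] := ballint_centered x bv rp.
have [b2 ->] := ballint_centered x0 bv r0p; apply: Int_le b1 b2 _ => w.
rewrite !indE !l2normZ !gtr0_norm ?invr_gt0// !(mulrC _^-1) !ltr_pdivrMr// !mul1r.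
have h := l2norm_dist w x x0; case: ltP => [wx|_].
  by have -> : l2norm (w - x0) < r0 by move: wx h xr; lra.
by rewrite mulr0; case: ltP => [wx|_]; rewrite ?mulr0// mulr1 v0// ltW.
Qed.

(** At fixed positive radius the average is continuous even for a discontinuous
    function: moving the centre perturbs the indicator of the ball, which is
    continuous off a sphere. *)
Lemma ballint_continuous M v (r : R) : bms M v -> 0 < r ->
  continuous (fun x => ballint v x r).
Proof.
move=> bv r0.
have rn0 := lt0r_neq0 r0.
pose F x w := v w * ind (r^-1 *: (w - x)).
have bF x : bms (M * (1 + `|1|)) (F x) by have [] := ballint_centered x bv r0.
have E x : ballint v x r = r^-1 ^+ n * Int (F x).
  have [_ <-] := ballint_centered x bv r0.
  by rewrite mulrA -exprMn mulVf// expr1n mul1r.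
rewrite (_ : (fun x => _) = fun x => r^-1 ^+ n * Int (F x)); last exact/funext.
move=> x.
suff cI : {for x, continuous (fun p => Int (F p))} by apply: near_seq_continuous => y cy; apply: cvgMr; exact: (continuous_near_seq cI cy).
apply: Int_continuous => //.
have [N [mN N0 sN]] : mu.-negligible [set w | l2norm (w - x) = r].
  exists [set w | l2norm (w - x) = r]; split => //; last exact: mu_sphere0.
  rewrite (_ : mkset _ = ecball x r `\` eball x r).
    by apply: measurableD; [exact: ecball_measurable|exact: eball_measurable].
  apply/seteqP; split => w /=; rewrite /ecball /eball/=.
    by move=> ->; rewrite lexx ltxx.
  by move=> [wr /negP]; rewrite -leNgt => rw; apply/eqP; rewrite eq_le wr.
exists N; split => // w /= nc; apply: sN => /=; apply: contrapT => wr; apply: nc.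
apply: near_seq_continuous => y cy; apply: cvgMr; apply/cvg_seqP => e e0.
have g0 : 0 < `|l2norm (w - x) - r| by rewrite normr_gt0 subr_eq0; apply/eqP.
have [k0 hk0] := invS_lt g0; exists k0 => k /hk0 kg.
suff -> : ind (r^-1 *: (w - y k)) = ind (r^-1 *: (w - x)) :> R by rewrite subrr normr0.
rewrite !indE !l2normZ gtr0_norm ?invr_gt0// !(mulrC r^-1) !ltr_pdivrMr// mul1r.
congr (nat_of_bool _)%:R.
have := cy k; have h1 := l2norm_dist w (y k) x; have h2 := l2norm_dist w x (y k).
move: h2; rewrite (l2normBC x (y k)) => h2 h3.
apply/idP/idP => h; move: kg h1 h2 h3 h; move: (k.+1%:R^-1) (l2norm (w - x)) (l2norm (w - y k)) (l2norm (y k - x)) => t a b c.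
- by case: (ger0P (a - r)); lra.
- by case: (ger0P (a - r)); lra.
Qed.

Definition submean (d : R) v := forall x (r : R), 0 < r -> l2norm x + r < d ->
  v x * vol R n <= ballint v x r.

Lemma bm_superpose M K (k v : V -> R) x (s : R) : bms K k -> bms M v ->
  bm (fun z => k z * v (x + s *: z)).
Proof.
move=> bk [mv vM _]; eexists; apply: bmsM bk _ (fun z _ => vM _).
by apply: (measurableT_comp mv); exact: (measurable_affine_map x s).
Qed.

Lemma ballint_superpose M K (k v : V -> R) x (r s : R) : bms K k -> bms M v ->
  (forall z, 1 < l2norm z -> k z = 0) ->
  bm (fun z => k z * ballint v (x + s *: z) r) /\
  ballint (fun x => Int (fun z => k z * v (x + s *: z))) x r =
    Int (fun z => k z * ballint v (x + s *: z) r).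
Proof.
move=> bk bv k1; have [mv vM vs] := bv; have [mk kK ks] := bk.
have [mi _ _] := @bms_ind R n.
have K0 : 0 <= K := le_trans (normr_ge0 _) (kK 0).
have M0 : 0 <= M := le_trans (normr_ge0 _) (vM 0).
pose F y z := ind y * (k z * v (x + s *: z + r *: y)).
have bF : bms2 (K * M + 1) F.
  split.
  - apply: measurable_funM; first exact: measurable_fst2.
    apply: measurable_funM; first exact: measurable_snd2.
    apply: (measurableT_comp mv).
    apply: measurable_fun_coordP => i.
    rewrite (_ : (fun _ => _) = fun p : V * V => x 0 i + s * p.2 0 i + r * p.1 0 i); last first.
      by apply/funext => p; rewrite !mxE.
    apply: measurable_funD; first apply: measurable_funD => //.
      apply: measurable_funM => //.
      by apply: (measurableT_comp (measurable_coord i)); exact: measurable_snd.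
    apply: measurable_funM => //.
    by apply: (measurableT_comp (measurable_coord i)); exact: measurable_fst.
  - move=> y z; rewrite /F !normrM (ger0_norm (ind_ge0 _)).
    apply: (@le_trans _ _ (1 * (K * M))); last by rewrite mul1r lerDl.
    by apply: ler_pM; rewrite ?ind_ge0 ?ind_le1 ?mulr_ge0 ?ler_pM.
  - move=> y z h; have KM : 0 <= K * M by exact: mulr_ge0.
    case: h => h; rewrite /F; last by rewrite k1 ?mul0r ?mulr0//; lra.
    by rewrite indE ltNge (ltW (le_lt_trans _ h)) ?mul0r//; lra.
have E2 z : Int (F^~ z) = k z * ballint v (x + s *: z) r.
  rewrite /ballint -bIntZ; first by apply: Int_ext => y; rewrite /F mulrCA.
  by eexists; exact: bms_moved bv.
split; first by apply: bm_ext E2 _; eexists; exact: bms_Int2 (bms2_swap bF).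
rewrite -(Int_ext E2) -(Int_fubini bF); apply: Int_ext => y.
rewrite -bIntZ; last exact: bm_superpose bk bv.
by apply: Int_ext => z; rewrite /F addrAC.
Qed.

(** By Fubini's theorem the average of a superposition of translates is the
    superposition of the averages; this serves both for ball averages and for
    mollification. *)
Lemma submean_superpose M K (k v : V -> R) (d s : R) : bms K k -> bms M v ->
  (forall z, 0 <= k z) -> (forall z, 1 < l2norm z -> k z = 0) -> submean d v ->
  submean (d - `|s|) (fun x => Int (fun z => k z * v (x + s *: z))).
Proof.
move=> bk bv k0 k1 sv x r r0 xr.
have [bb ->] := ballint_superpose x r s bk bv k1.
have bs := bm_superpose x s bk bv.
rewrite mulrC -bIntZ//; apply: bInt_le (bmZ _ bs) bb _ => z.
rewrite mulrCA; have [z1|/k1 ->] := leP (l2norm z) 1; last by rewrite !mul0r.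
apply: ler_wpM2l => //; rewrite mulrC; apply: sv => //.
have := l2normD x (s *: z); rewrite l2normZ.
have : `|s| * l2norm z <= `|s| * 1 by apply: ler_wpM2l.
by rewrite mulr1; lra.
Qed.

End averages.

Lemma seq_cvg_le {R : realType} (u w : nat -> R) (l l' : R) k0 :
  u k @[k --> \oo] --> l -> w k @[k --> \oo] --> l' ->
  (forall k, (k0 <= k)%N -> u k <= w k) -> l <= l'.
Proof. by move=> ul wl h; apply: ler_cvg_to ul wl _; exists k0. Qed.

Section continuous_moving_average.
Context {R : realType} {n : nat}.
Local Notation V := 'rV[R]_n.
Implicit Types (f g v : V -> R) (x z : V).

Lemma continuous_shift v x (s : nat -> R) z : {for x, continuous v} ->
  (s k @[k --> \oo] --> 0) -> v (x + s k *: z) @[k --> \oo] --> v x.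
Proof.
move=> cv /cvg_seqP s0; apply/cvg_seqP => e e0.
have /continuous_l2P/(_ _ e0)[d d0 hd] := cv.
have z0 : 0 < l2norm z + 1 by rewrite ltr_wpDl// l2norm_ge0.
have [|k0 hk] := s0 (d / (l2norm z + 1)); first by rewrite divr_gt0.
exists k0 => k /hk; rewrite subr0 ltr_pdivlMr// => h; apply: hd.
rewrite (addrC x) addrK l2normZ; apply: le_lt_trans h.
by apply: ler_wpM2l => //; rewrite lerDl.
Qed.

Lemma bms_moving_ballint M v (rho : V -> R) x (r : R) : bms M v ->
  continuous v -> continuous rho ->
  bms (2 * (1 + `|M * vol R n|))
    (fun y => ind y * ballint v (x + r *: y) (rho (x + r *: y))).
Proof.
move=> bv cv cr; apply: bmsM bms_ind _ _ => [|y _].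
  apply: (measurableT_comp (f := fun p => ballint v p (rho p)) _ (measurable_affine_map x r)).
  by apply: continuous_measurable_rV; exact: ballint_moving_continuous bv cv cr.
by apply: (ballint_bound _ _ bv); case: bv.
Qed.

Lemma Int_bump_gt0 : 0 < Int (bump 0 1 : V -> R).
Proof.
have [Kb bb] := csexp_bms (csexp_bump (n := n) (ltr01 : 0 < 1 :> R)).
have t0 : (2 : R) != 0 by [].
have := Int_affine (0 : V) t0 (@bms_ind R n); rewrite Int_ind.
rewrite (Int_ext (g := fun z => ind (2 *: z))); last by move=> z; rewrite add0r.
move=> E; have i0 : 0 < Int (fun z : V => ind (2 *: z) : R).
  by have := @vol_gt0 R n; rewrite E pmulr_rgt0// exprn_gt0// normr_gt0.
pose c := flat 0 (3 / 4 : R); have c0 : 0 < c by apply: flat_gt0; lra.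
have bi := bms_affine 0 t0 (@bms_ind R n).
apply: (@lt_le_trans _ _ (c * Int (fun z : V => ind (2 *: z) : R))); first by rewrite mulr_gt0.
have -> : (fun z : V => ind (2 *: z) : R) = fun z => ind (0 + 2 *: z).
  by apply/funext => z; rewrite add0r.
rewrite -(IntZ c bi); apply: (Int_le (bmsZ c bi) bb) => z.
rewrite add0r indE l2normZ gtr0_norm//; case: ltP => [z1|_]; last by rewrite mulr0 bump_ge0.
rewrite mulr1 bumpE subr0 divr1; apply: flat_nd.
have : l2norm z ^+ 2 <= (1 / 2) ^+ 2.
  by rewrite ler_pXn2r// ?nnegrE ?l2norm_ge0//; lra.
by lra.
Qed.

Lemma conv_bump M v x (s : R) : bms M v -> 0 < s ->
  conv v (bump 0 s) x = s ^+ n * Int (fun z => bump 0 1 z * v (x + (- s) *: z)).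
Proof.
move=> bv s0; have [N bN] := bms_conv bv x (csexp_bump s0).
have ns0 : - s != 0 by rewrite oppr_eq0 gt_eqF.
rewrite /conv (Int_affine x ns0 bN) normrN gtr0_norm//; congr (_ * _).
apply: Int_ext => z; rewrite opprD addNKr scaleNr opprK -[s *: z]add0r.
by rewrite bump_scale ?gt_eqF// mulrC add0r.
Qed.

(** The smooth case passes to the limit along mollifications, which are
    sub-mean on slightly smaller balls and hence have nonnegative Laplacian. *)
Lemma moving_submean_continuous M v (d : R) (rho : V -> R) x (r R1 : R) :
  bms M v -> continuous v -> submean d v -> smooth rho ->
  (forall p, slow rho p) -> (forall p, 0 <= rho p) -> 0 < r -> R1 < d ->
  (forall p, l2norm (p - x) <= r -> l2norm p + rho p <= R1) ->
  ballint v x (rho x) * vol R n <=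
  Int (fun y => ind y * ballint v (x + r *: y) (rho (x + r *: y))).
Proof.
move=> bv cv sv srho slo rho0 r0 R1d hR1.
have [mv vM vs] := bv; have M0 : 0 <= M := le_trans (normr_ge0 _) (vM 0).
pose g := (d - R1) / 2; have g0 : 0 < g by rewrite divr_gt0// subr_gt0.
pose s (k : nat) : R := g * k.+1%:R^-1.
have s0 k : 0 < s k by rewrite mulr_gt0// invr_gt0 ltr0n.
have sg k : s k <= g.
  by apply: ler_piMr; [exact: ltW|rewrite invf_le1 ?ltr0n// ler1n].
have scv : - s k @[k --> \oo] --> 0.
  apply/cvg_seqP => e e0; have [|k0 hk] := @invS_lt _ (e / g); first by rewrite divr_gt0.
  exists k0 => k /hk; rewrite subr0 normrN gtr0_norm// /s ltr_pdivlMr// mulrC.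
  by [].
have cb : csexp 1 (bump 0 1 : V -> R) := csexp_bump ltr01.
have [Kb bb] := csexp_bms cb; have [mb _ _] := bb.
pose k0 : R := Int (bump 0 1 : V -> R).
have k00 : 0 < k0.
  exact: Int_bump_gt0.
pose kap z : R := k0^-1 * bump 0 1 z.
have kap0 z : 0 <= kap z by rewrite mulr_ge0 ?bump_ge0// invr_ge0 ltW.
have kap1 z : 1 < l2norm z -> kap z = 0.
  by move=> /ltW z1; rewrite /kap bump_eq0 ?mulr0// subr0.
have kapK z : kap z <= k0^-1.
  by rewrite ler_piMr ?bump_le1// invr_ge0 ltW.
have bk : bms _ kap := bmsZ k0^-1 bb.
have Ik : Int kap = 1 by rewrite (IntZ _ bb) mulVf ?gt_eqF.
pose W k x := Int (fun z => kap z * v (x + (- s k) *: z)).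
pose K := k0^-1 * M + M + g + 1.
have K1 : 0 <= k0^-1 * M by rewrite mulr_ge0// invr_ge0 ltW.
have bW2 k : bms2 K (fun x z => kap z * v (x + (- s k) *: z)).
  split.
  - apply: measurable_funM.
      by apply: measurable_snd2; case: bk.
    apply: (measurableT_comp mv).
    apply: measurable_fun_coordP => i.
    rewrite (_ : (fun _ => _) = fun p : V * V => p.1 0 i + (- s k) * p.2 0 i); last first.
      by apply/funext => p; rewrite !mxE.
    apply: measurable_funD.
      by apply: (measurableT_comp (measurable_coord i)); exact: measurable_fst.
    apply: measurable_funM => //.
    by apply: (measurableT_comp (measurable_coord i)); exact: measurable_snd.
  - move=> y z; rewrite normrM ger0_norm//; apply: (@le_trans _ _ (k0^-1 * M)).
      exact: ler_pM.
    by rewrite /K; lra.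
  - move=> y z h; have [z1|/kap1 ->] := leP (l2norm z) 1; last by rewrite mul0r.
    rewrite vs ?mulr0//.
    have h1 := l2normB (y + - s k *: z) (- s k *: z); rewrite addrK in h1.
    have h2 : l2norm (- s k *: z) <= s k.
      by rewrite l2normZ normrN gtr0_norm// ler_piMr// ltW.
    have := sg k; case: h; move: h1 h2; rewrite /K; lra.
pose KW := K + Int (@ballfun R n K).
have bW k : bms KW (W k) := bms_Int2 (bW2 k).
have cW k : continuous (W k).
  move=> y; apply: (@Int_continuous _ _ K) => [p|]; first exact: bms2_section (bW2 k).
  apply: aeW => z; apply: near_seq_continuous => p hp; apply: cvgMr.
  apply: (@continuous_near_seq _ _ v _ (fun k' => p k' + _)); first exact: cv.
  by move=> j; rewrite opprD addrACA subrr addr0.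
have bB k := bms_moving_ballint x r (bW k) (cW k) (smooth_continuous srho).
have WE k : conv v (bump 0 (s k)) = fun x => (s k ^+ n * k0) * W k x.
  apply/funext => y; rewrite (conv_bump _ bv (s0 k)) -mulrA; congr (_ * _).
  rewrite /W -(IntZ _ (bms2_section _ (bW2 k))); apply: Int_ext => z.
  by rewrite /kap !mulrA divff ?gt_eqF// mul1r.
have main k : ballint (W k) x (rho x) * vol R n <=
    Int (fun y => ind y * ballint (W k) (x + r *: y) (rho (x + r *: y))).
  pose c := s k ^+ n * k0; have c0 : 0 < c by rewrite mulr_gt0// exprn_gt0.
  pose U := conv v (bump 0 (s k)).
  have cs : csexp (s k) (bump 0 (s k) : V -> R) := csexp_bump (s0 k).
  have sU : smooth U by move=> l y; exact: (conv_smooth bv cs).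
  have UE : U = fun x => c * W k x by exact: WE.
  have bUE y t : ballint U y t = c * ballint (W k) y t.
    rewrite /ballint -bIntZ; last by eexists; exact: bms_moved (bW k).
    by apply: Int_ext => z; rewrite UE mulrCA.
  have h := @moving_average_submean _ _ U sU _ _ rho srho x r (ltW r0).
  have {h} := h _ _ _; rewrite bUE.
  rewrite (Int_ext (g := fun y => c * (ind y * ballint (W k) (x + r *: y) (rho (x + r *: y))))); last first.
    by move=> y; rewrite bUE mulrCA.
  rewrite (IntZ _ (bB k)).
  rewrite -mulrA ler_pM2l//; apply.
  - by move=> i j; exact: (conv_partialC bv i j cs).
  - move=> i j l; rewrite (conv_partialE bv l cs); exact: (conv_partialC bv i j (csexp_partial l cs)).
  - move=> p px; split => // z z1.
    apply: (@ballint_lap_ge0 _ _ U _ g sU g0) => t t0 tg.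
    rewrite bUE UE -mulrA ler_pM2l//.
    apply: (submean_superpose bk bv kap0 kap1 sv t0).
    have := hR1 p px; have := sg k; have := l2normD p (rho p *: z).
    rewrite l2normZ ger0_norm// normrN gtr0_norm//.
    have : rho p * l2norm z <= rho p by rewrite ler_piMr// ltW.
    by move: tg; rewrite /g; lra.
have cvW y : W k y @[k --> \oo] --> v y.
  have h : forall z, kap z * v (y + - s k *: z) @[k --> \oo] --> kap z * v y.
    by move=> z; apply: cvgMr; apply: continuous_shift => //; exact: cv.
  have [_] := @Int_cvg_all _ _ K (fun k z => kap z * v (y + - s k *: z)) _ (fun k => bms2_section y (bW2 k)) h.
  rewrite (Int_ext (f := fun z => kap z * v y) (g := fun z => v y * kap z)); last first.
    by move=> z; rewrite mulrC.
  by rewrite (IntZ _ bk) Ik mulr1.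
have cvB y t : ballint (W k) y t @[k --> \oo] --> ballint v y t.
  have [|_] := @Int_cvg_all _ _ _ (fun k z => ind z * W k (y + t *: z))
    (fun z => ind z * v (y + t *: z)) (fun k => bms_moved y t (bW k)); last by [].
  by move=> z; apply: cvgMr.
have cvI : Int (fun y => ind y * ballint (W k) (x + r *: y) (rho (x + r *: y))) @[k --> \oo]
    --> Int (fun y => ind y * ballint v (x + r *: y) (rho (x + r *: y))).
  have [| |_] := @Int_cvg_all _ _ (2 * (1 + `|KW * vol R n|))
    (fun k y => ind y * ballint (W k) (x + r *: y) (rho (x + r *: y)))
    (fun y => ind y * ballint v (x + r *: y) (rho (x + r *: y))); last by [].
  - exact: bB.
  - by move=> y; apply: cvgMr.
apply: (@seq_cvg_le _ _ _ _ _ 0 _ cvI (fun k _ => main k)).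
by apply: cvgMl; exact: cvB.
Qed.

End continuous_moving_average.

Section moving_average_sh.
Context {R : realType} {n : nat}.
Local Notation V := 'rV[R]_n.
Implicit Types (f g v : V -> R) (x z : V).

Definition usc v := forall x, l2norm x < 1 -> forall a : R, v x < a ->
  \forall y \near x, v y < a.

(** Bounded real subharmonic functions on the unit ball, extended by zero so
    that they are globally defined, bounded and integrable. *)
Definition sh N v := [/\ forall x, `|v x| <= N, forall x, 1 <= l2norm x -> v x = 0,
  usc v & submean 1 v].

Lemma usc_measurable v : (forall x, 1 <= l2norm x -> v x = 0) -> usc v ->
  measurable_fun setT v.
Proof.
move=> v0 uv; apply: measurable_fun_lt => a; rewrite setTI.
rewrite (_ : mkset _ = (eball 0 1 `&` [set x | v x < a]) `|`
    (~` eball 0 1 `&` [set x | 0 < a])).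
  apply: measurableU.
    apply: open_measurable_rV; rewrite openE => x [x1 xa].
    have := uv x; rewrite -[l2norm x]subr0 => _.
    have x1' : l2norm x < 1 by move: x1; rewrite /eball/= subr0.
    apply: filterI; last exact: uv.
    exact: (@eball_open R n 0 1 _ x1).
  apply: measurableI; first by apply: measurableC; exact: eball_measurable.
  by case: (ltP 0 a) => h; [rewrite (_ : mkset _ = setT)//|rewrite (_ : mkset _ = set0)//];
    apply/seteqP; split.
apply/seteqP; split => x /=; rewrite /eball/= subr0.
  have [x1 xa|x1] := ltP (l2norm x) 1; first by left.
  by rewrite v0// => a0; right.
by case=> -[] // /negP; rewrite -leNgt => /v0 ->.
Qed.

Lemma sh_ge0 N v : sh N v -> 0 <= N.
Proof. by move=> [/(_ 0) h _ _ _]; exact: le_trans h. Qed.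

Lemma sh_bms N v : sh N v -> bms (N + 1) v.
Proof.
move=> sv; have N0 := sh_ge0 sv; case: sv => vN v0 uv _; split.
- exact: usc_measurable.
- by move=> x; apply: le_trans (vN x) _; rewrite lerDl.
- by move=> x h; apply: v0; lra.
Qed.

(** The last condition keeps the balls inside a smaller concentric ball, or at
    least inside the one through their centre, so that mollification at a small
    scale remains possible. *)
Definition admissible (rho : V -> R) :=
  [/\ smooth rho, forall p, 0 <= rho p, forall p, slow rho p &
    exists2 R1, R1 < 1 & forall p, l2norm p + rho p <= Num.max (l2norm p) R1].

Definition move v (rho : V -> R) x : R :=
  if l2norm x < 1 then ballint v x (rho x) / vol R n else 0.

Lemma le_move N v rho x : sh N v -> admissible rho -> l2norm x < 1 ->
  v x <= move v rho x.
Proof.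
move=> [_ _ _ sv] [_ r0 _ [R1 R11 hR]] x1; rewrite /move x1 ler_pdivlMr ?vol_gt0//.
have [rx|rx] := eqVneq (rho x) 0; first by rewrite rx ballint0.
apply: sv; first by rewrite lt_neqAle eq_sym rx r0.
by apply: le_lt_trans (hR x) _; rewrite gt_max x1.
Qed.

Lemma move_id v rho x : l2norm x < 1 -> rho x = 0 -> move v rho x = v x.
Proof. by move=> x1 r0; rewrite /move x1 r0 ballint0 mulfK// gt_eqF ?vol_gt0. Qed.

Lemma ballint_le M K f g x (r : R) : bms M f -> bms K g ->
  (forall y, l2norm (y - x) <= `|r| -> f y <= g y) -> ballint f x r <= ballint g x r.
Proof.
move=> bf bg fg; apply: Int_le (bms_moved x r bf) (bms_moved x r bg) _ => z.
rewrite indE; case: ltP => [z1|_]; last by rewrite !mul0r.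
rewrite !mul1r; apply: fg; rewrite (addrC x) addrK l2normZ.
by apply: ler_piMr => //; exact: ltW.
Qed.

Lemma ballint_cst (c : R) x (r : R) : ballint (fun=> c) x r = c * vol R n.
Proof.
by rewrite /ballint -Int_ind -(IntZ _ bms_ind); apply: Int_ext => z; rewrite mulrC.
Qed.

Lemma bms_indZ (c : R) : bms (2 * (1 + `| `|c| |)) (fun z : V => ind z * c).
Proof. by apply: bmsM bms_ind _ _ => //; exact: measurable_cst. Qed.

Section regularisation.
Variables (N : R) (v : V -> R).
Hypothesis sv : sh N v.
Let s (k : nat) : R := k.+1%:R^-1.
Let W k x : R := (vol R n)^-1 * ballint v x (s k).
Let bv := sh_bms sv.
Let N0 := sh_ge0 sv.

Let s0 k : 0 < s k. Proof. by rewrite invr_gt0 ltr0n. Qed.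
Let s1 k : s k <= 1. Proof. by rewrite invf_le1 ?ltr0n// ler1n. Qed.
Let vi : 0 < (vol R n)^-1. Proof. by rewrite invr_gt0 vol_gt0. Qed.

Let cW k : continuous (W k).
Proof.
move=> x; apply: near_seq_continuous => y hy; apply: cvgMr.
exact: (continuous_near_seq (ballint_continuous bv (s0 k) (x := x)) hy).
Qed.

Let WN k x : `|W k x| <= N.
Proof.
rewrite /W normrM gtr0_norm// mulrC ler_pdivrMr ?vol_gt0//.
by apply: (ballint_bound _ _ bv); case: sv.
Qed.

Let bW k : bms (N + 2) (W k).
Proof.
split; first exact: continuous_measurable_rV.
  by move=> x; apply: le_trans (WN k x) _; rewrite lerDl.
move=> x xN; rewrite /W /ballint (Int_ext (g := fun=> 0)) ?Int0 ?mulr0// => z.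
rewrite indE; case: ltP => [z1|_]; last by rewrite mul0r.
have [_ v0 _ _] := sv; rewrite v0 ?mulr0//.
have := l2normB (x + s k *: z) (s k *: z); rewrite addrK l2normZ gtr0_norm//.
have : s k * l2norm z <= 1.
  by rewrite -[leRHS]mulr1; apply: ler_pM; rewrite ?l2norm_ge0 ?s1 ?(ltW (s0 k))// ltW.
by move: xN N0; lra.
Qed.

Let sW k : submean (1 - s k) (W k).
Proof.
have h := @submean_superpose _ _ _ _ ind v 1 (s k) bms_ind bv.
move=> x r r0 xr; rewrite /W -mulrA.
rewrite {2}/ballint (Int_ext (g := fun z => (vol R n)^-1 * (ind z * ballint v (x + r *: z) (s k)))); last first.
  by move=> z; rewrite mulrCA.
rewrite (IntZ (M := 2 * (1 + `|N * vol R n|))); last first.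
  apply: bmsM bms_ind _ _ => [|z _].
    apply: (measurableT_comp (f := fun p => ballint v p (s k)) _ (measurable_affine_map x r)).
    by apply: continuous_measurable_rV; exact: ballint_continuous bv (s0 k).
  by apply: (ballint_bound _ _ bv); case: sv.
rewrite ler_pM2l//; apply: h => //.
- by move=> z /ltW z1; rewrite indE ltNge z1.
- by case: sv.
- by rewrite gtr0_norm.
Qed.

Let le_W k x : l2norm x + s k < 1 -> v x <= W k x.
Proof.
move=> xs; rewrite /W mulrC ler_pdivlMr ?vol_gt0//.
by case: sv => _ _ _; apply.
Qed.

Let cvW x : l2norm x < 1 -> W k x @[k --> \oo] --> v x.
Proof.
move=> x1; apply/cvg_seqP => e e0.
have [_ _ uv _] := sv.
have /near_l2norm[d d0 hd] : \forall y \near x, v y < v x + e / 2.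
  by apply: uv => //; rewrite ltrDl divr_gt0.
have [k0 hk] : exists k0, forall k, (k0 <= k)%N -> s k < Num.min (d / 2) (1 - l2norm x).
  by apply: invS_lt; rewrite lt_min divr_gt0//= subr_gt0.
exists k0 => k /hk; rewrite lt_min => /andP[kd kx].
have h1 : v x <= W k x by apply: le_W; move: kx; lra.
have h2 : W k x <= v x + e / 2.
  rewrite /W mulrC ler_pdivrMr ?vol_gt0//.
  have : ballint v x (s k) <= ballint (fun=> v x + e / 2) x (s k); last by rewrite ballint_cst.
  rewrite /ballint; apply: (Int_le (bms_moved x (s k) bv) (bms_indZ _)) => z.
  rewrite indE; case: ltP => [z1|_]; last by rewrite !mul0r.
  rewrite !mul1r; apply: ltW; apply: hd; rewrite (addrC x) addrK l2normZ gtr0_norm//.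
  have : s k * l2norm z <= s k by apply: ler_piMr; [exact: ltW|exact: ltW].
  by move: kd d0; lra.
by rewrite ger0_norm; move: h1 h2; lra.
Qed.

(** Averaging [v] at the fixed scale [s k] produces continuous functions that are
    sub-mean on a slightly smaller ball and tend to [v] pointwise by upper
    semicontinuity, so that the continuous case passes to the limit. *)
Lemma sh_move rho : admissible rho -> sh N (move v rho).
Proof.
move=> ad; have [srho rho0 slo [R1 R11 hR]] := ad.
have crho := smooth_continuous srho.
have bWk x : l2norm x < 1 ->
    ballint (W k) x (rho x) @[k --> \oo] --> ballint v x (rho x).
  move=> x1; have [|_] := @Int_cvg_all _ _ _ (fun k z => ind z * W k (x + rho x *: z))
    (fun z => ind z * v (x + rho x *: z)) (fun k => bms_moved x (rho x) (bW k)); last by [].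
  move=> z; rewrite indE; case: ltP => [z1|_]; last first.
    by under eq_fun do rewrite mul0r; rewrite mul0r; exact: cvg_cst.
  apply: cvgMr; apply: cvW; apply: le_lt_trans (l2normD _ _) _.
  rewrite l2normZ ger0_norm//; apply: (@le_lt_trans _ _ (Num.max (l2norm x) R1)).
    apply: le_trans (hR x); rewrite lerD2l; apply: ler_piMr => //; exact: ltW.
  by rewrite gt_max x1.
have dom (R2 : R) : R2 < 1 -> exists k0, forall k, (k0 <= k)%N -> s k < 1 - R2.
  by move=> h; apply: invS_lt; rewrite subr_gt0.
split.
- move=> x; rewrite /move; case: ifP => _; last by rewrite normr0.
  rewrite normrM (gtr0_norm vi) ler_pdivrMr ?vol_gt0//.
  by apply: (ballint_bound _ _ bv); case: sv.
- by move=> x x1; rewrite /move ltNge x1.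
- move=> x x1 a; rewrite {1}/move x1 ltr_pdivrMr ?vol_gt0// => xa.
  pose R0 := (1 + l2norm x) / 2; pose R2 := Num.max R0 R1.
  have R21 : R2 < 1 by rewrite gt_max /R0; apply/andP; split => //; lra.
  have [k0 hk0] := dom _ R21.
  have a0 : 0 < a * vol R n - ballint v x (rho x) by rewrite subr_gt0.
  have /cvg_seqP/(_ _ a0)[k1 hk1] := bWk x x1.
  pose k := maxn k0 k1; have := hk1 k (leq_maxr _ _).
  have := hk0 k (leq_maxl _ _); move=> sk /ltr_normlW k1a.
  have a1 : 0 < a * vol R n - ballint (W k) x (rho x) by move: k1a; lra.
  have /continuous_l2P/(_ _ a1)[d d0 hd] := ballint_moving_continuous (bW k) (@cW k) crho (x := x).
  apply/near_l2norm; exists (Num.min d ((1 - l2norm x) / 2)).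
    by rewrite lt_min d0/= divr_gt0// subr_gt0.
  move=> y; rewrite lt_min => /andP[yd yx].
  have yR0 : l2norm y < R0 by have := ler_l2norm_add x y; rewrite /R0; lra.
  have y1 : l2norm y < 1 by move: yR0; rewrite /R0; lra.
  rewrite /move y1 ltr_pdivrMr ?vol_gt0//.
  apply: (@le_lt_trans _ _ (ballint (W k) y (rho y))); last first.
    by have := ltr_normlW (hd y yd); rewrite ltrBlDr subrK.
  apply: ballint_le bv (bW k) _ => z; rewrite ger0_norm// => zy; apply: le_W.
  have : l2norm y + rho y <= R2.
    by apply: le_trans (hR y) _; rewrite /R2 ge_max !le_max (ltW yR0) lexx orbT.
  by have := ler_l2norm_add y z; move: sk zy; lra.
- move=> x r r0 xr.
  pose R2 := Num.max (l2norm x + r) R1.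
  have R21 : R2 < 1 by rewrite gt_max xr.
  have [k0 hk0] := dom _ R21.
  have x1 : l2norm x < 1 by move: xr r0; lra.
  have inx z : l2norm z < 1 -> l2norm (x + r *: z) < 1.
    move=> z1; apply: le_lt_trans (l2normD _ _) _; rewrite l2normZ gtr0_norm//.
    by apply: le_lt_trans xr; rewrite lerD2l; apply: ler_piMr; exact: ltW.
  rewrite {1}/move x1 divfK ?gt_eqF ?vol_gt0//.
  have -> : ballint (move v rho) x r =
      Int (fun y => (vol R n)^-1 * (ind y * ballint v (x + r *: y) (rho (x + r *: y)))).
    apply: Int_ext => z; rewrite indE; case: ltP => z1; last by rewrite !(mul0r, mulr0).
    by rewrite /move inx// !mul1r mulrC.
  have [|bl cl] := @Int_cvg_all _ _ (2 * (1 + `|(N + 2) * vol R n|))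
     (fun k y => ind y * ballint (W k) (x + r *: y) (rho (x + r *: y)))
     (fun y => ind y * ballint v (x + r *: y) (rho (x + r *: y)))
     (fun k => bms_moving_ballint x r (bW k) (@cW k) crho).
    move=> z; rewrite indE; case: ltP => z1; last first.
      by under eq_fun do rewrite mul0r; rewrite mul0r; exact: cvg_cst.
    by apply: cvgMr; apply: bWk; exact: inx.
  rewrite (IntZ _ bl) mulrC ler_pdivlMr ?vol_gt0//.
  apply: (@seq_cvg_le _ _ _ _ _ k0 _ cl).
    by apply: cvgMl; exact: bWk.
  move=> k /hk0 sk; apply: (@moving_submean_continuous _ _ (N + 2) _ (1 - s k) _ _ _ R2) => //.
    by move: sk; lra.
  move=> p px; apply: le_trans (hR p) _; rewrite /R2 ge_max !le_max lexx orbT andbT.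
  by have := ler_l2norm_add x p => h; apply/orP; left; move: px; lra.
Qed.

End regularisation.
End moving_average_sh.

(** * Obstacle problem: the largest subharmonic minorant *)

Section radius.
Context {R : realType} {n : nat}.
Local Notation V := 'rV[R]_n.
Implicit Types (x z : V).

Lemma partialZ (a : R) (f : V -> R) i x : differentiable f x ->
  partial i (fun x => a * f x) x = a * partial i f x.
Proof. by move=> df; apply: (deriveZ a (diff_derivable df)). Qed.

(** The normalisation makes [tau] the radius at the centre [x0]. *)
Definition rad x0 (d tau : R) x : R := tau / flat 0 1 * bump x0 d x.

Let c1 : 0 < flat 0 1 :> R. Proof. exact: flat_gt0. Qed.

Lemma rad_center x0 d (tau : R) : rad x0 d tau x0 = tau.
Proof.
rewrite /rad bumpE subrr l2norm0 mul0r expr0n subr0 divfK//; exact: lt0r_neq0.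
Qed.

Lemma rad_out x0 d (tau : R) x : 0 < d -> d <= l2norm (x - x0) -> rad x0 d tau x = 0.
Proof. by move=> d0 h; rewrite /rad bump_eq0// mulr0. Qed.

Lemma rad_ge0 x0 d (tau : R) x : 0 <= tau -> 0 <= rad x0 d tau x.
Proof. by move=> t0; rewrite mulr_ge0 ?bump_ge0// divr_ge0// ltW. Qed.

Lemma rad_le x0 d (tau : R) x : 0 < d -> 0 <= tau -> rad x0 d tau x <= tau.
Proof.
move=> d0 t0; rewrite -[leRHS](rad_center x0 d) /rad.
apply: ler_wpM2l; first by rewrite divr_ge0// ltW.
by apply: bump_anti => //; rewrite subrr l2norm0 l2norm_ge0.
Qed.

Lemma rad_diff x0 d (s t : R) x : 0 < d -> `|rad x0 d s x - rad x0 d t x| <= `|s - t|.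
Proof.
move=> d0.
have -> : rad x0 d s x - rad x0 d t x = (s - t) * rad x0 d 1 x by rewrite /rad; ring.
rewrite normrM; apply: ler_piMr => //.
by rewrite ger0_norm ?rad_ge0// rad_le.
Qed.

(** By scaling, the gradient of the radius function is of order [tau / d] and its
    Laplacian of order [tau / d ^ 2]. *)
Lemma admissible_rad : exists c : R, [/\ 0 < c, c <= 1 &
  forall x0 (d tau : R), 0 < d -> l2norm x0 + d < 1 -> 0 <= tau -> tau <= c * d ->
    admissible (rad x0 d tau) /\
    forall x, l2norm (x - x0) < d -> l2norm x + rad x0 d tau x <= l2norm x0 + d].
Proof.
pose f : V -> R := bump 0 1.
have cf : csexp 1 f := csexp_bump ltr01.
have [K1 K10 hK1] : exists2 K : R, 0 <= K & forall i x, `|partial i f x| <= K.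
  have /choice[K hK] (i : 'I_n) : exists B : R, 0 <= B /\ forall x, `|partial i f x| <= B.
    by have [B B0 hB] := csexp_bounded (csexp_partial i cf); exists B.
  exists (\sum_i K i) => [|i x]; first by apply: sumr_ge0 => i _; case: (hK i).
  apply: le_trans (proj2 (hK i) x) _; rewrite (bigD1 i)//= lerDl.
  by apply: sumr_ge0 => j _; case: (hK j).
have [K2 K20 hK2] : exists2 K : R, 0 <= K & forall x, `|lap f x| <= K.
  have /choice[K hK] (i : 'I_n) : exists B : R, 0 <= B /\ forall x, `|partial i (partial i f) x| <= B.
    by have [B B0 hB] := csexp_bounded (csexp_partial i (csexp_partial i cf)); exists B.
  exists (\sum_i K i) => [|x]; first by apply: sumr_ge0 => i _; case: (hK i).
  by apply: le_trans (ler_norm_sum _ _ _) _; apply: ler_sum => i _; case: (hK i).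
have [C C0 hC] := @flat_bound R 0.
pose m := n%:R * K1; have m0 : 0 <= m by rewrite mulr_ge0.
pose L := 1 + m + n%:R + K2; have n0 : 0 <= n%:R :> R by [].
have L1 : 1 <= L by rewrite /L; lra.
have Lm : m <= L by rewrite /L; lra.
have Ln : n%:R <= L by rewrite /L; lra.
have LK : K2 <= L by rewrite /L; lra.
have L0 : 0 < L by lra.
pose t := (4 * L ^+ 3 + 2 * C)^-1.
have L31 : L <= L ^+ 3 by rewrite -[X in X <= _]expr1 ler_weXn2l.
have T0 : 0 < 4 * L ^+ 3 + 2 * C by lra.
have t0 : 0 < t by rewrite invr_gt0.
have tC : t * (2 * C) <= 1.
  by rewrite mulrC ler_pdivrMr// mul1r; lra.
have tL3 : t * L ^+ 3 <= 1 / 4.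
  by rewrite mulrC ler_pdivrMr//; lra.
have tL : t * L <= 1 / 4 by apply: le_trans tL3; rewrite ler_pM2l.
have t14 : t <= 1 / 4 by apply: le_trans tL; rewrite ler_peMr// ltW.
exists (flat 0 1 * t); split.
- by rewrite mulr_gt0.
- have := flat_le1 (1 : R); have := ltW c1; move: tL t0 t14; move: (flat 0 1) => a; nra.
move=> x0 d tau d0 xd tau0 taud.
pose A := tau / flat 0 1.
have A0 : 0 <= A by rewrite divr_ge0// ltW.
have Ad : A * d^-1 <= t by rewrite ler_pdivrMr// ler_pdivrMr// mulrC mulrA.
have AE : tau / flat 0 1 = A by []; clearbody A.
have di0 : 0 < d^-1 by rewrite invr_gt0.
have dn0 : d != 0 by rewrite gt_eqF.
pose g x := A * f x.
have sg : smooth g by apply: smoothM; [exact: smooth_cst|exact: sexp_smooth (sexp_bump _ _)].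
pose a := - (d^-1 *: x0).
have rE : rad x0 d tau = fun x => g (a + d^-1 *: x).
  apply/funext => x; rewrite /rad AE /g /f -(bump_scale x0 _ dn0); congr (_ * bump _ _ _).
  by rewrite scalerDr /a scalerN !scalerA divff// !scale1r addrA subrr add0r.
have pg i x : partial i g x = A * partial i f x.
  have df : differentiable f x by exact: sexp_differentiable (sexp_bump _ _) x.
  exact: partialZ.
have ppg i x : partial i (partial i g) x = A * partial i (partial i f) x.
  rewrite (_ : partial i g = fun x => A * partial i f x); last exact/funext.
  have df : differentiable (partial i f) x by apply: sexp_differentiable; case: (csexp_partial i cf).
  exact: partialZ.
have pr i : partial i (rad x0 d tau) = fun x => d^-1 * partial i g (a + d^-1 *: x).
  apply/funext => x; rewrite rE.
  by have [_] := @partial_affine _ _ g a d^-1 i x (smooth_differentiable _ sg).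
have ppr i x : partial i (partial i (rad x0 d tau)) x =
    d^-1 * (d^-1 * (A * partial i (partial i f) (a + d^-1 *: x))).
  rewrite pr -ppg; have sgi := smooth_partial i sg.
  have [dd ee] := @partial_affine _ _ (partial i g) a d^-1 i x (smooth_differentiable _ sgi).
  by rewrite -ee; exact: (partialZ d^-1 i dd).
have sr : smooth (rad x0 d tau) by rewrite rE; exact: smooth_affine.
have inball p : l2norm (p - x0) < d -> l2norm p + rad x0 d tau p <= l2norm x0 + d.
  move=> pd.
  pose w := l2norm (p - x0) / d.
  have w0 : 0 <= w by rewrite divr_ge0 ?l2norm_ge0// ltW.
  have w1 : w <= 1 by rewrite ler_pdivrMr// mul1r ltW.
  have wd : l2norm (p - x0) = w * d by rewrite /w divfK.
  have h : rad x0 d tau p <= d - l2norm (p - x0).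
    rewrite /rad bumpE -/w AE wd.
    have h1 : flat 0 (1 - w ^+ 2) <= C * (2 * (1 - w)).
      apply: le_trans (hC _) _; apply: ler_wpM2l => //.
      by rewrite ger0_norm; nra.
    have h2 : A <= t * d by rewrite -ler_pdivrMr.
    apply: (@le_trans _ _ (t * d * (C * (2 * (1 - w))))).
      by apply: ler_pM => //; exact: flat_ge0.
    have -> : t * d * (C * (2 * (1 - w))) = (t * (2 * C)) * (d * (1 - w)) by ring.
    have -> : d - w * d = d * (1 - w) by ring.
    by apply: ler_piMl => //; rewrite mulr_ge0 ?subr_ge0// ltW.
  by have := ler_l2norm_add x0 p; lra.
split => //; split => //.
- by move=> p; exact: rad_ge0.
- move=> p; rewrite /slow.
  have gr : l2norm (gradient (rad x0 d tau) p) <= t * m.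
    rewrite /m mulrCA; apply: l2norm_le_coord; first by rewrite mulr_ge0// ltW.
    move=> i; rewrite mxE pr pg !normrM (ger0_norm A0) gtr0_norm// mulrA.
    by apply: ler_pM => //; [rewrite mulr_ge0// ltW|rewrite mulrC].
  have lr : `|lap (rad x0 d tau) p * rad x0 d tau p| <= t ^+ 2 * K2.
    have -> : lap (rad x0 d tau) p = d^-1 * d^-1 * A * lap f (a + d^-1 *: p).
      rewrite /lap mulr_sumr; apply: eq_bigr => i _.
      by rewrite ppr !mulrA.
    rewrite normrM (ger0_norm (x := rad x0 d tau p)) ?rad_ge0//.
    rewrite 3!normrM (ger0_norm A0) (gtr0_norm di0).
    have rA : rad x0 d tau p <= A by rewrite /rad AE ler_piMr ?bump_le1.
    apply: (@le_trans _ _ ((A * d^-1) ^+ 2 * K2)).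
      have -> : (A * d^-1) ^+ 2 * K2 = (d^-1 * d^-1 * A * K2) * A by ring.
      apply: ler_pM => //; [by rewrite !mulr_ge0// (ltW di0)|exact: rad_ge0|].
      by apply: ler_wpM2l => //; rewrite !mulr_ge0// (ltW di0).
    by apply: ler_wpM2r => //; rewrite ler_pXn2r ?nnegrE ?mulr_ge0 ?(ltW di0) ?(ltW t0).
  have G0 := l2norm_ge0 (gradient (rad x0 d tau) p).
  move: gr lr G0; move: (l2norm _) `|_ * rad _ _ _ _| => G l gr lr G0.
  have tm : t * m <= 1 / 4 by apply: le_trans tL; rewrite ler_pM2l.
  have h1 : n%:R * G ^+ 2 <= t * (t * L ^+ 3).
    apply: (@le_trans _ _ (L * (t * L) ^+ 2)); last first.
      by rewrite (_ : L * (t * L) ^+ 2 = t * (t * L ^+ 3))//; ring.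
    apply: ler_pM => //; first exact: sqr_ge0.
    rewrite ler_pXn2r// ?nnegrE; [|by rewrite mulr_ge0// ltW].
    by apply: le_trans gr _; rewrite ler_pM2l.
  have h2 : t ^+ 2 * K2 <= t * (t * L).
    by rewrite expr2 -mulrA; apply: ler_wpM2l; [exact: ltW|rewrite ler_pM2l].
  have h3 : t * (t * L ^+ 3) <= 1 / 4 * (1 / 4).
    by apply: ler_pM => //; [exact: ltW|rewrite mulr_ge0 ?exprn_ge0// ltW].
  have h4 : t * (t * L) <= 1 / 4 * (1 / 4).
    by apply: ler_pM => //; [exact: ltW|rewrite mulr_ge0// ltW].
  by lra.
- exists (l2norm x0 + d) => // p.
  have [pd|pd] := leP d (l2norm (p - x0)); first by rewrite rad_out// addr0 le_max lexx.
  by rewrite le_max inball// orbT.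
Qed.

End radius.

Section obstacle.
Context {R : realType} {n : nat}.
Local Notation V := 'rV[R]_n.
Implicit Types (f g v b : V -> R) (x y z p : V).

Lemma bm_ind_dotv p : bm (fun z => ind z * dotv p z).
Proof.
apply: (bm_ind_mul (B := l2norm p)) => [|z z1].
  by apply: continuous_measurable_rV; exact: dotv_continuous.
apply: le_trans (cauchy_schwarz _ _) _; apply: ler_piMr; [exact: l2norm_ge0|exact: ltW].
Qed.

Lemma Int_ind_dotv p : Int (fun z => ind z * dotv p z) = 0.
Proof.
have [K bK] := bm_ind_dotv p; have n1 : (-1 : R) != 0 by rewrite oppr_eq0 oner_neq0.
have := Int_affine 0 n1 bK; rewrite normrN1 expr1n mul1r.
rewrite (Int_ext (f := fun z => ind (0 + -1 *: z) * _) (g := fun z => -1 * (ind z * dotv p z))); last first.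
  by move=> z; rewrite add0r dotvZr scaleN1r !indE l2normN; ring.
by rewrite (IntZ _ bK); lra.
Qed.

Lemma ballint_affine (a : R) p x0 x (r : R) :
  bm (fun z => ind z * (a + dotv p (x + r *: z - x0))) /\
  ballint (fun y => a + dotv p (y - x0)) x r = (a + dotv p (x - x0)) * vol R n.
Proof.
have E z : ind z * (a + dotv p (x + r *: z - x0)) =
    (a + dotv p (x - x0)) * ind z + r * (ind z * dotv p z).
  rewrite (addrAC x) (dotvDr p (x - x0)) dotvZr; ring.
have b1 : bm (fun z => (a + dotv p (x - x0)) * ind z) by apply: bmZ; exists 2; exact: bms_ind.
have b2 := bmZ r (bm_ind_dotv p).
split; first by apply: bm_ext (bmD b1 b2) => z.
rewrite /ballint (Int_ext E) bIntD// (IntZ _ bms_ind) Int_ind bIntZ ?Int_ind_dotv ?mulr0 ?addr0//.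
exact: bm_ind_dotv.
Qed.

Lemma ballint_le_quadratic K f (a M r : R) p x : bms K f -> 0 <= M ->
  (forall z, l2norm z < 1 -> f (x + r *: z) <= a + dotv p (r *: z) + M * l2norm (r *: z) ^+ 2) ->
  ballint f x r <= (a + M * r ^+ 2) * vol R n.
Proof.
move=> bf M0 hf; have [ba] := ballint_affine (a + M * r ^+ 2) p x x r.
rewrite subrr dotvC dotv0l addr0 => <-.
apply: (bInt_le _ ba); first by eexists; exact: bms_moved bf.
move=> z; rewrite indE; case: ltP => [z1|_]; last by rewrite !mul0r.
rewrite !mul1r (addrAC x) subrr add0r.
apply: le_trans (hf z z1) _; rewrite addrAC lerD2r lerD2l ler_wpM2l//.
rewrite l2normZ exprMn real_normK ?num_real//; apply: ler_piMr; first exact: sqr_ge0.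
by rewrite expr_le1// ?l2norm_ge0// ltW.
Qed.

Lemma sh_cut N v (c : R) : 0 <= c -> sh N v ->
  sh (N + c) (fun x => if l2norm x < 1 then v x - c else 0).
Proof.
move=> c0 sv; have bv := sh_bms sv; have N0 := sh_ge0 sv; case: sv => vN v0 uv smv; split.
- move=> x; case: ifP => _; last by rewrite normr0 addr_ge0.
  by apply: le_trans (ler_normB _ _) _; rewrite (ger0_norm c0) lerD2r.
- by move=> x; rewrite leNgt => /negbTE ->.
- move=> x x1 a; rewrite x1 ltrBlDr => /(uv x x1) h.
  have h1 : \forall y \near x, l2norm y < 1.
    have := @eball_open R n 0 1 x; rewrite /eball/= subr0 => /(_ x1).
    by apply: filterS => y /=; rewrite subr0.
  by apply: filterS2 h h1 => y h ->; rewrite ltrBlDr.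
- move=> x r r0 xr; have x1 : l2norm x < 1 by move: r0 xr; lra.
  have -> : ballint (fun x => if l2norm x < 1 then v x - c else 0) x r =
      ballint v x r - c * vol R n.
    rewrite -(ballint_cst (n := n) c x r) /ballint.
    rewrite -(IntB (bms_moved x r bv) (bms_indZ (n := n) c)); apply: Int_ext => z.
    rewrite indE; case: ltP => [z1|_]; last by rewrite !mul0r subr0.
    rewrite !mul1r; have -> // : l2norm (x + r *: z) < 1.
    apply: le_lt_trans (l2normD _ _) _; rewrite l2normZ gtr0_norm//.
    by apply: le_lt_trans xr; rewrite lerD2l; apply: ler_piMr; exact: ltW.
  by rewrite x1 mulrBl lerB// smv.
Qed.

(** The last condition bounds second derivatives of the obstacle from above; it
    is the part of a [C^1,1] bound that a minimum of two functions inherits. *)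
Definition obstacle_sol (N M : R) b v := [/\ sh N v,
  forall x, l2norm x < 1 -> v x <= b x,
  forall K f, sh K f -> (forall x, l2norm x < 1 -> f x <= b x) ->
    forall x, l2norm x < 1 -> f x <= v x &
  forall x, l2norm x < 1 -> exists2 p, l2norm p <= N &
    forall y, l2norm y < 1 -> b y <= b x + dotv p (y - x) + M * l2norm (y - x) ^+ 2].

Definition radius_const (c : R) := [/\ 0 < c, c <= 1 &
  forall (x0 : V) (d tau : R), 0 < d -> l2norm x0 + d < 1 -> 0 <= tau -> tau <= c * d ->
    admissible (rad x0 d tau) /\
    forall x, l2norm (x - x0) < d -> l2norm x + rad x0 d tau x <= l2norm x0 + d].

Variables (N M c : R) (b v : V -> R).
Hypotheses (M0 : 0 <= M) (sol : obstacle_sol N M b v) (hc : radius_const c).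

Let sv : sh N v. Proof. by case: sol. Qed.
Let bv := sh_bms sv.
Let N0 : 0 <= N. Proof. exact: sh_ge0 sv. Qed.

Lemma ball_in x0 (d : R) y : l2norm x0 + d < 1 -> l2norm (y - x0) <= d -> l2norm y < 1.
Proof. by move=> h h1; have := ler_l2norm_add x0 y; lra. Qed.

(** The moving average of [v], lowered by [M tau ^ 2], stays below the
    obstacle; maximality of [v] then bounds the average at the centre. *)
Lemma sol_avg x0 (d tau : R) : 0 < d -> l2norm x0 + d < 1 -> 0 <= tau ->
  tau <= c * d -> ballint v x0 tau <= (v x0 + M * tau ^+ 2) * vol R n.
Proof.
move=> d0 xd t0 tc; have [_ _ /(_ _ _ _ d0 xd t0 tc)[ad _]] := hc.
have [_ vb vmax hQ] := sol.
have Mt : 0 <= M * tau ^+ 2 by rewrite mulr_ge0// sqr_ge0.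
have x1 : l2norm x0 < 1 by move: d0 xd; lra.
have := vmax _ _ (sh_cut Mt (sh_move sv ad)) _ _ x1.
rewrite x1 /move x1 rad_center lerBlDr ler_pdivrMr ?vol_gt0//; apply=> x {}x1.
rewrite x1 lerBlDr ler_pdivrMr ?vol_gt0//.
have [p _ hp] := hQ x x1.
set r := rad x0 d tau x; have r0 : 0 <= r by exact: rad_ge0.
have rt : r <= tau by exact: rad_le.
apply: (@le_trans _ _ ((b x + M * r ^+ 2) * vol R n)); last first.
  apply: ler_wpM2r; first exact: ltW vol_gt0.
  by rewrite lerD2l ler_wpM2l// ler_pXn2r.
apply: (@ballint_le_quadratic _ _ _ _ _ p _ bv M0) => z z1.
have xz : l2norm (x + r *: z) < 1.
  have [_ _ _ [R1 R11 /(_ x) hR]] := ad.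
  apply: le_lt_trans (l2normD _ _) _; rewrite l2normZ ger0_norm//.
  apply: (@le_lt_trans _ _ (Num.max (l2norm x) R1)); last by rewrite gt_max x1.
  by apply: le_trans hR; rewrite lerD2l; apply: ler_piMr => //; exact: ltW.
by apply: le_trans (vb _ xz) _; have := hp _ xz; rewrite (addrC x) addrK.
Qed.

Lemma sol_submean x (r : R) : 0 <= r -> l2norm x + r < 1 -> v x * vol R n <= ballint v x r.
Proof.
rewrite le_eqVlt => /predU1P[<- _|r0 xr]; first by rewrite ballint0.
by case: sv => _ _ _; apply.
Qed.

(** At a fixed small radius the average is continuous, and it approximates [v]
    from above uniformly, by [sol_avg]. *)
Lemma sol_continuous x : l2norm x < 1 -> {for x, continuous v}.
Proof.
move=> x1; apply/continuous_l2P => e e0.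
have [c0 c1 _] := hc.
pose d : R := (1 - l2norm x) / 4; have d0 : 0 < d by rewrite divr_gt0// subr_gt0.
have M1 : 0 < M + 1 by rewrite ltr_wpDl.
pose r : R := Num.min (Num.min (c * d) 1) (e / (8 * (M + 1))).
have r0 : 0 < r by rewrite !lt_min ltr01 mulr_gt0//= divr_gt0// mulr_gt0.
have [rc r1 re] : [/\ r <= c * d, r <= 1 & r <= e / (8 * (M + 1))].
  by split; rewrite /r !ge_min lexx ?orbT.
have Mr : M * r ^+ 2 <= e / 8.
  apply: (@le_trans _ _ ((M + 1) * r)).
    apply: ler_pM => //; [exact: sqr_ge0|lra|].
    by rewrite expr2; apply: ler_piMr => //; exact: ltW.
  apply: (@le_trans _ _ ((M + 1) * (e / (8 * (M + 1))))); first by rewrite ler_pM2l.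
  by rewrite le_eqVlt; apply/orP; left; apply/eqP; field; rewrite gt_eqF.
have e4 : 0 < e / 4 * vol R n by rewrite mulr_gt0 ?vol_gt0// divr_gt0.
have /continuous_l2P/(_ _ e4)[d1 d10 hd] := ballint_continuous bv r0 (x := x).
exists (Num.min d1 d); first by rewrite lt_min d10.
move=> y; rewrite lt_min => /andP[yd1 yd].
have xd : l2norm x + d < 1 by rewrite /d; lra.
have yd' : l2norm y + d < 1 by have := ler_l2norm_add x y; rewrite /d in yd *; lra.
have cd : c * d <= d by rewrite ler_piMl// ltW.
have := hd y yd1; rewrite ltr_norml => /andP[h1 h2].
have a1 := sol_avg d0 xd (ltW r0) rc; have a2 := sol_avg d0 yd' (ltW r0) rc.
have a3 : v x * vol R n <= ballint v x r by apply: sol_submean (ltW r0) _; lra.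
have a4 : v y * vol R n <= ballint v y r by apply: sol_submean (ltW r0) _; lra.
have vp : 0 < vol R n := vol_gt0.
move: h1 h2 a1 a2 a3 a4; move: (ballint v x r) (ballint v y r) => A B h1 h2 a1 a2 a3 a4.
have b1 : (v y - v x) * vol R n <= (e / 8 + e / 4) * vol R n.
  apply: (@le_trans _ _ ((M * r ^+ 2 + e / 4) * vol R n)); first by lra.
  by apply: ler_wpM2r; [exact: ltW|rewrite lerD2r].
have b2 : (v x - v y) * vol R n <= (e / 8 + e / 4) * vol R n.
  apply: (@le_trans _ _ ((M * r ^+ 2 + e / 4) * vol R n)); first by lra.
  by apply: ler_wpM2r; [exact: ltW|rewrite lerD2r].
rewrite !ler_pM2r// in b1 b2.
by rewrite ltr_norml; apply/andP; split; lra.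
Qed.

(** Compare the paraboloids that touch at [x] and at [y]. *)
Lemma obstacle_continuous x : l2norm x < 1 -> {for x, continuous b}.
Proof.
move=> x1; have [_ _ _ hQ] := sol; apply/continuous_l2P => e e0.
have T0 : 0 < 2 * (N + M + 1) by rewrite mulr_gt0// ltr_wpDl// addr_ge0.
exists (Num.min (Num.min 1 (1 - l2norm x)) (e / (2 * (N + M + 1)))).
  by rewrite !lt_min ltr01 subr_gt0 x1/= divr_gt0.
move=> y; rewrite !lt_min => /andP[/andP[d1 dx] de].
have y1 : l2norm y < 1 by have := ler_l2norm_add x y; lra.
rewrite ltr_pdivlMr// in de.
have [p pN /(_ y y1) hp] := hQ x x1; have [q qN /(_ x x1) hq] := hQ y y1.
have := ler_pM (l2norm_ge0 _) (l2norm_ge0 (y - x)) pN (lexx _).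
have := ler_pM (l2norm_ge0 _) (l2norm_ge0 (y - x)) qN (lexx _).
have := cauchy_schwarz q (x - y); have := cauchy_schwarz p (y - x).
rewrite (l2normBC x y) in hq *; rewrite !ler_norml => /andP[_ c1] /andP[_ c2].
have s0 := l2norm_ge0 (y - x).
have : M * l2norm (y - x) ^+ 2 <= M * l2norm (y - x).
  by apply: ler_wpM2l => //; rewrite expr2; apply: ler_piMr => //; exact: ltW.
move: hp hq c1 c2 de d1 s0.
move: (l2norm (y - x)) (dotv p _) (dotv q _) (l2norm p * _) (l2norm q * _) (M * (_ ^+ 2)) => s P Q A B Z.
by move=> *; rewrite ltr_norml; apply/andP; split; nra.
Qed.

Lemma sol_unif (R1 e : R) : R1 < 1 -> 0 < e -> exists k : nat, forall x y,
  l2norm x <= R1 -> l2norm y < 1 -> l2norm (y - x) < k.+1%:R^-1 -> `|v y - v x| < e.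
Proof.
move=> R11 e0.
pose P (k : nat) x := forall y, l2norm y < 1 -> l2norm (y - x) < k.+1%:R^-1 -> `|v y - v x| < e.
have := @compact_near_coveringP _ (ecball (0 : V) R1).
move=> [/(_ (@ecball_compact _ _ _ _)) h _].
have [|k _ hk] := h nat \oo P _.
  move=> x; rewrite /ecball/= subr0 => xR.
  have e2 : 0 < e / 2 by rewrite divr_gt0.
  have /continuous_l2P/(_ _ e2)[d d0 hd] := sol_continuous (le_lt_trans xR R11).
  have [k0 hk0] : exists k0, forall k, (k0 <= k)%N -> k.+1%:R^-1 < d / 2.
    by apply: invS_lt; rewrite divr_gt0.
  exists (eball x (d / 2), [set k | (k0 <= k)%N]).
    split => /=; last by exists k0.
    by apply/nbhs_l2normP; exists (d / 2) => //; rewrite divr_gt0.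
  move=> [x' k] /= [xx' /hk0 k0k] y y1 yx'.
  have h1 := l2norm_dist y x' x.
  have := hd x' _; have := hd y _.
  have -> : l2norm (y - x) < d.
    move: xx' k0k yx' h1; rewrite /eball/=.
    by move: (k.+1%:R^-1) (l2norm (y - x)) (l2norm (y - x')) (l2norm (x' - x)) => t a b' c'; lra.
  have -> : l2norm (x' - x) < d by move: xx'; rewrite /eball/=; lra.
  move=> /(_ isT) + /(_ isT); rewrite !ltr_norml => /andP[? ?] /andP[? ?].
  by apply/andP; split; lra.
exists k => x y xR; apply: (hk k (leqnn _)).
by rewrite /= /ecball/= subr0.
Qed.

Lemma sol_gap x0 (d : R) : l2norm x0 + d < 1 ->
  (forall y, l2norm (y - x0) <= d -> v y < b y) -> exists2 g : R, 0 < g &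
  forall y, l2norm (y - x0) <= d -> v y + g <= b y.
Proof.
move=> xd vb.
pose P (k : nat) x := k.+1%:R^-1 <= b x - v x.
have := @compact_near_coveringP _ (ecball x0 d).
move=> [/(_ (@ecball_compact _ _ _ _)) h _].
have [|k _ hk] := h nat \oo P _.
  move=> x xd'; have x1 := ball_in xd xd'.
  pose e : R := (b x - v x) / 4; have e0 : 0 < e by rewrite divr_gt0// subr_gt0 vb.
  have /continuous_l2P/(_ _ e0)[d1 d10 hd1] := sol_continuous x1.
  have /continuous_l2P/(_ _ e0)[d2 d20 hd2] := obstacle_continuous x1.
  have [k0 hk0] := invS_lt e0.
  exists (eball x (Num.min d1 d2), [set k | (k0 <= k)%N]).
    split => /=; last by exists k0.
    by apply/nbhs_l2normP; exists (Num.min d1 d2) => //; rewrite lt_min d10.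
  move=> [y k] /= [yx /hk0 k0k]; move: yx; rewrite /eball/= lt_min => /andP[/hd1 + /hd2].
  rewrite /P !ltr_norml => /andP[h1 h2] /andP[h3 h4]; move: k0k h1 h2 h3 h4.
  have : b x - v x = 4 * e by rewrite /e; field.
  clearbody e; move: e0; clear hd1 hd2 hk0; move: e.
  by move: (k.+1%:R^-1) (b x) (v x) (b y) (v y) => *; lra.
exists k.+1%:R^-1; first by rewrite invr_gt0 ltr0n.
move=> y yd; have := hk k (leqnn _) y yd; rewrite /P.
by move: (k.+1%:R^-1) => t; lra.
Qed.

(** Enlarging the averaging radius a little keeps the moving average below the
    obstacle, because there is a gap; by maximality it then does not exceed [v].
    The radius [r] is reached in finitely many equal steps, short enough for the
    uniform continuity of [v]. *)
Lemma sol_mean x0 (d r : R) : 0 < d -> l2norm x0 + d < 1 ->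
  (forall y, l2norm (y - x0) <= d -> v y < b y) -> 0 <= r -> r <= c * d ->
  ballint v x0 r = v x0 * vol R n.
Proof.
move=> d0 xd vb r0 rc; have [_ _ hadm] := hc; have [_ vleb vmax _] := sol.
have [g g0 hg] := sol_gap xd vb; have [k hk] := sol_unif xd g0.
have T0 : 0 < k.+1%:R^-1 / (r + 1) by rewrite divr_gt0 ?invr_gt0 ?ltr0n//; lra.
have [m /(_ m (leqnn _)) hm] := invS_lt T0.
have r10 : 0 < r + 1 by lra.
have dlt : m.+1%:R^-1 * r < k.+1%:R^-1.
  rewrite ltr_pdivlMr// in hm; apply: le_lt_trans hm.
  by apply: ler_wpM2l; [rewrite invr_ge0|lra].
pose q (j : nat) := j%:R / m.+1%:R * r.
have q0 j : 0 <= q j by rewrite mulr_ge0// divr_ge0.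
have qr j : (j <= m.+1)%N -> q j <= r.
  by move=> jm; apply: ler_piMl => //; rewrite ler_pdivrMr ?ltr0n// mul1r ler_nat.
have adm j : (j <= m.+1)%N -> admissible (rad x0 d (q j)).
  by move=> jm; apply: (proj1 (hadm _ _ _ _ _ _ _)) => //; exact: le_trans (qr _ jm) rc.
have main j : (j <= m.+1)%N -> forall x, l2norm x < 1 -> move v (rad x0 d (q j)) x = v x.
  elim: j => [_ x x1|j IH jm x x1].
    by apply: move_id => //; rewrite /q !mul0r /rad !mul0r.
  have ad := adm _ jm; apply/eqP; rewrite eq_le (le_move sv ad x1) andbT.
  apply: (vmax _ _ (sh_move sv ad)) => // {x1}x x1.
  have [dx|xd'] := leP d (l2norm (x - x0)).
    by rewrite move_id ?vleb// rad_out.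
  apply: le_trans (hg x (ltW xd')); rewrite /move x1 ler_pdivrMr ?vol_gt0//.
  have := IH (ltnW jm) x x1; rewrite /move x1 => /(canRL (divfK _)) h.
  rewrite mulrDl -h ?gt_eqF ?vol_gt0// -(ballint_cst (n := n) g x (rad x0 d (q j) x)).
  have b1 := bms_moved x (rad x0 d (q j) x) bv.
  rewrite /ballint -(IntD b1 (bms_indZ (n := n) g)).
  apply: (Int_le (bms_moved x _ bv) (bmsD b1 (bms_indZ (n := n) g))) => z.
  rewrite indE; case: ltP => [z1|_]; last by rewrite !mul0r addr0.
  rewrite !mul1r -lerBlDl; apply/ltW/ltr_normlW.
  have inb i : (i <= m.+1)%N -> l2norm (x + rad x0 d (q i) x *: z) <= l2norm x0 + d.
    move=> im.
    have [_ /(_ x xd') h'] := hadm x0 d (q i) d0 xd (q0 i) (le_trans (qr _ im) rc).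
    apply: le_trans h'; apply: le_trans (l2normD _ _) _; rewrite lerD2l l2normZ.
    by rewrite ger0_norm ?rad_ge0//; apply: ler_piMr; [exact: rad_ge0|exact: ltW].
  apply: hk; [exact/inb/ltnW|exact: le_lt_trans (inb _ jm) xd|].
  rewrite opprD addrACA subrr add0r -scalerBl l2normZ.
  apply: le_lt_trans dlt; apply: (@le_trans _ _ `|q j.+1 - q j|).
    apply: le_trans (_ : `|rad x0 d (q j.+1) x - rad x0 d (q j) x| <= _); last exact: rad_diff.
    by apply: ler_piMr => //; exact: ltW.
  rewrite /q -mulrBl -mulrBl -natr1 addrAC subrr add0r mul1r ger0_norm//.
  by rewrite mulr_ge0// invr_ge0.
have x1 : l2norm x0 < 1 by move: d0 xd; lra.
have := main _ (leqnn _) x0 x1; rewrite /move x1 rad_center /q divff ?mul1r ?pnatr_eq0//.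
by move=> /(canRL (divfK _)) ->//; rewrite gt_eqF ?vol_gt0.
Qed.

End obstacle.

(** * The mean value property and smooth kernels *)

Section kernel.
Context {R : realType} {n : nat}.
Local Notation V := 'rV[R]_n.
Implicit Types (f v U : V -> R) (x y z p : V).

Lemma Int_csexp_partial r (a f : V -> R) i : csexp r a -> smooth f ->
  Int (fun y => partial i a y * f y) = - Int (fun y => a y * partial i f y).
Proof.
move=> ca sf; have [K ba] := csexp_bms ca; have [K' ba'] := csexp_bms (csexp_partial i ca).
have sa : smooth a by apply: sexp_smooth; case: ca.
have sfi := smooth_partial i sf.
have K0 : 0 <= K by case: ba => _ /(_ 0) + _; exact: le_trans.
have [B B0 hB] := smooth_bounded_on (K + 1) sf.
have [B' B'0 hB'] := smooth_bounded_on (K + 1) sfi.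
have [B2 B20 hB2] := smooth_bounded_on (K' + 1) sf.
have [L L0 hL] := smooth_lipschitz_on i K sf.
have [L' L'0 hL'] := smooth_lipschitz_on i (K + 1) sa.
have [ma aK as0] := ba; have [ma' aK' as0'] := ba'.
apply: (@Int_by_parts _ _ f a (partial i f) (partial i a) i K B (L + L')
  (K' * (1 + `|B2|)) (K * (1 + `|B'|)) ba (smooth_measurable sf) hB).
- move=> x t t0 t1; apply: (@le_trans _ _ (L' * t)); last by rewrite ler_pM2r// lerDr.
  have [xK|xK] := leP (l2norm x) (K + 1).
    by rewrite -[in leRHS](gtr0_norm t0); apply: hL'; rewrite // gtr0_norm.
  rewrite !as0 ?subrr ?normr0 ?mulr_ge0//; [exact: ltW|lra|].
  have := l2normB (x + t *: delta_mx 0 i) (t *: delta_mx 0 i); rewrite addrK.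
  by rewrite [l2norm (t *: _)]l2normZ l2norm_delta mulr1 gtr0_norm//; lra.
- move=> x t xK t0 t1; apply: (@le_trans _ _ (L * t)); last by rewrite ler_pM2r// lerDl.
  rewrite distrC -scaleNr -[leRHS](_ : L * `|- t| = _); last by rewrite normrN gtr0_norm.
  by apply: hL; rewrite // normrN gtr0_norm.
- apply: bmsM ba' (smooth_measurable sf) _ => x nx; apply: hB2.
  rewrite leNgt; apply/negP => h; move: nx; rewrite as0' ?eqxx//; lra.
- apply: bmsM ba (smooth_measurable sfi) _ => x nx; apply: hB'.
  rewrite leNgt; apply/negP => h; move: nx; rewrite as0 ?eqxx//; lra.
- by apply: aeW => x; have [] := differentiable_quotient i (smooth_differentiable x sa).
- by apply: aeW => x _; have [] := differentiable_quotient i (smooth_differentiable x sf).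
Qed.

(** Since the derivative of [flat 0] is [flat 2], this is the radial kernel
    for which [z * kern z] is a gradient, namely of [- bump 0 1 / 2]. *)
Definition kern z : R := flat 2 (1 - dotv z z).

Lemma csexp_kern : csexp 1 kern.
Proof.
split.
  apply: sexp_flat; apply: sexp_add; first exact: sexp_cst.
  rewrite (_ : (fun x => _) = fun x => -1 * \sum_i x 0 i * x 0 i); last first.
    by apply/funext => x; rewrite mulN1r.
  apply: sexp_mul; first exact: sexp_cst.
  by apply: sexp_sum => i; apply: sexp_mul; exact: sexp_coord.
by move=> x x1; rewrite /kern flat_le0// subr_le0 -l2norm_sqr exprn_ege1// ltW.
Qed.

Lemma partial_dotv i x : partial i (fun y => dotv y y) x = 2 * x 0 i.
Proof.
have [h|_ ->] := @differentiable_quadratic R n (fun y => dotv y y) x (2 *: x) 1 1 ltr01.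
  move=> _; rewrite l2norm_sqr dotvDl !dotvDr dotvZl (dotvC h x) mul1r.
  rewrite (_ : _ - _ - _ = dotv h h) ?ger0_norm -?l2norm_sqr ?sqr_ge0//; ring.
by rewrite mxE.
Qed.

Lemma partial_bump01 i z : partial i (bump 0 1) z = - 2 * (z 0 i * kern z).
Proof.
have s1 : sexp (fun z : V => 1 - dotv z z).
  have -> : (fun z : V => 1 - dotv z z) = fun x => 1 + -1 * \sum_i x 0 i * x 0 i.
    by apply/funext => x; rewrite mulN1r.
  apply: sexp_add; first exact: sexp_cst.
  apply: sexp_mul; first exact: sexp_cst.
  by apply: sexp_sum => j; apply: sexp_mul; exact: sexp_coord.
rewrite (_ : bump 0 1 = fun z => flat 0 (1 - dotv z z)); last first.
  by apply/funext => y; rewrite /bump subr0 expr1n divr1.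
rewrite (partial_flatE _ _ s1) /kern oppr0 mul0r add0r.
suff -> : partial i (fun z : V => 1 - dotv z z) z = - 2 * z 0 i by rewrite mulrA.
have dd : differentiable (fun y : V => dotv y y) z.
  have [h|] := @differentiable_quadratic R n (fun y => dotv y y) z (2 *: z) 1 1 ltr01; last by [].
  move=> _; rewrite l2norm_sqr dotvDl !dotvDr dotvZl (dotvC h z) mul1r.
  rewrite (_ : _ - _ - _ = dotv h h) ?ger0_norm -?l2norm_sqr ?sqr_ge0//; ring.
apply: etrans (_ : partial i (fun y => 1 + -1 * dotv y y) z = _).
  by congr (partial i _ z); apply/funext => y; rewrite mulN1r.
rewrite partialD//; last exact: differentiableZ.
by rewrite partial_cst add0r partialZ// partial_dotv mulrA mulN1r.
Qed.

Lemma Int_kern_gt0 : 0 < Int kern.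
Proof.
have [K bK] := csexp_bms csexp_kern; have [K' bB] := csexp_bms (csexp_bump (n := n) (ltr01 : (0 : R) < 1)).
apply: lt_le_trans (@Int_bump_gt0 R n) _; apply: (Int_le bB bK) => z.
rewrite bumpE subr0 divr1 l2norm_sqr /kern /flat; case: ifPn => // t0.
rewrite expr0 mul1r; apply: ler_peMl; first exact: expR_ge0.
apply: exprn_ege1; rewrite -[leLHS]invr1 lef_pV2 ?posrE//.
by rewrite gerBl -l2norm_sqr sqr_ge0.
Qed.

(** For harmonic [U] the radial derivative of the average against [kern] is an
    integral of the Laplacian. *)
Lemma kern_mean_smooth U x (r : R) : smooth U -> 0 <= r ->
  (forall z (t : R), 0 <= t -> t <= r -> l2norm z <= 1 -> lap U (x + t *: z) = 0) ->
  Int (fun z => kern z * U (x + r *: z)) = U x * Int kern.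
Proof.
move=> sU r0 hl; have [K bK] := csexp_bms csexp_kern; have [_ k1] := csexp_kern.
have cb : csexp 1 (bump 0 1 : V -> R) := csexp_bump ltr01.
pose g t := Int (fun z => kern z * U (x + t *: z)).
pose dg t := Int (fun z => kern z * dirder z U (x + t *: z)).
have dgs (t : R) : is_derive t (1 : R) g (dg t) by exact: is_derive_weighted bK k1 sU.
have bcs (a f : V -> R) : csexp 1 a -> smooth f -> bm (fun z => a z * f z).
  move=> ca sf; have [Ka ba] := csexp_bms ca; have [B _ hB] := smooth_bounded_on 1 sf.
  eexists; apply: bmsM ba (smooth_measurable sf) _ => z.
  have [z1 _|z1] := leP (l2norm z) 1; first exact: hB.
  by case: ca => _ ->; rewrite ?eqxx.
have dg0 t : 0 <= t -> t <= r -> dg t = 0.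
  move=> t0 tr; rewrite /dg.
  have sp i := smooth_partial i sU.
  rewrite (Int_ext (g := fun z => \sum_i kern z * (z 0 i * partial i U (x + t *: z)))); last first.
    by move=> z; rewrite mulr_sumr.
  rewrite bInt_sum; last first.
    move=> i; apply: bcs csexp_kern _; exact: smooth_coord_affine.
  apply: (@etrans _ _ (\sum_i 2^-1 * Int (fun z => bump 0 1 z * (t * partial i (partial i U) (x + t *: z))))).
    apply: eq_bigr => i _; apply: (@mulfI _ (-2)); first by rewrite oppr_eq0.
    rewrite -bIntZ; last by apply: bcs csexp_kern _; exact: smooth_coord_affine.
    rewrite (Int_ext (g := fun z => partial i (bump 0 1) z * partial i U (x + t *: z))); last first.
      by move=> z; rewrite partial_bump01; ring.
    rewrite (Int_csexp_partial i cb (smooth_affine x t (sp i))) mulNr mulrA divff ?mul1r//.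
    congr (- _); apply: Int_ext => z; congr (_ * _).
    by have [_] := @partial_affine _ _ (partial i U) x t i z (smooth_differentiable _ (sp i)).
  rewrite -mulr_sumr -bInt_sum; last first.
    move=> i; apply: bcs cb _; apply: smoothM; first exact: smooth_cst.
    apply: smooth_affine; do 2 apply: smooth_partial; exact: sU.
  rewrite (Int_ext (g := fun=> 0)) ?Int0 ?mulr0// => z.
  have [z1|z1] := leP (l2norm z) 1; last first.
    by rewrite big1// => i _; case: cb => _ -> //; rewrite mul0r.
  rewrite -mulr_sumr -mulr_sumr; have := hl z t t0 tr z1; rewrite /lap => ->.
  by rewrite !mulr0.
have e1 : g 0 <= g r by apply: nondecreasing_from_derivative r0 dgs _ => t t0 tr; rewrite dg0.
have e2 : - g 0 <= - g r.
  apply: (@nondecreasing_from_derivative _ (fun t => - g t) (fun t => - dg t) r r0).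
  by move=> t t0 tr; rewrite dg0// oppr0.
have -> : U x * Int kern = g 0.
  rewrite /g -(IntZ _ bK); apply: Int_ext => z.
  by rewrite scale0r addr0 mulrC.
by apply/eqP; rewrite -/(g r) eq_le e1 andbT -lerN2.
Qed.

Lemma lapN U x : smooth U -> lap (fun y => -1 * U y) x = - lap U x.
Proof.
move=> sU; rewrite /lap -sumrN; apply: eq_bigr => i _.
have sp := smooth_partial i sU.
apply: (etrans (congr1 (fun f => partial i f x) (_ : _ = fun y => -1 * partial i U y))).
  by apply/funext => y; apply: partialZ; exact: smooth_differentiable.
by rewrite partialZ ?mulN1r//; exact: smooth_differentiable.
Qed.

(** Mollifications of a function with the local mean value property are
    harmonic; the kernel identity then passes to the limit. *)
Lemma kern_mean M v x0 (d r1 : R) y (r : R) : bms M v -> 0 < r1 ->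
  (forall x, l2norm (x - x0) < d -> {for x, continuous v}) ->
  (forall x (s : R), l2norm (x - x0) < d -> 0 <= s -> s <= r1 ->
    ballint v x s = v x * vol R n) ->
  0 <= r -> l2norm (y - x0) + r < d ->
  Int (fun z => kern z * v (y + r *: z)) = v y * Int kern.
Proof.
move=> bv r10 cv hv r0 yr; have [mv vM _] := bv.
pose g : R := (d - l2norm (y - x0) - r) / 2.
have g0 : 0 < g by rewrite divr_gt0//; move: yr; lra.
pose s (k : nat) : R := g * k.+1%:R^-1.
have s0 k : 0 < s k by rewrite mulr_gt0// invr_gt0 ltr0n.
have sg k : s k <= g.
  by apply: ler_piMr; [exact: ltW|rewrite invf_le1 ?ltr0n// ler1n].
have scv : - s k @[k --> \oo] --> 0.
  apply/cvg_seqP => e e0; have [|k0 hk] := @invS_lt _ (e / g); first by rewrite divr_gt0.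
  exists k0 => k /hk; rewrite subr0 normrN gtr0_norm// /s ltr_pdivlMr// mulrC.
  by [].
have cb : csexp 1 (bump 0 1 : V -> R) := csexp_bump ltr01.
have [Kb bb] := csexp_bms cb; have [_ b1] := cb.
have [Kk bk] := csexp_bms csexp_kern; have [_ k1] := csexp_kern.
pose W k x := Int (fun z => bump 0 1 z * v (x + (- s k) *: z)).
have WU k x : s k ^+ n * W k x = conv v (bump 0 (s k)) x by rewrite (conv_bump _ bv (s0 k)).
have sn k : 0 < s k ^+ n by rewrite exprn_gt0.
have W1 k x : (s k ^+ n)^-1 * conv v (bump 0 (s k)) x = W k x.
  by rewrite -WU mulKf// gt_eqF.
have sW k : smooth (W k).
  rewrite (_ : W k = fun x => (s k ^+ n)^-1 * conv v (bump 0 (s k)) x).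
    apply: smoothM; first exact: smooth_cst.
    by move=> l q; exact: (conv_smooth bv (csexp_bump (s0 k))).
  by apply/funext => x; rewrite W1.
have near_in k x : l2norm (x - x0) < d - g -> forall z, l2norm z <= 1 ->
    l2norm (x + - s k *: z - x0) < d.
  move=> xd z z1; rewrite addrAC; apply: le_lt_trans (l2normD _ _) _.
  rewrite l2normZ normrN gtr0_norm//; have := sg k.
  have : s k * l2norm z <= s k by apply: ler_piMr => //; exact: ltW.
  by move: xd; lra.
have ballW k x t : l2norm (x - x0) < d - g -> 0 <= t -> t <= r1 ->
    ballint (W k) x t = W k x * vol R n.
  move=> xd t0 tr; have [_ ->] := ballint_superpose x t (- s k) bb bv b1.
  rewrite mulrC -bIntZ; last exact: bm_superpose bb bv.
  apply: Int_ext => z; have [z1|/b1 ->] := leP (l2norm z) 1; last by rewrite !mul0r mulr0.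
  by rewrite hv// ?near_in//; ring.
have lapW k x : l2norm (x - x0) < d - g -> lap (W k) x = 0.
  move=> xd; apply/eqP; rewrite eq_le; apply/andP; split; last first.
    apply: (ballint_lap_ge0 (sW k) r10) => t t0 tr.
    by rewrite ballW// ltW.
  rewrite -oppr_ge0 -lapN//.
  have sN : smooth (fun y => -1 * W k y) by apply: smoothM; [exact: smooth_cst|].
  apply: (ballint_lap_ge0 sN r10) => t t0 tr; rewrite -mulrA -(ballW k x t)// ?(ltW t0, ltW tr)//.
  rewrite /ballint -bIntZ.
    by rewrite le_eqVlt; apply/orP; left; apply/eqP; apply: Int_ext => z; rewrite mulrCA.
  by apply: bm_ind_smooth; exact: smooth_affine.
have KW k : Int (fun z => kern z * W k (y + r *: z)) = W k y * Int kern.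
  apply: kern_mean_smooth => // z t t0 tr z1; apply: lapW.
  rewrite addrAC; apply: le_lt_trans (l2normD _ _) _; rewrite l2normZ ger0_norm//.
  have : t * l2norm z <= r by rewrite -[r]mulr1; apply: ler_pM => //; exact: l2norm_ge0.
  by rewrite /g; move: yr; lra.
pose k0 : R := Int (bump 0 1 : V -> R).
have k00 : 0 < k0 := Int_bump_gt0.
have M0 : 0 <= M := le_trans (normr_ge0 _) (vM 0).
have Kb0 : 0 <= Kb by case: bb => _ /(_ 0) + _; exact: le_trans.
have cvW x : l2norm (x - x0) < d -> W k x @[k --> \oo] --> k0 * v x.
  move=> xd.
  have h z : bump 0 1 z * v (x + - s k *: z) @[k --> \oo] --> bump 0 1 z * v x.
    by apply: cvgMr; apply: continuous_shift => //; exact: cv.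
  have bF k : bms (Kb * (1 + `|M|)) (fun z => bump 0 1 z * v (x + - s k *: z)).
    apply: bmsM bb _ (fun z _ => vM _).
    by apply: (measurableT_comp mv); exact: (measurable_affine_map x (- s k)).
  have [_] := Int_cvg_all bF h.
  rewrite (Int_ext (f := fun z => bump 0 1 z * v x) (g := fun z => v x * bump 0 1 z)); last first.
    by move=> z; rewrite mulrC.
  by rewrite (IntZ _ bb) mulrC.
have WB k x : `|W k x| <= M * k0.
  rewrite /W -(IntZ _ bb).
  have [K1 bs] := bm_superpose x (- s k) bb bv.
  apply: le_trans (Int_norm bs) _; apply: Int_le (bms_norm bs) (bmsZ M bb) _ => z.
  by rewrite normrM ger0_norm ?bump_ge0// mulrC ler_wpM2r ?bump_ge0.
have c1 : Int (fun z => kern z * W k (y + r *: z)) @[k --> \oo] -->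
    Int (fun z => kern z * (k0 * v (y + r *: z))).
  have bF k : bms (Kk * (1 + `|M * k0|)) (fun z => kern z * W k (y + r *: z)).
    apply: bmsM bk _ (fun z _ => WB k _).
    by apply: smooth_measurable; exact: smooth_affine.
  have [|_] := Int_cvg_all bF (f := fun z => kern z * (k0 * v (y + r *: z))); last by [].
  move=> z; have [z1|/k1 ->] := leP (l2norm z) 1; last first.
    by under eq_fun do rewrite mul0r; rewrite mul0r; exact: cvg_cst.
  apply: cvgMr; apply: cvW; rewrite addrAC; apply: le_lt_trans (l2normD _ _) _.
  apply: le_lt_trans yr; rewrite lerD2l l2normZ ger0_norm//; exact: ler_piMr.
have c2 : W k y * Int kern @[k --> \oo] --> k0 * v y * Int kern.
  by apply: cvgMl; apply: cvW; move: yr r0; lra.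
have : Int (fun z => kern z * (k0 * v (y + r *: z))) = k0 * v y * Int kern.
  apply: (@cvg_unique _ _ _ _ _ _ c1); first exact: Rhausdorff.
  by rewrite /= (funext KW).
rewrite (Int_ext (g := fun z => k0 * (kern z * v (y + r *: z)))); last first.
  by move=> z; rewrite mulrCA.
rewrite bIntZ; last exact: bm_superpose bk bv.
by rewrite -mulrA => /(mulfI (lt0r_neq0 k00)).
Qed.

End kernel.

(** * Quadratic expansion of the solution *)

Section kernel_expansion.
Context {R : realType} {n : nat}.
Local Notation V := 'rV[R]_n.
Implicit Types (f v : V -> R) (x y z p q u : V).

Let ind3 u : R := ind (3^-1 *: u).

Let bms_ind3 : exists K, bms K ind3.
Proof.
have n3 : (3^-1 : R) != 0 by [].
have bi := bms_affine 0 n3 (@bms_ind R n); eexists.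
suff -> : ind3 = fun u => ind (0 + 3^-1 *: u) by exact: bi.
by apply/funext => u; rewrite add0r.
Qed.

Let ind3E u : l2norm u <= 2 -> ind3 u = 1.
Proof. by move=> u2; rewrite /ind3 indE l2normZ gtr0_norm// (_ : _ < 1)//; lra. Qed.

Let Int_bound (F : V -> R) (E : R) : bm F -> (forall u, `|F u| <= E * ind3 u) ->
  `|Int F| <= E * Int ind3.
Proof.
move=> [K bF] h; have [K3 b3] := bms_ind3.
by apply: le_trans (Int_norm bF) _; rewrite -(IntZ E b3); apply: Int_le (bms_norm bF) (bmsZ E b3) h.
Qed.

(** Differences of a reproduced function fall on the kernel, whose Taylor
    expansion is then integrated against the function. *)
Lemma kern_expansion : exists2 C : R, 0 <= C &
  forall K f x (r A : R), bms K f -> 0 < r ->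
  (forall z, l2norm z <= 1 ->
    Int (fun u => kern u * f (x + r *: z + r *: u)) = f (x + r *: z) * Int (kern : V -> R)) ->
  (forall u, l2norm u <= 2 -> `|f (x + r *: u)| <= A) ->
  exists2 q, l2norm q <= C * A &
    forall z, l2norm z <= 1 ->
      `|f (x + r *: z) - f x - dotv q z| <= C * A * l2norm z ^+ 2.
Proof.
have ck := @csexp_kern R n; have [B B0 hB] := csexp_taylor ck.
have [Kk bk] := csexp_bms ck; have [sk k1] := ck.
have /choice[Kp hKp] (i : 'I_n) : exists K : R, 0 <= K /\ forall u, `|partial i kern u| <= K.
  by have [K K0 h] := csexp_bounded (csexp_partial i ck); exists K.
pose S : R := \sum_i Kp i; have S0 : 0 <= S by apply: sumr_ge0 => i _; case: (hKp i).
have KS i u : `|partial i kern u| <= S.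
  apply: le_trans (proj2 (hKp i) u) _; rewrite /S (bigD1 i)//= lerDl.
  by apply: sumr_ge0 => j _; case: (hKp j).
have kp i u : 1 < l2norm u -> partial i kern u = 0 by case: (csexp_partial i ck) => _; apply.
pose k0 : R := Int (kern : V -> R); have k00 : 0 < k0 := Int_kern_gt0.
pose I3 := Int ind3; have I30 : 0 <= I3 by apply: Int_ge0 => u; exact: ind_ge0.
pose C := k0^-1 * (B + n%:R * S) * I3.
have ki0 : 0 <= k0^-1 by rewrite invr_ge0 ltW.
have nS : 0 <= n%:R * S by rewrite mulr_ge0.
exists C => [|K f x r A bf r0 hrep hA]; first by rewrite !mulr_ge0// addr_ge0.
have A0 : 0 <= A by apply: le_trans (hA 0 _); rewrite ?l2norm0.
pose h u := f (x + r *: u).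
have [mf fK _] := bf.
have mh : measurable_fun setT h by exact: (measurableT_comp mf (measurable_affine_map x r)).
have hrep' z : l2norm z <= 1 -> bm (fun u => kern (u - z) * h u) /\
    h z * k0 = Int (fun u => kern (u - z) * h u).
  move=> z1; have n1 : (1 : R) != 0 by [].
  have bF : bms (Kk * (1 + `|K|)) (fun u => kern u * h (z + u)).
    apply: bmsM bk _ (fun u _ => fK _); apply: (measurableT_comp mh).
    apply: measurable_fun_coordP => i; rewrite (_ : (fun _ => _) = fun u : V => z 0 i + u 0 i).
      by apply: measurable_funD => //; exact: measurable_coord.
    by apply/funext => u; rewrite mxE.
  have bG := bms_affine (- z) n1 bF.
  have E : (fun u => kern (- z + 1 *: u) * h (z + (- z + 1 *: u))) =
      fun u => kern (u - z) * h u.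
    by apply/funext => u; rewrite scale1r addNKr addrC.
  rewrite -E; split; first by eexists; exact: bG.
  have := Int_affine (- z) n1 bF; rewrite normr1 expr1n mul1r => <-.
  rewrite /h -hrep//; apply: Int_ext => u.
  by rewrite scalerDr addrA.
have bmp i : bm (fun u => partial i kern u * h u).
  have [Ki bi] := csexp_bms (csexp_partial i ck).
  by eexists; apply: bmsM bi mh (fun u _ => fK _).
pose q : V := \row_i (- k0^-1 * Int (fun u => partial i kern u * h u)).
have hu u : l2norm u <= 1 -> `|h u| <= A by move=> u1; apply: hA; lra.
have qi i : `|q 0 i| <= k0^-1 * (S * A) * I3.
  rewrite mxE normrM normrN (ger0_norm ki0) -(mulrA k0^-1); apply: ler_wpM2l => //.
  apply: Int_bound => // u; have [u1|/kp ->] := leP (l2norm u) 1; last first.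
    by rewrite mul0r normr0 !mulr_ge0// ind_ge0.
  rewrite ind3E ?mulr1; last by lra.
  by rewrite normrM; apply: ler_pM => //; exact: hu.
exists q.
  apply: le_trans (l2norm_le_coord _ qi) _; first by rewrite !mulr_ge0.
  have -> : n%:R * (k0^-1 * (S * A) * I3) = (k0^-1 * (n%:R * S) * I3) * A by ring.
  apply: ler_wpM2r => //; apply: ler_wpM2r => //; apply: ler_wpM2l => //.
  by rewrite lerDr.
move=> z z1.
have z01 : l2norm (0 : V) <= 1 by rewrite l2norm0.
have [b1 E1] := hrep' z z1; have [b2 E2] := hrep' 0 z01.
pose G u := (kern (u + - z) - kern u - \sum_i (- z) 0 i * partial i kern u) * h u.
have bS : bm (fun u => \sum_i (- z) 0 i * (partial i kern u * h u)).
  by apply: bm_sum => i; exact: bmZ.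
have b2' : bm (fun u => kern u * h u) by apply: bm_ext b2 => u; rewrite subr0.
have GE u : G u = kern (u - z) * h u - kern u * h u - \sum_i (- z) 0 i * (partial i kern u * h u).
  rewrite /G !mulrBl; congr (_ - _); rewrite mulr_suml; apply: eq_bigr => i _.
  by rewrite mulrA.
have bG : bm G by apply: bm_ext (bmB (bmB b1 b2') bS) => u; rewrite GE.
have IG : Int G = k0 * (h z - h 0 - dotv q z).
  rewrite (Int_ext GE) (bIntB (bmB b1 b2') bS) (bIntB b1 b2') -E1.
  have -> : Int (fun u => kern u * h u) = h 0 * k0.
    by rewrite E2; apply: Int_ext => u; rewrite subr0.
  rewrite bInt_sum; last by move=> i; exact: bmZ.
  have -> : \sum_i Int (fun u => (- z) 0 i * (partial i kern u * h u)) = k0 * dotv q z.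
    rewrite /dotv mulr_sumr; apply: eq_bigr => i _; rewrite bIntZ// !mxE.
    by rewrite mulrA mulrA mulrN divff ?gt_eqF//; ring.
  by ring.
have -> : f (x + r *: z) - f x - dotv q z = k0^-1 * Int G.
  by rewrite IG mulKf ?gt_eqF// /h scaler0 addr0.
rewrite normrM ger0_norm//.
apply: (@le_trans _ _ (k0^-1 * (B * l2norm z ^+ 2 * A * I3))); last first.
  have -> : k0^-1 * (B * l2norm z ^+ 2 * A * I3) = (k0^-1 * B * I3) * (A * l2norm z ^+ 2) by ring.
  rewrite /C -[leRHS]mulrA; apply: ler_wpM2r; first by rewrite mulr_ge0// sqr_ge0.
  by apply: ler_wpM2r => //; apply: ler_wpM2l => //; rewrite lerDl.
apply: ler_wpM2l => //; apply: Int_bound => // u.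
have [u2|u2] := leP (l2norm u) 2.
  rewrite ind3E// mulr1 /G normrM; apply: ler_pM => //; last exact: hA.
  by have := hB u (- z); rewrite l2normN.
have h1 : 1 < l2norm u by apply: lt_trans u2; rewrite ltr1n.
have h2 : 1 < l2norm (u - z).
  move: (ler_l2norm_add z u) u2 z1; move: (l2norm u) (l2norm z) (l2norm (u - z)).
  by clear=> *; lra.
rewrite GE !k1// !mul0r subrr big1 ?subr0 ?normr0.
  have i0 : 0 <= ind3 u by exact: ind_ge0.
  by rewrite !mulr_ge0 ?l2norm_ge0.
by move=> i _; rewrite kp// mul0r mulr0.
Qed.

Lemma Int_kern_dotv p : bm (fun z => kern z * dotv p z) /\
  Int (fun z => kern z * dotv p z) = 0.
Proof.
have [Kk bk] := csexp_bms (@csexp_kern R n); have [_ k1] := @csexp_kern R n.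
have bK : bms (Kk * (1 + `|l2norm p|)) (fun z => kern z * dotv p z).
  apply: bmsM bk _ _ => [|z].
    by apply: continuous_measurable_rV; exact: dotv_continuous.
  have [z1 _|/k1 ->] := leP (l2norm z) 1; last by rewrite eqxx.
  by apply: le_trans (cauchy_schwarz _ _) _; apply: ler_piMr; [exact: l2norm_ge0|].
split; first by eexists; exact: bK.
have n1 : (-1 : R) != 0 by rewrite oppr_eq0 oner_neq0.
have := Int_affine 0 n1 bK; rewrite normrN1 expr1n mul1r.
rewrite (Int_ext (f := fun z => kern (0 + -1 *: z) * _) (g := fun z => -1 * (kern z * dotv p z))); last first.
  by move=> z; rewrite add0r dotvZr scaleN1r /kern dotvNl dotvC dotvNl opprK; ring.
by rewrite (IntZ _ bK); lra.
Qed.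

End kernel_expansion.

Section solution_expansion.
Context {R : realType} {n : nat}.
Local Notation V := 'rV[R]_n.
Implicit Types (f g v b : V -> R) (x y z p q : V).

(** The first term comes from comparing averages near a contact point, the second
    from the trivial bound [3 N] at distances beyond [c / 8], as
    [192 = 3 * 8 ^ 2]. *)
Definition contact_const (N M c : R) : R := (2 ^+ n * 4 + 1) * M + 192 * N / c ^+ 2.

(** The second summand serves points at distance more than [1 / 8] from the contact
    set, where the affine function is [0] and [N = 16 * N * (2 / 8) ^ 2]. *)
Definition affine_const (N M c : R) : R := contact_const N M c + 16 * N.

Lemma contact_const_ge (N M c : R) : 0 <= M -> 0 <= N -> 0 < c ->
  0 <= 192 * N / c ^+ 2 /\ M <= (2 ^+ n * 4 + 1) * M.
Proof.
move=> M0 N0 c0; split; first by rewrite divr_ge0 ?sqr_ge0 ?mulr_ge0.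
by apply: ler_peMl => //; rewrite lerDr mulr_ge0// exprn_ge0.
Qed.

Section fixed_solution.
Variables (N M c : R) (b v : V -> R).
Hypotheses (M0 : 0 <= M) (sol : obstacle_sol N M b v) (hc : @radius_const R n c).

Let sv : sh N v. Proof. by case: sol. Qed.
Let bv := sh_bms sv.
Let N0 : 0 <= N. Proof. exact: sh_ge0 sv. Qed.
Let vN x : `|v x| <= N. Proof. by case: sv. Qed.
Let c0 : 0 < c. Proof. by case: hc. Qed.

(** The difference to an affine function, cut off outside the unit ball so that
    it stays integrable. *)
Let aff (s a : R) p x0 y : R := ind y * (s * (a + dotv p (y - x0) - v y)).

Let bms_aff s a p x0 : exists K, bms K (aff s a p x0).
Proof.
eexists; apply: bmsM (bms_ind) _ (_ : forall y, _ -> _ <= `|s| * (`|a| + l2norm p * (1 + l2norm x0) + N)).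
  have [mv _ _] := bv; apply: measurable_funM => //; apply: measurable_funB => //.
  apply: measurable_funD => //.
  rewrite (_ : (fun y => _) = dotv p \o affine_map (- x0) 1); last first.
    by apply/funext => y; rewrite /= /affine_map scale1r addrC.
  apply: measurableT_comp; last exact: measurable_affine_map.
  by apply: continuous_measurable_rV; exact: dotv_continuous.
move=> y; rewrite indE; case: ltP => [y1 _|_]; last by rewrite eqxx.
rewrite normrM; apply: ler_wpM2l => //; apply: le_trans (ler_normB _ _) _.
apply: lerD => //; apply: le_trans (ler_normD _ _) _; rewrite lerD2l.
apply: le_trans (cauchy_schwarz _ _) _; apply: ler_wpM2l; first exact: l2norm_ge0.
by apply: le_trans (l2normB _ _) _; rewrite lerD2r ltW.
Qed.

Let affE s a p x0 y : l2norm y < 1 -> aff s a p x0 y = s * (a + dotv p (y - x0) - v y).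
Proof. by move=> y1; rewrite /aff indE y1 mul1r. Qed.

Let in1 x (r : R) z : 0 <= r -> l2norm x + r < 1 -> l2norm z <= 1 -> l2norm (x + r *: z) < 1.
Proof.
move=> r0 xr z1; apply: le_lt_trans (l2normD _ _) _; rewrite l2normZ ger0_norm//.
by apply: le_lt_trans xr; rewrite lerD2l; apply: ler_piMr.
Qed.

Let ballint_aff a p x0 x (r : R) : 0 <= r -> l2norm x + r < 1 ->
  ballint (aff 1 a p x0) x r = (a + dotv p (x - x0)) * vol R n - ballint v x r.
Proof.
move=> r0 xr; have [ba <-] := ballint_affine a p x0 x r.
have bV : bm (fun z => ind z * v (x + r *: z)) by eexists; exact: bms_moved bv.
rewrite /ballint -(bIntB ba bV); apply: Int_ext => z; rewrite [ind z]indE.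
case: ltP => [z1|_]; last by rewrite !mul0r subrr.
by rewrite affE ?mul1r//; apply: in1 => //; exact: ltW.
Qed.

(** At a contact point the touching paraboloid bounds [v] from above; the
    deviation below it is controlled at the scale of the distance by comparing
    averages over two nested balls. *)
Lemma contact_expansion x0 : l2norm x0 <= 3 / 8 -> v x0 = b x0 ->
  exists2 p, l2norm p <= N & forall x, l2norm x <= 1 / 2 ->
    `|v x - v x0 - dotv p (x - x0)| <= contact_const N M c * l2norm (x - x0) ^+ 2.
Proof.
move=> x038 vb0; have [_ vb _ hQ] := sol; have [C1 C2] := (contact_const_ge M0 N0 c0).
have c1 : c <= 1 by case: hc.
have x01 : l2norm x0 < 1 by lra.
have [p pN hp] := hQ x0 x01; exists p => // x x12.
have x1 : l2norm x < 1 by lra.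
have s_ge0 := l2norm_ge0 (x - x0); set s := l2norm (x - x0) in s_ge0 *.
have up y : l2norm y < 1 -> v y <= v x0 + dotv p (y - x0) + M * l2norm (y - x0) ^+ 2.
  by move=> y1; apply: le_trans (vb y y1) _; rewrite vb0; exact: hp.
have upx := up x x1; rewrite -/s in upx.
have s2 : 0 <= s ^+ 2 by exact: sqr_ge0.
have Cs : contact_const N M c * s ^+ 2 = (2 ^+ n * 4 + 1) * M * s ^+ 2 + 192 * N / c ^+ 2 * s ^+ 2.
  by rewrite /contact_const mulrDl.
have Cs1 : 0 <= 192 * N / c ^+ 2 * s ^+ 2 by exact: mulr_ge0.
have Cs2 : M * s ^+ 2 <= (2 ^+ n * 4 + 1) * M * s ^+ 2 by exact: ler_wpM2r.
(* Balls of radius comparable to [s] are averaged below, which requires [s] small. *)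
have [s8|s8] := ltP (c / 8) s.
  apply: (@le_trans _ _ (3 * N)).
    have s1 : s <= 1.
      have := l2normB x x0; rewrite -/s; move: x12 x038; move: (l2norm x) (l2norm x0) => *; lra.
    apply: le_trans (ler_normB _ _) _.
    have h1 : `|dotv p (x - x0)| <= N * 1.
      by apply: le_trans (cauchy_schwarz _ _) _; apply: ler_pM => //; exact: l2norm_ge0.
    have h2 : `|v x - v x0| <= N + N by apply: le_trans (ler_normB _ _) _; apply: lerD.
    by move: h1 h2; lra.
  have h1 : 3 * N <= 192 * N / c ^+ 2 * s ^+ 2.
    have -> : 192 * N / c ^+ 2 * s ^+ 2 = 3 * N * (8 * s / c) ^+ 2.
      by rewrite !exprMn exprVn; ring.
    apply: ler_peMr; first exact: mulr_ge0.
    by apply: exprn_ege1; rewrite ler_pdivlMr// mul1r; lra.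
  rewrite Cs; apply: (le_trans h1); rewrite lerDr.
  by apply: le_trans Cs2; exact: mulr_ge0.
have [/eqP s00|s00] := boolP (s == 0).
  have -> : x = x0.
    by apply/eqP; rewrite -subr_eq0; apply/eqP; apply: l2norm_eq0.
  rewrite !subrr dotvC dotv0l subr0 normr0 mulr_ge0//.
  by rewrite /contact_const addr_ge0// (le_trans M0).
have s0 : 0 < s by rewrite lt_neqAle eq_sym s00.
(* The affine function [a + p . (y - x0)] exceeds [v] on the ball of radius [2 s]. *)
pose a := 4 * M * s ^+ 2 + v x0.
have [K bw] := bms_aff 1 a p x0; set w := aff 1 a p x0 in bw.
have sc : s <= c * 4^-1 by lra.
have s18 : s <= 1 / 8 by lra.
have A1 : ballint v x s <= (v x + M * s ^+ 2) * vol R n.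
  by apply: (sol_avg M0 sol hc (d := 4^-1)) => //; lra.
have A2 : v x0 * vol R n <= ballint v x0 (2 * s).
  by apply: (sol_submean sol); [rewrite mulr_ge0|lra].
have W1 : ballint w x s = (a + dotv p (x - x0)) * vol R n - ballint v x s.
  by apply: ballint_aff => //; lra.
have W2 : ballint w x0 (2 * s) = a * vol R n - ballint v x0 (2 * s).
  rewrite (ballint_aff a p x0) ?mulr_ge0//; last by lra.
  by rewrite subrr dotvC dotv0l addr0.
have W3 : s ^+ n * ballint w x s <= (2 * s) ^+ n * ballint w x0 (2 * s).
  apply: (ballint_center_le bw) => //; first by rewrite mulr_gt0.
    by rewrite -/s; lra.
  move=> y ys; have y1 : l2norm y < 1.
    by have := ler_l2norm_add x0 y; move: ys; lra.
  rewrite /w affE// mul1r subr_ge0; apply: le_trans (up y y1) _.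
  have h : M * l2norm (y - x0) ^+ 2 <= 4 * M * s ^+ 2.
    have -> : 4 * M * s ^+ 2 = M * (2 * s) ^+ 2 by ring.
    by apply: ler_wpM2l => //; rewrite ler_pXn2r// ?nnegrE ?mulr_ge0 ?l2norm_ge0.
  rewrite /a; move: h; move: (M * _) (4 * M * _) (v x0) (dotv p _).
  by move=> *; lra.
have sn : 0 < s ^+ n by rewrite exprn_gt0.
rewrite exprMn mulrAC (mulrC _ (s ^+ n)) ler_pM2l// in W3.
have vp : 0 < vol R n := vol_gt0.
have W4 : ballint w x0 (2 * s) <= 4 * M * s ^+ 2 * vol R n.
  by rewrite W2 /a; move: A2; rewrite mulrDl; lra.
have W5 : ballint w x s <= 2 ^+ n * (4 * M * s ^+ 2 * vol R n).
  apply: (le_trans W3).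
  by apply: ler_wpM2l => //; exact: exprn_ge0.
have low : v x0 + dotv p (x - x0) - v x <= (2 ^+ n * 4 + 1) * M * s ^+ 2.
  rewrite -(ler_pM2r vp).
  have Ms : 0 <= 4 * M * s ^+ 2 * vol R n by rewrite !mulr_ge0// ltW.
  move: W5 A1 Ms; rewrite W1 /a.
  move: (ballint v x s) (dotv p _) (2 ^+ n) (v x) (v x0) (vol R n) vp => B P T X Y Z Z0 h1 h2 h3.
  by nra.
rewrite Cs ler_norml; apply/andP; split.
  by move: low Cs1; move: (dotv p _) (v x) (v x0) => *; lra.
by move: upx Cs1 Cs2; move: (dotv p _) (v x) (v x0) => *; lra.
Qed.

(** At a point [x] where [v] has the mean value property at scale [D] and is
    affine up to an error quadratic in the distance plus [D], rescaling the
    kernel identity to size [D] gives the expansion. *)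
Lemma scaled_expansion Ck x (D a : R) p0 : 0 <= Ck ->
  (forall K f x (r A : R), bms K f -> 0 < r ->
    (forall z, l2norm z <= 1 ->
      Int (fun u => kern u * f (x + r *: z + r *: u)) = f (x + r *: z) * Int (kern : V -> R)) ->
    (forall u, l2norm u <= 2 -> `|f (x + r *: u)| <= A) ->
    exists2 q, l2norm q <= Ck * A &
      forall z, l2norm z <= 1 ->
        `|f (x + r *: z) - f x - dotv q z| <= Ck * A * l2norm z ^+ 2) ->
  l2norm x < 1 / 8 -> 0 < D -> D <= 1 / 8 -> l2norm p0 <= N ->
  (forall y, l2norm (y - x) <= D -> v y < b y) ->
  (forall y, l2norm y <= 1 / 2 ->
    `|v y - a - dotv p0 (y - x)| <= affine_const N M c * (l2norm (y - x) + 2 * D) ^+ 2) ->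
  exists2 p, l2norm p <= N + 48 * Ck * affine_const N M c &
    forall y, l2norm y <= 1 / 2 ->
      `|v y - v x - dotv p (y - x)| <=
      (768 * Ck + 545) * affine_const N M c * l2norm (y - x) ^+ 2.
Proof.
move=> Ck0 hk x18 D0 D18 p0N hvb hE; have [C1 C2] := (contact_const_ge M0 N0 c0).
have c1 : c <= 1 by case: hc.
set K5 := affine_const N M c in hE *.
have K50 : 0 <= K5.
  by rewrite /K5 /affine_const /contact_const !addr_ge0 ?(le_trans M0 C2)// mulr_ge0.
pose r : R := D / 8; have r0 : 0 < r by rewrite divr_gt0.
have rD : D = 8 * r by rewrite /r; field.
clearbody r.
have [K bf] := bms_aff (-1) a p0 x; set f := aff (-1) a p0 x in bf.
have fE y : l2norm y < 1 -> f y = v y - a - dotv p0 (y - x).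
  by move=> y1; rewrite /f affE//; ring.
have inb (t : R) u : 0 <= t -> t <= 1 / 4 -> l2norm u <= t -> l2norm (x + u) <= 1 / 2.
  by move=> t0 t1 ut; apply: le_trans (l2normD _ _) _; lra.
have rep z : l2norm z <= 1 ->
    Int (fun u => kern u * f (x + r *: z + r *: u)) = f (x + r *: z) * Int (kern : V -> R).
  move=> z1; pose y : V := x + r *: z; rewrite -/y.
  have rz : l2norm (r *: z) <= r by rewrite l2normZ gtr0_norm//; apply: ler_piMr => //; exact: ltW.
  have yx : l2norm (y - x) <= r by rewrite /y addrAC subrr add0r.
  have y1 : l2norm y <= 1 / 8 + r by apply: le_trans (l2normD _ _) _; lra.
  have hm : Int (fun u => kern u * v (y + r *: u)) = v y * Int (kern : V -> R).
    apply: (@kern_mean _ _ _ _ x (D / 2) (c * (D / 2)) y r bv) => //.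
    - by rewrite mulr_gt0// divr_gt0.
    - move=> x' x'D; apply: (sol_continuous M0 sol hc).
      by have := ler_l2norm_add x x'; lra.
    - move=> x' t x'D t0 tc; apply: (sol_mean M0 sol hc (d := D / 2)) => //.
      + by rewrite divr_gt0.
      + by have := ler_l2norm_add x x'; lra.
      + by move=> y' y'x; apply: hvb; have := l2norm_dist y' x' x; lra.
    - exact: ltW.
    - by lra.
  have [Kk bk] := csexp_bms (@csexp_kern R n); have [_ k1] := @csexp_kern R n.
  have bkv := bm_superpose y r bk bv.
  have [bkd Ikd] := Int_kern_dotv p0.
  have bc := bmZ (a + dotv p0 (y - x)) (ex_intro _ Kk bk : bm (kern : V -> R)).
  rewrite (Int_ext (g := fun u => kern u * v (y + r *: u) - (a + dotv p0 (y - x)) * kern u - r * (kern u * dotv p0 u))); last first.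
    move=> u; have [u1|/k1 ->] := leP (l2norm u) 1; last by rewrite !(mul0r, mulr0) !subr0.
    rewrite fE; last first.
      apply: le_lt_trans (l2normD _ _) _; rewrite l2normZ gtr0_norm//.
      have : r * l2norm u <= r by apply: ler_piMr => //; exact: ltW.
      by lra.
    by rewrite (addrAC y) (dotvDr p0 (y - x)) dotvZr; ring.
  rewrite (bIntB (bmB bkv bc) (bmZ r bkd)) (bIntB bkv bc) hm (IntZ _ bk) (bIntZ _ bkd) Ikd.
  by rewrite fE; [ring|lra].
have hA u : l2norm u <= 2 -> `|f (x + r *: u)| <= K5 * (6 * D ^+ 2).
  move=> u2; have ru : l2norm (r *: u) <= 2 * r.
    by rewrite l2normZ gtr0_norm// mulrC; apply: ler_wpM2r => //; exact: ltW.
  have xu : l2norm (x + r *: u) <= 1 / 2 by apply: inb ru; lra.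
  rewrite fE; last by lra.
  apply: le_trans (hE _ xu) _; rewrite addrAC subrr add0r; apply: ler_wpM2l => //.
  have := l2norm_ge0 (r *: u); move: ru; rewrite rD; move: (l2norm (r *: u)) => t t1 t0.
  apply: (@le_trans _ _ ((18 * r) ^+ 2)); first by rewrite ler_pXn2r// ?nnegrE; lra.
  by have := sqr_ge0 r; lra.
have [q qC hq] := hk K f x r _ bf r0 rep hA.
pose A := K5 * (6 * D ^+ 2); rewrite -/A in qC hq.
have E1 : Ck * A = 384 * Ck * K5 * r ^+ 2 by rewrite /A rD; ring.
have qr : l2norm (r^-1 *: q) <= 384 * Ck * K5 * r.
  rewrite l2normZ gtr0_norm ?invr_gt0// mulrC ler_pdivrMr//.
  by apply: (le_trans qC); rewrite E1 expr2 mulrA.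
have CK : 0 <= Ck * K5 by exact: mulr_ge0.
exists (p0 + r^-1 *: q).
  apply: le_trans (l2normD _ _) _; apply: lerD => //; apply: (le_trans qr).
  by have : Ck * K5 * r <= Ck * K5 * (1 / 8) by [apply: ler_wpM2l => //; lra]; lra.
move=> y y12; have y1 : l2norm y < 1 by lra.
have x12 : l2norm x <= 1 / 2 by lra.
set t := l2norm (y - x); have t0 : 0 <= t := l2norm_ge0 _.
have ee : v y - v x - dotv (p0 + r^-1 *: q) (y - x) = f y - f x - dotv q (r^-1 *: (y - x)).
  rewrite !fE//; last by lra.
  by rewrite subrr dotvDl !dotvZl !dotvZr (dotvC p0 0) dotv0l; ring.
have [tr|tr] := leP t r.
  have z1 : l2norm (r^-1 *: (y - x)) <= 1.
    by rewrite l2normZ gtr0_norm ?invr_gt0// mulrC ler_pdivrMr// mul1r.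
  have := hq _ z1; rewrite scalerA divff ?gt_eqF// scale1r subrKC -ee.
  move=> h; apply: (le_trans h).
  rewrite E1 l2normZ gtr0_norm ?invr_gt0// -/t exprMn exprVn.
  have -> : 384 * Ck * K5 * r ^+ 2 * ((r ^+ 2)^-1 * t ^+ 2) = 384 * (Ck * K5) * t ^+ 2.
    by field; rewrite gt_eqF.
  apply: ler_wpM2r; first exact: sqr_ge0.
  by have -> : (768 * Ck + 545) * K5 = 768 * (Ck * K5) + 545 * K5 by [ring]; lra.
rewrite ee; apply: le_trans (ler_normB _ _) _.
have b1 : `|f y| <= K5 * (289 * t ^+ 2).
  rewrite fE//; apply: le_trans (hE y y12) _; rewrite -/t; apply: ler_wpM2l => //.
  have -> : 289 * t ^+ 2 = (17 * t) ^+ 2 by ring.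
  by rewrite ler_pXn2r// ?nnegrE; move: tr D0 rD t0; lra.
have b2 : `|f x| <= K5 * (256 * t ^+ 2).
  have x1 : l2norm x < 1 by lra.
  rewrite fE//; apply: le_trans (hE x x12) _; rewrite subrr l2norm0; apply: ler_wpM2l => //.
  have -> : 256 * t ^+ 2 = (16 * t) ^+ 2 by ring.
  by rewrite ler_pXn2r// ?nnegrE; move: tr D0 rD t0; lra.
have b3 : `|dotv q (r^-1 *: (y - x))| <= 384 * (Ck * K5) * t ^+ 2.
  rewrite dotvZr -dotvZl; apply: le_trans (cauchy_schwarz _ _) _; rewrite -/t.
  have -> : 384 * (Ck * K5) * t ^+ 2 = 384 * Ck * K5 * t * t by ring.
  apply: ler_wpM2r => //; apply: (le_trans qr).
  have : Ck * K5 * r <= Ck * K5 * t by apply: ler_wpM2l => //; exact: ltW.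
  by lra.
have b4 : `|f y - f x| <= `|f y| + `|f x| := ler_normB _ _.
have -> : (768 * Ck + 545) * K5 * t ^+ 2 = 768 * (Ck * K5) * t ^+ 2 + K5 * (289 * t ^+ 2) + K5 * (256 * t ^+ 2).
  by ring.
have : 0 <= (Ck * K5) * t ^+ 2 by rewrite mulr_ge0// sqr_ge0.
move: b1 b2 b3 b4; move: (Ck * K5) => CK5.
move: `|f y - f x| `|f y| `|f x| `|dotv _ _| => F1 F2 F3 F4; move: (t ^+ 2) => T.
by lra.
Qed.

End fixed_solution.

(** At a point off the contact set, take the first dyadic ball that meets the contact set: [v] is
    reproduced by averages on the half-size ball, and the expansion at the
    contact point bounds its distance to an affine function there. *)
Theorem sol_expansion (N M : R) : 0 <= N -> 0 <= M -> exists2 C : R, 0 <= C &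
  forall b v, obstacle_sol N M b v -> forall x, l2norm x < 1 / 8 ->
    exists2 p, l2norm p <= C & forall y, l2norm y <= 1 / 2 ->
      `|v y - v x - dotv p (y - x)| <= C * l2norm (y - x) ^+ 2.
Proof.
move=> N0 M0; have [c hc] := @admissible_rad R n.
have [Ck Ck0 hk] := @kern_expansion R n.
have c0 : 0 < c by case: hc.
have [C1 C2] := contact_const_ge M0 N0 c0.
pose K3 := contact_const N M c; pose K5 := affine_const N M c.
have K30 : 0 <= K3 by rewrite addr_ge0// (le_trans M0).
have K35 : K3 <= K5 by rewrite lerDl mulr_ge0.
have K50 : 0 <= K5 by exact: le_trans K35.
have CK : 0 <= Ck * K5 by exact: mulr_ge0.
pose C := N + 768 * (Ck * K5) + 545 * K5.
have CC : (768 * Ck + 545) * K5 <= C by rewrite /C; have -> : (768 * Ck + 545) * K5 = 768 * (Ck * K5) + 545 * K5 by [ring]; lra.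
have CN : N + 48 * Ck * K5 <= C by rewrite /C; have -> : 48 * Ck * K5 = 48 * (Ck * K5) by [ring]; lra.
exists C => [|b v sol x x18]; first by rewrite /C; lra.
have x1 : l2norm x < 1 by lra.
have [sv vb _ _] := sol; have [vN _ _ _] := sv.
have [vbx|vbx] := leP (b x) (v x).
  have x38 : l2norm x <= 3 / 8 by lra.
  have e : v x = b x by apply/eqP; rewrite eq_le vb.
  have [p pN hp] := contact_expansion M0 sol hc x38 e.
  exists p => [|y y12]; first by apply: (le_trans pN); rewrite /C; lra.
  apply: le_trans (hp y y12) _; apply: ler_wpM2r; first exact: sqr_ge0.
  by rewrite -/K3 /C; lra.
pose D (k : nat) : R := 2^-1 ^+ k / 8.
have D0 k : 0 < D k by rewrite divr_gt0// exprn_gt0// invr_gt0.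
have D1 k : D k <= 1 / 8 by rewrite ler_pM2r// exprn_ile1// invf_le1// ler1n.
pose P k := `[< forall y, l2norm (y - x) <= D k -> v y < b y >].
have exP : exists k, P k.
  pose e : R := (b x - v x) / 2; have e0 : 0 < e by rewrite divr_gt0// subr_gt0.
  have /continuous_l2P/(_ _ e0)[d1 d10 hd1] := sol_continuous M0 sol hc x1.
  have /continuous_l2P/(_ _ e0)[d2 d20 hd2] := obstacle_continuous M0 sol x1.
  have d0 : 0 < Num.min d1 d2 by rewrite lt_min d10.
  have [k /(_ k (leqnn _)) hk'] := invS_lt d0.
  exists k; apply/asboolP => y yx.
  have : l2norm (y - x) < Num.min d1 d2.
    apply: (le_lt_trans yx); apply: le_lt_trans hk'; rewrite /D exprVn.
    apply: (@le_trans _ _ ((2 ^+ k)^-1)).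
      by rewrite ler_pdivrMr// ler_peMr// ?invr_ge0 ?exprn_ge0// ler1n.
    by rewrite lef_pV2 ?posrE ?exprn_gt0 ?ltr0n// -natrX ler_nat ltn_expl.
  rewrite lt_min => /andP[/hd1 + /hd2]; rewrite !ltr_norml => /andP[_ h1] /andP[h2 _].
  have : b x - v x = 2 * e by rewrite /e; field.
  by clearbody e; move: h1 h2; move: (v y) (v x) (b x) (b y) => *; lra.
have [k /asboolP hPk kmin] := ex_minnP exP.
suff [a [p0 [p0N hE]]] : exists a p0, l2norm p0 <= N /\ forall y, l2norm y <= 1 / 2 ->
    `|v y - a - dotv p0 (y - x)| <= K5 * (l2norm (y - x) + 2 * D k) ^+ 2.
  have [p pC hp] := scaled_expansion M0 sol hc Ck0 hk x18 (D0 k) (D1 k) p0N hPk hE.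
  exists p => [|y y12]; first exact: le_trans pC CN.
  apply: le_trans (hp y y12) _; apply: ler_wpM2r; [exact: sqr_ge0|exact: CC].
case: k hPk kmin => [|k] hPk kmin.
  exists 0, 0; split => [|y y12]; first by rewrite l2norm0.
  rewrite dotv0l !subr0 /D expr0 mul1r; apply: (le_trans (vN y)).
  apply: (@le_trans _ _ (K5 * 16^-1)).
    by rewrite /K5 /affine_const -/K3; lra.
  apply: ler_wpM2l => //; have -> : (16^-1 : R) = (2 * 8^-1) ^+ 2 by field.
  by rewrite ler_pXn2r ?nnegrE ?addr_ge0 ?l2norm_ge0// lerDr l2norm_ge0.
have /asboolP/existsNP[x0 /not_implyP[x0D /negP]] : ~~ P k.
  by apply/negP => /kmin; rewrite ltnn.
rewrite -leNgt => bv0.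
have DS : D k = 2 * D k.+1 by rewrite /D exprS; field.
have D1k := D1 k.
have x038 : l2norm x0 <= 3 / 8 by have := ler_l2norm_add x x0; lra.
have e : v x0 = b x0 by apply/eqP; rewrite eq_le bv0 vb//; lra.
have [p pN hp] := contact_expansion M0 sol hc x038 e.
exists (v x0 + dotv p (x - x0)), p; split => // y y12.
have -> : v y - (v x0 + dotv p (x - x0)) - dotv p (y - x) = v y - v x0 - dotv p (y - x0).
  have -> : y - x0 = (y - x) + (x - x0) by rewrite addrA subrK.
  by rewrite (dotvDr p (y - x)); ring.
apply: le_trans (hp y y12) _; apply: ler_pM => //; first exact: sqr_ge0.
rewrite ler_pXn2r ?nnegrE ?addr_ge0 ?l2norm_ge0 ?mulr_ge0 ?(ltW (D0 _))// -DS.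
by have := l2norm_dist y x x0; rewrite (l2normBC x x0); move: x0D; lra.
Qed.

End solution_expansion.

(** * Functions with bounded weak Hessian *)

Section C11_functions.
Context {R : realType} {n : nat}.
Local Notation V := 'rV[R]_n.
Local Notation mu := (@lebesgue_rV R n).
Implicit Types (f g b u : V -> R) (x y z p h : V).

Lemma eball0 x (r : R) : eball 0 r x = (l2norm x < r) :> Prop.
Proof. by rewrite /eball/= subr0. Qed.

Lemma mu_setT_gt0 : (0 < mu setT)%E.
Proof.
apply: (@lt_le_trans _ _ (mu (eball 0 1))); last first.
  by apply: le_measure; rewrite ?inE//; exact: eball_measurable.
by rewrite mu_eball01 lte_fin vol_gt0.
Qed.

Lemma integral_eball_Int K f g (r : R) : bms K f -> measurable_fun (eball 0 r) g ->
  {ae mu, forall x, l2norm x < r -> f x = g x} ->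
  (forall x, r <= l2norm x -> f x = 0) ->
  (\int[mu]_(x in eball 0 r) (g x)%:E = (Int f)%:E)%E.
Proof.
move=> bf mg fg f0; have mD := eball_measurable (0 : V) r.
have [mf _ _] := bf.
rewrite (@ae_eq_integral _ _ _ _ _ (fun x => (f x)%:E))//.
- rewrite integral_mkcond (_ : (fun x => (f x)%:E) \_ _ = EFin \o f); last first.
    apply/funext => x; rewrite patchE; case: ifPn => // /negP h.
    rewrite /= f0// leNgt; apply/negP => xr; apply: h.
    by rewrite inE /eball/= subr0.
  by rewrite /Int /Rintegral fineK//; apply: integrable_fin_num => //; exact: bms_integrable bf.
- exact/measurable_EFinP.
- by apply/measurable_EFinP; exact: measurable_funTS.
- by apply: filterS fg => x h Dx; rewrite h//; move: Dx; rewrite /eball/= subr0.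
Qed.

(** Unpacking of the norm: all entries of the sum are nonnegative, so a bound on
    the sum bounds each of them. *)
Lemma C2norm_lt (r N : R) b : 0 < r -> (C2norm (eball 0 r) b < N%:E)%E ->
  [/\ C1_on (eball 0 r) b, forall x, l2norm x < r -> `|b x| <= N,
      forall x, l2norm x < r -> l2norm (gradient b x) <= N &
      exists2 H, weak_hessian (eball 0 r) b H &
        {ae mu, forall x, l2norm x < r -> l2norm (H x) <= N}].
Proof.
move=> r0 /ereal_inf_lt[_ [c1 [H [wH ->]]]].
set A := ereal_sup _; set B := sup_norm _ _; set L := Linfty_norm _ _ => lt.
have o0 : eball (0 : V) r 0 by rewrite eball0 l2norm0.
have A0 : (0 <= A)%E.
  by apply: le_trans (_ : (`|b 0|%:E <= A)%E); [rewrite lee_fin|apply: ereal_sup_ubound; exists 0].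
have B0 : (0 <= B)%E.
  apply: le_trans (_ : ((l2norm (gradient b 0))%:E <= B)%E); first by rewrite lee_fin l2norm_ge0.
  by apply: ereal_sup_ubound; exists 0.
have L0 : (0 <= L)%E.
  apply: ess_sup_gee; first exact: mu_setT_gt0.
  apply: aeW => x; rewrite patchE; case: ifP => // _; rewrite lee_fin; exact: sqrtr_ge0.
have AN : (A <= N%:E)%E.
  by apply: le_trans (ltW lt); rewrite -addeA leeDl// adde_ge0.
have BN : (B <= N%:E)%E.
  by apply: le_trans (ltW lt); rewrite addeAC leeDr// adde_ge0.
have LN : (L <= N%:E)%E by apply: le_trans (ltW lt); rewrite leeDr// adde_ge0.
split => // [x xr|x xr|].
- rewrite -lee_fin; apply: le_trans AN; apply: ereal_sup_ubound.
  by exists x => //; rewrite eball0.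
- rewrite -lee_fin; apply: le_trans BN; apply: ereal_sup_ubound.
  by exists x => //; rewrite eball0.
exists H => //; move/ess_supP : LN; apply: filterS => x + xr.
by rewrite patchE mem_set ?eball0.
Qed.

Lemma quadratic_form_le (A : 'M[R]_n) h :
  `|\sum_i h 0 i * \sum_j h 0 j * A i j| <= l2norm A * l2norm h ^+ 2.
Proof.
pose q : V := \row_i \sum_j h 0 j * A i j.
have -> : \sum_i h 0 i * \sum_j h 0 j * A i j = dotv h q.
  by apply: eq_bigr => i _; rewrite mxE.
apply: le_trans (cauchy_schwarz _ _) _.
rewrite mulrC expr2 mulrA; apply: ler_wpM2r; first exact: l2norm_ge0.
rewrite -(ler_pXn2r (n := 2))// ?nnegrE ?mulr_ge0 ?l2norm_ge0 ?sqrtr_ge0//.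
rewrite exprMn l2norm_sqr [X in _ <= X * _]sqr_sqrtr; last by apply: sumr_ge0 => i _; apply: sumr_ge0 => j _; exact: sqr_ge0.
rewrite /dotv mulr_suml; apply: ler_sum => i _.
pose a : V := \row_j A i j.
have -> : q 0 i = dotv h a by rewrite mxE; apply: eq_bigr => j _; rewrite mxE.
have -> : \sum_j A i j ^+ 2 = l2norm a ^+ 2.
  by rewrite l2norm_sqr; apply: eq_bigr => j _; rewrite mxE expr2.
rewrite -expr2 -real_normK ?num_real// -exprMn ler_pXn2r// ?nnegrE ?mulr_ge0 ?l2norm_ge0//.
by rewrite mulrC; exact: cauchy_schwarz.
Qed.

Lemma Int_le_ae K M f g : bms K f -> bms M g ->
  {ae mu, forall x, f x <= g x} -> Int f <= Int g.
Proof.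
move=> bf bg fg; have [mf fK f0] := bf; have [mg gM g0] := bg.
have bm' : bms (K + M) (fun x => Num.min (f x) (g x)).
  have K0 : 0 <= K := le_trans (normr_ge0 _) (fK 0).
  have M0 : 0 <= M := le_trans (normr_ge0 _) (gM 0).
  split.
  - exact: measurable_minr.
  - move=> x; rewrite /Num.min; case: ifP => _.
      by apply: le_trans (fK x) _; rewrite lerDl.
    by apply: le_trans (gM x) _; rewrite lerDr.
  - by move=> x h; rewrite f0 ?g0 ?minxx//; lra.
rewrite (Int_ae_eq bf bm'); last by apply: filterS fg => x /min_l ->.
by apply: (Int_le bm' bg) => x; rewrite ge_min lexx orbT.
Qed.

Lemma bms_ext K f g : f =1 g -> bms K f -> bms K g.
Proof. by move=> /funext ->. Qed.

Section paraboloid.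
Variables (N : R) (b : V -> R) (H : V -> 'M[R]_n).
Hypotheses (cb : C1_on (eball 0 1) b) (bN : forall x, l2norm x < 1 -> `|b x| <= N)
  (wH : weak_hessian (eball 0 1) b H)
  (HN : {ae mu, forall x, l2norm x < 1 -> l2norm (H x) <= N}).

Let N0 : 0 <= N.
Proof. by apply: le_trans (bN (x := 0) _); rewrite ?l2norm0. Qed.

Let u x : R := ind x * b x.

Let cu x : l2norm x < 1 -> {for x, continuous u}.
Proof.
move=> x1; have bc : {for x, continuous b}.
  by apply: differentiable_continuous; have [] := cb (x := x); rewrite ?eball0.
apply/continuous_l2P => e e0; have /continuous_l2P/(_ _ e0)[d d0 hd] := bc.
exists (Num.min d (1 - l2norm x)); first by rewrite lt_min d0 subr_gt0.
move=> y; rewrite lt_min => /andP[yd yx].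
have y1 : l2norm y < 1 by have := ler_l2norm_add x y; lra.
by rewrite /u !indE x1 y1 !mul1r; exact: hd.
Qed.

Let bu : bms (N + 1) u.
Proof.
have uN x : `|u x| <= N.
  by rewrite /u indE; case: ltP => [x1|_]; rewrite ?mul1r ?mul0r ?normr0//; exact: bN.
split.
- apply: measurable_fun_lt => a; rewrite setTI.
  rewrite (_ : mkset _ = (eball 0 1 `&` [set x | u x < a]) `|` (~` eball 0 1 `&` [set x | 0 < a])).
    apply: measurableU.
      apply: open_measurable_rV; rewrite openE => x [x1 xa].
      have x1' : l2norm x < 1 by rewrite eball0 in x1.
      apply: filterI; first exact: (@eball_open R n 0 1 _ x1).
      have a0 : 0 < a - u x by rewrite subr_gt0.
      have /continuous_l2P/(_ _ a0)[d d0 hd] := cu x1'.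
      apply/nbhs_l2normP; exists d => // y /hd /ltr_normlW.
      by rewrite ltrD2r.
    apply: measurableI; first by apply: measurableC; exact: eball_measurable.
    by case: (ltP 0 a) => h; [rewrite (_ : mkset _ = setT)//|rewrite (_ : mkset _ = set0)//];
      apply/seteqP; split.
  apply/seteqP; split => x /=; rewrite eball0.
    move=> h; have [x1|x1] := boolP (l2norm x < 1); [by left; split|right; split; first exact/negP].
    by move: h; rewrite /u indE (negbTE x1) mul0r.
  by move=> [[]//|[/negP x1]]; rewrite /u indE (negbTE x1) mul0r.
- by move=> x; apply: le_trans (uN x) _; rewrite lerDl.
- by move=> x xN; rewrite /u indE ltNge (le_trans _ (ltW xN)) ?mul0r// lerDr.
Qed.

(** The Hessian truncated entrywise to [-N, N], which does not change it on the
    ball up to a null set. *)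
Let Hc i j x : R := ind x * Num.max (- N) (Num.min N (H x i j)).

Let bH i j : bms (2 * (1 + N)) (Hc i j).
Proof.
have [mH _ _] := wH i j.
have HcN x : `|Hc i j x| <= N.
  rewrite /Hc indE; case: ltP => _; last by rewrite mul0r normr0.
  rewrite mul1r ler_norml; apply/andP; split; first by rewrite le_max lexx.
  by rewrite ge_max ge_min lexx andbT; have := N0; lra.
split.
- rewrite (_ : Hc i j = (fun x => Num.max (- N) (Num.min N (H x i j))) \_ (eball 0 1)).
    apply/(measurable_restrictT _ _).1; first exact: eball_measurable.
    apply: measurable_maxr; first exact: measurable_cst.
    by apply: measurable_minr; first exact: measurable_cst.
  apply/funext => x; rewrite patchE /Hc indE.
  case: (boolP (l2norm x < 1)) => x1.
    by rewrite mem_set ?eball0// mul1r.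
  by rewrite memNset ?mul0r// eball0; exact/negP.
- by move=> x; apply: le_trans (HcN x) _; have := N0; lra.
- by move=> x xN; rewrite /Hc indE ltNge (le_trans _ (ltW xN)) ?mul0r//; have := N0; lra.
Qed.

Let HcE : {ae mu, forall x, forall i j, l2norm x < 1 -> Hc i j x = H x i j}.
Proof.
apply: filterS HN => x hx i j x1; rewrite /Hc indE x1 mul1r.
have : `|H x i j| <= N.
  apply: le_trans (hx x1); rewrite -sqrtr_sqr; apply: ler_wsqrtr.
  rewrite (bigD1 i)//= (bigD1 j)//= -addrA lerDl addr_ge0//.
    by apply: sumr_ge0 => k _; exact: sqr_ge0.
  by apply: sumr_ge0 => k _; apply: sumr_ge0 => l _; exact: sqr_ge0.
by rewrite ler_norml => /andP[h1 h2]; rewrite min_r// max_r.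
Qed.

Let bump_refl (p : V) (e : R) : bump p e = fun y : V => bump 0 e (p + (-1) *: y).
Proof.
by apply/funext => y; rewrite bumpC [LHS]bump_shift scaleN1r.
Qed.

Let partial_reflect (p : V) i (f : V -> R) : sexp f ->
  partial i (fun y => f (p + (-1) *: y)) = fun y => -1 * partial i f (p + (-1) *: y).
Proof.
move=> sf; apply/funext => y.
by have [] := @partial_affine _ _ f p (-1) i y (sexp_differentiable sf _).
Qed.

Let hess_conv (p : V) (e : R) i j : 0 < e -> l2norm p + e < 1 ->
  conv u (partial i (partial j (bump 0 e))) p = Int (fun y => Hc i j y * bump p e y).
Proof.
move=> e0 pe; have se : sexp (bump (0 : V) e) by exact: sexp_bump.
have tf : test_function (eball 0 1) (bump p e).
  apply: test_bump => // y; rewrite /ecball/= eball0 => yp.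
  by have := ler_l2norm_add p y; lra.
have [mH _ /(_ _ tf) h] := wH i j.
have pp y : partial i (partial j (bump p e)) y = partial i (partial j (bump 0 e)) (p - y).
  rewrite bump_refl (partial_reflect p j se).
  have dd : differentiable (fun y => partial j (bump 0 e) (p + (-1) *: y)) y.
    have sj := sexp_partial j se.
    by have [] := @partial_affine _ _ (partial j (bump 0 e)) p (-1) i y (sexp_differentiable sj _).
  rewrite (partialZ (-1) i dd) (partial_reflect p i (sexp_partial j se)).
  by rewrite mulrA mulrNN mulr1 mul1r scaleN1r.
have uE y : l2norm y < 1 -> u y * partial i (partial j (bump 0 e)) (p - y) =
    b y * partial i (partial j (bump p e)) y.
  move=> y1; apply: (congr2 *%R); last exact: esym (pp y).
  by rewrite /u indE y1 mul1r.
have [N1 b1] := bms_conv bu p (csexp_partial i (csexp_partial j (csexp_bump e0))).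
have mb : measurable_fun setT (bump p e) by apply: sexp_measurable; exact: sexp_bump.
have b2 : bms (2 * (1 + N) * (1 + `|1|)) (fun y => Hc i j y * bump p e y).
  apply: bmsM (bH i j) mb _ => y _.
  by rewrite ger0_norm ?bump_ge0// bump_le1.
apply/EFin_inj; rewrite /conv.
rewrite -(@integral_eball_Int _ _ (fun y => b y * partial i (partial j (bump p e)) y) 1 b1).
- rewrite h (@integral_eball_Int _ (fun y => Hc i j y * bump p e y) _ _ b2)//.
  + apply: measurable_funM => //; exact: measurable_funTS.
  + by apply: filterS HcE => x hx x1; rewrite hx.
  + by move=> x x1; rewrite /Hc indE ltNge x1 !mul0r.
- apply: (@eq_measurable_fun _ _ _ _ _ (fun y => u y * partial i (partial j (bump 0 e)) (p - y))).
    by move=> y; rewrite inE eball0 => y1; exact: uE.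
  by case: b1 => m1 _ _; exact: measurable_funTS.
- by apply: aeW => y y1; exact: uE.
- move=> y y1; apply: etrans (_ : 0 * partial i (partial j (bump 0 e)) (p - y) = 0); last exact: mul0r.
  by congr (_ * _); rewrite /u indE ltNge y1 mul0r.
Qed.

Let mollified_taylor (e : R) x h : 0 < e -> l2norm x + e < 1 -> l2norm (x + h) + e < 1 ->
  `|conv u (bump 0 e) (x + h) - conv u (bump 0 e) x
    - \sum_i h 0 i * partial i (conv u (bump 0 e)) x|
  <= N * Int (bump 0 e : V -> R) * l2norm h ^+ 2.
Proof.
move=> e0 xe xhe; have ce := csexp_bump (n := n) e0.
have sU := conv_smooth bu ce.
have [Kb bb] := csexp_bms ce.
apply: taylor2.
- by move=> y; exact: (sU [::]).
- by move=> i y; exact: (sU [:: i]).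
move=> t /andP[t0 t1].
have te : l2norm (x + t *: h) + e < 1.
  have -> : x + t *: h = (1 - t) *: x + t *: (x + h).
    by rewrite scalerBl scale1r scalerDr addrA subrK.
  apply: (@le_lt_trans _ _ ((1 - t) * l2norm x + t * l2norm (x + h) + e)).
    rewrite lerD2r; apply: le_trans (l2normD _ _) _; rewrite !l2normZ.
    by rewrite !ger0_norm// subr_ge0.
  move: xe xhe; move: (l2norm x) (l2norm (x + h)) => a c xe xhe.
  have : (1 - t) * (a + e) <= (1 - t) * Num.max (a + e) (c + e).
    by apply: ler_wpM2l; rewrite ?subr_ge0// le_max lexx.
  have : t * (c + e) <= t * Num.max (a + e) (c + e).
    by apply: ler_wpM2l => //; rewrite le_max lexx orbT.
  have : Num.max (a + e) (c + e) < 1 by rewrite gt_max xe.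
  by move: (Num.max _ _) => m; lra.
set p := x + t *: h in te *.
have E i j : partial j (partial i (conv u (bump 0 e))) p = Int (fun y => Hc j i y * bump p e y).
  rewrite -(hess_conv j i e0 te) (conv_partialE bu i ce).
  by rewrite (conv_partialE bu j (csexp_partial i ce)).
have mb : measurable_fun setT (bump p e) by apply: sexp_measurable; exact: sexp_bump.
have bI i j : bm (fun y => Hc j i y * bump p e y).
  exists (2 * (1 + N) * (1 + `|1|)); apply: bmsM (bH j i) mb _ => y _.
  by rewrite ger0_norm ?bump_ge0// bump_le1.
pose F y := \sum_i h 0 i * \sum_j h 0 j * (Hc j i y * bump p e y).
have bj i : bm (fun y => \sum_j h 0 j * (Hc j i y * bump p e y)).
  by apply: bm_sum => j; exact: bmZ.
have [K bF] : bm F by apply: bm_sum => i; exact: bmZ.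
have -> : \sum_i h 0 i * \sum_j h 0 j * partial j (partial i (conv u (bump 0 e))) p = Int F.
  rewrite bInt_sum; last by move=> i; exact: bmZ.
  apply: eq_bigr => i _; rewrite bIntZ//; congr (_ * _).
  rewrite bInt_sum; last by move=> j; exact: bmZ.
  by apply: eq_bigr => j _; rewrite bIntZ// E.
have bumpI : bms (Kb + (Kb + l2norm (- p)) / `|1|) (bump p e) /\ Int (bump p e) = Int (bump (0 : V) e).
  have n1 : (1 : R) != 0 by [].
  have eq : bump p e = fun y => bump 0 e (- p + 1 *: y).
    by apply/funext => y; rewrite [LHS]bump_shift scale1r addrC.
  split; first by move: (bms_affine (- p) n1 bb); apply: bms_ext => y; exact: esym (congr1 (fun f => f y) eq).
  have -> : Int (bump p e) = Int (fun y => bump 0 e (- p + 1 *: y)) by exact: congr1 eq.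
  have E' := Int_affine (- p) n1 bb; rewrite normr1 expr1n mul1r in E'.
  exact: esym E'.
have [bp <-] := bumpI; rewrite mulrAC -(IntZ _ bp).
apply: le_trans (Int_norm bF) _; apply: (Int_le_ae (bms_norm bF) (bmsZ _ bp)).
apply: filterS2 HcE HN => y hy hN.
have -> : F y = (\sum_i h 0 i * \sum_j h 0 j * Hc j i y) * bump p e y.
  rewrite /F mulr_suml; apply: eq_bigr => i _; rewrite -mulrA; congr (_ * _).
  by rewrite mulr_suml; apply: eq_bigr => j _; rewrite mulrA.
rewrite normrM (ger0_norm (bump_ge0 _ _ _)); apply: ler_wpM2r; first exact: bump_ge0.
have [y1|y1] := ltP (l2norm y) 1; last first.
  rewrite big1 ?normr0; first by rewrite mulr_ge0// sqr_ge0.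
  by move=> i _; rewrite big1 ?mulr0// => j _; rewrite /Hc indE ltNge y1 mul0r mulr0.
have -> : \sum_i h 0 i * \sum_j h 0 j * Hc j i y = \sum_i h 0 i * \sum_j h 0 j * H y i j.
  transitivity (\sum_i \sum_j h 0 i * h 0 j * H y j i).
    by apply: eq_bigr => i _; rewrite mulr_sumr; apply: eq_bigr => j _; rewrite hy// mulrA.
  rewrite exchange_big; apply: eq_bigr => j _; rewrite mulr_sumr.
  by apply: eq_bigr => i _; rewrite mulrCA mulrA.
apply: le_trans (quadratic_form_le _ _) _; apply: ler_wpM2r; first exact: sqr_ge0.
exact: hN.
Qed.

(** Comparing increments along [h] and along [t * h] eliminates the gradient of
    the mollification, so that only values of [b] remain in the limit. *)
Let increment x h (t : R) : l2norm x < 1 -> l2norm (x + h) < 1 -> 0 < t -> t <= 1 ->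
  b (x + h) - b x <= (b (x + t *: h) - b x) / t + N * (t + 1) * l2norm h ^+ 2.
Proof.
move=> x1 xh1 t0 t1.
have xt1 : l2norm (x + t *: h) < 1.
  have -> : x + t *: h = (1 - t) *: x + t *: (x + h).
    by rewrite scalerBl scale1r scalerDr addrA subrK.
  apply: le_lt_trans (l2normD _ _) _; rewrite !l2normZ !ger0_norm ?subr_ge0// ?ltW//.
  have : (1 - t) * l2norm x <= (1 - t) * Num.max (l2norm x) (l2norm (x + h)).
    by apply: ler_wpM2l; rewrite ?subr_ge0// le_max lexx.
  have : t * l2norm (x + h) <= t * Num.max (l2norm x) (l2norm (x + h)).
    by apply: ler_wpM2l; [exact: ltW|rewrite le_max lexx orbT].
  have : Num.max (l2norm x) (l2norm (x + h)) < 1 by rewrite gt_max x1.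
  by move: (Num.max _ _) => m; lra.
pose m := Num.max (Num.max (l2norm x) (l2norm (x + h))) (l2norm (x + t *: h)).
have m1 : m < 1 by rewrite !gt_max x1 xh1.
pose g : R := (1 - m) / 2; have g0 : 0 < g by rewrite divr_gt0// subr_gt0.
pose s (k : nat) : R := g * k.+1%:R^-1.
have s0 k : 0 < s k by rewrite mulr_gt0// invr_gt0 ltr0n.
have sg k : s k <= g.
  by apply: ler_piMr; [exact: ltW|rewrite invf_le1 ?ltr0n// ler1n].
have ins k y : l2norm y <= m -> l2norm y + s k < 1.
  by have := sg k; rewrite /g => ? ?; lra.
have scv : - s k @[k --> \oo] --> 0.
  apply/cvg_seqP => e e0; have [|k0 hk] := @invS_lt _ (e / g); first by rewrite divr_gt0.
  exists k0 => k /hk; rewrite subr0 normrN gtr0_norm// /s ltr_pdivlMr// mulrC.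
  by [].
have [Kb bb] := csexp_bms (csexp_bump (n := n) (ltr01 : (0 : R) < 1)).
pose k0 : R := Int (bump 0 1 : V -> R); have k00 : 0 < k0 := Int_bump_gt0.
pose W k y := Int (fun z => bump 0 1 z * u (y + (- s k) *: z)).
have cvW y : l2norm y <= m -> W k y @[k --> \oo] --> k0 * b y.
  move=> ym; have y1 : l2norm y < 1 by exact: le_lt_trans m1.
  have hz z : bump 0 1 z * u (y + - s k *: z) @[k --> \oo] --> bump 0 1 z * u y.
    by apply: cvgMr; apply: continuous_shift => //; exact: cu.
  have [mu' uM _] := bu.
  have bF k : bms (Kb * (1 + `|N + 1|)) (fun z => bump 0 1 z * u (y + - s k *: z)).
    apply: bmsM bb _ (fun z _ => uM _).
    by apply: (measurableT_comp mu'); exact: (measurable_affine_map y (- s k)).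
  have [_] := Int_cvg_all bF hz.
  rewrite (Int_ext (f := fun z => bump 0 1 z * u y) (g := fun z => u y * bump 0 1 z)); last first.
    by move=> z; rewrite mulrC.
  by rewrite (IntZ _ bb) mulrC /u indE y1 mul1r.
have xm : l2norm x <= m by rewrite !le_max lexx.
have xhm : l2norm (x + h) <= m by rewrite !le_max lexx orbT.
have xtm : l2norm (x + t *: h) <= m by rewrite !le_max lexx orbT.
have main k : W k (x + h) - W k x <=
    (W k (x + t *: h) - W k x) / t + N * k0 * ((t + 1) * l2norm h ^+ 2).
  have sn : 0 < s k ^+ n by rewrite exprn_gt0.
  have E y : conv u (bump 0 (s k)) y = s k ^+ n * W k y by rewrite (conv_bump _ bu (s0 k)).
  have EI : Int (bump 0 (s k) : V -> R) = s k ^+ n * k0.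
    have [Ks bs] := csexp_bms (csexp_bump (n := n) (s0 k)).
    have sk0 : s k != 0 by rewrite gt_eqF.
    rewrite (Int_affine 0 sk0 bs) gtr0_norm//; congr (_ * _).
    by apply: Int_ext => z; rewrite bump_scale.
  have T1 := mollified_taylor (s0 k) (ins k _ xm) (ins k _ xhm).
  have T2 := mollified_taylor (s0 k) (ins k _ xm) (ins k _ xtm).
  pose G := \sum_i h 0 i * partial i (conv u (bump 0 (s k))) x.
  have EG : \sum_i (t *: h) 0 i * partial i (conv u (bump 0 (s k))) x = t * G.
    by rewrite mulr_sumr; apply: eq_bigr => i _; rewrite mxE mulrA.
  rewrite EG l2normZ (gtr0_norm t0) in T2; rewrite -/G in T1.
  rewrite !E EI in T1 T2; clear EG; move: G T1 T2 => G.
  rewrite !ler_norml => /andP[_ T1] /andP[T2 _].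
  rewrite -(ler_pM2l sn).
  have T3 : G <= s k ^+ n * ((W k (x + t *: h) - W k x) / t) + N * (s k ^+ n * k0) * (t * l2norm h ^+ 2).
    rewrite -(ler_pM2l t0).
    have -> : t * (s k ^+ n * ((W k (x + t *: h) - W k x) / t) + N * (s k ^+ n * k0) * (t * l2norm h ^+ 2))
      = s k ^+ n * W k (x + t *: h) - s k ^+ n * W k x + N * (s k ^+ n * k0) * (t * l2norm h) ^+ 2.
      by field; rewrite gt_eqF.
    move: T2; move: (t * G) (N * _ * (_ ^+ 2)) (_ * W k x) (_ * W k _) => a1 a2 a3 a4; lra.
  have -> : s k ^+ n * ((W k (x + t *: h) - W k x) / t + N * k0 * ((t + 1) * l2norm h ^+ 2)) =
     s k ^+ n * ((W k (x + t *: h) - W k x) / t) + N * (s k ^+ n * k0) * (t * l2norm h ^+ 2)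
       + N * (s k ^+ n * k0) * l2norm h ^+ 2 by ring.
  rewrite mulrBr; move: T1 T3.
  move: (s k ^+ n * W k (x + h)) (s k ^+ n * W k x) (s k ^+ n * (_ / t)) (N * _ * _) (N * _ * _).
  by move=> a1 a2 a3 a4 a5; lra.
have L : k0 * b (x + h) - k0 * b x <=
    (k0 * b (x + t *: h) - k0 * b x) / t + N * k0 * ((t + 1) * l2norm h ^+ 2).
  apply: (@seq_cvg_le _ _ _ _ _ 0 _ _ (fun k _ => main k)).
    by apply: cvgB; apply: cvW.
  apply: cvgD; last exact: cvg_cst.
  by apply: cvgMl; apply: cvgB; apply: cvW.
rewrite -(ler_pM2l k00); apply: le_trans (_ : _ <= k0 * b (x + h) - k0 * b x) _; first by rewrite mulrBr.
apply: le_trans L _; rewrite le_eqVlt; apply/orP; left; apply/eqP; field; exact: lt0r_neq0.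
Qed.

(** Letting [t] tend to [0] in [increment]. *)
Lemma paraboloid x y : l2norm x < 1 -> l2norm y < 1 ->
  b y <= b x + dotv (gradient b x) (y - x) + N * l2norm (y - x) ^+ 2.
Proof.
move=> x1 y1; pose h : V := y - x; have yE : y = x + h by rewrite /h subrKC.
have xh1 : l2norm (x + h) < 1 by rewrite -yE.
have [db _] : differentiable b x /\ {for x, continuous (gradient b)} by apply: cb; rewrite eball0.
have [_ q] := derive_quotient h db.
rewrite (derive_sum_partial h db) in q.
have qE : \sum_i h 0 i * partial i b x = dotv (gradient b x) h.
  by rewrite dotvC; apply: eq_bigr => i _; congr (_ * _); rewrite mxE.
rewrite qE in q.
suff L : b (x + h) - b x <= dotv (gradient b x) h + N * l2norm h ^+ 2.
  by move: L; rewrite -yE -/h; lra.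
have -> : N * l2norm h ^+ 2 = N * (0 + 1) * l2norm h ^+ 2 by rewrite add0r mulr1.
apply: (@seq_cvg_le _ (fun=> b (x + h) - b x)
   (fun k => (b (x + k.+1%:R^-1 *: h) - b x) / k.+1%:R^-1 + N * (k.+1%:R^-1 + 1) * l2norm h ^+ 2) _ _ 0).
- exact: cvg_cst.
- apply: cvgD => //; apply: cvgMl; apply: cvgMr; apply: cvgD; last exact: cvg_cst.
  exact: cvg_harmonic.
- by move=> k _; apply: increment => //; rewrite ?invr_gt0 ?ltr0n// invf_le1 ?ltr0n// ler1n.
Qed.

End paraboloid.
End C11_functions.

(** * The envelope solves an obstacle problem *)

Section envelope.
Context {R : realType} {n : nat}.
Local Notation V := 'rV[R]_n.
Local Notation mu := (@lebesgue_rV R n).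
Implicit Types (b v : V -> R) (f g : V -> \bar R) (x y z : V).

(** For competitors in the envelope only semicontinuity is at hand; comparison
    comes directly from the integral as a supremum over simple functions. *)
Lemma integral_mono (D : set V) f g : (forall x, D x -> (f x <= g x)%E) ->
  (\int[mu]_(x in D) f x <= \int[mu]_(x in D) g x)%E.
Proof.
move=> fg.
have ge0 f1 f2 : (forall x, D x -> 0 <= f1 x)%E -> (forall x, D x -> f1 x <= f2 x)%E ->
    (\int[mu]_(x in D) f1 x <= \int[mu]_(x in D) f2 x)%E.
  move=> f10 f12; have f20 x : D x -> (0 <= f2 x)%E by move=> Dx; apply: le_trans (f12 _ Dx); exact: f10.
  rewrite !ge0_integralE//; apply: ereal_sup_le => _ [h hf <-]; exists h => // x.
  apply: le_trans (hf x) _; rewrite !patchE; case: ifPn => //; rewrite inE; exact: f12.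
rewrite [leLHS]integralE [leRHS]integralE; apply: leeB.
  apply: ge0 => x Dx; first exact: funepos_ge0.
  by apply: (funepos_le (D := D)); rewrite ?inE// => y; rewrite inE; exact: fg.
apply: ge0 => x Dx; first exact: funeneg_ge0.
by apply: (funeneg_le (D := D)); rewrite ?inE// => y; rewrite inE; exact: fg.
Qed.

Lemma mu_eballE (x : V) (r : R) : 0 < r -> fine (mu (eball x r)) = r ^+ n * vol R n.
Proof. by move=> r0; rewrite (mu_eball x r0). Qed.

Lemma integral_eball_ballint K v x (r : R) : bms K v -> 0 < r ->
  (\int[mu]_(y in eball x r) (v y)%:E = (r ^+ n * ballint v x r)%:E)%E.
Proof.
move=> bv r0; have [b1 ->] := ballint_centered x bv r0.
have [m1 _ _] := b1; have mD := eball_measurable x r.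
rewrite integral_mkcond (_ : (fun y => (v y)%:E) \_ _ = EFin \o (fun w => v w * ind (r^-1 *: (w - x)))); last first.
  apply/funext => w; rewrite patchE /= indE l2normZ gtr0_norm ?invr_gt0//.
  rewrite (mulrC r^-1) ltr_pdivrMr// mul1r; have [wx|wx] := boolP (l2norm (w - x) < r).
    by rewrite mem_set// mulr1.
  by rewrite memNset ?mulr0//; exact/negP.
by rewrite /Int /Rintegral fineK//; apply: integrable_fin_num => //; exact: bms_integrable b1.
Qed.

Hypothesis n_gt0 : (0 < n)%N.

Lemma sh_subharmonic K v : sh K v -> subharmonic (eball 0 1) (fun x => (v x)%:E).
Proof.
move=> sv; have bv := sh_bms sv; case: sv => vK v0 uv smv; split.
- by move=> x _; rewrite ltry.
- move=> x; rewrite eball0 => x1 a; rewrite lte_fin => /(uv x x1).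
  by apply: filterS => y; rewrite lte_fin.
- move=> x r r0 hx; have xr := ecball_sub_eball n_gt0 r0 hx.
  rewrite (integral_eball_ballint x bv r0) (mu_eballE x r0) -EFinM lee_fin.
  have rn : 0 < r ^+ n by rewrite exprn_gt0.
  rewrite invfM mulrACA mulVf ?gt_eqF// mul1r mulrC ler_pdivlMr ?vol_gt0//.
  exact: smv.
Qed.

Variables (N : R) (b : V -> R).
Hypotheses (bN : forall x, l2norm x < 1 -> `|b x| <= N)
  (hQ : forall x, l2norm x < 1 -> exists2 p, l2norm p <= N &
    forall y, l2norm y < 1 -> b y <= b x + dotv p (y - x) + N * l2norm (y - x) ^+ 2).

Let benv := subharmonic_envelope (eball 0 1) b.

Let N0 : 0 <= N.
Proof. by apply: le_trans (bN (x := 0) _); rewrite ?l2norm0. Qed.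

Let benv_le x : l2norm x < 1 -> (benv x <= (b x)%:E)%E.
Proof.
by move=> x1; apply: ge_ereal_sup => _ [f [_ fb] <-]; apply: fb; rewrite eball0.
Qed.

Let le_benv f x : subharmonic (eball 0 1) f -> (forall y, l2norm y < 1 -> (f y <= (b y)%:E)%E) ->
  (f x <= benv x)%E.
Proof.
by move=> sf fb; apply: ereal_sup_ubound; exists f => //; split => // y; rewrite eball0; exact: fb.
Qed.

Let benv_ge x : l2norm x < 1 -> ((- N)%:E <= benv x)%E.
Proof.
move=> x1; apply: (@le_benv (cst (- N)%:E)).
  split => [y _|y _ a h|].
  - exact: ltry.
  - by apply/near_l2norm; exists 1.
  - move=> y r r0 _; rewrite integral_cst; last exact: eball_measurable.
    rewrite (mu_eballE y r0); set c := r ^+ n * vol R n.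
    have cp : 0 < c by rewrite mulr_gt0 ?vol_gt0 ?exprn_gt0.
    have := congr1 (fun t => (c^-1%:E * ((- N)%:E * t))%E) (mu_eball y r0).
    rewrite -/c => e; apply: (@le_trans _ _ (c^-1%:E * ((- N)%:E * c%:E))%E); last by rewrite -e.
    by rewrite -!EFinM lee_fin mulrCA mulVf ?mulr1// gt_eqF.
by move=> y y1; rewrite lee_fin; have := bN y1; rewrite ler_norml => /andP[].
Qed.

(** Extended by zero so that it is a bounded function on the whole space. *)
Definition real_env x : R := if l2norm x < 1 then fine (benv x) else 0.

Lemma real_envE x : l2norm x < 1 -> benv x = (real_env x)%:E.
Proof.
move=> x1; rewrite /real_env x1 fineK// fin_numE; apply/andP; split.
  by apply/eqP => e; have := benv_ge x1; rewrite e.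
by apply/eqP => e; have := benv_le x1; rewrite e.
Qed.

Let env_le x : l2norm x < 1 -> real_env x <= b x.
Proof. by move=> x1; rewrite -lee_fin -real_envE// benv_le. Qed.

Let env_ge x : l2norm x < 1 -> - N <= real_env x.
Proof. by move=> x1; rewrite -lee_fin -real_envE// benv_ge. Qed.

Let env_max K (f : V -> R) : sh K f -> (forall x, l2norm x < 1 -> f x <= b x) ->
  forall x, l2norm x < 1 -> f x <= real_env x.
Proof.
move=> sf fb x x1; rewrite -lee_fin -real_envE//; apply: (@le_benv (fun x => (f x)%:E)).
  exact: sh_subharmonic sf.
by move=> y y1; rewrite lee_fin fb.
Qed.

Let v := real_env.

Let vN x : l2norm x < 1 -> v x <= N.
Proof. by move=> x1; apply: le_trans (env_le x1) _; exact: le_trans (ler_norm _) (bN x1). Qed.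

(** [w] is the upper semicontinuous regularisation of the envelope. *)
Let S x : set R := [set a | \forall y \near x, l2norm y < 1 -> v y <= a].
Let w x : R := if l2norm x < 1 then inf (S x) else 0.

Let S0 x : S x !=set0.
Proof. by exists N; apply/near_l2norm; exists 1 => // y _; exact: vN. Qed.

Let Slb x : l2norm x < 1 -> lbound (S x) (v x).
Proof. by move=> x1 a /nbhs_singleton; apply. Qed.

Let wlb x a : l2norm x < 1 -> S x a -> w x <= a.
Proof. by move=> x1 Sa; rewrite /w x1; apply: ge_inf => //; exists (v x); exact: Slb. Qed.

Let v_le_w x : l2norm x < 1 -> v x <= w x.
Proof. by move=> x1; rewrite /w x1; apply: lb_le_inf; [exact: S0|exact: Slb]. Qed.

Let near_in1 x : l2norm x < 1 -> \forall y \near x, l2norm y < 1.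
Proof.
move=> x1; apply/near_l2norm; exists (1 - l2norm x); first by rewrite subr_gt0.
by move=> y yx; have := ler_l2norm_add x y; lra.
Qed.

Let w_bound x : `|w x| <= N.
Proof.
have [x1|x1] := ltP (l2norm x) 1; last by rewrite /w ltNge x1 normr0.
rewrite ler_norml; apply/andP; split.
  by apply: le_trans (env_ge x1) _; exact: v_le_w.
by apply: wlb => //; apply/near_l2norm; exists 1 => // y _; exact: vN.
Qed.

Let w_usc : usc w.
Proof.
move=> x x1 a; rewrite {1}/w x1 => /(inf_lt (@S0 x))[a' Sa' a'a].
have h : \forall y \near x, S y a'.
  have /near_l2norm[d d0 hd] := Sa'; have d2 : 0 < d / 2 by rewrite divr_gt0.
  apply/near_l2norm; exists (d / 2) => // y yx; apply/near_l2norm; exists (d / 2) => // z zy.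
  by apply: hd; have := l2norm_dist z y x; move: yx zy; lra.
apply: filterS2 h (near_in1 x1) => y Sy y1.
exact: le_lt_trans (wlb y1 Sy) a'a.
Qed.

Let w_le_b x : l2norm x < 1 -> w x <= b x.
Proof.
move=> x1; apply/ler_addgt0Pr => e e0; apply: wlb => //.
have [p pN hp] := hQ x1.
pose q : R := N + N + 1; have q0 : 0 < q by rewrite /q; have := N0; lra.
apply/near_l2norm; exists (Num.min 1 (e / q)); first by rewrite lt_min ltr01 divr_gt0.
move=> y; rewrite lt_min ltr_pdivlMr// => /andP[y1 ye] yin.
apply: le_trans (env_le yin) _; apply: le_trans (hp y yin) _; rewrite -addrA lerD2l.
have s0 := l2norm_ge0 (y - x).
have h1 : dotv p (y - x) <= N * l2norm (y - x).
  apply: le_trans (ler_norm _) _; apply: le_trans (cauchy_schwarz _ _) _.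
  exact: ler_wpM2r.
have h2 : N * l2norm (y - x) ^+ 2 <= N * l2norm (y - x).
  apply: ler_wpM2l; first exact: N0.
  by rewrite expr2; apply: ler_piMr => //; exact: ltW.
apply: le_trans (lerD h1 h2) _; apply: le_trans (ltW ye).
by rewrite /q !mulrDr mulr1 !(mulrC N) lerDl.
Qed.

Let w0 x : 1 <= l2norm x -> w x = 0.
Proof. by rewrite /w leNgt => /negbTE ->. Qed.

Let bw : bms (N + 1) w.
Proof.
have N00 := N0; split; first exact: usc_measurable.
- by move=> x; apply: le_trans (w_bound x) _; rewrite lerDl.
- by move=> x h; apply: w0; lra.
Qed.

(** Each competitor lies below [w], so its averages, hence the envelope, lie
    below averages of [w], which depend continuously on the centre. *)
Let w_submean : submean 1 w.
Proof.
have v_avg y (r : R) : 0 < r -> l2norm y + r < 1 -> v y * vol R n <= ballint w y r.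
  move=> r0 yr; have y1 : l2norm y < 1 by move: r0 yr; lra.
  rewrite -ler_pdivlMr ?vol_gt0// -lee_fin /v -(real_envE y1).
  apply: ge_ereal_sup => _ [f [sf fb] <-].
  have [_ _ /(_ y r r0)] := sf; move=> /(_ _)/le_trans; apply.
    by move=> z /= zy; rewrite eball0; have := ler_l2norm_add y z; move: zy yr; rewrite /ecball/=; lra.
  rewrite (mu_eballE y r0).
  have rn : 0 < r ^+ n by rewrite exprn_gt0.
  have -> : ballint w y r / vol R n = (r ^+ n * vol R n)^-1 * (r ^+ n * ballint w y r).
    by rewrite invfM mulrACA mulVf ?gt_eqF// mul1r mulrC.
  rewrite EFinM; apply: lee_wpmul2l.
    by rewrite lee_fin invr_ge0 mulr_ge0// ltW// vol_gt0.
  rewrite -(integral_eball_ballint y bw r0); apply: integral_mono => z zy.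
  have z1 : l2norm z < 1 by have := ler_l2norm_add y z; move: zy yr; rewrite /eball/=; lra.
  apply: (@le_trans _ _ (benv z)); first by apply: le_benv => // u u1; apply: fb; rewrite eball0.
  by rewrite real_envE// lee_fin v_le_w.
move=> x r r0 xr; have x1 : l2norm x < 1 by move: r0 xr; lra.
rewrite -ler_pdivlMr ?vol_gt0//; apply/ler_addgt0Pr => e e0; apply: wlb => //.
have ev : 0 < e * vol R n by rewrite mulr_gt0 ?vol_gt0.
have /continuous_l2P/(_ _ ev)[d d0 hd] := ballint_continuous bw r0 (x := x).
apply/near_l2norm; exists (Num.min d (1 - l2norm x - r)).
  by rewrite lt_min d0/=; lra.
move=> y; rewrite lt_min => /andP[yd yx] _.
have yr : l2norm y + r < 1 by have := ler_l2norm_add x y; lra.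
have vp : 0 < vol R n := vol_gt0.
rewrite -(ler_pM2r vp) mulrDl divfK ?gt_eqF//; apply: le_trans (v_avg _ _ r0 yr) _.
by rewrite -lerBlDl; apply/ltW/ltr_normlW/hd.
Qed.

(** The regularisation of the envelope is subharmonic and below the continuous
    obstacle, so it is itself a competitor and coincides with the envelope. *)
Lemma envelope_obstacle_sol : obstacle_sol N N b real_env.
Proof.
have sw : sh N w by split.
have wv x : l2norm x < 1 -> w x <= v x by move=> x1; apply: env_max sw w_le_b _ x1.
have E : w = v.
  apply/funext => x; have [x1|x1] := ltP (l2norm x) 1.
    by apply/eqP; rewrite eq_le wv//= v_le_w.
  by rewrite w0// /v /real_env ltNge x1.
by split => //; rewrite -/v -E.
Qed.

End envelope.

(** * Weak limits of bounded functions *)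

Section weak_limit.
Context {R : realType} {n : nat}.
Local Notation V := 'rV[R]_n.
Local Notation mu := (@lebesgue_rV R n).
Implicit Types (w phi : V -> R) (q u : nat -> V -> R) (x : V).
Variables (r L : R).
Hypotheses (r0 : 0 < r) (L0 : 0 <= L).

Definition bounded_on_ball w := [/\ measurable_fun setT w, forall x, `|w x| <= L &
  forall x, r <= l2norm x -> w x = 0].

Lemma bounded_on_ball_bms w : bounded_on_ball w -> bms (L + r) w.
Proof.
move=> [mw wL w0]; split => // [x|x xr]; last by apply: w0; have := L0; lra.
by apply: le_trans (wL x) _; rewrite lerDl ltW.
Qed.

Let bmM w w' : bounded_on_ball w -> bounded_on_ball w' -> bm (fun x => w x * w' x).
Proof.
move=> gw gw'; exists ((L + r) * (1 + `|L|)).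
by apply: bmsM (bounded_on_ball_bms gw) _ _; case: gw' => // ? h _ x _.
Qed.

Let bm_indic_eball : bm (\1_(eball (0 : V) r) : V -> R).
Proof.
exists (r + 1); apply: bms_indic; [exact: ltW|exact: eball_measurable|].
by move=> x; rewrite eball0 => /ltW.
Qed.

(** Square-summably fast Cauchy sequences converge almost everywhere: the
    integrals of the increments are summable. *)
Lemma fast_ae_cvg u : (forall j, bounded_on_ball (u j)) ->
  (forall j, Int (fun x => (u j.+1 x - u j x) ^+ 2) <= 2^-1 ^+ j * 2^-1 ^+ j) ->
  exists2 H, bounded_on_ball H & {ae mu, forall x, u j x @[j --> \oo] --> H x}.
Proof.
move=> gu hu.
pose d j x : R := `|u j.+1 x - u j x|.
have bu j := bounded_on_ball_bms (gu j).
have bd j : bms (L + r + (L + r)) (d j) := bms_norm (bmsB (bu j.+1) (bu j)).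
have bd2 j : bm (fun x => (u j.+1 x - u j x) ^+ 2).
  exists ((L + r + (L + r)) * (1 + `|L + r + (L + r)|)).
  have b1 := bmsB (bu j.+1) (bu j); have [m1 k1 _] := b1.
  exact: bmsM b1 m1 (fun x _ => k1 x).
pose C : R := Int (\1_(eball (0 : V) r)).
have C0 : 0 <= C by apply: Int_ge0 => x; rewrite indicE.
pose e j : R := 2^-1 ^+ j; have e0 j : 0 < e j by rewrite exprn_gt0// invr_gt0.
have Id j : Int (d j) <= (C + 1) * e j.
  apply: (@le_trans _ _ (Int (fun x => e j * \1_(eball (0 : V) r) x + (e j)^-1 * (u j.+1 x - u j x) ^+ 2))).
    apply: bInt_le; [by eexists; exact: bd|by apply: bmD; exact: bmZ|].
    move=> x; have [xr|xr] := ltP (l2norm x) r; last first.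
      rewrite /d; have [_ _ ->] := gu j.+1 => //; have [_ _ ->] := gu j => //.
      by rewrite subrr normr0 addr_ge0 ?mulr_ge0 ?invr_ge0 ?indicE ?sqr_ge0 ?(ltW (e0 j)).
    rewrite indicE mem_set ?eball0// mulr1 -(ler_pM2l (e0 j)) mulrDr mulrA divff ?gt_eqF// mul1r.
    rewrite -[X in _ <= _ + X]real_normK ?num_real// -/(d j x).
    by move: (d j x) (e j) => a c; nra.
  rewrite bIntD; [|exact: bmZ|exact: bmZ]; rewrite !bIntZ// -/C.
  have -> : (C + 1) * e j = e j * C + (e j)^-1 * (e j * e j) by field; rewrite gt_eqF.
  by rewrite lerD2l; apply: ler_wpM2l; [rewrite invr_ge0 ltW|exact: hu].
have md j : measurable_fun setT (fun x => (d j x)%:E) by apply/measurable_EFinP; case: (bd j).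
have d0 j x : (0 <= (d j x)%:E)%E by rewrite lee_fin; exact: normr_ge0.
pose G x := (\sum_(0 <= j <oo) (d j x)%:E)%E.
have IG : (\int[mu]_x G x < +oo)%E.
  rewrite /G integral_nneseries//.
  have E j : (\int[mu]_x (d j x)%:E = (Int (d j))%:E)%E.
    by rewrite /Int /Rintegral fineK//; apply: integrable_fin_num => //; exact: bms_integrable (bd j).
  apply: (@le_lt_trans _ _ ((C + 1) * 2)%:E); last by rewrite ltry.
  apply: lime_le; first by apply: is_cvg_nneseries => j _ _; apply: integral_ge0.
  apply: nearW => k.
  rewrite (eq_bigr (fun j => (Int (d j))%:E)); last by move=> j _; exact: E.
  rewrite sumEFin lee_fin.
  apply: (@le_trans _ _ ((C + 1) * (2 - 2 * 2^-1 ^+ k))); last first.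
    apply: ler_wpM2l; first by rewrite addr_ge0.
    by rewrite gerBl mulr_ge0// exprn_ge0// invr_ge0.
  elim: k => [|k IH]; first by rewrite big_geq// expr0 mulr1 subrr mulr0.
  rewrite big_nat_recr//=; apply: le_trans (lerD IH (Id k)) _.
  by rewrite -mulrDr; apply: ler_wpM2l; [rewrite addr_ge0|rewrite /e exprS; lra].
have mG : measurable_fun setT G by apply: ge0_emeasurable_sum.
have G0 x : (0 <= G x)%E by apply: nneseries_ge0.
have iG : mu.-integrable setT G.
  by apply/integrableP; split => //; under eq_integral do rewrite gee0_abs//.
have cvx x : G x \is a fin_num -> cvgn (u^~ x).
  move=> Gf; have cs : cvgn (series (fun j => u j.+1 x - u j x)).
    apply: normed_cvg; apply: nondecreasing_is_cvgn.
      apply/nondecreasing_seqP => k; rewrite [leRHS]seriesSr lerDl; exact: normr_ge0.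
    exists (fine (G x)) => _ [k _ <-]; rewrite -lee_fin fineK// /series /= -sumEFin.
    by apply: (@nneseries_lim_ge _ (fun j => (d j x)%:E) xpredT 0%N k).
  have -> : u^~ x = (fun k => u 0%N x + series (fun j => u j.+1 x - u j x) k).
    by apply/funext => k; rewrite /series /= telescope_sumr// subrKC.
  by apply: is_cvgD => //; exact: is_cvg_cst.
have [Z [mZ Z0 sZ]] := integrable_ae measurableT iG.
pose F j x : R := \1_(~` Z) x * u j x.
have cF x : cvgn (F^~ x).
  rewrite /F indicE; case: (boolP (x \in ~` Z)) => [|_]; last first.
    by under eq_fun do rewrite mul0r; exact: is_cvg_cst.
  rewrite inE => /= xZ; under eq_fun do rewrite mul1r.
  apply: cvx; apply: contrapT => nf; apply: xZ; apply: sZ => /= h; apply: nf; exact: h.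
have bF j : bms ((L + r) * (1 + `|1|)) (F j).
  rewrite (_ : F j = fun x => u j x * \1_(~` Z) x); last by apply/funext => x; rewrite mulrC.
  apply: bmsM (bu j) _ _; first by apply: measurable_indic; exact: measurableC.
  by move=> x _; rewrite indicE ger0_norm// lern1 leq_b1.
pose H x : R := limn (F^~ x).
have FH x : F j x @[j --> \oo] --> H x by exact: cF.
have [[mH _ _] _] := Int_cvg_all bF FH.
have FL j x : `|F j x| <= L.
  have [_ uL _] := gu j; rewrite /F normrM -[leRHS]mul1r; apply: ler_pM => //.
  by rewrite indicE ger0_norm// lern1 leq_b1.
exists H; first split => //.
- move=> x; rewrite ler_norml; apply/andP; split.
    apply: (@seq_cvg_le _ (fun=> - L) (F^~ x) _ _ 0); [exact: cvg_cst|exact: FH|].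
    by move=> k _; have := FL k x; rewrite ler_norml => /andP[].
  apply: (@seq_cvg_le _ (F^~ x) (fun=> L) _ _ 0); [exact: FH|exact: cvg_cst|].
  by move=> k _; have := FL k x; rewrite ler_norml => /andP[].
- move=> x xr; rewrite /H (_ : F^~ x = fun=> 0) ?lim_cst//.
  by apply/funext => j; have [_ _ u0] := gu j; rewrite /F u0// mulr0.
exists Z; split => // x /= nc; apply: contrapT => xZ; apply: nc.
have := FH x; rewrite (_ : F^~ x = u^~ x)//; apply/funext => j.
by rewrite /F indicE mem_set// mul1r.
Qed.

(** The function [H] is a weak limit of [q], stated only for those test functions
    on which the pairings converge. Almost-minimisers of the square norm over the closed convex sets of
    functions whose pairings are as controlled as those of the tail of the
    sequence form a Cauchy sequence, by the parallelogram identity. *)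
Lemma weak_limit q : (forall k, bounded_on_ball (q k)) ->
  exists2 H, bounded_on_ball H & forall phi (T : R), bm phi ->
    Int (fun x => q k x * phi x) @[k --> \oo] --> T ->
    Int (fun x => H x * phi x) = T.
Proof.
move=> gq.
pose K m w := bounded_on_ball w /\ forall phi (T e : R), bm phi ->
  (forall k, (m <= k)%N -> `|Int (fun x => q k x * phi x) - T| <= e) ->
  `|Int (fun x => w x * phi x) - T| <= e.
have bwphi w phi : bounded_on_ball w -> bm phi -> bm (fun x => w x * phi x).
  move=> gw [Kp bp]; have [mp pK _] := bp; exists ((L + r) * (1 + `|Kp|)).
  exact: bmsM (bounded_on_ball_bms gw) mp (fun x _ => pK x).
have Kq m : K m (q m) by split => // phi T e _; apply.
have Kmono m m' w : (m <= m')%N -> K m' w -> K m w.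
  by move=> mm [gw h]; split => // phi T e bp hk; apply: h => // k m'k; apply: hk; exact: leq_trans m'k.
have Kmid m w w' : K m w -> K m w' -> K m (fun x => 2^-1 * (w x + w' x)).
  move=> [gw hw] [gw' hw']; split.
    have [mw wL w0] := gw; have [mw' wL' w0'] := gw'; split.
    - by apply: measurable_funM => //; exact: measurable_funD.
    - move=> x; rewrite normrM gtr0_norm ?invr_gt0//.
      by have := ler_normD (w x) (w' x); have := wL x; have := wL' x; lra.
    - by move=> x xr; rewrite w0// w0'// addr0 mulr0.
  move=> phi T e bp hk; have h1 := hw phi T e bp hk; have h2 := hw' phi T e bp hk.
  rewrite (Int_ext (g := fun x => 2^-1 * (w x * phi x + w' x * phi x))); last by move=> x; ring.
  rewrite bIntZ; last by apply: bmD; exact: bwphi.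
  rewrite bIntD; [|exact: bwphi|exact: bwphi].
  move: h1 h2; move: (Int _) (Int _) => a c; rewrite !ler_norml => /andP[? ?] /andP[? ?].
  by apply/andP; split; lra.
pose E m := [set s | exists2 w, K m w & s = Int (fun x => w x * w x)].
have [B hB] : exists B : R, forall w, bounded_on_ball w -> Int (fun x => w x * w x) <= B.
  pose c := (L + r) * (1 + `|L|); exists (Int (@ballfun R n c)) => w gw.
  have bw : bms c (fun x => w x * w x).
    by apply: bmsM (bounded_on_ball_bms gw) _ _; case: gw => // ? h _ x _.
  have c0 : 0 <= c by case: bw => _ /(_ 0) + _; exact: le_trans.
  apply: (Int_le bw (bms_ballfun c0)) => x; exact: le_trans (ler_norm _) (bms_ballfun_ge x bw).
have sq0 w : 0 <= Int (fun x => w x * w x) by apply: Int_ge0 => x; rewrite -expr2 sqr_ge0.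
have E0 m : E m !=set0 by exists (Int (fun x => q m x * q m x)), (q m).
have Elb m : lbound (E m) 0 by move=> _ [w _ ->].
pose I m := inf (E m).
have hI m w : K m w -> I m <= Int (fun x => w x * w x).
  by move=> Kw; apply: ge_inf; [exists 0; exact: Elb|exists w].
have Imono m m' : (m <= m')%N -> I m <= I m'.
  move=> mm; apply: lb_le_inf => // _ [w Kw ->]; apply: hI; exact: Kmono Kw.
have IB m : I m <= B by apply: le_trans (hI _ _ (Kq m)) _; exact: hB.
have /choice[w hw] m : exists w, K m w /\ Int (fun x => w x * w x) < I m + m.+1%:R^-1.
  have m0 : (0 : R) < m.+1%:R^-1 by rewrite invr_gt0 ltr0n.
  have hI' : has_inf (E m) by split => //; exists 0; exact: Elb.
  have [_ [w Kw ->] h] := inf_adherent m0 hI'.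
  by exists w.
have gw m : bounded_on_ball (w m) by case: (hw m) => -[].
have par m m' : (m <= m')%N -> Int (fun x => (w m' x - w m x) ^+ 2) <=
    2 * (I m' - I m) + 2 * m.+1%:R^-1 + 2 * m'.+1%:R^-1.
  move=> mm; have [Km h1] := hw m; have [Km' h2] := hw m'.
  have := hI _ _ (Kmid _ _ _ Km (Kmono _ _ _ mm Km')).
  have g1 := gw m; have g2 := gw m'.
  rewrite (Int_ext (f := fun x => _ ^+ 2) (g := fun x => 2 * (w m' x * w m' x) + 2 * (w m x * w m x)
     - 4 * (2^-1 * (w m x + w m' x) * (2^-1 * (w m x + w m' x))))); last by move=> x; field.
  have bmid := Kmid _ _ _ Km (Kmono _ _ _ mm Km').
  have b1 : bm (fun x => 2 * (w m' x * w m' x)) by apply: bmZ; exact: bmM.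
  have b2 : bm (fun x => 2 * (w m x * w m x)) by apply: bmZ; exact: bmM.
  have b3 : bm (fun x => 2^-1 * (w m x + w m' x) * (2^-1 * (w m x + w m' x))).
    by case: bmid => gmid _; exact: (bmM gmid gmid).
  rewrite (bIntB (bmD b1 b2) (bmZ 4 b3)) (bIntD b1 b2) (bIntZ _ b3).
  rewrite (bIntZ _ (bmM g2 g2)) (bIntZ _ (bmM g1 g1)).
  move: h1 h2; move: (Int _) (Int _) (Int _) (m.+1%:R^-1 : R) (m'.+1%:R^-1 : R) (I m) (I m').
  by move=> *; lra.
have cauchy (e : R) : 0 < e -> exists M, forall m m', (M <= m)%N -> (M <= m')%N ->
    Int (fun x => (w m' x - w m x) ^+ 2) <= e.
  move=> e0; have sI : has_sup (range I).
    by split; [exists (I 0%N), 0%N|exists B => _ [m _ <-]].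
  have e8 : 0 < e / 8 by rewrite divr_gt0.
  have [_ [m0 _ <-] hm0] := sup_adherent e8 sI.
  have [k0 hk0] := invS_lt e8.
  have main m m' : (maxn m0 k0 <= m)%N -> (m <= m')%N ->
      Int (fun x => (w m' x - w m x) ^+ 2) <= e.
    rewrite geq_max => /andP[m0m k0m] mm; apply: le_trans (par _ _ mm) _.
    have h1 : I m' <= sup (range I) by apply: ub_le_sup; [case: sI|exists m'].
    have h2 := Imono _ _ m0m; have h3 := hk0 m k0m; have h4 := hk0 m' (leq_trans k0m mm).
    move: h1 h2 h3 h4 hm0; move: (m.+1%:R^-1 : R) (m'.+1%:R^-1 : R) (I m) (I m') (sup _) (I m0).
    by move=> *; lra.
  exists (maxn m0 k0) => m m' hm hm'; case: (leqP m m') => [|/ltnW] mm; first exact: main.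
  rewrite (Int_ext (g := fun x => (w m x - w m' x) ^+ 2)); first exact: main.
  by move=> x; rewrite -sqrrN opprB.
have ej j : (0 : R) < 2^-1 ^+ j * 2^-1 ^+ j by rewrite mulr_gt0// exprn_gt0// invr_gt0.
have /choice[M hM] j := cauchy _ (ej j).
pose mj j := (\sum_(i < j.+1) M i)%N.
have mjM j i : (i <= j)%N -> (M i <= mj j)%N.
  move=> ij; rewrite /mj (bigD1 (Ordinal (ij : i < j.+1)%N))//=; exact: leq_addr.
pose u j := w (mj j + j)%N.
have [H gH cH] : exists2 H, bounded_on_ball H & {ae mu, forall x, u j x @[j --> \oo] --> H x}.
  apply: fast_ae_cvg => [j|j]; first exact: gw.
  by apply: hM; apply: leq_trans (leq_addr _ _); exact: mjM.
exists H => // phi T bp hT.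
have [Kp bp'] := bp; have [mp pK p0] := bp'.
have cI : Int (fun x => u j x * phi x) @[j --> \oo] --> Int (fun x => H x * phi x).
  apply: (@Int_cvg _ _ ((L + r) * (1 + `|Kp|)) ((L + r) * (1 + `|Kp|))).
  - by move=> j; apply: bmsM (bounded_on_ball_bms (gw _)) mp (fun x _ => pK x).
  - by apply: bmsM (bounded_on_ball_bms gH) mp (fun x _ => pK x).
  - by apply: filterS cH => x hx; exact: cvgMl.
apply: (@cvg_unique _ _ _ _ _ _ cI); first exact: Rhausdorff.
apply/cvg_seqP => e e0; have e2 : 0 < e / 2 by rewrite divr_gt0.
have /cvg_seqP/(_ _ e2)[k0 hk0] := hT.
exists k0 => j k0j; have [[_ hj] _] := hw (mj j + j)%N.
apply: (@le_lt_trans _ _ (e / 2)); last by lra.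
apply: hj => // k hk; apply/ltW/hk0.
by apply: leq_trans k0j _; apply: leq_trans hk; exact: leq_addl.
Qed.

End weak_limit.

(** * From quadratic expansions to a bound on the norm *)

Section expansion_C11.
Context {R : realType} {n : nat}.
Local Notation V := 'rV[R]_n.
Local Notation mu := (@lebesgue_rV R n).
Implicit Types (f g u w phi psi : V -> R) (x y z p h : V).

Let tt (k : nat) : R := k.+1%:R^-1.

Let tt_gt0 k : 0 < tt k. Proof. by rewrite invr_gt0 ltr0n. Qed.

Let tt_le1 k : tt k <= 1. Proof. by rewrite invf_le1 ?ltr0n// ler1n. Qed.

(** Turns a function controlled only on a ball into a bounded one with bounded
    support. *)
Definition cut (r : R) f x : R := if l2norm x < r then f x else 0.

Lemma cut_measurable (r : R) f : (forall x, l2norm x < r -> {for x, continuous f}) ->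
  measurable_fun setT (cut r f).
Proof.
move=> cf; apply: measurable_fun_lt => a; rewrite setTI.
rewrite (_ : mkset _ = (eball 0 r `&` [set x | f x < a]) `|` (~` eball 0 r `&` [set x | 0 < a])).
  apply: measurableU.
    apply: open_measurable_rV; rewrite openE => x [x1 xa].
    have x1' : l2norm x < r by rewrite eball0 in x1.
    apply: filterI; first exact: (@eball_open R n 0 r _ x1).
    have a0 : 0 < a - f x by rewrite subr_gt0.
    have /continuous_l2P/(_ _ a0)[d d0 hd] := cf x x1'.
    apply/nbhs_l2normP; exists d => // y /hd /ltr_normlW.
    by rewrite ltrD2r.
  apply: measurableI; first by apply: measurableC; exact: eball_measurable.
  by case: (ltP 0 a) => h; [rewrite (_ : mkset _ = setT)//|rewrite (_ : mkset _ = set0)//];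
    apply/seteqP; split.
apply/seteqP; split => x /=; rewrite eball0 /cut.
  by case: (boolP (l2norm x < r)) => x1 h; [left|right; split => //; apply/negP].
by case: (boolP (l2norm x < r)) => x1 [[]|[]].
Qed.

Lemma compact_sub_eball (K : set V) (r : R) : compact K -> K `<=` eball 0 r ->
  exists2 d : R, 0 < d & forall x, K x -> l2norm x + d <= r.
Proof.
move=> cK Kr; pose P (k : nat) x := l2norm x + tt k <= r.
have [/(_ cK) h _] := @compact_near_coveringP _ K.
have [|k _ hk] := h nat \oo P _.
  move=> x Kx; have xr : l2norm x < r by rewrite -eball0; exact: Kr.
  have e0 : 0 < (r - l2norm x) / 2 by rewrite divr_gt0// subr_gt0.
  have [k0 hk0] := invS_lt e0.
  exists (eball x ((r - l2norm x) / 2), [set k | (k0 <= k)%N]).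
    split => /=; last by exists k0.
    by apply/nbhs_l2normP; exists ((r - l2norm x) / 2).
  move=> [y k] /= [yx /hk0 k0k]; rewrite /P /tt.
  have h1 := ler_l2norm_add x y; move: yx k0k h1; rewrite /eball/=.
  by move: (k.+1%:R^-1 : R) (l2norm y) (l2norm x) (l2norm (y - x)) => *; lra.
by exists (tt k) => // x Kx; exact: (hk k (leqnn _) x Kx).
Qed.

(** Zero where the increment leaves the ball, so that a Lipschitz bound inside
    the ball suffices. *)
Definition quot (r : R) u i (k : nat) x : R :=
  if (l2norm x < r) && (l2norm (x + tt k *: delta_mx 0 i) < r)
  then (u (x + tt k *: delta_mx 0 i) - u x) / tt k else 0.

Lemma quot_bounded (r L : R) u i k : measurable_fun setT u -> 0 <= L ->
  (forall x y, l2norm x < r -> l2norm y < r -> `|u y - u x| <= L * l2norm (y - x)) ->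
  bounded_on_ball r L (quot r u i k).
Proof.
move=> mu' L0 hL; split.
- have mA := eball_measurable (0 : V) r.
  pose T x := x + tt k *: delta_mx 0 i.
  have mT : measurable_fun setT T.
    rewrite (_ : T = affine_map (tt k *: delta_mx 0 i) 1); first exact: measurable_affine_map.
    by apply/funext => x; rewrite /affine_map scale1r addrC.
  rewrite (_ : quot r u i k = fun x => \1_(eball 0 r) x * \1_(eball 0 r) (T x) * ((u (T x) - u x) / tt k)).
    have m1 : measurable_fun setT (\1_(eball (0 : V) r) : V -> R) by exact: measurable_indic.
    apply: measurable_funM; first by apply: measurable_funM => //; exact: (measurableT_comp m1 mT).
    apply: measurable_funM => //; apply: measurable_funB => //; exact: (measurableT_comp mu' mT).
  apply/funext => x; rewrite /quot !indicE.
  have e y : (y \in eball (0 : V) r) = (l2norm y < r) by apply/idP/idP; rewrite inE eball0.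
  by rewrite !e -/(T x); case: (_ < r); case: (_ < r); rewrite ?mul1r ?mulr1 ?mul0r ?mulr0 ?mul0r.
- move=> x; rewrite /quot; case: ifP => [/andP[x1 x2]|_]; last by rewrite normr0.
  rewrite normrM [`|_^-1|]gtr0_norm ?invr_gt0// ler_pdivrMr//.
  apply: le_trans (hL _ _ x1 x2) _; rewrite addrC addKr l2normZ l2norm_delta mulr1.
  by rewrite gtr0_norm.
- by move=> x xr; rewrite /quot ltNge xr.
Qed.

(** Translation invariance moves the difference onto the test function, whose
    support stays inside the ball for small increments. *)
Lemma quot_weak (r Mu : R) u i psi (K : set V) : 0 < r -> bms Mu u ->
  (forall x, r <= l2norm x -> u x = 0) -> smooth psi -> compact K ->
  K `<=` eball 0 r -> (forall x, ~ K x -> psi x = 0) ->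
  Int (fun x => quot r u i k x * psi x) @[k --> \oo] --> - Int (fun x => u x * partial i psi x).
Proof.
move=> r0 bu u0 sp cK Kr p0; have [mu' uM _] := bu.
have [d d0 hd] := compact_sub_eball cK Kr.
have Mu0 : 0 <= Mu := le_trans (normr_ge0 _) (uM 0).
have [L L0 hL] := smooth_lipschitz_on i r sp.
pose e : V := delta_mx 0 i.
pose F k x := u x * ((psi x - psi (x - tt k *: e)) / tt k).
have mpsi := smooth_measurable sp.
have mshift (g : V -> R) (a : V) : measurable_fun setT g -> measurable_fun setT (fun x => g (x + a)).
  move=> mg; rewrite (_ : (fun x => _) = g \o affine_map a 1).
    apply: measurableT_comp => //; exact: measurable_affine_map.
  by apply/funext => x; rewrite /= /affine_map scale1r addrC.
have bF k : bms (Mu * (1 + `|L|)) (F k).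
  apply: bmsM bu _ _.
    by apply: measurable_funM => //; apply: measurable_funB => //; exact: mshift.
  move=> x ux; have xr : l2norm x <= r.
    by rewrite leNgt; apply/negP => h; move: ux; rewrite u0 ?eqxx// ltW.
  rewrite normrM [`|_^-1|]gtr0_norm ?invr_gt0// ler_pdivrMr// distrC -scaleNr.
  rewrite -[leRHS](_ : L * `|- tt k| = _); last by rewrite normrN gtr0_norm.
  by apply: hL; rewrite // normrN gtr0_norm.
have cF x : F k x @[k --> \oo] --> u x * partial i psi x.
  by apply: cvgMr; have [] := derive_quotient e (smooth_differentiable x sp).
have [_ cI] := Int_cvg_all bF cF.
have [k0 hk0] := invS_lt d0.
have main k : (k0 <= k)%N -> Int (fun x => quot r u i k x * psi x) = - Int (F k).
  move=> /hk0 kd; have tn0 : tt k != 0 by rewrite gt_eqF.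
  have [B _ hB] := smooth_bounded_on r sp.
  have psiB x : `|psi x| <= `|B|.
    have [Kx|nK] := pselect (K x); last by rewrite p0// normr0.
    apply: le_trans (ler_norm B); apply: hB; have := hd x Kx; lra.
  have b1 : bms (Mu * (1 + `| `|B| |)) (fun x => u x * psi x) by apply: bmsM bu mpsi (fun x _ => psiB x).
  have b2 : bms (Mu * (1 + `| `|B| |)) (fun x => u x * psi (x - tt k *: e)).
    by apply: bmsM bu _ (fun x _ => psiB _); exact: mshift.
  have n1 : (1 : R) != 0 by [].
  have b3 := bms_affine (tt k *: e) n1 b2.
  have E3 := Int_affine (tt k *: e) n1 b2; rewrite normr1 expr1n mul1r in E3.
  rewrite (Int_ext (g := fun x => (tt k)^-1 * (u (tt k *: e + 1 *: x) * psi (tt k *: e + 1 *: x - tt k *: e) - u x * psi x))).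
    rewrite bIntZ; last by apply: bmB; eexists; [exact: b3|exact: b1].
    rewrite (IntB b3 b1) -E3 (Int_ext (f := F k) (g := fun x => (tt k)^-1 * (u x * psi x - u x * psi (x - tt k *: e)))).
      rewrite bIntZ; last by apply: bmB; eexists; [exact: b1|exact: b2].
      by rewrite (IntB b1 b2); ring.
    by move=> x; rewrite /F; ring.
  move=> x; rewrite scale1r (addrC _ x) addrK.
  have [Kx|nK] := pselect (K x); last by rewrite p0// !mulr0 subrr mulr0.
  have x1 := hd x Kx; have xr : l2norm x < r by move: x1 d0; lra.
  rewrite /quot xr /= -/e; have -> : l2norm (x + tt k *: e) < r.
    apply: le_lt_trans (l2normD _ _) _; rewrite l2normZ l2norm_delta mulr1 gtr0_norm//.
    by move: kd x1; rewrite -/(tt k); lra.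
  by ring.
apply/cvg_seqP => ep ep0; have /cvg_seqP/(_ _ ep0)[k1 hk1] := cI.
exists (maxn k0 k1) => k; rewrite geq_max => /andP[k0k k1k].
by rewrite main// -opprD normrN; exact: hk1.
Qed.

Section local_expansion.
Variables (N C : R) (f : V -> R).
Let r : R := 8^-1.
Hypotheses (C0 : 0 <= C) (fN : forall x, l2norm x < r -> `|f x| <= N)
  (hexp : forall x, l2norm x < r -> exists2 p, l2norm p <= C &
    forall y, l2norm y <= 1 / 2 ->
      `|f y - f x - dotv p (y - x)| <= C * l2norm (y - x) ^+ 2).

Let r0 : 0 < r. Proof. by rewrite invr_gt0. Qed.

Let N0 : 0 <= N. Proof. by apply: le_trans (fN (x := 0) _); rewrite ?l2norm0. Qed.

Let grad_exp x : l2norm x < r -> [/\ differentiable f x, l2norm (gradient f x) <= C &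
  forall y, l2norm y <= 1 / 2 ->
    `|f y - f x - dotv (gradient f x) (y - x)| <= C * l2norm (y - x) ^+ 2].
Proof.
move=> xr; have [p pC hp] := hexp xr.
have e0 : (0 : R) < 3 / 8 by [].
have [h|df dp] := @differentiable_quadratic _ _ f x p C (3 / 8) e0.
  move=> hs; have := hp (x + h); rewrite (addrC x h) addrK; apply.
  by apply: le_trans (l2normD _ _) _; move: xr hs; rewrite /r; lra.
have -> : gradient f x = p by apply/rowP => i; rewrite mxE dp.
by split.
Qed.

Let f_lip x y : l2norm x < r -> l2norm y < r -> `|f y - f x| <= 2 * C * l2norm (y - x).
Proof.
move=> xr yr; have [_ gC hx] := grad_exp xr.
have y2 : l2norm y <= 1 / 2 by move: yr; rewrite /r; lra.
have h := hx y y2; set s := l2norm (y - x) in h *.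
have s0 : 0 <= s by exact: l2norm_ge0.
have s1 : s <= 1 by have := l2normB y x; rewrite -/s; move: xr yr; rewrite /r; lra.
have h1 : `|dotv (gradient f x) (y - x)| <= C * s.
  by apply: le_trans (cauchy_schwarz _ _) _; exact: ler_wpM2r.
have h2 : C * s ^+ 2 <= C * s by apply: ler_wpM2l => //; rewrite expr2; exact: ler_piMr.
have := ler_normD (f y - f x - dotv (gradient f x) (y - x)) (dotv (gradient f x) (y - x)).
by rewrite subrK; move: h h1 h2; move: (dotv _ _) (C * _ ^+ 2) => a c; lra.
Qed.

(** Comparing the expansions at two points, both evaluated at a third point at
    the same distance in a coordinate direction. *)
Let grad_lip i x y : l2norm x < r -> l2norm y < r ->
  `|partial i f y - partial i f x| <= 6 * C * l2norm (y - x).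
Proof.
move=> xr yr; have [_ _ hx] := grad_exp xr; have [_ _ hy] := grad_exp yr.
set s := l2norm (y - x); have s0 : 0 <= s by exact: l2norm_ge0.
have [/eqP e|sn] := boolP (s == 0).
  have -> : y = x by apply/eqP; rewrite -subr_eq0; apply/eqP/l2norm_eq0.
  by rewrite subrr normr0 !mulr_ge0.
have sp : 0 < s by rewrite lt_neqAle eq_sym sn.
pose z : V := y + s *: delta_mx 0 i.
have s14 : s <= 1 / 4 by have := l2normB y x; rewrite -/s; move: xr yr; rewrite /r; lra.
have zy : z - y = s *: delta_mx 0 i by rewrite /z addrAC subrr add0r.
have zys : l2norm (z - y) = s by rewrite zy l2normZ l2norm_delta mulr1 gtr0_norm.
have z2 : l2norm z <= 1 / 2.
  by have := ler_l2norm_add y z; rewrite zys; move: yr; rewrite /r; lra.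
have y2 : l2norm y <= 1 / 2 by move: yr; rewrite /r; lra.
have zx : l2norm (z - x) <= 2 * s by have := l2norm_dist z y x; rewrite zys -/s; lra.
have h1 := hx z z2; have h2 := hx y y2; have h3 := hy z z2.
rewrite zys in h3; rewrite -/s in h2.
have h1' : `|f z - f x - dotv (gradient f x) (z - x)| <= 4 * (C * s ^+ 2).
  apply: le_trans h1 _; have -> : 4 * (C * s ^+ 2) = C * (2 * s) ^+ 2 by ring.
  by apply: ler_wpM2l => //; rewrite ler_pXn2r// ?nnegrE ?l2norm_ge0// mulr_ge0.
have gi (a : V) : dotv (gradient f a) (s *: delta_mx 0 i) = s * partial i f a.
  by rewrite dotvZr dotv_delta mxE.
have E : dotv (gradient f x) (z - x) = dotv (gradient f x) (y - x) + s * partial i f x.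
  by rewrite -gi -dotvDr /z addrAC.
rewrite zy gi in h3; rewrite E in h1'.
rewrite -(ler_pM2l sp) -[X in X * `|_|](gtr0_norm sp) -normrM mulrBr.
have -> : s * (6 * C * s) = 6 * (C * s ^+ 2) by ring.
move: h1' h2 h3; move: (dotv _ _) (s * partial i f x) (s * partial i f y) (C * s ^+ 2) => a p q c.
by rewrite !ler_norml => /andP[? ?] /andP[? ?] /andP[? ?]; apply/andP; split; lra.
Qed.

Let C1 : C1_on (eball 0 r) f.
Proof.
move=> x; rewrite eball0 => xr; have [df _ _] := grad_exp xr; split => // A.
move=> /nbhs_l2normP[e e0 hA]; apply/nbhs_l2normP.
have q0 : 0 < n%:R * (6 * C) + 1 by rewrite ltr_wpDl// !mulr_ge0.
exists (Num.min (r - l2norm x) (e / (n%:R * (6 * C) + 1))).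
  by rewrite lt_min subr_gt0 xr divr_gt0.
move=> y; rewrite lt_min ltr_pdivlMr// => /andP[yx ye]; apply: hA.
have yr : l2norm y < r by have := ler_l2norm_add x y; lra.
apply: le_lt_trans ye; apply: (@le_trans _ _ (n%:R * (6 * C * l2norm (y - x)))).
  apply: l2norm_le_coord; first by rewrite !mulr_ge0// l2norm_ge0.
  by move=> i; rewrite !mxE; exact: grad_lip.
move: (l2norm (y - x)) (l2norm_ge0 (y - x)) => s s0.
by rewrite mulrDr mulr1 mulrA mulrA (mulrC _ s) -(mulrA n%:R 6 C) lerDl.
Qed.

Let continuous_f x : l2norm x < r -> {for x, continuous f}.
Proof. by move=> /grad_exp[df _ _]; exact: differentiable_continuous. Qed.

Let continuous_partial i x : l2norm x < r -> {for x, continuous (partial i f)}.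
Proof.
move=> xr; apply/continuous_l2P => e e0.
have q0 : 0 < 6 * C + 1 by rewrite ltr_wpDl// mulr_ge0.
exists (Num.min (r - l2norm x) (e / (6 * C + 1))).
  by rewrite lt_min subr_gt0 xr divr_gt0.
move=> y; rewrite lt_min ltr_pdivlMr// => /andP[yx ye].
have yr : l2norm y < r by have := ler_l2norm_add x y; lra.
apply: le_lt_trans (grad_lip i xr yr) _; apply: le_lt_trans ye.
by rewrite mulrDr mulr1 mulrC lerDl l2norm_ge0.
Qed.

Let f0 := cut r f.
Let g0 i := cut r (partial i f).

Let cut_bms (w : V -> R) (B : R) : 0 <= B -> (forall x, l2norm x < r -> {for x, continuous w}) ->
  (forall x, l2norm x < r -> `|w x| <= B) -> bms (B + 1) (cut r w).
Proof.
move=> B0 cw wB; split; first exact: cut_measurable.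
- move=> x; rewrite /cut; case: ifP => [/wB h|_]; last by rewrite normr0 addr_ge0.
  by apply: le_trans h _; rewrite lerDl.
- move=> x xB; rewrite /cut ifF//; apply/negbTE; rewrite -leNgt.
  by apply: le_trans (ltW xB); rewrite /r; move: B0; lra.
Qed.

Let bf0 : bms (N + 1) f0.
Proof. by apply: cut_bms => //; exact: N0. Qed.

Let bg0 i : bms (C + 1) (g0 i).
Proof.
apply: cut_bms => // x xr; first exact: continuous_partial.
have [_ gC _] := grad_exp xr; apply: le_trans gC.
by have := coord_le_l2norm (gradient f x) i; rewrite mxE.
Qed.

Let cut0 (w : V -> R) x : r <= l2norm x -> cut r w x = 0.
Proof. by rewrite /cut leNgt => /negbTE ->. Qed.

Let cut_lip (w : V -> R) (L : R) :
  (forall x y, l2norm x < r -> l2norm y < r -> `|w y - w x| <= L * l2norm (y - x)) ->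
  forall x y, l2norm x < r -> l2norm y < r -> `|cut r w y - cut r w x| <= L * l2norm (y - x).
Proof. by move=> h x y xr yr; rewrite /cut xr yr; exact: h. Qed.

(** The difference quotients of [f] tend to its classical derivative, which is
    therefore also the weak one. *)
Let first_order i psi (K : set V) : smooth psi -> compact K -> K `<=` eball 0 r ->
  (forall x, ~ K x -> psi x = 0) ->
  Int (fun x => g0 i x * psi x) = - Int (fun x => f0 x * partial i psi x).
Proof.
move=> sp cK Kr p0; have c1 := quot_weak r0 bf0 (@cut0 f) sp cK Kr p0.
have [mf _ _] := bf0.
have C20 : 0 <= 2 * C by rewrite mulr_ge0.
have bq k := bounded_on_ball_bms r0 C20 (quot_bounded i k mf C20 (cut_lip f_lip)).
have [B _ hB] := smooth_bounded_on r sp.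
have psiB x : `|psi x| <= `|B|.
  have [Kx|nK] := pselect (K x); last by rewrite p0// normr0.
  apply: le_trans (ler_norm B); apply: hB; apply: ltW.
  by have := Kr x Kx; rewrite eball0.
have bF k : bms ((2 * C + r) * (1 + `| `|B| |)) (fun x => quot r f0 i k x * psi x).
  by apply: bmsM (bq k) (smooth_measurable sp) (fun x _ => psiB x).
have cq x : quot r f0 i k x * psi x @[k --> \oo] --> g0 i x * psi x.
  apply: cvgMl; have [xr|xr] := ltP (l2norm x) r; last first.
    by rewrite /g0 cut0// /quot ltNge xr/=; exact: cvg_cst.
  have [df _ _] := grad_exp xr.
  have [_ c] := derive_quotient (delta_mx 0 i) df.
  rewrite /g0 /cut xr; apply/cvg_seqP => e e0; have /cvg_seqP/(_ _ e0)[k0 hk0] := c.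
  have d0 : 0 < r - l2norm x by rewrite subr_gt0.
  have [k1 hk1] := invS_lt d0.
  exists (maxn k0 k1) => k; rewrite geq_max => /andP[/hk0 h /hk1 kr].
  have xt : l2norm (x + tt k *: delta_mx 0 i) < r.
    apply: le_lt_trans (l2normD _ _) _; rewrite l2normZ l2norm_delta mulr1 gtr0_norm//.
    by move: kr; rewrite -/(tt k); lra.
  by rewrite /quot xr xt /= /f0 /cut xr xt.
have [_ c2] := Int_cvg_all bF cq.
by apply: (@cvg_unique _ _ _ _ _ _ c2); [exact: Rhausdorff|exact: c1].
Qed.

(** A weak limit of the difference quotients of a first derivative. *)
Let hessian_entry i j : exists2 H, bounded_on_ball r (6 * C) H &
  forall phi, test_function (eball 0 r) phi ->
    Int (fun x => H x * phi x) = Int (fun x => f0 x * partial i (partial j phi) x).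
Proof.
have C60 : 0 <= 6 * C by rewrite mulr_ge0.
have [mg _ _] := bg0 i.
have gq k := quot_bounded j k mg C60 (cut_lip (grad_lip i)).
have [H gH hH] := weak_limit r0 C60 gq.
exists H => // phi [sp [K [cK Kr p0]]].
have [B _ hB] := smooth_bounded_on r sp.
have bphi : bm phi.
  exists (`|B| + r); split; first exact: smooth_measurable.
  - move=> x; have [Kx|nK] := pselect (K x); last by rewrite p0// normr0 addr_ge0// ltW.
    apply: (@le_trans _ _ `|B|); last by rewrite lerDl ltW.
    apply: le_trans (ler_norm B); apply: hB; apply: ltW.
    by have := Kr x Kx; rewrite eball0.
  - move=> x xB; apply: p0 => Kx; have := Kr x Kx; rewrite eball0.
    by apply/negP; rewrite -leNgt; apply: le_trans (ltW xB); rewrite lerDr.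
have pj0 x : ~ K x -> partial j phi x = 0.
  apply: (@partial_zero _ _ j phi (~` K)).
    by rewrite openC; apply: compact_closed => //; exact: norm_hausdorff.
  by move=> y; exact: p0.
have -> : Int (fun x => H x * phi x) = - Int (fun x => g0 i x * partial j phi x).
  by apply: hH => //; apply: (quot_weak r0 (bg0 i) _ sp cK Kr p0) => x; exact: cut0.
by rewrite (first_order i (smooth_partial j sp) cK Kr pj0) opprK.
Qed.

Lemma C2norm_expansion : (C2norm (eball 0 r) f <= (N + C + n%:R * (6 * C))%:E)%E.
Proof.
have C60 : 0 <= 6 * C by rewrite mulr_ge0.
have /choice[H hH] (ij : 'I_n * 'I_n) : exists H : V -> R, bounded_on_ball r (6 * C) H /\
    forall phi, test_function (eball 0 r) phi ->
      Int (fun x => H x * phi x) = Int (fun x => f0 x * partial ij.1 (partial ij.2 phi) x).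
  by have [H h1 h2] := hessian_entry ij.1 ij.2; exists H.
pose Hm x : 'M[R]_n := \matrix_(i, j) H (i, j) x.
have HE i j : (fun x => Hm x i j) = H (i, j) by apply/funext => x; rewrite mxE.
have wH : weak_hessian (eball 0 r) f Hm.
  move=> i j; have [gH hphi] := hH (i, j); have bH := bounded_on_ball_bms r0 C60 gH.
  have [mH _ _] := bH; split.
  - by rewrite HE; exact: measurable_funTS.
  - move=> K cK _; have mK := compact_measurable_rV cK.
    rewrite (_ : (fun x => (Hm x i j)%:E) = EFin \o H (i, j)).
      apply: (integrableS measurableT mK) => //; exact: bms_integrable bH.
    by apply/funext => x; rewrite mxE.
  - move=> phi tp; have [sp [K [cK Kr p0]]] := tp.
    have spp : smooth (partial i (partial j phi)) by do 2 apply: smooth_partial.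
    have bounded g : smooth g -> exists B : R, forall x, l2norm x < r -> `|g x| <= B.
      by move=> sg; have [B _ hB] := smooth_bounded_on r sg; exists B => x /ltW; exact: hB.
    have [B1 hB1] := bounded _ spp; have [B2 hB2] := bounded _ sp.
    have b1 : bms ((N + 1) * (1 + `|B1|)) (fun x => f0 x * partial i (partial j phi) x).
      apply: bmsM bf0 (smooth_measurable spp) _ => x; have [xr _|xr] := ltP (l2norm x) r; first exact: hB1.
      by rewrite /f0 cut0 ?eqxx.
    have b2 : bms ((6 * C + r) * (1 + `|B2|)) (fun x => H (i, j) x * phi x).
      apply: bmsM bH (smooth_measurable sp) _ => x; have [xr _|xr] := ltP (l2norm x) r; first exact: hB2.
      by have [_ _ ->] := gH => //; rewrite eqxx.
    rewrite (@integral_eball_Int _ _ _ (fun x => f0 x * partial i (partial j phi) x) _ _ b1).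
    + rewrite (@integral_eball_Int _ _ _ (fun x => H (i, j) x * phi x) _ _ b2).
      * by congr (_%:E); exact: esym (hphi phi tp).
      * apply: (@eq_measurable_fun _ _ _ _ _ (fun x => H (i, j) x * phi x)).
          by move=> x _; rewrite mxE.
        by case: b2 => m2 _ _; exact: measurable_funTS.
      * by apply: aeW => x xr; rewrite mxE.
      * by move=> x xr; have [_ _ ->] := gH => //; rewrite mul0r.
    + apply: (@eq_measurable_fun _ _ _ _ _ (fun x => f0 x * partial i (partial j phi) x)).
        by move=> x; rewrite inE eball0 => xr; congr (_ * _); rewrite /f0 /cut xr.
      by case: b1 => m1 _ _; exact: measurable_funTS.
    + by apply: aeW => x xr; congr (_ * _); rewrite /f0 /cut xr.
    + by move=> x xr; apply: etrans (_ : 0 * partial i (partial j phi) x = 0);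
        [congr (_ * _); exact: cut0|exact: mul0r].
apply: (@le_trans _ _ (ereal_sup [set `|f x|%:E | x in eball 0 r]
        + sup_norm (eball 0 r) (gradient f) + Linfty_norm (eball 0 r) Hm)%E).
  by apply: ereal_inf_lbound; split; [exact: C1|exists Hm].
rewrite !EFinD; apply: leeD; first apply: leeD.
- by apply: ge_ereal_sup => _ [x + <-]; rewrite eball0 lee_fin; exact: fN.
- apply: ge_ereal_sup => _ [x + <-]; rewrite eball0 lee_fin => xr.
  by have [_ gC _] := grad_exp xr.
- apply/ess_supP; apply: aeW => x; rewrite patchE; case: ifP => _; rewrite lee_fin; last first.
    by rewrite mulr_ge0.
  rewrite -[leRHS]ger0_norm ?mulr_ge0// -sqrtr_sqr; apply: ler_wsqrtr.
  apply: (@le_trans _ _ (\sum_(i < n) \sum_(j < n) (6 * C) ^+ 2)).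
    apply: ler_sum => i _; apply: ler_sum => j _; rewrite mxE.
    have [[_ hb _] _] := hH (i, j).
    by rewrite -real_normK ?num_real// ler_pXn2r// ?nnegrE.
  have -> : (n%:R * (6 * C)) ^+ 2 = (6 * C) ^+ 2 *+ n *+ n.
    by rewrite -mulrnA -[RHS]mulr_natr natrM exprMn expr2 [RHS]mulrC.
  by rewrite sumr_const card_ord sumr_const card_ord.
Qed.

End local_expansion.
End expansion_C11.

(** * The envelope of a minimum *)

Section C2_of_envelope.
Context {R : realType} {n : nat}.
Hypothesis n_gt0 : (0 < n)%N.
Local Notation V := 'rV[R]_n.
Implicit Types (b : V -> R) (x y : V).

Lemma C11_paraboloid (N : R) b : (C2norm (eball 0 1) b < N%:E)%E ->
  (forall x, l2norm x < 1 -> `|b x| <= N) /\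
  (forall x, l2norm x < 1 -> exists2 p, l2norm p <= N &
    forall y, l2norm y < 1 -> b y <= b x + dotv p (y - x) + N * l2norm (y - x) ^+ 2).
Proof.
move=> /(C2norm_lt ltr01)[cb bN gN [H wH HN]]; split => // x x1.
by exists (gradient b x); [exact: gN|move=> y y1; exact: (paraboloid cb bN wH HN)].
Qed.

(** A paraboloid that touches from above the smaller of two functions touches
    their minimum, which may have corners but only concave ones. *)
Lemma min_paraboloid (N : R) (b0 b1 : V -> R) :
  (C2norm (eball 0 1) b0 < N%:E)%E -> (C2norm (eball 0 1) b1 < N%:E)%E ->
  (forall x, l2norm x < 1 -> `|Num.min (b0 x) (b1 x)| <= N) /\
  (forall x, l2norm x < 1 -> exists2 p, l2norm p <= N &
    forall y, l2norm y < 1 -> Num.min (b0 y) (b1 y) <=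
      Num.min (b0 x) (b1 x) + dotv p (y - x) + N * l2norm (y - x) ^+ 2).
Proof.
move=> /C11_paraboloid[b0N h0] /C11_paraboloid[b1N h1]; split => x x1.
  by case: (leP (b0 x) (b1 x)) => _; [exact: b0N|exact: b1N].
case: (leP (b0 x) (b1 x)) => _.
  have [p pN hp] := h0 x x1; exists p => // y y1.
  by apply: le_trans (hp y y1); rewrite ge_min lexx.
have [p pN hp] := h1 x x1; exists p => // y y1.
by apply: le_trans (hp y y1); rewrite ge_min lexx orbT.
Qed.

Lemma C2norm_envelope (N : R) : 0 <= N -> exists C : R, forall b0 b1 : V -> R,
  (C2norm (eball 0 1) b0 < N%:E)%E -> (C2norm (eball 0 1) b1 < N%:E)%E ->
  let benv := subharmonic_envelope (eball 0 1) (fun x => Num.min (b0 x) (b1 x)) in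
  (forall x, eball 0 8^-1 x -> benv x \is a fin_num) /\
  (C2norm (eball 0 8^-1) (fine \o benv) <= C%:E)%E.
Proof.
move=> N0; have [C C0 hC] := @sol_expansion R n N N N0 N0.
exists (N + C + n%:R * (6 * C)) => b0 b1 l0 l1 benv.
have [bN hQ] := min_paraboloid l0 l1.
pose v := real_env (fun x => Num.min (b0 x) (b1 x)).
have sol := envelope_obstacle_sol n_gt0 bN hQ.
have vE y : l2norm y < 1 -> benv y = (v y)%:E by move=> y1; exact: real_envE bN _ y1.
have fE y : l2norm y < 1 -> (fine \o benv) y = v y by move=> /vE e; rewrite /= e.
have small x : l2norm x < 8^-1 -> l2norm x < 1 by move: (l2norm x) => s; lra.
split => [x|]; first by rewrite eball0 => /small/vE ->.
apply: C2norm_expansion => // x xr; first by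
  rewrite fE ?small//; have [[vN _ _ _] _ _ _] := sol; exact: vN.
have [|p pC hp] := hC _ _ sol x; first by rewrite mul1r.
exists p => // y y2; have y1 : l2norm y < 1 by apply: le_lt_trans y2 _; lra.
by rewrite (fE y y1) (fE x (small _ xr)); exact: hp.
Qed.

End C2_of_envelope.

Theorem theorem2p4 (R : realType) (n : nat) (n_gt0 : (0 < n)%N) :
  exists C : R -> R -> R,
    forall b0 b1 : 'rV[R]_n -> R,
      C11 (eball 0 1) b0 -> C11 (eball 0 1) b1 ->
      let benv :=
        subharmonic_envelope (eball 0 1) (fun x => Num.min (b0 x) (b1 x)) in
      (forall x, eball 0 8^-1 x -> benv x \is a fin_num) /\
      (C2norm (eball 0 8^-1) (fine \o benv) <=
        (C (fine (C2norm (eball 0 1) b0)) (fine (C2norm (eball 0 1) b1)))%:E)%E.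
Proof.
have /choice[C hC] (N : {N : R | 0 <= N}) := C2norm_envelope n_gt0 (svalP N).
have N0 (c0 c1 : R) : 0 <= `|c0| + `|c1| + 1 by rewrite !addr_ge0.
pose bound c0 c1 : {N : R | 0 <= N} := exist (fun N => is_true (0 <= N)) _ (N0 c0 c1).
exists (fun c0 c1 => C (bound c0 c1)) => b0 b1 h0 h1.
have lt (e : \bar R) (t : R) : (e < +oo)%E -> `|fine e| + 1 <= t -> (e < t%:E)%E.
  case: e => [r| |] //= _; last by rewrite ltNyr.
  by rewrite lte_fin => h; apply: le_lt_trans (ler_norm r) _; lra.
pose c0 := fine (C2norm (eball 0 1) b0); pose c1 := fine (C2norm (eball 0 1) b1).
have l0 : (C2norm (eball 0 1) b0 < (sval (bound c0 c1))%:E)%E.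
  by apply: lt h0 _; rewrite lerD2r lerDl.
have l1 : (C2norm (eball 0 1) b1 < (sval (bound c0 c1))%:E)%E.
  by apply: lt h1 _; rewrite lerD2r lerDr.
exact: hC l0 l1.
Qed.
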